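(* Let $d\ge2$, $0<\alpha\le\beta$, and consider i.i.d. random conductances in $[\alpha,\beta]$ on the edges of $\mathbb{Z}^d$, with homogenized matrix $A_{\mathrm{hom}}$ and, for $\mu>0$ and $k\ge1$, approximations $A_{\mu,k}$ as defined in the context. For $D,q,k\ge0$ define $$\mathrm{Err}_{D,q,k}(\mu)=\begin{cases}\mu^{2k}&\text{if }k<D/4,\\ \mu^{2k}\ln_+^{1+q}(\mu^{-1})&\text{if }k=D/4,\\ \mu^{D/2}\ln_+^q(\mu^{-1})&\text{if }k>D/4,\end{cases}\qquad \ln_+(x)=\max\{\ln x,1\}.$$ Then there exists $q\ge0$ depending only on $\alpha$ and $\beta$ such that for all $\xi\in\mathbb{R}^d$ with $|\xi|=1$, all $\mu>0$ and all $k\ge1$, $$0\le\xi\cdot(A_{\mu,k}-A_{\mathrm{hom}})\xi\lesssim\begin{cases}\mathrm{Err}_{2,q,k}(\mu)&\text{if }d=2,\\ \mathrm{Err}_{d,0,k}(\mu)&\text{if }2<d\le5,\\ \mathrm{Err}_{6,1,k}(\mu)&\text{if }d=6,\\ \mathrm{Err}_{6,0,k}(\mu)&\text{if }6<d\le12,\\ \mathrm{Err}_{d-6,0,k}(\mu)&\text{if }d>12,\end{cases}$$ where $\lesssim$ means $\le$ up to a multiplicative constant depending only on $d,\alpha,\beta$.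
   Context: Environment: $\mathbb{B}$ is the set of non-oriented nearest-neighbour edges of $\mathbb{Z}^d$, $\Omega=[\alpha,\beta]^{\mathbb{B}}$, $\nu$ is a probability measure on $[\alpha,\beta]$, $\mathbb{P}=\nu^{\otimes\mathbb{B}}$, $\langle\cdot\rangle$ is expectation under $\mathbb{P}$; $\omega_{x,y}=\omega_{y,x}=\omega_e$ for $e=(x,y)$. Shifts: $(\theta_z\omega)_{x,y}=\omega_{x+z,y+z}$. A function $f:\mathbb{Z}^d\times\Omega\to\mathbb{R}$ is stationary if $f(x+z,\omega)=f(x,\theta_z\omega)$. $A(x,\omega)=\mathrm{diag}[\omega_{x,x+\mathbf{e}_1},\dots,\omega_{x,x+\mathbf{e}_d}]$, $A(\omega)=A(0,\omega)$. $\nabla u(x)=(u(x+\mathbf{e}_i)-u(x))_{i}$ and $\nabla^*\cdot F(x)=\sum_i(F_i(x)-F_i(x-\mathbf{e}_i))$. Homogenized matrix: for $\xi\in\mathbb{R}^d$ there is a unique measurable $\phi:\mathbb{Z}^d\times\Omega\to\mathbb{R}$ with $\phi(0,\cdot)\equiv0$, $\nabla\phi$ stationary (and square-integrable), $\langle\nabla\phi\rangle=0$, and $-\nabla^*\cdot A(\xi+\nabla\phi)=0$ in $\mathbb{Z}^d$ almost surely; $A_{\mathrm{hom}}$ is the symmetric matrix with $\xi\cdot A_{\mathrm{hom}}\xi=\langle(\xi+\nabla\phi)\cdot A(\xi+\nabla\phi)\rangle$. Operator and spectral measure: $\mathcal{L}u(\omega)=\sum_{z\sim0}\omega_{0,z}(u(\omega)-u(\theta_z\omega))$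 on $L^2(\Omega)$ (sum over the $2d$ neighbours of $0$) is bounded, nonnegative and self-adjoint. The local drift is $\mathfrak{d}(\omega)=\sum_{i=1}^d\xi_i(\omega_{0,\mathbf{e}_i}-\omega_{-\mathbf{e}_i,0})$. For $f\in L^2(\Omega)$, $e_f$ is the spectral measure of $\mathcal{L}$ projected on $f$: $\langle f\,\Psi(\mathcal{L})f\rangle=\int_{\mathbb{R}^+}\Psi(\lambda)\,\mathrm{d}e_f(\lambda)$ for bounded continuous $\Psi:\mathbb{R}_+\to\mathbb{R}$. Approximations: with $P_k(\mu,\lambda)=\lambda^{-1}\big((\mu+\lambda)^2(2\mu+\lambda)^2\cdots(2^{k-1}\mu+\lambda)^2-2^{k(k-1)}\mu^{2k}\big)$ (a polynomial), $A_{\mu,k}$ is the symmetric matrix with $$\xi\cdot A_{\mu,k}\xi=\langle\xi\cdot A\xi\rangle-\int_{\mathbb{R}^+}\frac{P_k(\mu,\lambda)}{(\mu+\lambda)^2(2\mu+\lambda)^2\cdots(2^{k-1}\mu+\lambda)^2}\,\mathrm{d}e_{\mathfrak{d}}(\lambda).$$ *)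

(* Defs.v *)
From HB Require Import structures.
From mathcomp Require Import all_boot all_order all_algebra.
From mathcomp Require Import all_classical all_reals all_analysis.

Set Implicit Arguments.
Unset Strict Implicit.
Unset Printing Implicit Defensive.

Import Order.TTheory GRing.Theory Num.Theory.
Import numFieldNormedType.Exports.

Local Open Scope classical_set_scope.
Local Open Scope ring_scope.

Section Lattice.
Variables (R : realType) (d : nat).

Definition site : Type := 'rV[int]_d.

Definition unit_vec (i : 'I_d) : site := delta_mx 0 i.

(* Non-oriented nearest-neighbour edges: (x, i) stands for {x, x + e_i}; every
   edge of Z^d has exactly one such representation. *)
Definition edge : Type := (site * 'I_d)%type.

Definition grad (u : site -> R) (x : site) : 'rV[R]_d :=
  \row_i (u (x + unit_vec i) - u x).

Definition div_star (F : site -> 'rV[R]_d) (x : site) : R :=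
  \sum_i (F x 0 i - F (x - unit_vec i) 0 i).

Definition qform (A : 'M[R]_d) (xi : 'rV[R]_d) : R := (xi *m A *m xi^T) 0 0.

(* The library norm on matrices is the sup norm, hence this definition. *)
Definition euclid_norm (xi : 'rV[R]_d) : R := Num.sqrt (\sum_i xi 0 i ^+ 2).

End Lattice.

Section ConductanceSpace.
Variables (R : realType) (alpha beta : R) (hab : alpha <= beta).

(* The interval [alpha, beta] as a type. The proof of alpha <= beta is a
   parameter because measurable types must be inhabited. *)
Record conductance_set (h : alpha <= beta) : Type := Conductance
  { conductance_val : R; _ : alpha <= conductance_val <= beta }.

HB.instance Definition _ := [isSub for @conductance_val hab].
HB.instance Definition _ := [Choice of conductance_set hab by <:].
HB.instance Definition _ := isPointed.Build (conductance_set hab)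
  (Conductance hab (introT andP (conj (lexx alpha) hab))).

(* [alpha, beta] with the trace of the Borel sigma-algebra. *)
Definition conductance := g_sigma_algebra_preimageType
  (@conductance_val hab : conductance_set hab -> measurableTypeR R).

Definition cylinders (d : nat) : set (set (edge d -> conductance)) :=
  [set C | exists (e : edge d) (A : set conductance),
     measurable A /\ C = [set w | A (w e)]].

(* [alpha, beta]^B with the product sigma-algebra. *)
Definition Omega (d : nat) := g_sigma_algebraType (@cylinders d).

End ConductanceSpace.

Section SpectralMeasure.
Context {disp : measure_display} {T : measurableType disp} {R : realType}.
Variable P : probability T R.

Definition norm2 (f : T -> R) : \bar R := 'N[P]_2%:E[EFin \o f]%E.

Definition poly_op (L : (T -> R) -> (T -> R)) (p : {poly R}) (f : T -> R)
  : T -> R := fun w => \sum_(i < size p) p`_i * iter i L f w.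

(* Continuous functional calculus of a bounded nonnegative self-adjoint
   operator L on L^2: g represents Psi(L) f when g is the L^2-limit of p_n(L) f
   for polynomials p_n converging to Psi uniformly on [0, K], which contains the
   spectrum of L as soon as K bounds the operator norm of L. *)
Definition functional_calculus (L : (T -> R) -> (T -> R)) (Psi : R -> R)
    (f g : T -> R) : Prop :=
  g \in Lfun P 2%:E /\
  forall (K : R) (p : nat -> {poly R}),
    (forall u, u \in Lfun P 2%:E -> (norm2 (L u) <= K%:E * norm2 u)%E) ->
    (forall eps : R, 0 < eps -> \forall n \near \oo,
       forall lambda : R, 0 <= lambda <= K ->
         `|(p n).[lambda] - Psi lambda| <= eps) ->
    norm2 (fun w => poly_op L (p n) f w - g w) @[n --> \oo] --> (0 : \bar R)%E.

(* The measure e_f on R_+ with <f Psi(L) f> = \int Psi de_f for all bounded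
   continuous Psi on R_+, seen as a measure on R which does not charge the
   negative half-line. *)
Definition spectral_measure (L : (T -> R) -> (T -> R)) (f : T -> R)
    (e : {measure set (measurableTypeR R) -> \bar R}) : Prop :=
  e `]-oo, 0[%classic = 0%E /\
  forall (Psi : R -> R) (g : T -> R),
    {within `[0, +oo[%classic, continuous Psi} ->
    (exists M : R, forall lambda : R, 0 <= lambda -> `|Psi lambda| <= M) ->
    functional_calculus L Psi f g ->
    ('E_P[(f \* g)%R] = \int[e]_(lambda in `[0%R, +oo[%classic) (Psi lambda)%:E)%E.

End SpectralMeasure.

Section Homogenization.
Variables (R : realType) (alpha beta : R) (hab : alpha <= beta) (d : nat).

Local Notation Omega := (Omega hab d).

(* P is the product of copies of nu indexed by the edges: the finite-dimensional
   cylinders form a pi-system generating the sigma-algebra of Omega, so P is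
   unique. *)
Definition product_measure (nu : probability (conductance hab) R)
    (P : probability Omega R) : Prop :=
  forall (s : seq (edge d)) (A : edge d -> set (conductance hab)),
    uniq s -> (forall e, measurable (A e)) ->
    P [set w | forall e, e \in s -> A e (w e)] = (\prod_(e <- s) nu (A e))%E.

Definition cond (w : Omega) (x : site d) (i : 'I_d) : R :=
  conductance_val (w (x, i)).

Definition shift (z : site d) (w : Omega) : Omega :=
  fun e => w (e.1 + z, e.2).

Definition stationary (V : Type) (f : site d -> Omega -> V) : Prop :=
  forall x z w, f (x + z) w = f x (shift z w).

Definition Amat (w : Omega) (x : site d) : 'M[R]_d :=
  diag_mx (\row_i cond w x i).

Definition corrector (P : probability Omega R) (xi : 'rV[R]_d)
    (phi : site d -> Omega -> R) : Prop :=
  [/\ forall x, measurable_fun setT (phi x),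
      forall w, phi 0 w = 0,
      stationary (fun x w => grad (phi ^~ w) x),
      forall x i, (fun w => grad (phi ^~ w) x 0 i) \in Lfun P 2%:E /\
        ('E_P[(fun w => grad (phi ^~ w) x 0 i)%R] = 0)%E &
      {ae P, forall w, forall x : site d,
        - div_star (fun y => (xi + grad (phi ^~ w) y) *m Amat w y) x = 0}].

Definition homogenized_matrix (P : probability Omega R) (A : 'M[R]_d) : Prop :=
  A^T = A /\
  forall xi : 'rV[R]_d, exists phi : site d -> Omega -> R,
    corrector P xi phi /\
    ((qform A xi)%:E =
      'E_P[(fun w => qform (Amat w 0) (xi + grad (phi ^~ w) 0))%R])%E.

(* The neighbours of 0 are the e_i and the - e_i, and the edge {- e_i, 0} is
   represented by (- e_i, i). *)
Definition opL (u : Omega -> R) (w : Omega) : R :=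
  \sum_i (cond w 0 i * (u w - u (shift (unit_vec i) w))
          + cond w (- unit_vec i) i * (u w - u (shift (- unit_vec i) w))).

Definition drift (xi : 'rV[R]_d) (w : Omega) : R :=
  \sum_i xi 0 i * (cond w 0 i - cond w (- unit_vec i) i).

Definition Qpoly (mu : R) (k : nat) : {poly R} :=
  \prod_(i < k) ((2 ^+ i * mu)%:P + 'X) ^+ 2.

(* The division by 'X is exact. *)
Definition Ppoly (mu : R) (k : nat) : {poly R} :=
  (Qpoly mu k - (2 ^+ (k * k.-1) * mu ^+ (2 * k))%:P) %/ 'X.

Definition approx_matrix (P : probability Omega R) (mu : R) (k : nat)
    (A : 'M[R]_d) : Prop :=
  A^T = A /\
  forall xi : 'rV[R]_d,
    exists e : {measure set (measurableTypeR R) -> \bar R},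
      spectral_measure P opL (drift xi) e /\
      ((qform A xi)%:E =
         'E_P[(fun w => qform (Amat w 0) xi)%R] -
         \int[e]_(lambda in `[0%R, +oo[%classic)
           ((Ppoly mu k).[lambda] / (Qpoly mu k).[lambda])%R%:E)%E.

End Homogenization.

Section ErrorBounds.
Variable R : realType.

Definition ln_plus (x : R) : R := Num.max (ln x) 1.

Definition Err (D q k mu : R) : R :=
  if k < D / 4 then mu `^ (2 * k)
  else if k == D / 4 then mu `^ (2 * k) * ln_plus mu^-1 `^ (1 + q)
  else mu `^ (D / 2) * ln_plus mu^-1 `^ q.

Definition error_bound (d : nat) (q : R) (k : nat) (mu : R) : R :=
  if (d == 2)%N then Err 2 q k%:R mu
  else if (2 < d <= 5)%N then Err d%:R 0 k%:R mu
  else if (d == 6)%N then Err 6 1 k%:R mu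
  else if (6 < d <= 12)%N then Err 6 0 k%:R mu
  else Err (d%:R - 6) 0 k%:R mu.

End ErrorBounds.

(* Main.v *)
Require Import Defs.
From HB Require Import structures.
From mathcomp Require Import all_boot all_order all_algebra.
From mathcomp Require Import all_classical all_reals all_analysis.
From mathcomp Require Import measurable_realfun.
From mathcomp Require Import ring lra zify.

Set Implicit Arguments.
Unset Strict Implicit.
Unset Printing Implicit Defensive.

Import Order.TTheory GRing.Theory Num.Theory.
Import numFieldNormedType.Exports.

Local Open Scope classical_set_scope.
Local Open Scope ring_scope.

(* Put [c = 4 d beta], [T = 1 - L / c] (so [0 <= T <= 1]), [U_n = T^n drift] and
   [m_j = <drift U_j>]. Everything rests on the optimal decay
   [<U_n^2> <= C (n+1)^-(d/2+1)], valid without logarithms for every [d >= 2].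

   [U_n] is the value at the origin of a solution of a discrete heat equation whose
   initial datum is the divergence of a local field, so on a finite torus (where
   finitely many values of the conductances may be assumed) an Efron-Stein
   inequality bounds its moments by the sensitivities to single conductances.
   Duhamel's formula turns these into a convolution inequality for the moments of
   [U_n] and of its gradients, with kernels given by the decay of [T^n] on dipoles
   (Nash inequality; in dimension two, hole filling and Davies weights gain a small
   power). A first pass, with high moments, gives an almost optimal rate; in a
   second pass the dipole decay is decorrelated from the gradient by resampling the
   conductances of a small cube, which gives the optimal rate.

   Testing the corrector equation with [c^-1 sum_j U_j] and using that the shifts
   are mixing yields [xi . Ahom xi = <xi . A xi> - c^-1 sum_j m_j]. Positivity of the
   functional [p |-> <drift p(L) drift>] on Bernstein polynomials identifies [m_j]
   with the integral of [(1 - x/c)^j] against the spectral measure, which is carried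
   by [0 < x <= c]. The error is then the integral of [h / x], where
   [h = Q(0) / Q(x) <= C (mu / (mu + x))^2k]; expanding this power in powers of
   [1 - x/c] bounds it by sums of the [m_j], and the decay of [m_j] gives the error
   functions with [q = 0]. *)

(** * Elementary inequalities *)

Section Inequalities.
Variable R : realFieldType.
Implicit Types (x y : R) (n p : nat).

Lemma le_of_eq x y : x = y -> x <= y.
Proof. by move->. Qed.

Lemma ler_sqr_nneg x y : 0 <= x -> x <= y -> x ^+ 2 <= y ^+ 2.
Proof. by move=> x0 xy; rewrite lerXn2r ?nnegrE // (le_trans x0). Qed.

Lemma normr_exprn_even x n : `|x| ^+ (2 * n) = x ^+ (2 * n).
Proof. by rewrite !exprM real_normK ?num_real. Qed.

Lemma ler_sum_inj (I J : finType) (h : I -> J) (F : J -> R) :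
  injective h -> (forall j, 0 <= F j) -> \sum_i F (h i) <= \sum_j F j.
Proof.
move=> hi F0; rewrite -(big_imset _ (in2W hi)) /=.
by rewrite [leRHS](bigID (mem [set h x | x in xpredT]%SET)) /= lerDl sumr_ge0.
Qed.

Lemma ler_sum_cond (I : Type) (r : seq I) (P : pred I) (F : I -> R) :
  (forall i, 0 <= F i) -> \sum_(i <- r | P i) F i <= \sum_(i <- r) F i.
Proof. by move=> F0; rewrite [leRHS](bigID P) /= lerDl sumr_ge0. Qed.

Lemma exprn_tangent_le p x y : 0 <= x -> 0 <= y ->
  x ^+ p.+1 + p.+1%:R * x ^+ p * (y - x) <= y ^+ p.+1.
Proof.
move=> x0 y0; elim: p => [|p IH]; first by rewrite !expr1 expr0; lra.
have step_le : y * (x ^+ p.+1 + p.+1%:R * x ^+ p * (y - x)) <= y * y ^+ p.+1 by rewrite ler_wpM2l.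
rewrite [in leRHS]exprS; apply: le_trans step_le.
rewrite -subr_ge0 -(natr1 p.+1) !exprS.
have -> : y * (x * x ^+ p + p.+1%:R * x ^+ p * (y - x)) -
  (x * (x * x ^+ p) + (p.+1%:R + 1) * (x * x ^+ p) * (y - x)) =
  p.+1%:R * x ^+ p * (y - x) ^+ 2 by ring.
by rewrite mulr_ge0 ?sqr_ge0 // mulr_ge0 ?exprn_ge0.
Qed.

Lemma jensen_exprn (I : finType) (l u : I -> R) p :
  (forall i, 0 <= l i) -> \sum_i l i = 1 -> (forall i, 0 <= u i) ->
  (\sum_i l i * u i) ^+ p.+1 <= \sum_i l i * u i ^+ p.+1.
Proof.
move=> l0 l1 ldrift; set m := \sum_i l i * u i.
have m0 : 0 <= m by rewrite sumr_ge0 // => i _; rewrite mulr_ge0.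
have : \sum_i l i * (m ^+ p.+1 + p.+1%:R * m ^+ p * (u i - m)) <= \sum_i l i * u i ^+ p.+1.
  by apply: ler_sum => i _; rewrite ler_wpM2l // exprn_tangent_le.
suff -> : \sum_i l i * (m ^+ p.+1 + p.+1%:R * m ^+ p * (u i - m)) = m ^+ p.+1 by [].
under eq_bigr do rewrite mulrDr.
rewrite big_split /= -mulr_suml l1 mul1r.
under eq_bigr => i _ do rewrite mulrCA mulrBr.
by rewrite -mulr_sumr sumrB -mulr_suml l1 mul1r -/m subrr mulr0 addr0.
Qed.

Lemma jensen_sqr (I : finType) (l u : I -> R) :
  (forall i, 0 <= l i) -> \sum_i l i = 1 ->
  (\sum_i l i * u i) ^+ 2 <= \sum_i l i * u i ^+ 2.
Proof.
move=> l0 l1; set m := \sum_i l i * u i.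
have : 0 <= \sum_i l i * (u i - m) ^+ 2 by apply: sumr_ge0 => i _; rewrite mulr_ge0 ?sqr_ge0.
have expand (z : R) : \sum_i l i * (u i - z) ^+ 2 =
    \sum_i l i * u i ^+ 2 - 2 * z * \sum_i l i * u i + z ^+ 2 * \sum_i l i.
  by rewrite !mulr_sumr -sumrB -big_split /=; apply: eq_bigr => i _; ring.
by rewrite expand l1 -/m; lra.
Qed.

Lemma sqr_sum_le_weights (I : finType) (l u : I -> R) :
  (forall i, 0 < l i) -> \sum_i l i = 1 ->
  (\sum_i u i) ^+ 2 <= \sum_i u i ^+ 2 / l i.
Proof.
move=> l0 l1.
have := jensen_sqr (fun i => u i / l i) (fun i => ltW (l0 i)) l1.
have -> : \sum_i l i * (u i / l i) = \sum_i u i.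
  by apply: eq_bigr => i _; rewrite mulrC divfK // gt_eqF.
move/le_trans; apply; apply: ler_sum => i _.
by rewrite expr_div_n expr2 mulrC expr2 invfM -!mulrA mulVf ?gt_eqF // mulr1.
Qed.

End Inequalities.

Section CauchySchwarz.
Variable R : rcfType.

Lemma discriminant_le (a b c : R) :
  (forall t, 0 <= a - 2 * t * b + t ^+ 2 * c) -> b ^+ 2 <= a * c.
Proof.
move=> h; have := @deg_le2_poly_ge0 R (Poly [:: a; - 2 * b; c]) (size_Poly _).
rewrite !coef_Poly /= => d0; have {}d0 : (- 2 * b) ^+ 2 - 4 * c * a <= 0.
  by apply: d0 => t; rewrite !horner_cons hornerC; have := h t; congr (0 <= _); ring.
by move: d0; nra.
Qed.

Lemma sum_CauchySchwarz_weights (I : finType) (P : pred I) (w f g : I -> R) :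
  (forall i, 0 <= w i) ->
  (\sum_(i | P i) w i * f i * g i) ^+ 2 <=
  (\sum_(i | P i) w i * f i ^+ 2) * \sum_(i | P i) w i * g i ^+ 2.
Proof.
move=> w0; apply: discriminant_le => t.
rewrite !mulr_sumr -sumrB -big_split /=; apply: sumr_ge0 => i _.
by have := mulr_ge0 (w0 i) (sqr_ge0 (f i - t * g i)); congr (0 <= _); ring.
Qed.

Lemma sum_CauchySchwarz (I : finType) (P : pred I) (f g : I -> R) :
  (\sum_(i | P i) f i * g i) ^+ 2 <= (\sum_(i | P i) f i ^+ 2) * \sum_(i | P i) g i ^+ 2.
Proof.
have := sum_CauchySchwarz_weights P f g (fun=> ler01 : 0 <= 1 :> R).
by under eq_bigr do rewrite mul1r; under [in leRHS]eq_bigr do rewrite mul1r;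
   under [X in _ * X]eq_bigr do rewrite mul1r.
Qed.

End CauchySchwarz.

Lemma leq_half m : (m./2 <= m)%N. Proof. lia. Qed.

Lemma ltn_double_half m : (m < 2 * (m./2).+1)%N. Proof. lia. Qed.

Lemma sqrtr_le_sqr (R : rcfType) (x y : R) : 0 <= y -> x <= y ^+ 2 -> Num.sqrt x <= y.
Proof. by move=> y0 xy; rewrite -[leRHS](ger0_norm y0) -sqrtr_sqr ler_sqrt // sqr_ge0. Qed.

Lemma exists_pow2_inv_le (R : realType) (x : R) : 0 < x ->
  exists m, exists2 p, (2 ^ m)%N = p.+1 & (2 * p.+1)%:R^-1 <= x.
Proof.
move=> x0; exists (Num.truncn x^-1), (2 ^ Num.truncn x^-1).-1; rewrite prednK ?expn_gt0 //.
rewrite -[leRHS]invrK lef_pV2 ?posrE ?invr_gt0 ?ltr0n ?muln_gt0 ?expn_gt0 //.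
apply: ltW; apply: lt_le_trans (truncnS_gt _) _; rewrite ler_nat (leq_trans (ltn_expl _ (ltnSn 1))) //.
by rewrite leq_pmull.
Qed.

Section Powers.
Variable R : realType.
Implicit Types (x y : R) (n p : nat).

Lemma le_exprn_addgt0 n (X Y : R) : 0 <= Y ->
  (forall eta, 0 < eta -> X <= (Y + eta) ^+ n.+1) -> X <= Y ^+ n.+1.
Proof.
move=> Y0 h; have [X0|X0] := leP X 0; first by rewrite (le_trans X0) ?exprn_ge0.
pose r := X `^ (n.+1%:R^-1).
have r0 : 0 <= r by exact: powR_ge0.
have rX : r ^+ n.+1 = X by rewrite -powR_mulrn // -powRrM mulVf // powRr1 // ltW.
suff: r <= Y by move=> rY; rewrite -rX lerXn2r ?nnegrE.
apply/ler_addgt0Pr => eta eta0; move: (h _ eta0); rewrite -rX.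
by rewrite ler_pXn2r // nnegrE addr_ge0 // ltW.
Qed.

(* The weights are free: optimizing them over the simplex gives l i = k i / sum k. *)
Lemma le_exprn_sum_weights (I : finType) (k : I -> R) (X : R) n :
  (forall i, 0 <= k i) ->
  (forall l : I -> R, (forall i, 0 < l i) -> \sum_i l i = 1 ->
     X <= \sum_i l i * (k i / l i) ^+ n.+1) ->
  (0 < #|I|)%N -> X <= (\sum_i k i) ^+ n.+1.
Proof.
move=> k0 h I0; apply: le_exprn_addgt0; first exact: sumr_ge0.
move=> eta eta0; pose z := eta / #|I|%:R.
have z0 : 0 < z by rewrite divr_gt0 // ltr0n.
have Se : \sum_i (k i + z) = \sum_i k i + eta.
  rewrite big_split /= sumr_const -mulr_natr /z -mulrA mulVf ?mulr1 //.
  by rewrite pnatr_eq0 -lt0n.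
have S0 : 0 < \sum_i k i + eta by rewrite ltr_wpDl // sumr_ge0.
set Sm := \sum_i k i + eta in Se S0 *.
pose l i := (k i + z) / Sm.
have l0 i : 0 < l i by rewrite divr_gt0 // ltr_wpDl.
apply: le_trans (h l l0 _) _; first by rewrite -mulr_suml Se divff ?gt_eqF.
apply: (@le_trans _ _ (\sum_i l i * Sm ^+ n.+1)); last first.
  by rewrite -mulr_suml /l -mulr_suml Se divff ?gt_eqF // mul1r.
apply: ler_sum => i _; rewrite ler_wpM2l ?(ltW (l0 _)) //.
have kl : 0 <= k i / l i by exact: divr_ge0 (k0 i) (ltW (l0 i)).
rewrite lerXn2r ?nnegrE ?(ltW S0) //.
rewrite ler_pdivrMr // /l mulrC divfK ?gt_eqF //.
by rewrite lerDl ltW.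
Qed.

Definition powS n x : R := n.+1%:R `^ x.

Lemma powS_gt0 n x : 0 < powS n x. Proof. by rewrite powR_gt0 // ltr0n. Qed.
Lemma powS_ge0 n x : 0 <= powS n x. Proof. exact: powR_ge0. Qed.
Lemma powSD n x y : powS n (x + y) = powS n x * powS n y.
Proof. by rewrite /powS powRD // pnatr_eq0 implybT. Qed.
Lemma powSr0 n : powS n 0 = 1. Proof. exact: powRr0. Qed.
Lemma powSr1 n : powS n 1 = n.+1%:R. Proof. by rewrite /powS powRr1. Qed.
Lemma powSN n x : powS n (- x) = (powS n x)^-1. Proof. exact: powRN. Qed.
Lemma powS_mulN n x : powS n x * powS n (- x) = 1.
Proof. by rewrite -powSD subrr powSr0. Qed.
Lemma powS_exprn n x k : powS n x ^+ k = powS n (x * k%:R).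
Proof. by rewrite -powR_mulrn ?powS_ge0 // -powRrM. Qed.
Lemma powS0l x : powS 0 x = 1. Proof. by rewrite /powS powR1. Qed.

Lemma ler_powS n x y : x <= y -> powS n x <= powS n y.
Proof. by move=> h; apply: ler_powR => //; rewrite ler1n. Qed.

Lemma powS_antimono m n x : x <= 0 -> (m <= n)%N -> powS n x <= powS m x.
Proof.
move=> x0 mn; rewrite -(opprK x) ![powS _ (- - x)]powSN lef_pV2 ?posrE ?powS_gt0 //.
by rewrite /powS ge0_ler_powR ?nnegrE ?ler0n ?ler_nat // lerNr oppr0.
Qed.

Lemma powS_mono m n x : 0 <= x -> (m <= n)%N -> powS m x <= powS n x.
Proof. by move=> x0 mn; rewrite ge0_ler_powR ?nnegrE ?ler0n ?ler_nat. Qed.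

Lemma powS_scale_le K m n x : x <= 0 -> (n < K * m.+1)%N ->
  powS m x <= K%:R `^ (- x) * powS n x.
Proof.
move=> x0 nm; have K0 : (0 < K)%N by case: K nm.
have powR_le : n.+1%:R `^ (- x) <= K%:R `^ (- x) * m.+1%:R `^ (- x) :> R.
  rewrite -powRM ?ler0n // -natrM ge0_ler_powR ?nnegrE ?ler0n ?ler_nat //; lra.
have hn := powS_gt0 n (- x); have hm := powS_gt0 m (- x).
rewrite -[in leLHS](opprK x) -[in powS n x](opprK x) ![powS _ (- - x)]powSN.
by rewrite ler_pdivlMr // mulrC ler_pdivrMr // mulrC [leRHS]mulrC.
Qed.

Lemma powS_le_half x m n : 0 <= x -> (n < 2 * m.+1)%N ->
  powS m (- x) <= 2 `^ x * powS n (- x).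
Proof. by move=> x0 h; rewrite -[x in 2 `^ x]opprK; apply: powS_scale_le; rewrite ?oppr_le0. Qed.

Lemma powS_doubleS m x : powS (2 * m).+1 x = 2 `^ x * powS m x.
Proof.
rewrite /powS -powRM ?ler0n // -natrM; congr (_%:R `^ _); rewrite mulnS.
by rewrite -addn2 addnC.
Qed.

Lemma powS_le_eventually x y : 0 < x -> 0 < y ->
  exists m, forall n, (m <= n)%N -> powS n (- x) <= y.
Proof.
move=> x0 y0; pose b := y^-1 `^ x^-1; exists (Num.truncn b) => n nb.
have bn : b <= n.+1%:R.
  by apply: ltW; apply: lt_le_trans (truncnS_gt _) _; rewrite ler_nat ltnS.
rewrite powSN -[leRHS]invrK lef_pV2 ?posrE ?powS_gt0 ?invr_gt0 //.
have -> : y^-1 = b `^ x by rewrite /b -powRrM mulVf ?gt_eqF // powRr1 // invr_ge0 ltW.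
by rewrite ge0_ler_powR ?nnegrE ?powR_ge0 ?ler0n // ltW.
Qed.

Lemma powS_divX n x k : (0 < k)%N -> powS n (x / k%:R) ^+ k = powS n x.
Proof. by move=> k0; rewrite powS_exprn divfK // pnatr_eq0 -lt0n. Qed.

Definition nroot q (x : R) : R := x `^ q%:R^-1.
Lemma nroot_ge0 q x : 0 <= nroot q x. Proof. exact: powR_ge0. Qed.
Lemma nrootK q x : (0 < q)%N -> 0 <= x -> nroot q x ^+ q = x.
Proof.
move=> q0 x0; rewrite /nroot -powR_mulrn ?powR_ge0 // -powRrM mulVf ?powRr1 //.
by rewrite pnatr_eq0 -lt0n.
Qed.
Lemma nroot_le q (x y : R) : (0 < q)%N -> 0 <= x -> 0 <= y -> x <= y ^+ q -> nroot q x <= y.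
Proof.
move=> q0 x0 y0 h; rewrite -(@ler_pXn2r _ q) ?nnegrE ?nroot_ge0 // nrootK //.
Qed.

End Powers.

(** * Random walks on a finite quotient of the lattice *)

Section HeatStep.
Variables (R : realFieldType) (V : zmodType) (d : nat) (e : 'I_d -> V).
Implicit Types (f g : V -> R) (a b : V * 'I_d -> R) (E : V * 'I_d).

Definition ediff E f : R := f (E.1 + e E.2) - f E.1.
Definition lap a f x : R :=
  \sum_i (a (x, i) * (f x - f (x + e i)) + a (x - e i, i) * (f x - f (x - e i))).
Definition delta (y x : V) : R := (x == y)%:R.
Definition dipole E (x : V) : R := delta (E.1 + e E.2) x - delta E.1 x.

Lemma lapB a f g x : lap a (fun y => f y - g y) x = lap a f x - lap a g x.
Proof. by rewrite /lap -sumrB; apply: eq_bigr => i _; ring. Qed.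
Lemma lapD a f g x : lap a (fun y => f y + g y) x = lap a f x + lap a g x.
Proof. by rewrite /lap -big_split; apply: eq_bigr => i _ /=; ring. Qed.
Lemma lapZ a k f x : lap a (fun y => k * f y) x = k * lap a f x.
Proof. by rewrite /lap mulr_sumr; apply: eq_bigr => i _; ring. Qed.

Variables (alpha beta : R).
Hypotheses (d_gt0 : (0 < d)%N) (alpha_gt0 : 0 < alpha) (le_ab : alpha <= beta).

Definition elliptic a := forall E, alpha <= a E <= beta.

(* With this normalization the walk generated by [heat_step] is lazy: it stays put with probability at least 1/2. *)
Fact spec_bound_key : unit. Proof. by []. Qed.
Definition spec_bound : R := locked_with spec_bound_key (4 * d%:R * beta).
Lemma spec_boundE : spec_bound = 4 * d%:R * beta. Proof. by rewrite /spec_bound unlock. Qed.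

Definition scaled_lap a f x : R := spec_bound^-1 * lap a f x.
Definition heat_step a f x : R := f x - scaled_lap a f x.
Definition heat a n f := iter n (heat_step a) f.

Lemma heat_addn a m n f : heat a (m + n) f = heat a m (heat a n f).
Proof. exact: iterD. Qed.

Lemma heat_stepB a f g x : heat_step a (fun y => f y - g y) x = heat_step a f x - heat_step a g x.
Proof. by rewrite /heat_step /scaled_lap lapB; ring. Qed.
Lemma heat_stepD a f g x : heat_step a (fun y => f y + g y) x = heat_step a f x + heat_step a g x.
Proof. by rewrite /heat_step /scaled_lap lapD; ring. Qed.
Lemma heat_stepZ a k f x : heat_step a (fun y => k * f y) x = k * heat_step a f x.
Proof. by rewrite /heat_step /scaled_lap lapZ; ring. Qed.
Lemma heatB a n f g x : heat a n (fun y => f y - g y) x = heat a n f x - heat a n g x.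
Proof.
elim: n x => //= n IH x; rewrite -heat_stepB; congr heat_step; apply/funext => y; exact: IH.
Qed.
Lemma heatD a n f g x : heat a n (fun y => f y + g y) x = heat a n f x + heat a n g x.
Proof.
elim: n x => //= n IH x; rewrite -heat_stepD; congr heat_step; apply/funext => y; exact: IH.
Qed.
Lemma heatZ a n k f x : heat a n (fun y => k * f y) x = k * heat a n f x.
Proof.
elim: n x => //= n IH x; rewrite -heat_stepZ; congr heat_step; apply/funext => y; exact: IH.
Qed.

Lemma lap_heat a n f : lap a (heat a n f) = heat a n (lap a f).
Proof.
elim: n => //= n IH; rewrite -IH; apply/funext => x.
rewrite /heat_step [LHS](lapB a (heat a n f)) /scaled_lap; congr (_ - _).
exact: (lapZ a _ (lap a (heat a n f))).
Qed.

Lemma beta_gt0 : 0 < beta. Proof. exact: lt_le_trans le_ab. Qed.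
Lemma dR_gt0 : 0 < d%:R :> R. Proof. by rewrite ltr0n. Qed.
Lemma spec_bound_gt0 : 0 < spec_bound.
Proof. by rewrite spec_boundE !mulr_gt0 // ?dR_gt0 // beta_gt0. Qed.

Lemma heat_stepE a f x : heat_step a f x = (1 - spec_bound^-1 * \sum_i (a (x, i) + a (x - e i, i))) * f x
  + spec_bound^-1 * \sum_i (a (x, i) * f (x + e i) + a (x - e i, i) * f (x - e i)).
Proof.
rewrite /heat_step /scaled_lap; have -> : lap a f x = (\sum_i (a (x, i) + a (x - e i, i))) * f x -
    \sum_i (a (x, i) * f (x + e i) + a (x - e i, i) * f (x - e i)).
  by rewrite /lap mulr_suml -sumrB; apply: eq_bigr => i _; ring.
by ring.
Qed.

Section Elliptic.
Variable a : V * 'I_d -> R.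
Hypothesis ha : elliptic a.

Lemma elliptic_ge0 E : 0 <= a E.
Proof. by have /andP[h _] := ha E; exact: le_trans (ltW alpha_gt0) h. Qed.

Lemma sum_star_le x : \sum_i (a (x, i) + a (x - e i, i)) <= spec_bound / 2.
Proof.
apply: (@le_trans _ _ (\sum_(i < d) (beta + beta))).
  by apply: ler_sum => i _; apply: lerD; [case/andP: (ha (x, i))|case/andP: (ha (x - e i, i))].
by rewrite sumr_const card_ord -mulr_natr spec_boundE; lra.
Qed.

Lemma heat_step_ge0 f : (forall x, 0 <= f x) -> forall x, 0 <= heat_step a f x.
Proof.
move=> f0 x; rewrite heat_stepE addr_ge0 // mulr_ge0 ?invr_ge0 ?(ltW spec_bound_gt0) ?f0 //; last first.
  by rewrite sumr_ge0 // => i _; rewrite addr_ge0 // mulr_ge0 // elliptic_ge0.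
rewrite subr_ge0 ler_pdivrMl ?spec_bound_gt0 // mulr1; apply: le_trans (sum_star_le x) _.
by have := spec_bound_gt0; lra.
Qed.

Lemma heat_ge0 f n : (forall x, 0 <= f x) -> forall x, 0 <= heat a n f x.
Proof. by move=> f0; elim: n => //= n IH; exact: heat_step_ge0. Qed.

Lemma normr_heat_le f n x : `|heat a n f x| <= heat a n (fun y => `|f y|) x.
Proof.
have sub_ge0 : 0 <= heat a n (fun y => `|f y| - f y) x.
  by apply: heat_ge0 => y; rewrite subr_ge0 ler_norm.
have add_ge0 : 0 <= heat a n (fun y => `|f y| + f y) x.
  by apply: heat_ge0 => y; have := ler_norm (- f y); rewrite normrN; lra.
rewrite ler_norml; move: sub_ge0 add_ge0; rewrite heatB heatD; lra.
Qed.

Lemma heat_cst k n x : heat a n (fun=> k) x = k.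
Proof.
have step_cst : heat_step a (fun=> k) = fun=> k.
  apply/funext => y; rewrite /heat_step /scaled_lap /lap big1 ?mulr0 ?subr0 // => i _.
  by rewrite subrr !mulr0 addr0.
by have -> // : heat a n (fun=> k) = fun=> k; elim: n => //= n ->.
Qed.

Lemma normr_heat_le_sup K f n x : (forall y, `|f y| <= K) -> `|heat a n f x| <= K.
Proof.
move=> fK; apply: le_trans (normr_heat_le f n x) _; rewrite -subr_ge0 -{1}(heat_cst K n x) -heatB.
by apply: heat_ge0 => y; rewrite subr_ge0.
Qed.

End Elliptic.
End HeatStep.
Arguments delta {R V} y x.
Arguments dipole {R V d} e E x.

Section HeatFlow.
Variables (R : rcfType) (V : finZmodType) (d : nat) (e : 'I_d -> V).
Implicit Types (f g : V -> R) (a b : V * 'I_d -> R) (E : V * 'I_d).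

Definition dot f g : R := \sum_x f x * g x.
Definition gradsq f : R := \sum_E ediff e E f ^+ 2.

Lemma sum_edges (F : V * 'I_d -> R) : \sum_E F E = \sum_x \sum_i F (x, i).
Proof. by rewrite pair_bigA /=; apply: eq_bigr => -[]. Qed.

Lemma sum_translate (F : V -> R) y : \sum_x F (x + y) = \sum_x F x.
Proof. by rewrite [RHS](reindex_inj (addIr y)). Qed.

(* Each edge has two endpoints; [F x y E] is a contribution of the edge [E] seen from [x]. *)
Lemma sum_neighbours (F : V -> V -> V * 'I_d -> R) :
  \sum_x \sum_i (F x (x + e i) (x, i) + F x (x - e i) (x - e i, i)) =
  \sum_E (F E.1 (E.1 + e E.2) E + F (E.1 + e E.2) E.1 E).
Proof.
rewrite (sum_edges (fun E => F E.1 (E.1 + e E.2) E + F (E.1 + e E.2) E.1 E)) exchange_big /=.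
rewrite [RHS]exchange_big; apply: eq_bigr => i _ /=.
rewrite !big_split /=; congr (_ + _).
by rewrite -(sum_translate _ (e i)); apply: eq_bigr => x _; rewrite addrK.
Qed.

Lemma dot_lap a f g : dot f (lap e a g) = \sum_E a E * ediff e E f * ediff e E g.
Proof.
rewrite /dot; under eq_bigr do rewrite /lap mulr_sumr.
under eq_bigr => x _ do under eq_bigr => i _ do rewrite mulrDr.
rewrite (sum_neighbours (fun x y E => f x * (a E * (g x - g y)))).
by apply: eq_bigr => -[x i] _; rewrite /ediff /=; ring.
Qed.

Lemma dotC f g : dot f g = dot g f.
Proof. by apply: eq_bigr => x _; rewrite mulrC. Qed.
Lemma dotBr f g h : dot f (fun x => g x - h x) = dot f g - dot f h.
Proof. by rewrite /dot -sumrB; apply: eq_bigr => x _; rewrite mulrBr. Qed.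
Lemma dotZr k f g : dot f (fun x => k * g x) = k * dot f g.
Proof. by rewrite /dot mulr_sumr; apply: eq_bigr => x _; rewrite mulrCA. Qed.
Lemma dotBl f g h : dot (fun x => f x - g x) h = dot f h - dot g h.
Proof. by rewrite dotC dotBr !(dotC h). Qed.
Lemma dot_sumr (I : finType) f (F : I -> V -> R) :
  dot f (fun x => \sum_j F j x) = \sum_j dot f (F j).
Proof.
by rewrite /dot exchange_big; apply: eq_bigr => x _; rewrite mulr_sumr.
Qed.
Lemma dot_ge0 f : 0 <= dot f f.
Proof. by rewrite sumr_ge0 // => x _; rewrite -expr2 sqr_ge0. Qed.

Lemma dot_delta y f : dot (delta y) f = f y.
Proof.
rewrite /dot (bigD1 y) //= /delta eqxx mul1r big1 ?addr0 // => x /negPf ->.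
by rewrite mul0r.
Qed.
Lemma dot_dipole E f : dot (dipole e E) f = ediff e E f.
Proof. by rewrite dotBl !dot_delta. Qed.

Lemma sum_delta (y : V) : \sum_x delta y x = 1 :> R.
Proof.
rewrite /delta (bigD1 y) //= eqxx big1 ?addr0 // => x /negPf -> //.
Qed.

Variables (alpha beta : R).
Hypotheses (d_gt0 : (0 < d)%N) (alpha_gt0 : 0 < alpha) (le_ab : alpha <= beta).
Local Notation spec_bound := (spec_bound d beta).
Local Notation scaled_lap := (scaled_lap e beta).
Local Notation heat_step := (heat_step e beta).
Local Notation heat := (heat e beta).

Definition energy a f : R := dot f (scaled_lap a f).

Lemma energyE a f : energy a f = spec_bound^-1 * \sum_E a E * ediff e E f ^+ 2.
Proof.
rewrite /energy /scaled_lap dotZr dot_lap; congr (_ * _).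
by apply: eq_bigr => E _; rewrite expr2 mulrA.
Qed.

Lemma dot_scaled_lap a f g : dot f (scaled_lap a g) = dot (scaled_lap a f) g.
Proof.
rewrite [RHS]dotC /scaled_lap !dotZr !dot_lap; congr (_ * _).
by apply: eq_bigr => E _; rewrite mulrAC.
Qed.
Lemma dot_heat_step a f g : dot f (heat_step a g) = dot (heat_step a f) g.
Proof. by rewrite dotBr dotBl dot_scaled_lap. Qed.
Lemma dot_heat a n f g : dot f (heat a n g) = dot (heat a n f) g.
Proof.
elim: n f => //= n IH f; rewrite dot_heat_step IH /heat; congr dot.
by rewrite -iterS iterSr.
Qed.
Lemma heat_sum a n (I : finType) (F : I -> V -> R) x :
  heat a n (fun y => \sum_j F j y) x = \sum_j heat a n (F j) x.
Proof.
rewrite -[LHS]dot_delta dot_heat dot_sumr; apply: eq_bigr => j _.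
by rewrite -dot_heat dot_delta.
Qed.

Lemma sum_heat_step a f : \sum_x heat_step a f x = \sum_x f x.
Proof.
have -> : \sum_x heat_step a f x = dot (fun _ => 1) (heat_step a f).
  by apply: eq_bigr => x _; rewrite mul1r.
rewrite /heat_step dotBr /scaled_lap dotZr dot_lap [X in _ - _ * X]big1 ?mulr0 ?subr0.
  by apply: eq_bigr => x _; rewrite mul1r.
by move=> E _; rewrite /ediff subrr mulr0 mul0r.
Qed.
Lemma sum_heat a n f : \sum_x heat a n f x = \sum_x f x.
Proof. by elim: n => //= n IH; rewrite sum_heat_step. Qed.

Section Elliptic.
Variable a : V * 'I_d -> R.
Hypothesis ha : elliptic alpha beta a.

Let spec_gt0 : 0 < spec_bound := spec_bound_gt0 d_gt0 alpha_gt0 le_ab.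
Let a_ge0 := elliptic_ge0 alpha_gt0 ha.

Lemma scaled_lap_sqr_le f x : scaled_lap a f x ^+ 2 <= (2 * spec_bound)^-1 *
  \sum_i (a (x, i) * (f x - f (x + e i)) ^+ 2 + a (x - e i, i) * (f x - f (x - e i)) ^+ 2).
Proof.
set Q := \sum_i _.
have lap_sqr_le : lap e a f x ^+ 2 <= Q * \sum_i (a (x, i) + a (x - e i, i)).
  apply: discriminant_le => t; rewrite /Q /lap !mulr_sumr -sumrB -big_split /=.
  apply: sumr_ge0 => i _.
  have := mulr_ge0 (a_ge0 (x, i)) (sqr_ge0 (f x - f (x + e i) - t)).
  have := mulr_ge0 (a_ge0 (x - e i, i)) (sqr_ge0 (f x - f (x - e i) - t)).
  lra.
have Q_ge0 : 0 <= Q.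
  by apply: sumr_ge0 => i _; rewrite addr_ge0 // mulr_ge0 ?sqr_ge0.
rewrite /scaled_lap exprMn exprVn ler_pdivrMl ?exprn_gt0 //; apply: le_trans lap_sqr_le _.
have -> : spec_bound ^+ 2 * ((2 * spec_bound)^-1 * Q) = Q * (spec_bound / 2) by field; rewrite gt_eqF.
by rewrite ler_wpM2l // (sum_star_le _ ha).
Qed.

Lemma weighted_scaled_lap_sqr_le (w f : V -> R) : (forall x, 0 <= w x) ->
  \sum_x w x * scaled_lap a f x ^+ 2 <= (2 * spec_bound)^-1 *
    \sum_E a E * (w E.1 + w (E.1 + e E.2)) * ediff e E f ^+ 2.
Proof.
move=> w0; have -> : \sum_E a E * (w E.1 + w (E.1 + e E.2)) * ediff e E f ^+ 2 =
  \sum_E (w E.1 * (a E * (f E.1 - f (E.1 + e E.2)) ^+ 2) +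
          w (E.1 + e E.2) * (a E * (f (E.1 + e E.2) - f E.1) ^+ 2)).
  by apply: eq_bigr => E _; rewrite /ediff; ring.
rewrite -(sum_neighbours (fun x y E => w x * (a E * (f x - f y) ^+ 2))) mulr_sumr.
apply: ler_sum => x _; under eq_bigr => i _ do rewrite -mulrDr.
by rewrite -[in leRHS]mulr_sumr [leRHS]mulrCA; apply: ler_wpM2l => //; exact: scaled_lap_sqr_le.
Qed.

Lemma scaled_lap_le_energy f : dot (scaled_lap a f) (scaled_lap a f) <= energy a f.
Proof.
have := @weighted_scaled_lap_sqr_le (fun _ => 1) f (fun _ => ler01); rewrite energyE.
under eq_bigr do rewrite mul1r expr2.
move/le_trans; apply; rewrite invfM [2^-1 * _]mulrC -mulrA ler_wpM2l ?invr_ge0 ?(ltW spec_gt0) //.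
rewrite mulr_sumr; apply: ler_sum => E _.
by apply: le_of_eq; field.
Qed.

Lemma energy_ge0 f : 0 <= energy a f.
Proof.
rewrite energyE mulr_ge0 ?invr_ge0 ?(ltW spec_gt0) // sumr_ge0 // => E _.
by rewrite mulr_ge0 ?sqr_ge0.
Qed.

Lemma heat_step_sqrE f : dot (heat_step a f) (heat_step a f) = dot f f - 2 * energy a f + dot (scaled_lap a f) (scaled_lap a f).
Proof. by rewrite /heat_step dotBl !dotBr -dot_scaled_lap /energy; ring. Qed.

Lemma heat_step_sqr_le f : dot (heat_step a f) (heat_step a f) <= dot f f - energy a f.
Proof. by rewrite heat_step_sqrE; have := scaled_lap_le_energy f; lra. Qed.

Lemma heat_step_sqr_antimono f : dot (heat_step a f) (heat_step a f) <= dot f f.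
Proof. by have := heat_step_sqr_le f; have := energy_ge0 f; lra. Qed.

Lemma energy_le f : energy a f <= dot f f.
Proof. by have := heat_step_sqr_le f; have := dot_ge0 (heat_step a f); lra. Qed.

Lemma energy_heat_step_le f : energy a (heat_step a f) <= energy a f.
Proof.
have ST : scaled_lap a (heat_step a f) = fun x => scaled_lap a f x - scaled_lap a (scaled_lap a f) x.
  by apply/funext => x; rewrite /scaled_lap /heat_step lapB mulrBr.
rewrite {1}/energy ST {1}/heat_step dotBl !dotBr -[dot f (scaled_lap a (scaled_lap a f))]/(dot f (scaled_lap a _)) (dot_scaled_lap a f (scaled_lap a f)).
have := energy_le (scaled_lap a f); rewrite /energy.
have := scaled_lap_le_energy f; have := dot_ge0 (scaled_lap a f); rewrite /energy; lra.
Qed.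

Lemma heat_sqr_antimono f m n : (m <= n)%N -> dot (heat a n f) (heat a n f) <= dot (heat a m f) (heat a m f).
Proof.
move=> /subnK <-; elim: (n - m)%N => // k IH.
by rewrite addSn; apply: le_trans IH; exact: heat_step_sqr_antimono.
Qed.

Lemma energy_heat_decay f m : m.+1%:R * energy a (heat a m f) <= dot f f.
Proof.
have Em k n : (k <= n)%N -> energy a (heat a n f) <= energy a (heat a k f).
  move=> /subnK <-; elim: (n - k)%N => // j IH.
  by rewrite addSn; apply: le_trans IH; exact: energy_heat_step_le.
suff h : \sum_(k < m.+1) energy a (heat a k f) + dot (heat a m.+1 f) (heat a m.+1 f) <= dot f f.
  apply: le_trans h; rewrite -[leLHS]addr0 lerD ?dot_ge0 //.
  rewrite -[m.+1 in leLHS]card_ord mulr_natl -sumr_const; apply: ler_sum => k _.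
  by apply: Em; rewrite -ltnS.
elim: m.+1 => [|n IH]; first by rewrite big_ord0 add0r.
rewrite big_ord_recr /=; apply: le_trans IH; rewrite -addrA lerD2l.
by have := heat_step_sqr_le (heat a n f); rewrite /heat; lra.
Qed.

Lemma gradsq_le_energy f : alpha * gradsq f <= spec_bound * energy a f.
Proof.
rewrite energyE mulrA divff ?gt_eqF ?spec_gt0 // mul1r /gradsq mulr_sumr.
by apply: ler_sum => E _; rewrite ler_wpM2r ?sqr_ge0 //; case/andP: (ha E).
Qed.

Lemma gradsq_heat_decay f m : gradsq (heat a m f) <= spec_bound / alpha * dot f f / m.+1%:R.
Proof.
rewrite ler_pdivlMr ?ltr0n // mulrAC ler_pdivlMr //.
have := gradsq_le_energy (heat a m f); have := energy_heat_decay f m => energy_decay gradsq_le.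
have scaled_energy_decay : spec_bound * (m.+1%:R * energy a (heat a m f)) <= spec_bound * dot f f by rewrite ler_pM2l ?spec_gt0.
have scaled_gradsq_le : m.+1%:R * (alpha * gradsq (heat a m f)) <= m.+1%:R * (spec_bound * energy a (heat a m f)).
  by rewrite ler_wpM2l.
by apply: le_trans scaled_energy_decay; rewrite mulrCA; apply: le_trans scaled_gradsq_le; apply: le_of_eq; ring.
Qed.

Lemma heat_l1_le f n : \sum_x `|heat a n f x| <= \sum_x `|f x|.
Proof.
rewrite -(sum_heat a n (fun y => `|f y|)); apply: ler_sum => x _; exact: (normr_heat_le e d_gt0 alpha_gt0 le_ab ha).
Qed.

Lemma heat_delta_l1 n (y : V) : \sum_x `|heat a n (delta y) x| = 1.
Proof.
rewrite -[RHS](sum_delta y) -(sum_heat a n (delta y)); apply: eq_bigr => x _.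
by rewrite ger0_norm // (heat_ge0 e d_gt0 alpha_gt0 le_ab ha) // => z; rewrite /delta ler0n.
Qed.

End Elliptic.
End HeatFlow.

Lemma dot_CauchySchwarz (R : rcfType) (V : finZmodType) (f g : V -> R) :
  dot f g ^+ 2 <= dot f f * dot g g.
Proof.
have := sum_CauchySchwarz xpredT f g.
by under [X in _ <= X * _]eq_bigr do rewrite expr2; under [X in _ <= _ * X]eq_bigr do rewrite expr2.
Qed.

(** * Nash inequality and heat-kernel decay *)

Section LatticePoints.
Variables (V : zmodType) (d : nat) (e : 'I_d -> V).
Implicit Types (k l : 'I_d -> nat).

Definition lattice_pt k : V := \sum_i e i *+ k i.

(* The box of side N embeds: up to that scale the quotient V of Z^d looks like Z^d. *)
Definition box_embeds N := forall k l, (forall i, k i < N)%N -> (forall i, l i < N)%N ->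
  lattice_pt k = lattice_pt l -> k =1 l.

End LatticePoints.

Section Nash.
Variables (R : realType) (V : finZmodType) (d : nat) (e : 'I_d -> V).
Implicit Types (f : V -> R) (k l : 'I_d -> nat).
Local Notation lattice_pt := (lattice_pt e).
Local Notation box_embeds := (box_embeds e).

Lemma sum_sqr_path_le f (s : seq 'I_d) :
  \sum_x (f (x + \sum_(i <- s) e i) - f x) ^+ 2 <=
  (size s)%:R * \sum_(i <- s) \sum_x ediff e (x, i) f ^+ 2.
Proof.
elim: s => [|j s IH].
  by rewrite !big_nil mul0r big1 // => x _; rewrite addr0 subrr expr0n.
rewrite !big_cons /=; set y := \sum_(i <- s) e i in IH *.
set W := \sum_(i <- s) _ in IH *; set D := \sum_x ediff e (x, j) f ^+ 2.
have D0 : 0 <= D by rewrite sumr_ge0 // => x _; rewrite sqr_ge0.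
have W0 : 0 <= W by rewrite sumr_ge0 // => i _; rewrite sumr_ge0 // => x _; rewrite sqr_ge0.
have [s0|s0] := posnP (size s).
  have y0 : y = 0 by rewrite /y (size0nil s0) big_nil.
  have -> : W = 0 by rewrite /W (size0nil s0) big_nil.
  rewrite s0 mul1r addr0; apply: ler_sum => x _; by rewrite y0 addr0.
have m0 : 0 < (size s)%:R :> R by rewrite ltr0n.
set m : R := (size s)%:R in IH m0 *.
apply: (@le_trans _ _ (\sum_x ((1 + m^-1) * (f (x + e j + y) - f (x + e j)) ^+ 2
   + (1 + m) * ediff e (x, j) f ^+ 2))).
  apply: ler_sum => x _; rewrite addrA /ediff /=.
  set A := f (x + e j + y); set B := f (x + e j); set C := f x.
  have h : 0 <= m^-1 * ((A - B) - m * (B - C)) ^+ 2 by rewrite mulr_ge0 ?sqr_ge0 // invr_ge0 ltW.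
  rewrite -subr_ge0; apply: (le_trans h); apply: le_of_eq.
  by field; lra.
rewrite big_split /= -!mulr_sumr.
rewrite (sum_translate (fun z => (f (z + y) - f z) ^+ 2) (e j)) -/D.
rewrite -natr1 -/m mulrDr addrC [m + 1]addrC lerD2l.
have h : (1 + m^-1) * \sum_x (f (x + y) - f x) ^+ 2 <= (1 + m^-1) * (m * W).
  by rewrite ler_wpM2l // addr_ge0 // invr_ge0 ltW.
by apply: le_trans h _; apply: le_of_eq; field; lra.
Qed.

Lemma big_lattice_path (M : nmodType) (F : 'I_d -> M) k :
  \sum_(i <- flatten [seq nseq (k i) i | i <- enum 'I_d]) F i = \sum_i F i *+ k i.
Proof.
rewrite big_flatten big_map big_enum /=; apply: eq_bigr => i _.
by rewrite big_nseq; elim: (k i) => //= n ->; rewrite mulrS.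
Qed.

Lemma sum_sqr_shift_le f k r : (forall i, k i <= r)%N ->
  \sum_x (f (x + lattice_pt k) - f x) ^+ 2 <= d%:R * r%:R ^+ 2 * gradsq e f.
Proof.
move=> kr; have := sum_sqr_path_le f (flatten [seq nseq (k i) i | i <- enum 'I_d]).
rewrite !big_lattice_path -/(lattice_pt k) => /le_trans; apply.
have D0 i : 0 <= \sum_x ediff e (x, i) f ^+ 2 by rewrite sumr_ge0 // => x _; rewrite sqr_ge0.
have path_size_le : (size (flatten [seq nseq (k i) i | i <- enum 'I_d]) <= d * r)%N.
  rewrite -sum1_size big_lattice_path (leq_trans (n := \sum_(i < d) r)) //.
    have mulrn1 n : (1%N *+ n)%R = n by elim: n => // n IH; rewrite mulrS IH.
    by apply: leq_sum => i _; rewrite mulrn1.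
  by rewrite sum_nat_const card_ord.
have path_energy_le : \sum_i (\sum_x ediff e (x, i) f ^+ 2) *+ k i <= r%:R * gradsq e f.
  rewrite /gradsq sum_edges exchange_big mulr_sumr; apply: ler_sum => i _.
  by rewrite -mulr_natl ler_wpM2r // ler_nat.
move: path_size_le; rewrite -(ler_nat R) => path_size_le.
have := ler_pM (ler0n _ _) (sumr_ge0 _ (fun i _ => mulrn_wge0 (k i) (D0 i))) path_size_le path_energy_le.
move=> /le_trans; apply.
by rewrite natrM; apply: le_of_eq; ring.
Qed.

Section BoxAverage.
Variables (N r : nat).
Hypotheses (emb : box_embeds N) (r_gt0 : (0 < r)%N) (le_rN : (r <= N)%N).

Let weight : R := (r%:R ^+ d)^-1.
Let weight_gt0 : 0 < weight. Proof. by rewrite invr_gt0 exprn_gt0 // ltr0n. Qed.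
Let sum_weight : \sum_(k : {ffun 'I_d -> 'I_r}) weight = 1.
Proof. by rewrite sumr_const card_ffun !card_ord -mulr_natl natrX divff // gt_eqF // -invr_gt0. Qed.

Definition box_average f x : R :=
  \sum_(k : {ffun 'I_d -> 'I_r}) weight * f (x + lattice_pt (fun i => k i)).

Lemma box_average_dist_le f :
  \sum_x (box_average f x - f x) ^+ 2 <= d%:R * r%:R ^+ 2 * gradsq e f.
Proof.
apply: (@le_trans _ _ (\sum_x \sum_(k : {ffun 'I_d -> 'I_r})
    weight * (f (x + lattice_pt (fun i => k i)) - f x) ^+ 2)).
  apply: ler_sum => x _.
  apply: le_trans (jensen_sqr _ (fun=> ltW weight_gt0) sum_weight).
  under [in leRHS]eq_bigr do rewrite mulrBr.
  by rewrite sumrB -mulr_suml sum_weight mul1r.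
rewrite exchange_big /= -[leRHS]mul1r -[X in _ <= X * _]sum_weight mulr_suml; apply: ler_sum => k _.
rewrite -mulr_sumr ler_wpM2l ?(ltW weight_gt0) //.
by apply: sum_sqr_shift_le => i; rewrite ltnW.
Qed.

Lemma normr_box_average_le f x : `|box_average f x| <= weight * \sum_z `|f z|.
Proof.
rewrite /box_average -mulr_sumr normrM (gtr0_norm weight_gt0) ler_wpM2l ?(ltW weight_gt0) //.
apply: le_trans (ler_norm_sum _ _ _) _.
pose pt (k : {ffun 'I_d -> 'I_r}) := x + lattice_pt (fun i => k i).
apply: (ler_sum_inj (h := pt) (F := fun z => `|f z|)) => // k l /addrI/emb kl.
by apply/ffunP => i; apply/val_inj; apply: kl => j; exact: leq_trans (ltn_ord _) le_rN.
Qed.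

Lemma box_average_l1_le f : \sum_x `|box_average f x| <= \sum_z `|f z|.
Proof.
apply: (@le_trans _ _ (\sum_x \sum_(k : {ffun 'I_d -> 'I_r})
    weight * `|f (x + lattice_pt (fun i => k i))|)).
  apply: ler_sum => x _; apply: le_trans (ler_norm_sum _ _ _) _.
  by apply: ler_sum => k _; rewrite normrM (gtr0_norm weight_gt0).
rewrite exchange_big /=.
under eq_bigr => k _ do rewrite -mulr_sumr (sum_translate (fun z => `|f z|)).
by rewrite -mulr_suml sum_weight mul1r.
Qed.

Lemma box_average_sqr_le f : \sum_x box_average f x ^+ 2 <= weight * (\sum_x `|f x|) ^+ 2.
Proof.
have l1_ge0 : 0 <= weight * \sum_z `|f z| by rewrite mulr_ge0 ?(ltW weight_gt0) ?sumr_ge0.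
rewrite expr2 mulrA; apply: le_trans (ler_wpM2l l1_ge0 (box_average_l1_le f)).
rewrite mulr_sumr; apply: ler_sum => x _.
by rewrite -real_normK ?num_real // expr2 ler_wpM2r // normr_box_average_le.
Qed.

Lemma nash_inequality f :
  dot f f <= 2 * (d%:R * r%:R ^+ 2) * gradsq e f + 2 * (r%:R ^+ d)^-1 * (\sum_x `|f x|) ^+ 2.
Proof.
have := box_average_dist_le f; have := box_average_sqr_le f.
suff : dot f f <= 2 * (\sum_x (box_average f x - f x) ^+ 2 + \sum_x box_average f x ^+ 2).
  by rewrite /weight; lra.
rewrite -big_split mulr_sumr; apply: ler_sum => x _ /=.
by have := sqr_ge0 (2 * box_average f x - f x); lra.
Qed.

End BoxAverage.
End Nash.

Lemma ex_sqr_scale (K n : nat) : (0 < K)%N ->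
  exists r, (r ^ 2 * K <= n < r.+1 ^ 2 * K)%N.
Proof.
move=> K0; have ex : exists r, (r ^ 2 * K <= n)%N by exists 0%N.
have ub r : (r ^ 2 * K <= n)%N -> (r <= n)%N.
  move=> h; apply: leq_trans h; rewrite -[X in (X <= _)%N]muln1 leq_mul //.
  by rewrite -mulnn; case: r => // r; rewrite leq_pmulr.
case: (ex_maxnP ex ub) => r h1 h2; exists r; rewrite h1 /= ltnNge; apply/negP => /h2.
by rewrite ltnn.
Qed.

Lemma ex_sqr_scale_half (K m : nat) : (0 < K)%N -> (m.+1 <= 2 * K)%N \/
  exists r, [/\ (0 < r)%N, (r <= m)%N, (r ^ 2 * K <= (m./2).+1)%N & (m.+1 <= 8 * K * r ^ 2)%N].
Proof.
move=> K0; have [r /andP[le_rm lt_mr]] := @ex_sqr_scale K (m./2).+1 K0.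
have [mK|mK] := leqP m.+1 (2 * K); [by left|right; exists r].
have r0 : (0 < r)%N by rewrite lt0n; apply/eqP => r0; move: lt_mr; rewrite r0; lia.
have le_rrK : (r * r <= r ^ 2 * K)%N by rewrite -mulnn leq_pmulr.
split=> //; first by nia.
have : (r.+1 ^ 2 <= 4 * r ^ 2)%N by rewrite -[4%N]/(2 ^ 2)%N -expnMn leq_exp2r //; lia.
nia.
Qed.

Section HeatKernel.
Variables (R : realType) (d : nat) (alpha beta : R).
Hypotheses (d_gt0 : (0 < d)%N) (alpha_gt0 : 0 < alpha) (le_ab : alpha <= beta).
Let c0 := spec_bound_gt0 d_gt0 alpha_gt0 le_ab.
Let hd : R := d%:R / 2.
Let hd0 : 0 <= hd. Proof. by rewrite divr_ge0. Qed.

Lemma dot_delta_delta (V : finZmodType) (y : V) : dot (@delta R V y) (delta y) = 1.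
Proof. by rewrite dot_delta /delta eqxx. Qed.

Section OnQuotient.
Variables (V : finZmodType) (e : 'I_d -> V) (N : nat) (a : V * 'I_d -> R) (y : V).
Hypotheses (emb : box_embeds e N) (ha : elliptic alpha beta a).

Definition kernel_sqr n := dot (heat e beta a n (delta y)) (heat e beta a n (delta y)).

Lemma kernel_sqr_antimono m n : (m <= n)%N -> kernel_sqr n <= kernel_sqr m.
Proof. exact: (heat_sqr_antimono e d_gt0 alpha_gt0 le_ab ha). Qed.

Lemma kernel_sqr_le1 n : kernel_sqr n <= 1.
Proof. by rewrite -(dot_delta_delta y) (kernel_sqr_antimono (leq0n n)). Qed.

Lemma kernel_sqr_nash n r : (0 < r)%N -> (r <= N)%N -> kernel_sqr n.*2 <=
  2 * (d%:R * r%:R ^+ 2) * (spec_bound d beta / alpha * kernel_sqr n / n.+1%:R) + 2 * (r%:R ^+ d)^-1.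
Proof.
move=> r0 rN; rewrite {1}/kernel_sqr -addnn heat_addn.
apply: le_trans (nash_inequality emb r0 rN _) _.
rewrite -heat_addn (heat_delta_l1 e d_gt0 alpha_gt0 le_ab ha) expr1n mulr1 heat_addn lerD2r.
by rewrite ler_wpM2l ?(gradsq_heat_decay e d_gt0 alpha_gt0 le_ab ha) // mulr_ge0 // mulr_ge0 ?sqr_ge0.
Qed.

End OnQuotient.

Lemma ge1_powS_le m (B : R) : m.+1%:R <= B -> 1 <= B `^ hd * powS m (- hd).
Proof.
move=> mB; rewrite powSN ler_pdivlMr ?powS_gt0 // mul1r.
by rewrite ge0_ler_powR ?nnegrE ?ler0n ?(le_trans _ mB).
Qed.

Lemma inv_scale_powS_le m r (B : R) : (0 < r)%N -> 0 <= B -> m.+1%:R <= B * r%:R ^+ 2 ->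
  (r%:R ^+ d)^-1 <= B `^ hd * powS m (- hd).
Proof.
move=> r0 B0 mr; have rd_gt0 : 0 < r%:R ^+ d :> R by rewrite exprn_gt0 // ltr0n.
rewrite -[leLHS]mul1r ler_pdivrMr // mulrAC.
suff -> : r%:R ^+ d = (r%:R ^+ 2) `^ hd :> R by rewrite -powRM ?sqr_ge0 // ge1_powS_le.
rewrite -[_ ^+ 2]powR_mulrn ?ler0n // -powRrM -powR_mulrn ?ler0n //; congr (_ `^ _).
by rewrite /hd; field.
Qed.

Lemma heat_kernel_decay : exists2 C : R, 0 < C &
  forall (V : finZmodType) (e : 'I_d -> V) N a, box_embeds e N -> elliptic alpha beta a ->
  forall n y, (n <= N)%N ->
  dot (heat e beta a n (delta y)) (heat e beta a n (delta y)) <= C * powS n (- hd).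
Proof.
pose q := spec_bound d beta / alpha; have q0 : 0 < q by exact: divr_gt0.
have two : 0 < 2 `^ hd :> R by rewrite powR_gt0.
pose A : R := 2 * d%:R * q * (2 * 2 `^ hd).
have [K K0 AK] : exists2 K : nat, (0 < K)%N & A <= K%:R.
  by exists (Num.truncn A).+1 => //; apply: ltW; apply: truncnS_gt.
pose D : R := (8 * K%:R) `^ hd; have D0 : 0 < D by rewrite powR_gt0 // mulr_gt0 ?ltr0n.
exists (4 * D); first by rewrite mulr_gt0.
move=> V e N a emb ha n y nN; rewrite -/(kernel_sqr e a y n); elim/ltn_ind: n nN => m IH mN.
have [mK|[r [r0 rm rK mr]]] := ex_sqr_scale_half m K0.
  apply: le_trans (kernel_sqr_le1 e y ha m) _.
  apply: le_trans (_ : D * powS m (- hd) <= _); last first.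
    by rewrite ler_wpM2r ?powS_ge0 //; lra.
  by apply: ge1_powS_le; rewrite -natrM ler_nat; lia.
have m0 : (0 < m)%N := leq_trans r0 rm; pose n := m./2.
have nm : (n < m)%N by rewrite /n; lia.
have le_2nm : (n.*2 <= m)%N by rewrite /n; lia.
apply: le_trans (kernel_sqr_antimono e y ha le_2nm) _.
apply: le_trans (kernel_sqr_nash y emb ha n r0 (leq_trans rm mN)) _; rewrite -/q.
have grad_part : 2 * (d%:R * r%:R ^+ 2) * (q * kernel_sqr e a y n / n.+1%:R) <=
    2 * D * powS m (- hd).
  have -> : 2 * (d%:R * r%:R ^+ 2) * (q * kernel_sqr e a y n / n.+1%:R) =
      (r%:R ^+ 2 * A) / n.+1%:R * (kernel_sqr e a y n / (2 * 2 `^ hd)).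
    by rewrite /A; field; rewrite ?gt_eqF ?pnatr_eq0.
  apply: (@le_trans _ _ (kernel_sqr e a y n / (2 * 2 `^ hd))).
    rewrite ler_piMl ?divr_ge0 ?dot_ge0 ?mulr_ge0 ?powR_ge0 //.
    rewrite ler_pdivrMr ?mul1r ?ltr0n // (le_trans (ler_wpM2l (sqr_ge0 _) AK)) //.
    by rewrite -natrX -natrM ler_nat.
  rewrite ler_pdivrMr ?mulr_gt0 //; apply: (le_trans (IH n nm (leq_trans (ltnW nm) mN))).
  have powS_nm : powS n (- hd) <= 2 `^ hd * powS m (- hd).
    have := @powS_scale_le R 2 n m (- hd); rewrite opprK oppr_le0; apply => //.
    exact: ltn_double_half.
  by have := ler_wpM2l (ltW D0) powS_nm; lra.
have mass_part : (r%:R ^+ d)^-1 <= D * powS m (- hd).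
  by apply: inv_scale_powS_le => //; rewrite -natrX -!natrM ler_nat.
by apply: le_trans (lerD grad_part (ler_wpM2l (ler0n R 2) mass_part)) _; apply: le_of_eq; ring.
Qed.

Lemma heat_kernel_grad_decay : exists2 C : R, 0 < C &
  forall (V : finZmodType) (e : 'I_d -> V) N a, box_embeds e N -> elliptic alpha beta a ->
  forall n y, (n <= N)%N -> gradsq e (heat e beta a n (delta y)) <= C * powS n (- (hd + 1)).
Proof.
have [C C0 hC] := heat_kernel_decay.
exists (spec_bound d beta / alpha * (2 * 2 `^ hd * C)).
  by apply: mulr_gt0; [exact: divr_gt0|rewrite mulr_gt0 // mulr_gt0 // powR_gt0].
move=> V e N a tor ha n y nN; pose m := n./2.
have -> : heat e beta a n (delta y) = heat e beta a (n - m) (heat e beta a m (delta y)).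
  by rewrite -heat_addn subnK // leq_half.
apply: le_trans (gradsq_heat_decay e d_gt0 alpha_gt0 le_ab ha _ _) _.
rewrite -!mulrA ler_pM2l ?spec_bound_gt0 // ler_pM2l ?invr_gt0 //.
have mn : (m <= n)%N by exact: leq_half.
have kernel_le := hC V e N a tor ha m y (leq_trans mn nN).
have pwnm : powS m (- hd) <= 2 `^ hd * powS n (- hd).
  have := @powS_scale_le R 2 m n (- hd); rewrite opprK; apply; first by rewrite oppr_le0.
  exact: ltn_double_half.
rewrite opprD powSD [powS n (- 1)]powSN powSr1.
have i : (n - m).+1%:R^-1 <= 2 * n.+1%:R^-1 :> R.
  rewrite -[2]invrK -invfM lef_pV2 ?posrE ?mulr_gt0 ?invr_gt0 ?ltr0n //.
  rewrite ler_pdivrMl // -natrM ler_nat mul2n -addnn -[X in (X < _)%N](subnK mn).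
  by rewrite -addSn leq_add // leqW // leq_subRL // addnn; lia.
have z : 0 <= (n - m).+1%:R^-1 :> R by rewrite invr_ge0.
apply: (le_trans (ler_pM (dot_ge0 _) z (le_trans kernel_le (ler_wpM2l (ltW C0) pwnm)) i)).
by apply: le_of_eq; ring.
Qed.

Lemma dot_sub_le (V : finZmodType) (f g : V -> R) :
  dot (fun x => f x - g x) (fun x => f x - g x) <= 2 * dot f f + 2 * dot g g.
Proof.
rewrite /dot !mulr_sumr -big_split; apply: ler_sum => x _ /=.
by have := sqr_ge0 (f x + g x); lra.
Qed.

Lemma heat_dipole_decay : exists2 C : R, 0 < C &
  forall (V : finZmodType) (e : 'I_d -> V) N a, box_embeds e N -> elliptic alpha beta a ->
  forall n E, (n <= N)%N ->
  dot (heat e beta a n (dipole e E)) (heat e beta a n (dipole e E)) <= C * powS n (- hd).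
Proof.
have [C C0 hC] := heat_kernel_decay; exists (4 * C); first by rewrite mulr_gt0.
move=> V e N a tor ha n E nN.
have -> : heat e beta a n (dipole e E) = fun x =>
  heat e beta a n (delta (E.1 + e E.2)) x - heat e beta a n (delta E.1) x.
  by apply/funext => x; rewrite /dipole heatB.
apply: le_trans (dot_sub_le _ _) _.
have := hC V e N a tor ha n (E.1 + e E.2) nN; have := hC V e N a tor ha n E.1 nN.
lra.
Qed.

End HeatKernel.

(** * Product spaces and the Efron-Stein inequality *)

Section FiniteProduct.
Variables (R : realFieldType) (S J : finType) (w : S -> R).
Hypotheses (w_ge0 : forall s, 0 <= w s) (w_sum : \sum_s w s = 1).
Local Notation Om := {ffun J -> S}.
Implicit Types (F G : Om -> R) (s t : Om).

Definition prod_weight s : R := \prod_j w (s j).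
Definition expect F : R := \sum_s prod_weight s * F s.

Lemma prod_weight_ge0 s : 0 <= prod_weight s. Proof. by rewrite prodr_ge0. Qed.

Lemma sum_prod_weight : \sum_s prod_weight s = 1.
Proof.
by rewrite /prod_weight -(bigA_distr_bigA (fun _ x => w x)) /= big1.
Qed.

Lemma expect_cst k : expect (fun=> k) = k.
Proof. by rewrite /expect -mulr_suml sum_prod_weight mul1r. Qed.
Lemma expectD F G : expect (fun s => F s + G s) = expect F + expect G.
Proof. by rewrite /expect -big_split; apply: eq_bigr => s _; rewrite mulrDr. Qed.
Lemma expectB F G : expect (fun s => F s - G s) = expect F - expect G.
Proof. by rewrite /expect -sumrB; apply: eq_bigr => s _; rewrite mulrBr. Qed.
Lemma expectZ k F : expect (fun s => k * F s) = k * expect F.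
Proof. by rewrite /expect mulr_sumr; apply: eq_bigr => s _; rewrite mulrCA. Qed.
Lemma expect_sum (I : finType) (P : pred I) (F : I -> Om -> R) :
  expect (fun s => \sum_(i | P i) F i s) = \sum_(i | P i) expect (F i).
Proof.
by rewrite /expect exchange_big; apply: eq_bigr => s _; rewrite mulr_sumr.
Qed.
Lemma le_expect F G : (forall s, F s <= G s) -> expect F <= expect G.
Proof. by move=> h; apply: ler_sum => s _; rewrite ler_wpM2l ?prod_weight_ge0. Qed.
Lemma expect_ge0 F : (forall s, 0 <= F s) -> 0 <= expect F.
Proof. by move=> h; rewrite sumr_ge0 // => s _; rewrite mulr_ge0 ?prod_weight_ge0. Qed.
Lemma eq_expect F G : F =1 G -> expect F = expect G.
Proof. by move=> h; apply: eq_bigr => s _; rewrite h. Qed.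

Lemma expect_exprn_le F p : (forall s, 0 <= F s) -> expect F ^+ p.+1 <= expect (fun s => F s ^+ p.+1).
Proof. by move=> F0; apply: jensen_exprn => //; [exact: prod_weight_ge0|exact: sum_prod_weight]. Qed.

Lemma expect_reindex (h : J -> J) F : injective h ->
  expect (fun s => F [ffun j => s (h j)]) = expect F.
Proof.
move=> hi; have h_bij : bijective h by apply: injF_bij.
have reindex_inj_ffun : injective (fun s : Om => [ffun j => s (h j)] : Om).
  case: h_bij => g hg gh s t /ffunP st; apply/ffunP => j.
  by move: (st (g j)); rewrite !ffunE gh.
rewrite [RHS](reindex_inj reindex_inj_ffun); apply: eq_bigr => s _; congr (_ * _).
rewrite /prod_weight (reindex_inj hi) /=; apply: eq_bigr => j _; by rewrite ffunE.
Qed.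

Definition depends_on (A : pred J) F := forall s t, (forall j, A j -> s j = t j) -> F s = F t.

Lemma expect_indep (A : pred J) F G : depends_on A F -> depends_on (predC A) G ->
  expect (fun s => F s * G s) = expect F * expect G.
Proof.
move=> dF dG; pose mix s t : Om := [ffun j => if A j then s j else t j].
rewrite -[LHS]mul1r -sum_prod_weight [LHS]mulr_suml.
transitivity (\sum_s \sum_t prod_weight s * prod_weight t * (F s * G s)).
  rewrite exchange_big; apply: eq_bigr => t _; rewrite /expect mulr_sumr.
  by apply: eq_bigr => s _; rewrite mulrA (mulrC (prod_weight t)).
rewrite pair_bigA /=.
have mix_inj : injective (fun p : Om * Om => (mix p.1 p.2, mix p.2 p.1)).
  move=> [s t] [s' t'] [] /ffunP st /ffunP ts.
  by congr (_, _); apply/ffunP => j; move: (st j) (ts j); rewrite !ffunE; case: ifP.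
rewrite (reindex_inj mix_inj) /=.
transitivity (\sum_(p : Om * Om) prod_weight p.1 * prod_weight p.2 * (F p.1 * G p.2)).
  apply: eq_bigr => -[s t] _ /=; congr (_ * (_ * _)).
  - rewrite /prod_weight -!big_split /=; apply: eq_bigr => j _; rewrite !ffunE.
    by case: ifP => _ //; rewrite mulrC.
  - by apply: dF => j Aj; rewrite ffunE Aj.
  - by apply: dG => j /negPf Aj; rewrite ffunE Aj.
rewrite -(pair_bigA _ (fun s t => prod_weight s * prod_weight t * (F s * G t))) /=.
rewrite /expect mulr_suml; apply: eq_bigr => s _; rewrite mulr_sumr; apply: eq_bigr => t _.
by ring.
Qed.

End FiniteProduct.

Section Young.
Variable R : realFieldType.
Implicit Types x y : R.

Lemma young_exprn p (eps V y : R) : 0 < eps -> 0 <= V -> 0 <= y ->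
  V * y ^+ p <= eps * y ^+ p.+1 + (eps ^+ p)^-1 * V ^+ p.+1.
Proof.
move=> e0 V0 y0; have ep : 0 < eps ^+ p by rewrite exprn_gt0.
have [h|h] := leP V (eps * y).
  apply: (@le_trans _ _ (eps * y ^+ p.+1)).
    by rewrite exprS mulrA ler_wpM2r ?exprn_ge0.
  by rewrite lerDl mulr_ge0 ?exprn_ge0 // invr_ge0 ltW.
apply: (@le_trans _ _ ((eps ^+ p)^-1 * V ^+ p.+1)); last first.
  by rewrite lerDr mulr_ge0 ?exprn_ge0 // ltW.
rewrite exprS mulrCA ler_wpM2l // ler_pdivlMl // -exprMn lerXn2r ?nnegrE ?(ltW h) //.
by rewrite mulr_ge0 // ltW.
Qed.

Lemma sqr_subX_le p x y : (x ^+ p.+1 - y ^+ p.+1) ^+ 2 <=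
  p.+1%:R ^+ 2 * ((x - y) ^+ 2 * (x ^+ (2 * p) + y ^+ (2 * p))).
Proof.
pose M : R := Num.max `|x| `|y|.
have subX_le : `|x ^+ p.+1 - y ^+ p.+1| <= `|x - y| * (p.+1%:R * M ^+ p).
  rewrite subrXX normrM ler_wpM2l //; apply: le_trans (ler_norm_sum _ _ _) _.
  apply: (@le_trans _ _ (\sum_(i < p.+1) M ^+ p)); last first.
    by rewrite sumr_const card_ord mulr_natl.
  apply: ler_sum => i _.
  have -> : M ^+ p = M ^+ (p - i) * M ^+ i by rewrite -exprD subnK // -ltnS.
  rewrite normrM !normrX.
  by rewrite ler_pM ?exprn_ge0 // lerXn2r ?nnegrE ?le_max ?lexx ?normr_ge0 ?orbT.
rewrite -[_ ^+ 2 in leLHS]real_normK ?num_real //.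
apply: (@le_trans _ _ ((`|x - y| * (p.+1%:R * M ^+ p)) ^+ 2)).
  by rewrite lerXn2r ?nnegrE // mulr_ge0 // mulr_ge0 // exprn_ge0 // le_max normr_ge0.
rewrite exprMn exprMn mulrCA ler_wpM2l ?sqr_ge0 // real_normK ?num_real //.
rewrite ler_wpM2l ?sqr_ge0 // -exprM mulnC /M.
have even_ge0 (z : R) : 0 <= z ^+ (2 * p) by rewrite exprM exprn_ge0 ?sqr_ge0.
by rewrite maxEle; case: ifP => _; rewrite normr_exprn_even ?lerDr ?lerDl even_ge0.
Qed.
End Young.

Section EfronStein.
Variables (R : realFieldType) (S E : finType) (w : S -> R).
Hypotheses (w_ge0 : forall s, 0 <= w s) (w_sum : \sum_s w s = 1).
(* Three independent copies of the environment, labelled None, Some false and Some true. *)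
Let J := (E * option bool)%type.
Local Notation Om := {ffun J -> S}.
Local Notation expect := (@expect R S (E * option bool)%type w).
Implicit Types (Z : Om -> R) (s : Om) (k : bool) (A B : pred E).

Definition swap_index A k (j : E * option bool) : E * option bool :=
  if A j.1 then (j.1, if j.2 == None then Some k else if j.2 == Some k then None else j.2) else j.
Definition swap_copies A k s : Om := [ffun j => s (swap_index A k j)].

Lemma swap_indexK A k : involutive (swap_index A k).
Proof. by case=> x [[]|]; case: k; rewrite /swap_index /=; case Ax: (A x); rewrite /= ?Ax. Qed.

Lemma swap_copiesK A k : involutive (swap_copies A k).
Proof. by move=> s; apply/ffunP => j; rewrite !ffunE swap_indexK. Qed.

Lemma expect_swap A k Z : expect (fun s => Z (swap_copies A k s)) = expect Z.
Proof. exact: (expect_reindex _ _ (can_inj (swap_indexK A k))). Qed.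

Lemma swap_copies_comp A B k s : swap_copies A k (swap_copies B k s) = swap_copies (fun x => A x (+) B x) k s.
Proof.
apply/ffunP => -[x c]; rewrite !ffunE; congr (s _); rewrite /swap_index /=.
by case Ax: (A x); case Bx: (B x); rewrite /= ?Bx //; case: c => [[]|]; case: k.
Qed.

Definition depends_on_main Z := depends_on (fun j : E * option bool => j.2 == None) Z.

Lemma expect_mul_swap_all Z : depends_on_main Z -> expect (fun s => Z s * Z (swap_copies xpredT false s)) = expect Z ^+ 2.
Proof.
move=> hZ; rewrite (expect_indep w_sum hZ); first by rewrite (expect_swap xpredT false Z).
move=> s t h; apply: hZ => -[x c] /= /eqP ->; rewrite !ffunE /swap_index /=; exact: h.
Qed.

Definition resample (x : E) s := swap_copies (pred1 x) false s.

Lemma resampleK x : involutive (resample x). Proof. exact: swap_copiesK. Qed.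
Lemma expect_resample x Z : expect (fun s => Z (resample x s)) = expect Z. Proof. exact: expect_swap. Qed.

Lemma expect_mul_resample_diff x Z W :
  expect (fun s => Z s * (W s - W (resample x s))) =
  2^-1 * expect (fun s => (Z s - Z (resample x s)) * (W s - W (resample x s))).
Proof.
apply: (@mulfI _ 2) => //; rewrite mulVKf // mulr_natl mulr2n.
rewrite -[X in _ + X](expect_resample x) -expectD; apply: eq_expect => s.
by rewrite resampleK; ring.
Qed.

Lemma efron_stein_seq Z (l : seq E) : uniq l ->
  expect (fun s => Z s * (Z s - Z (swap_copies (mem l) false s))) <=
  2^-1 * \sum_(x <- l) expect (fun s => (Z s - Z (resample x s)) ^+ 2).
Proof.
elim: l => [_|x l IH /andP[xl ul]].
  rewrite big_nil mulr0; have -> : (fun s => Z s * (Z s - Z (swap_copies (mem [::]) false s))) = fun=> 0.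
    apply/funext => s; suff -> : swap_copies (mem [::]) false s = s by rewrite subrr mulr0.
    by apply/ffunP => j; rewrite ffunE /swap_index.
  by rewrite expect_cst.
pose B := swap_copies (mem l) false; pose Y s := Z (B s).
have BxE s : resample x (B s) = B (resample x s).
  by rewrite /resample /B !swap_copies_comp; congr swap_copies; apply/funext => y; rewrite addbC.
have YxE s : Z (swap_copies (mem (x :: l)) false s) = Y (resample x s).
  rewrite /Y -BxE /resample /B swap_copies_comp; congr (Z (swap_copies _ _ _)).
  by apply/funext => y /=; rewrite inE; case: eqP => [->|//] /=; rewrite (negPf xl).
rewrite big_cons mulrDr addrC.
have -> : expect (fun s => Z s * (Z s - Z (swap_copies (mem (x :: l)) false s))) =
    expect (fun s => Z s * (Z s - Y s)) + expect (fun s => Z s * (Y s - Y (resample x s))).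
  by rewrite -expectD; apply: eq_expect => s; rewrite YxE; ring.
apply: lerD; first exact: IH.
have Y_sqr : expect (fun s => (Y s - Y (resample x s)) ^+ 2) = expect (fun s => (Z s - Z (resample x s)) ^+ 2).
  rewrite -(expect_swap (mem l) false (fun s => (Z s - Z (resample x s)) ^+ 2)).
  by apply: eq_expect => s; rewrite -/(B s) BxE.
rewrite expect_mul_resample_diff ler_wpM2l //.
apply: (@le_trans _ _ (expect (fun s => 2^-1 * (Z s - Z (resample x s)) ^+ 2 + 2^-1 * (Y s - Y (resample x s)) ^+ 2))).
  by apply: le_expect => // s; have := sqr_ge0 ((Z s - Z (resample x s)) - (Y s - Y (resample x s))); lra.
by rewrite expectD !expectZ Y_sqr; lra.
Qed.

Lemma efron_stein Z : depends_on_main Z ->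
  expect (fun s => Z s ^+ 2) <= expect Z ^+ 2 + 2^-1 * \sum_x expect (fun s => (Z s - Z (resample x s)) ^+ 2).
Proof.
move=> hZ; have := @efron_stein_seq Z (enum E) (enum_uniq E).
rewrite big_enum /= -lerBlDl -(expect_mul_swap_all hZ).
have -> : expect (fun s => Z s * (Z s - Z (swap_copies (mem (enum E)) false s))) =
  expect (fun s => Z s ^+ 2) - expect (fun s => Z s * Z (swap_copies xpredT false s)).
  rewrite -expectB; apply: eq_expect => s; rewrite mulrBr expr2; congr (_ - _ * Z _).
  by apply/ffunP => j; rewrite !ffunE /swap_index /= mem_enum.
by [].
Qed.

Definition es_variance Z s := \sum_x (Z s - Z (resample x s)) ^+ 2.
Lemma es_variance_ge0 Z s : 0 <= es_variance Z s.
Proof. by rewrite sumr_ge0 // => x _; rewrite sqr_ge0. Qed.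

Lemma sum_expect_resample_exprn_le Z p :
  \sum_x expect (fun s => (Z s ^+ p.+1 - Z (resample x s) ^+ p.+1) ^+ 2) <=
  p.+1%:R ^+ 2 * (2 * expect (fun s => es_variance Z s * Z s ^+ (2 * p))).
Proof.
have -> : expect (fun s => es_variance Z s * Z s ^+ (2 * p)) =
    \sum_x expect (fun s => (Z s - Z (resample x s)) ^+ 2 * Z s ^+ (2 * p)).
  by rewrite -expect_sum; apply: eq_expect => s; rewrite /es_variance mulr_suml.
rewrite !mulr_sumr; apply: ler_sum => x _.
apply: (@le_trans _ _ (expect (fun s => p.+1%:R ^+ 2 *
    ((Z s - Z (resample x s)) ^+ 2 * Z s ^+ (2 * p) +
     (Z s - Z (resample x s)) ^+ 2 * Z (resample x s) ^+ (2 * p))))).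
  by apply: le_expect => // s; rewrite -mulrDr; apply: sqr_subX_le.
rewrite expectZ ler_wpM2l ?sqr_ge0 // expectD -[X in _ + X <= _](expect_resample x).
rewrite mulr_natl mulr2n lerD2l; apply: le_of_eq; apply: eq_expect => s.
by rewrite resampleK -sqrrN opprB.
Qed.

Lemma efron_stein_exprn p Z : depends_on_main Z ->
  expect (fun s => Z s ^+ (2 * p.+1)) <= 2 * expect (fun s => Z s ^+ p.+1) ^+ 2 +
  2 * p.+1%:R ^+ 2 * (2 * p.+1%:R ^+ 2) ^+ p * expect (fun s => es_variance Z s ^+ p.+1).
Proof.
move=> hZ; have n2_gt0 : 0 < p.+1%:R ^+ 2 :> R by rewrite exprn_gt0.
have hZp : depends_on_main (fun s => Z s ^+ p.+1) by move=> s t st; rewrite (hZ s t).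
have := efron_stein hZp; under [X in X <= _ -> _]eq_expect do rewrite -exprM mulnC.
have := sum_expect_resample_exprn_le Z p; move: n2_gt0; move: (p.+1%:R ^+ 2) => n2 n2_gt0.
have absorb : expect (fun s => es_variance Z s * Z s ^+ (2 * p)) <=
    (2 * n2)^-1 * expect (fun s => Z s ^+ (2 * p.+1)) +
    (2 * n2) ^+ p * expect (fun s => es_variance Z s ^+ p.+1).
  rewrite -!expectZ -expectD; apply: le_expect => // s; rewrite !exprM -[(2 * n2) ^+ p]invrK -exprVn.
  by apply: young_exprn; rewrite ?invr_gt0 ?mulr_gt0 ?sqr_ge0 ?es_variance_ge0.
have {absorb} := ler_wpM2l (ltW (mulr_gt0 (ltr0n R 2) n2_gt0)) absorb.
rewrite mulrDr mulVKf ?gt_eqF ?mulr_gt0 //.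
move: (expect _) (expect _) (expect _) (\sum_x _) => *; lra.
Qed.

End EfronStein.

Lemma efron_stein_pow (R : realFieldType) (m : nat) : exists2 C : R, 0 < C &
  forall (S E : finType) (w : S -> R), (forall s, 0 <= w s) -> \sum_s w s = 1 ->
  forall Z : {ffun E * option bool -> S} -> R, depends_on_main Z -> expect w Z = 0 ->
  expect w (fun s => Z s ^+ (2 * 2 ^ m)) <= C * expect w (fun s => es_variance Z s ^+ (2 ^ m)).
Proof.
elim: m => [|m [C C0 IH]].
  exists 2^-1; first by rewrite invr_gt0.
  move=> S E w w0 w1 Z hZ Z0; have := efron_stein w0 w1 hZ; rewrite Z0 expr0n add0r.
  by rewrite expn0 muln1 /es_variance; under [X in _ -> _ <= _ * X]eq_expect do rewrite expr1; rewrite expect_sum.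
pose p := (2 ^ m.+1).-1; have predE : p.+1 = (2 ^ m.+1)%N by rewrite prednK // expn_gt0.
have p1E : p.+1 = (2 * 2 ^ m)%N by rewrite predE expnS.
pose K : R := 2 * p.+1%:R ^+ 2 * (2 * p.+1%:R ^+ 2) ^+ p.
exists (2 * C ^+ 2 + K).
  by rewrite addr_gt0 ?mulr_gt0 ?exprn_gt0 ?mulr_gt0 ?exprn_gt0 ?ltr0n.
move=> S E w w0 w1 Z hZ Z0; rewrite -predE; apply: le_trans (efron_stein_exprn w0 w1 p hZ) _.
rewrite -/K [leRHS]mulrDl lerD2r -mulrA ler_pM2l //.
have V0 := es_variance_ge0 Z.
apply: (@le_trans _ _ ((C * expect w (fun s => es_variance Z s ^+ (2 ^ m))) ^+ 2)).
  apply: ler_sqr_nneg; last by rewrite p1E; apply: IH.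
  by apply: expect_ge0 => // s; rewrite p1E exprM exprn_ge0 ?sqr_ge0.
rewrite exprMn ler_wpM2l ?sqr_ge0 //.
have := expect_exprn_le w0 w1 1 (fun s => exprn_ge0 (2 ^ m) (V0 s)).
by move=> /le_trans; apply; apply: le_expect => // s; rewrite -exprM p1E mulnC.
Qed.

(** * Duhamel formula and the finite model *)

Section Drift.
Variables (R : realFieldType) (V : zmodType) (d : nat) (e : 'I_d -> V) (beta : R) (xi : 'I_d -> R).
Implicit Types (a : V * 'I_d -> R).

Definition ldrift a x : R := \sum_i xi i * (a (x, i) - a (x - e i, i)).
Definition heat_ldrift a n := heat e beta a n (ldrift a).

Lemma normr_ldrift_le alpha a x : 0 < alpha -> alpha <= beta -> elliptic alpha beta a -> (forall i, `|xi i| <= 1) ->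
  `|ldrift a x| <= 2 * d%:R * beta.
Proof.
move=> alpha0 le_ab ha xi_le; have b0 := lt_le_trans alpha0 le_ab.
apply: le_trans (ler_norm_sum _ _ _) _.
apply: (@le_trans _ _ (\sum_(i < d) 2 * beta)); last by rewrite sumr_const card_ord -mulr_natl; lra.
apply: ler_sum => i _; rewrite normrM -[leRHS]mul1r ler_pM //.
have /andP[a_ge a_le] := ha (x, i); have /andP[a'_ge a'_le] := ha (x - e i, i).
by rewrite ler_norml; apply/andP; split; lra.
Qed.

End Drift.

Lemma heat_ldrift_transfer (R : realFieldType) (V V' : zmodType) (d : nat) (e : 'I_d -> V) (e' : 'I_d -> V')
    (beta : R) (xi : 'I_d -> R) (rep : V -> V') (D : nat -> V -> Prop) (a : V * 'I_d -> R) (a' : V' * 'I_d -> R) :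
  (forall k x, D k.+1 x -> D k x) ->
  (forall k x i, D k.+1 x -> D k (x + e i) /\ D k (x - e i)) ->
  (forall k x i, D k x -> rep (x + e i) = rep x + e' i /\ rep (x - e i) = rep x - e' i) ->
  (forall x i, a (x, i) = a' (rep x, i)) ->
  forall n x, D n x -> heat_ldrift e beta xi a n x = heat_ldrift e' beta xi a' n (rep x).
Proof.
move=> D_sub D_nbr rep_dir aE; elim=> [|n IH] x Dx.
  by apply: eq_bigr => i _; have [_ down] := rep_dir _ _ i Dx; rewrite !aE down.
transitivity (heat_step e beta a (heat_ldrift e beta xi a n) x); first by [].
transitivity (heat_step e' beta a' (heat_ldrift e' beta xi a' n) (rep x)); last by [].
rewrite /heat_step /scaled_lap /lap (IH _ (D_sub _ _ Dx)); congr (_ - _ * _); apply: eq_bigr => i _.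
have [Dup Ddown] := D_nbr _ _ i Dx; have [up down] := rep_dir _ _ i Dx.
by rewrite !aE -up -down (IH _ Dup) (IH _ Ddown).
Qed.

Section Duhamel.
Variables (R : rcfType) (V : finZmodType) (d : nat) (e : 'I_d -> V) (beta : R).
Implicit Types (f g : V -> R) (a b : V * 'I_d -> R) (E : V * 'I_d).
Local Notation heat := (heat e beta).
Local Notation heat_step := (heat_step e beta).
Local Notation c := (spec_bound d beta).

Lemma dot_heat_step_sub a b f g :
  dot g (heat_step a f) - dot g (heat_step b f) = - c^-1 * \sum_E (a E - b E) * ediff e E g * ediff e E f.
Proof.
rewrite /heat_step !dotBr /scaled_lap !dotZr !dot_lap.
have -> : \sum_E (a E - b E) * ediff e E g * ediff e E f =
  \sum_E a E * ediff e E g * ediff e E f - \sum_E b E * ediff e E g * ediff e E f.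
  by rewrite -sumrB; apply: eq_bigr => E _; ring.
by ring.
Qed.

Lemma duhamel a b n f g :
  dot g (heat a n f) - dot g (heat b n f) =
  - c^-1 * \sum_(k < n) \sum_E (a E - b E) * ediff e E (heat a (n.-1 - k) g) * ediff e E (heat b k f).
Proof.
elim: n g => [|n IH] g; first by rewrite big_ord0 mulr0 subrr.
have last_step := dot_heat_step_sub a b (heat b n f) g.
rewrite dot_heat_step -[heat_step b (heat b n f)]/(heat b n.+1 f) in last_step.
rewrite [heat a n.+1 f]/= dot_heat_step big_ord_recr /= subnn mulrDr -last_step.
have -> : \sum_(i < n) \sum_E (a E - b E) * ediff e E (heat a (n - i) g) * ediff e E (heat b i f) =
  \sum_(k < n) \sum_E (a E - b E) * ediff e E (heat a (n.-1 - k) (heat_step a g)) * ediff e E (heat b k f).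
  apply: eq_bigr => k _; apply: eq_bigr => E _; congr (_ * ediff e E _ * _).
  have -> : (n - k)%N = (n.-1 - k).+1 by have := ltn_ord k; case: (n) k => // m k km; rewrite subSn.
  by rewrite -addn1 heat_addn.
by rewrite -IH; ring.
Qed.

Variable xi : 'I_d -> R.
Local Notation ldrift := (ldrift e xi).
Local Notation heat_ldrift := (heat_ldrift e beta xi).

Lemma dot_ldrift a f : dot f (ldrift a) = - \sum_E xi E.2 * a E * ediff e E f.
Proof.
rewrite /dot /ldrift; under eq_bigr do rewrite mulr_sumr.
rewrite [LHS]exchange_big sum_edges [X in - X]exchange_big /= -sumrN; apply: eq_bigr => i _.
under eq_bigr => x _ do rewrite mulrBr mulrBr.
rewrite sumrB -[X in _ - X](sum_translate _ (e i)) -sumrB -sumrN; apply: eq_bigr => x _.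
by rewrite addrK /ediff /=; ring.
Qed.

Lemma sum_ldrift a : \sum_x ldrift a x = 0.
Proof.
have -> : \sum_x ldrift a x = dot (fun=> 1) (ldrift a) by apply: eq_bigr => x _; rewrite mul1r.
rewrite dot_ldrift big1 ?oppr0 // => E _; by rewrite /ediff subrr mulr0.
Qed.

Lemma heat_dot_delta a n f x : heat a n f x = dot (heat a n (delta x)) f.
Proof. by rewrite -dot_heat dot_delta. Qed.

Lemma heat_ldrift_sub a b E0 n x : (forall E, E != E0 -> a E = b E) ->
  heat_ldrift a n x - heat_ldrift b n x =
  - (a E0 - b E0) * xi E0.2 * ediff e E0 (heat a n (delta x)) -
  c^-1 * \sum_(k < n) (a E0 - b E0) * ediff e E0 (heat a (n.-1 - k) (delta x)) * ediff e E0 (heat_ldrift b k).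
Proof.
move=> ab; have one_edge (F : V * 'I_d -> R) : \sum_E (a E - b E) * F E = (a E0 - b E0) * F E0.
  by rewrite (bigD1 E0) //= big1 ?addr0 // => E /ab ->; rewrite subrr mul0r.
have propagator := duhamel a b n (ldrift b) (delta x); rewrite !dot_delta -/(heat_ldrift b n) in propagator.
have datum : heat a n (ldrift a) x - heat a n (ldrift b) x = - (a E0 - b E0) * xi E0.2 * ediff e E0 (heat a n (delta x)).
  rewrite !heat_dot_delta !dot_ldrift -opprB opprK addrC -sumrB.
  rewrite !mulNr -mulrA -(one_edge (fun E => xi E.2 * ediff e E (heat a n (delta x)))).
  by congr (- _); apply: eq_bigr => E _; ring.
have -> : heat_ldrift a n x - heat_ldrift b n x = (heat a n (ldrift a) x - heat a n (ldrift b) x) + (heat a n (ldrift b) x - heat_ldrift b n x).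
  by rewrite /heat_ldrift; ring.
rewrite datum propagator [- c^-1 * _]mulNr; congr (_ - _ * _); apply: eq_bigr => k _.
under eq_bigr => E _ do rewrite -mulrA.
by rewrite one_edge -mulrA.
Qed.

End Duhamel.

Record torus_model (R : realType) (d : nat) (alpha beta : R) := TorusModel {
  tm_site : finZmodType;
  tm_dir : 'I_d -> tm_site;
  tm_size : nat;
  tm_embeds : box_embeds tm_dir tm_size;
  tm_state : finType;
  tm_law : tm_state -> R;
  tm_law_ge0 : forall s, 0 <= tm_law s;
  tm_law_sum : \sum_s tm_law s = 1;
  tm_cond : tm_state -> R;
  tm_cond_bnd : forall s, alpha <= tm_cond s <= beta;
  tm_xi : 'I_d -> R;
  tm_xi_le : forall i, `|tm_xi i| <= 1 }.

Arguments tm_law {R d alpha beta} t s : rename.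
Arguments tm_embeds {R d alpha beta} _ k l _ _ _ _.

Section TorusModelTheory.
Variables (R : realType) (d : nat) (alpha beta : R) (M : torus_model d alpha beta).
Local Notation V := (tm_site M).
Local Notation e := (tm_dir M).
Local Notation ed := (V * 'I_d)%type.
Local Notation Om := {ffun ed * option bool -> tm_state M}.
Local Notation expect := (@expect R (tm_state M) (ed * option bool)%type (tm_law M)).
Implicit Types (s t : Om) (E : ed) (x z : V).

Definition env s E : R := tm_cond (s (E, None)).
Definition evolved s n := heat_ldrift e beta (tm_xi M) (env s) n.
Definition kernel_grad s n x E := ediff e E (heat e beta (env s) n (delta x)).
Definition heat_dipole s n E := heat e beta (env s) n (dipole e E).

Lemma env_elliptic s : elliptic alpha beta (env s).
Proof. by move=> E; exact: tm_cond_bnd. Qed.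

Lemma env_resample s E E' : E' != E -> env (resample E s) E' = env s E'.
Proof. by move=> h; rewrite /env ffunE /swap_index /= (negPf h). Qed.

Lemma evolved_depends_on n x : depends_on_main (fun s => evolved s n x).
Proof.
move=> s t h; have env_eq : env s = env t by apply/funext => E; rewrite /env h.
by rewrite /evolved env_eq.
Qed.

Definition translate_index z (j : ed * option bool) := ((j.1.1 + z, j.1.2), j.2).
Definition translate z s : Om := [ffun j => s (translate_index z j)].
Lemma translate_index_inj z : injective (translate_index z).
Proof. by move=> [[x i] k] [[y j] l] [] /addIr -> -> ->. Qed.
Lemma expect_translate z (F : Om -> R) : expect (fun s => F (translate z s)) = expect F.
Proof. exact: (expect_reindex _ _ (@translate_index_inj z)). Qed.
Lemma env_translate z s E : env (translate z s) E = env s (E.1 + z, E.2).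
Proof. by rewrite /env ffunE. Qed.

Lemma heat_translate z s n (f : V -> R) x :
  heat e beta (env (translate z s)) n (fun y => f (y + z)) x = heat e beta (env s) n f (x + z).
Proof.
elim: n f x => //= n IH f x; rewrite /heat_step /scaled_lap /lap IH; congr (_ - _ * _); apply: eq_bigr => i _.
by rewrite !IH !env_translate /= !(addrAC _ _ z).
Qed.

Lemma evolved_translate z s n x : evolved (translate z s) n x = evolved s n (x + z).
Proof.
rewrite /evolved /heat_ldrift -heat_translate; congr (heat _ _ _ _ _ x); apply/funext => y; rewrite /ldrift.
by apply: eq_bigr => i _; rewrite !env_translate /= addrAC.
Qed.

Lemma card_gt0 : 0 < #|V|%:R :> R.
Proof. by rewrite ltr0n; apply/card_gt0P; exists 0. Qed.

Lemma expect_model_cst k : expect (fun=> k) = k.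
Proof. by rewrite expect_cst ?tm_law_sum. Qed.

Lemma le_model_expect F G : (forall s, F s <= G s) -> expect F <= expect G.
Proof. by apply: le_expect; exact: tm_law_ge0. Qed.

Lemma model_expect_ge0 F : (forall s, 0 <= F s) -> 0 <= expect F.
Proof. by apply: expect_ge0; exact: tm_law_ge0. Qed.

Lemma expect_evolved n x : expect (fun s => evolved s n x) = 0.
Proof.
have site_indep z : expect (fun s => evolved s n z) = expect (fun s => evolved s n x).
  rewrite -[RHS](expect_translate (z - x)); apply: eq_expect => s; by rewrite evolved_translate addrC subrK.
have := expect_sum (tm_law M) xpredT (fun z s => evolved s n z).
under eq_bigr do rewrite site_indep.
rewrite sumr_const; have -> : (fun s => \sum_z evolved s n z) = fun=> 0.
  by apply/funext => s; rewrite sum_heat sum_ldrift.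
rewrite expect_cst ?tm_law_sum // => /esym/eqP; rewrite mulrn_eq0 => /orP[|/eqP //].
by have := card_gt0; rewrite ltr0n lt0n => /negPf ->.
Qed.

Definition site_mean (F : V -> R) : R := #|V|%:R^-1 * \sum_x F x.
Lemma le_site_mean F G : (forall x, F x <= G x) -> site_mean F <= site_mean G.
Proof.
by move=> h; rewrite ler_wpM2l ?invr_ge0 ?(ltW card_gt0) //; apply: ler_sum.
Qed.
Lemma site_mean_ge0 F : (forall x, 0 <= F x) -> 0 <= site_mean F.
Proof. by move=> h; rewrite mulr_ge0 ?invr_ge0 ?(ltW card_gt0) // sumr_ge0. Qed.
Lemma site_meanZ k F : site_mean (fun x => k * F x) = k * site_mean F.
Proof. by rewrite /site_mean -mulr_sumr mulrCA. Qed.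
Lemma site_mean_cst k : site_mean (fun=> k) = k.
Proof. by rewrite /site_mean sumr_const -[k *+ _]mulr_natl mulKf // gt_eqF // card_gt0. Qed.
Lemma site_mean_sum (I : finType) (F : I -> V -> R) : site_mean (fun x => \sum_k F k x) = \sum_k site_mean (F k).
Proof. by rewrite /site_mean exchange_big mulr_sumr. Qed.

Definition sol_norm q n : R := nroot q (site_mean (fun x => expect (fun s => `|evolved s n x| ^+ q))).
Definition grad_norm q n : R := nroot q (#|V|%:R^-1 * \sum_E expect (fun s => `|ediff e E (evolved s n)| ^+ q)).
Lemma sol_norm_ge0 q n : 0 <= sol_norm q n. Proof. exact: nroot_ge0. Qed.
Lemma grad_norm_ge0 q n : 0 <= grad_norm q n. Proof. exact: nroot_ge0. Qed.
Lemma sol_normX q n : (0 < q)%N -> sol_norm q n ^+ q = site_mean (fun x => expect (fun s => `|evolved s n x| ^+ q)).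
Proof.
by move=> q0; rewrite nrootK // site_mean_ge0 // => x; apply: model_expect_ge0 => s; rewrite exprn_ge0.
Qed.
Lemma grad_normX q n : (0 < q)%N ->
  grad_norm q n ^+ q = #|V|%:R^-1 * \sum_E expect (fun s => `|ediff e E (evolved s n)| ^+ q).
Proof.
move=> q0; rewrite nrootK // mulr_ge0 ?invr_ge0 ?(ltW card_gt0) // sumr_ge0 // => E _.
by apply: model_expect_ge0 => s; rewrite exprn_ge0.
Qed.

End TorusModelTheory.

Section PowerInequalities.
Variable R : realFieldType.

Lemma jensen_mixed_norm (I E : finType) (l : I -> R) (f : I -> E -> R) p :
  (forall i, 0 < l i) -> \sum_i l i = 1 ->
  (\sum_x (\sum_k f k x) ^+ 2) ^+ p.+1 <=
  \sum_k l k * ((\sum_x f k x ^+ 2) / l k ^+ 2) ^+ p.+1.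
Proof.
move=> l0 l1; have f0 k : 0 <= \sum_x f k x ^+ 2 by rewrite sumr_ge0 // => x _; rewrite sqr_ge0.
apply: (@le_trans _ _ ((\sum_k l k * ((\sum_x f k x ^+ 2) / l k ^+ 2)) ^+ p.+1)); last first.
  by apply: jensen_exprn => // i; [exact: ltW|rewrite divr_ge0 ?sqr_ge0].
rewrite lerXn2r ?nnegrE //.
- by rewrite sumr_ge0 // => x _; rewrite sqr_ge0.
- by rewrite sumr_ge0 // => k _; rewrite mulr_ge0 ?(ltW (l0 _)) // divr_ge0 ?sqr_ge0.
apply: (@le_trans _ _ (\sum_x \sum_k f k x ^+ 2 / l k)).
  by apply: ler_sum => x _; exact: sqr_sum_le_weights.
rewrite exchange_big /=; apply: ler_sum => k _; rewrite -mulr_suml.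
by apply: le_of_eq; field; rewrite gt_eqF.
Qed.

Lemma sum_exprn_le_weights (E : finType) (A B : E -> R) p :
  (forall x, 0 <= A x) -> (forall x, 0 <= B x) ->
  (\sum_x A x * B x) ^+ p.+1 <= (\sum_x A x) ^+ p * \sum_x A x * B x ^+ p.+1.
Proof.
move=> A0 B0; set s := \sum_x A x.
have s0 : 0 <= s by exact: sumr_ge0.
have [sp|sn] := ltP 0 s; last first.
  have se : s = 0 by apply/eqP; rewrite eq_le sn s0.
  have Ax x : A x = 0 by apply: (psumr_eq0P _ se).
  rewrite big1; last by move=> x _; rewrite Ax mul0r.
  by rewrite expr0n mulr_ge0 ?exprn_ge0 // sumr_ge0 // => x _; rewrite Ax mul0r.
have := @jensen_exprn R E (fun x => A x / s) B p.
have -> : \sum_x A x / s = 1 by rewrite -mulr_suml divff // gt_eqF.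
move=> /(_ (fun x => divr_ge0 (A0 x) s0) erefl B0).
have -> : \sum_x A x / s * B x = (\sum_x A x * B x) / s.
  by rewrite mulr_suml; apply: eq_bigr => x _; rewrite mulrAC.
have -> : \sum_x A x / s * B x ^+ p.+1 = (\sum_x A x * B x ^+ p.+1) / s.
  by rewrite mulr_suml; apply: eq_bigr => x _; rewrite mulrAC.
rewrite expr_div_n ler_pdivrMr ?exprn_gt0 // => /le_trans; apply.
rewrite exprS -!mulrA; set X := \sum_x _.
rewrite [s^-1 * _]mulrCA.
by rewrite mulVKf ?gt_eqF // mulrC.
Qed.

Lemma exprn_even_tangent_le p (y m : R) :
  m ^+ (2 * p.+1) + (2 * p.+1%:R * m ^+ (2 * p).+1) * (y - m) <= y ^+ (2 * p.+1).
Proof.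
have := exprn_tangent_le p (sqr_ge0 m) (sqr_ge0 y); rewrite -!exprM => /(le_trans _); apply.
rewrite lerD2l exprS.
have -> : 2 * p.+1%:R * (m * m ^+ (2 * p)) * (y - m) = p.+1%:R * m ^+ (2 * p) * (2 * m * (y - m)) by ring.
rewrite ler_wpM2l //; first by rewrite mulr_ge0 // exprM exprn_ge0 // sqr_ge0.
by have := sqr_ge0 (y - m); lra.
Qed.

Lemma exprn_superadd p (A B : R) : 0 <= A -> 0 <= B -> A ^+ p.+1 + B ^+ p.+1 <= (A + B) ^+ p.+1.
Proof.
move=> A0 B0; elim: p => [|p IH]; first by rewrite !expr1.
have IH_mul := ler_wpM2l (addr_ge0 A0 B0) IH.
rewrite [leRHS]exprS; apply: le_trans IH_mul; rewrite ![_ ^+ p.+2]exprS mulrDl !mulrDr.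
have := mulr_ge0 A0 (exprn_ge0 p.+1 B0); have := mulr_ge0 B0 (exprn_ge0 p.+1 A0); lra.
Qed.

Lemma clarkson_even p (x y : R) : ((x + y) / 2) ^+ (2 * p.+1) + ((x - y) / 2) ^+ (2 * p.+1) <=
  (x ^+ (2 * p.+1) + y ^+ (2 * p.+1)) / 2.
Proof.
rewrite !exprM; apply: le_trans (exprn_superadd _ (sqr_ge0 _) (sqr_ge0 _)) _.
have -> : ((x + y) / 2) ^+ 2 + ((x - y) / 2) ^+ 2 = (x ^+ 2 + y ^+ 2) / 2 by field.
have tangent_at_mean (z : R) := exprn_tangent_le p (divr_ge0 (addr_ge0 (sqr_ge0 x) (sqr_ge0 y)) (ler0n R 2)) (sqr_ge0 z).
have := tangent_at_mean x; have := tangent_at_mean y; set m := (_ / 2); set K := p.+1%:R * m ^+ p.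
have -> : y ^+ 2 - m = - (x ^+ 2 - m) by rewrite /m; field.
by rewrite mulrN; lra.
Qed.
End PowerInequalities.

Section Dissipation.
Variable R : rcfType.

(* Half of the mass is kept at [x], so it can be shared out between the midpoints [(x + y j) / 2]. *)
Lemma lazy_jensen (J : finType) (w y : J -> R) (x : R) p : (forall j, 0 <= w j) -> \sum_j w j <= 2^-1 ->
  ((1 - \sum_j w j) * x + \sum_j w j * y j) ^+ (2 * p.+1) <= (1 - \sum_j w j) * x ^+ (2 * p.+1) +
    \sum_j w j * y j ^+ (2 * p.+1) - 2 * \sum_j w j * ((x - y j) / 2) ^+ (2 * p.+1).
Proof.
move=> w0; set q := (2 * p.+1)%N; set W := \sum_j w j => W2; set S := \sum_j w j * y j.
set m := _ + S; pose K := 2 * p.+1%:R * m ^+ (2 * p).+1.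
have tangent z : m ^+ q + K * (z - m) <= z ^+ q by exact: exprn_even_tangent_le.
have clarkson z : ((x + z) / 2) ^+ q <= (x ^+ q + z ^+ q) / 2 - ((x - z) / 2) ^+ q.
  by have := clarkson_even p x z; rewrite -/q; lra.
have balance : (1 - 2 * W) * (m ^+ q + K * (x - m)) +
    \sum_j 2 * w j * (m ^+ q + K * ((x + y j) / 2 - m)) = m ^+ q.
  have -> : \sum_j 2 * w j * (m ^+ q + K * ((x + y j) / 2 - m)) =
      (2 * m ^+ q + K * (x - 2 * m)) * W + K * S.
    by rewrite !mulr_sumr -big_split; apply: eq_bigr => j _ /=; field.
  by have -> : S = m - (1 - W) * x; [rewrite /m addrC addKr|ring].
rewrite -[leLHS]balance; apply: (@le_trans _ _ ((1 - 2 * W) * x ^+ q +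
    \sum_j 2 * w j * ((x ^+ q + y j ^+ q) / 2 - ((x - y j) / 2) ^+ q))).
  apply: lerD; first by apply: ler_wpM2l; [lra|exact: tangent].
  apply: ler_sum => j _; apply: ler_wpM2l; first by rewrite mulr_ge0.
  exact: le_trans (tangent _) (clarkson _).
have -> : \sum_j 2 * w j * ((x ^+ q + y j ^+ q) / 2 - ((x - y j) / 2) ^+ q) =
    x ^+ q * W + \sum_j w j * y j ^+ q - 2 * \sum_j w j * ((x - y j) / 2) ^+ q.
  rewrite !mulr_sumr -big_split -sumrB; apply: eq_bigr => j _ /=.
  by move: (x ^+ q) (y j ^+ q) (_ ^+ q) => *; field.
by apply: le_of_eq; ring.
Qed.

Variables (V : finZmodType) (d : nat) (e : 'I_d -> V) (alpha beta : R).
Hypotheses (d_gt0 : (0 < d)%N) (alpha_gt0 : 0 < alpha) (le_ab : alpha <= beta).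
Variable a : V * 'I_d -> R.
Hypothesis ha : elliptic alpha beta a.
Local Notation c := (spec_bound d beta).
Let c_gt0 : 0 < c := spec_bound_gt0 d_gt0 alpha_gt0 le_ab.
Let a_ge0 := elliptic_ge0 alpha_gt0 ha.

Lemma heat_step_exprn_le p (f : V -> R) x (q := (2 * p.+1)%N) :
  heat_step e beta a f x ^+ q <= heat_step e beta a (fun y => f y ^+ q) x - 2 / c *
    \sum_i (a (x, i) * ((f x - f (x + e i)) / 2) ^+ q + a (x - e i, i) * ((f x - f (x - e i)) / 2) ^+ q).
Proof.
pose w (j : 'I_d * bool) := c^-1 * a (if j.2 then x else x - e j.1, j.1).
pose y (j : 'I_d * bool) := f (if j.2 then x + e j.1 else x - e j.1).
have star (F : R -> R) : \sum_j w j * F (y j) =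
    c^-1 * \sum_i (a (x, i) * F (f (x + e i)) + a (x - e i, i) * F (f (x - e i))).
  rewrite -(pair_bigA _ (fun i s => w (i, s) * F (y (i, s)))) mulr_sumr /=.
  by apply: eq_bigr => i _; rewrite big_bool /w /y /= mulrDr !mulrA.
have mass : \sum_j w j = c^-1 * \sum_i (a (x, i) + a (x - e i, i)).
  have := star (fun=> 1); under eq_bigr do rewrite mulr1.
  by under [in X in _ = X -> _]eq_bigr do rewrite !mulr1.
have := @lazy_jensen _ w y (f x) p; rewrite -/q (star id) (star (fun z => z ^+ q)) mass.
rewrite (star (fun z => ((f x - z) / 2) ^+ q)) [2 * (_ * _)]mulrA.
rewrite -(heat_stepE e beta a f x) -(heat_stepE e beta a (fun z => f z ^+ q) x); apply.
  by move=> j; rewrite mulr_ge0 ?invr_ge0 // ltW.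
by rewrite ler_pdivrMl // (sum_star_le e ha).
Qed.

Lemma heat_step_dissipation p (f : V -> R) :
  (4 * alpha / c / 2 ^+ (2 * p.+1)) * \sum_E ediff e E f ^+ (2 * p.+1) <=
  \sum_x f x ^+ (2 * p.+1) - \sum_x heat_step e beta a f x ^+ (2 * p.+1).
Proof.
have := ler_sum _ (fun x _ => heat_step_exprn_le p f x) : \sum_x _ <= \sum_x _.
set q := (2 * p.+1)%N.
rewrite sumrB sum_heat_step -mulr_sumr (sum_neighbours e (fun x y E => a E * ((f x - f y) / 2) ^+ q)).
move=> h; rewrite lerBrDl -lerBrDr; apply: le_trans h _; rewrite lerB //.
rewrite !mulr_sumr; apply: ler_sum => E _.
have half_diff (y z : R) : ((y - z) / 2) ^+ q = (z - y) ^+ q / 2 ^+ q.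
  by rewrite expr_div_n !exprM -sqrrN opprB.
have D_ge0 : 0 <= ediff e E f ^+ q by rewrite exprM exprn_ge0 ?sqr_ge0.
have -> : a E * ((f E.1 - f (E.1 + e E.2)) / 2) ^+ q + a E * ((f (E.1 + e E.2) - f E.1) / 2) ^+ q =
    2 * a E * (ediff e E f ^+ q / 2 ^+ q).
  by rewrite [X in a E * X + _]half_diff [X in _ + a E * X]half_diff -[X in _ + a E * (X / _)]normr_exprn_even distrC normr_exprn_even; ring.
have -> : 4 * alpha / c / 2 ^+ q * ediff e E f ^+ q = 2 / c * (2 * alpha * (ediff e E f ^+ q / 2 ^+ q)) by ring.
rewrite ler_wpM2l ?divr_ge0 ?(ltW c_gt0) // ler_wpM2r ?(divr_ge0 D_ge0) ?exprn_ge0 //.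
by case/andP: (ha E); lra.
Qed.

End Dissipation.

Section OneStep.
Variables (R : realType) (d : nat) (alpha beta : R).
Hypotheses (d_gt0 : (0 < d)%N) (alpha_gt0 : 0 < alpha) (le_ab : alpha <= beta).
Local Notation c := (spec_bound d beta).
Let c0 : 0 < c := spec_bound_gt0 d_gt0 alpha_gt0 le_ab.
Definition decay_exp : R := (d%:R / 2 + 1) / 2.

Lemma kernel_gradE (M : torus_model d alpha beta) s n x E : kernel_grad (M := M) s n x E = heat_dipole s n E x.
Proof. by rewrite /kernel_grad -dot_dipole dot_heat dotC dot_delta. Qed.

Lemma sum_kernel_grad_sqr (M : torus_model d alpha beta) s n E :
  \sum_x kernel_grad (M := M) s n x E ^+ 2 = dot (heat_dipole s n E) (heat_dipole s n E).
Proof. by apply: eq_bigr => x _; rewrite kernel_gradE expr2. Qed.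

Definition sensitivity (M : torus_model d alpha beta) p t k : R :=
  site_mean (fun x => expect (tm_law M) (fun s =>
    (\sum_E kernel_grad (M := M) s t x E ^+ 2 * ediff (tm_dir M) E (evolved (resample E s) k) ^+ 2) ^+ p)).

Lemma sensitivity_ge0 M p t k : 0 <= sensitivity M p t k.
Proof.
apply: site_mean_ge0 => x; apply: model_expect_ge0 => s; apply: exprn_ge0.
by rewrite sumr_ge0 // => E _; rewrite mulr_ge0 ?sqr_ge0.
Qed.

Lemma norm_diff_le (k x y : R) : beta - alpha <= k -> alpha <= x <= beta -> alpha <= y <= beta -> `|x - y| <= k.
Proof. by move=> k0 /andP[h1 h2] /andP[h3 h4]; rewrite ler_norml; apply/andP; split; lra. Qed.

Lemma env_sub_resample_le (M : torus_model d alpha beta) s E : `|env (M := M) s E - env (resample E s) E| <= beta.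
Proof.
by apply: norm_diff_le (env_elliptic s E) (env_elliptic (resample E s) E); rewrite gerBl ltW.
Qed.

Lemma env_sub_resample_sqr_le (M : torus_model d alpha beta) s E :
  (env (M := M) s E - env (resample E s) E) ^+ 2 <= beta ^+ 2.
Proof. by rewrite -real_normK ?num_real // ler_sqr_nneg ?env_sub_resample_le. Qed.

Section DuhamelTerms.
Variables (M : torus_model d alpha beta) (n : nat).
Local Notation Om := {ffun tm_site M * 'I_d * option bool -> tm_state M}.
Local Notation expect := (expect (tm_law M)).
Implicit Types (s : Om) (x : tm_site M) (E : tm_site M * 'I_d).

(* The effect on [evolved s n x] of resampling [E] at time [k < n]; the last term, [k = n], is the effect on the initial datum. *)
Definition duhamel_term s x k E : R := if (k < n)%N then
    - c^-1 * ((env s E - env (resample E s) E) * kernel_grad s (n.-1 - k) x E * ediff (tm_dir M) E (evolved (resample E s) k))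
  else - (env s E - env (resample E s) E) * tm_xi M E.2 * kernel_grad s n x E.

Lemma es_variance_evolved x s :
  es_variance (fun s => evolved s n x) s = \sum_E (\sum_(k < n.+1) duhamel_term s x k E) ^+ 2.
Proof.
apply: eq_bigr => E _; congr (_ ^+ 2); rewrite big_ord_recr /= /duhamel_term ltnn.
rewrite (@heat_ldrift_sub _ _ _ _ _ _ (env s) (env (resample E s)) E); last first.
  by move=> E' h; rewrite env_resample.
rewrite addrC -/(kernel_grad s n x E); congr (_ + _); rewrite mulr_sumr -sumrN.
by apply: eq_bigr => k _; rewrite ltn_ord mulNr.
Qed.

Lemma duhamel_term_moment_le p k : (k < n)%N ->
  site_mean (fun x => expect (fun s => (\sum_E duhamel_term s x k E ^+ 2) ^+ p)) <=
  (beta / c) ^+ (2 * p) * sensitivity M p (n.-1 - k) k.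
Proof.
move=> kn; rewrite -site_meanZ; apply: le_site_mean => x; rewrite -expectZ; apply: le_model_expect => s.
rewrite exprM -exprMn lerXn2r ?nnegrE //.
- by rewrite sumr_ge0 // => E _; rewrite sqr_ge0.
- by rewrite mulr_ge0 ?sqr_ge0 // sumr_ge0 // => E _; rewrite mulr_ge0 ?sqr_ge0.
rewrite mulr_sumr; apply: ler_sum => E _; rewrite /duhamel_term kn.
set g := kernel_grad _ _ _ _; set dh := ediff _ _ _.
have -> : (- c^-1 * ((env s E - env (resample E s) E) * g * dh)) ^+ 2 =
    (env s E - env (resample E s) E) ^+ 2 * (c^-1 ^+ 2 * (g ^+ 2 * dh ^+ 2)) by ring.
have -> : (beta / c) ^+ 2 * (g ^+ 2 * dh ^+ 2) = beta ^+ 2 * (c^-1 ^+ 2 * (g ^+ 2 * dh ^+ 2)) by ring.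
by rewrite ler_wpM2r ?env_sub_resample_sqr_le // mulr_ge0 ?sqr_ge0 // mulr_ge0 ?sqr_ge0.
Qed.

Lemma duhamel_datum_moment_le p (G : R) :
  (forall s x, gradsq (tm_dir M) (heat (tm_dir M) beta (env s) n (delta x)) <= G) ->
  site_mean (fun x => expect (fun s => (\sum_E duhamel_term s x n E ^+ 2) ^+ p)) <= (beta ^+ 2 * G) ^+ p.
Proof.
move=> gradG; rewrite -[leRHS](site_mean_cst M); apply: le_site_mean => x.
rewrite -[leRHS](expect_model_cst M); apply: le_model_expect => s.
have sum_le : \sum_E duhamel_term s x n E ^+ 2 <= beta ^+ 2 * G.
  apply: le_trans (ler_wpM2l (sqr_ge0 _) (gradG s x)); rewrite /gradsq mulr_sumr.
  apply: ler_sum => E _; rewrite /duhamel_term ltnn !exprMn sqrrN.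
  rewrite ler_wpM2r ?sqr_ge0 // -[leRHS]mulr1 ler_pM ?sqr_ge0 ?env_sub_resample_sqr_le //.
  by rewrite -real_normK ?num_real // -(expr1n _ 2) ler_sqr_nneg ?tm_xi_le.
have sum_ge0 : 0 <= \sum_E duhamel_term s x n E ^+ 2 by rewrite sumr_ge0 // => E _; rewrite sqr_ge0.
by rewrite lerXn2r ?nnegrE ?(le_trans sum_ge0).
Qed.

Lemma es_variance_minkowski p (K : nat -> R) : (forall k, 0 <= K k) ->
  (forall k : 'I_n.+1, site_mean (fun x => expect (fun s => (\sum_E duhamel_term s x k E ^+ 2) ^+ p.+1)) <=
     K k ^+ (2 * p.+1)) ->
  site_mean (fun x => expect (fun s => es_variance (fun s => evolved s n x) s ^+ p.+1)) <=
  (\sum_(k < n.+1) K k) ^+ (2 * p.+1).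
Proof.
move=> K0 termK; have -> : (2 * p.+1)%N = (2 * p.+1).-1.+1 by lia.
apply: le_exprn_sum_weights => [k|l l0 l1|]; [exact: K0| |by rewrite card_ord].
apply: (@le_trans _ _ (site_mean (fun x => expect (fun s =>
    \sum_(k < n.+1) l k * ((\sum_E duhamel_term s x k E ^+ 2) / l k ^+ 2) ^+ p.+1)))).
  apply: le_site_mean => x; by apply: le_model_expect => s; rewrite es_variance_evolved; exact: jensen_mixed_norm.
have -> : (fun x => expect (fun s => \sum_(k < n.+1) l k * ((\sum_E duhamel_term s x k E ^+ 2) / l k ^+ 2) ^+ p.+1)) =
    fun x => \sum_(k < n.+1) (l k / l k ^+ 2 ^+ p.+1) * expect (fun s => (\sum_E duhamel_term s x k E ^+ 2) ^+ p.+1).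
  apply/funext => x; rewrite expect_sum; apply: eq_bigr => k _; rewrite -expectZ; apply: eq_expect => s.
  by rewrite expr_div_n; ring.
rewrite site_mean_sum; apply: ler_sum => k _; rewrite site_meanZ.
have -> : l k * (K k / l k) ^+ (2 * p.+1).-1.+1 = (l k / l k ^+ 2 ^+ p.+1) * K k ^+ (2 * p.+1).
  by rewrite expr_div_n prednK // -exprM mulrA mulrAC.
by rewrite ler_wpM2l ?termK // divr_ge0 ?exprn_ge0 ?sqr_ge0 // ltW.
Qed.

End DuhamelTerms.

Lemma sol_norm_le_sensitivity m : exists2 C : R, 0 < C & forall (M : torus_model d alpha beta) n (kap : nat -> R),
  (n <= tm_size M)%N -> (forall k, (k < n)%N -> 0 <= kap k) ->
  (forall k, (k < n)%N -> sensitivity M (2 ^ m) (n.-1 - k) k <= kap k ^+ (2 * 2 ^ m)) ->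
  sol_norm M (2 * 2 ^ m) n <= C * (powS n (- decay_exp) + \sum_(k < n) kap k).
Proof.
have [C1 C10 ES] := efron_stein_pow R m.
have [Cg Cg0 grad_decay] := heat_kernel_grad_decay d_gt0 alpha_gt0 le_ab.
have [p pE] : exists p, (2 ^ m)%N = p.+1 by exists (2 ^ m).-1; rewrite prednK // expn_gt0.
rewrite pE in ES *; have b0 : 0 < beta := beta_gt0 alpha_gt0 le_ab.
pose L := beta * Num.sqrt Cg + beta / c.
have L0 : 0 < L by rewrite addr_gt0 ?mulr_gt0 ?invr_gt0 ?sqrtr_gt0.
exists (nroot (2 * p.+1) C1 * L); first by rewrite mulr_gt0 // /nroot powR_gt0.
move=> M n kap nN kap0 sens.
pose K k := if (k < n)%N then beta / c * kap k else beta * Num.sqrt Cg * powS n (- decay_exp).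
have K0 k : 0 <= K k.
  rewrite /K; case: ifP => [kn|_]; first by rewrite mulr_ge0 ?kap0 // divr_ge0 // ltW.
  by rewrite mulr_ge0 ?powS_ge0 // mulr_ge0 ?sqrtr_ge0 // ltW.
have sumK : \sum_(k < n.+1) K k <= L * (powS n (- decay_exp) + \sum_(k < n) kap k).
  rewrite big_ord_recr /= {2}/K ltnn mulrDr addrC lerD //.
    by rewrite ler_wpM2r ?powS_ge0 // lerDl divr_ge0 // ltW.
  rewrite mulr_sumr; apply: ler_sum => k _; rewrite /K ltn_ord ler_wpM2r ?kap0 //.
  by rewrite lerDr mulr_ge0 ?sqrtr_ge0 // ltW.
have termK (k : 'I_n.+1) : site_mean (fun x => expect (tm_law M) (fun s =>
    (\sum_E duhamel_term n s x k E ^+ 2) ^+ p.+1)) <= K k ^+ (2 * p.+1).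
  rewrite /K; have [kn|kn] := ltnP k n.
    apply: le_trans (duhamel_term_moment_le _ _ kn) _; rewrite [leRHS]exprMn ler_wpM2l ?sens //.
    by rewrite exprn_ge0 // divr_ge0 // ltW.
  have -> : k = n :> nat by apply/eqP; rewrite eqn_leq kn -ltnS ltn_ord.
  have -> : beta * Num.sqrt Cg * powS n (- decay_exp) =
      beta * (Num.sqrt Cg * powS n (- decay_exp)) by rewrite mulrA.
  rewrite exprM [(beta * _) ^+ 2]exprMn; apply: duhamel_datum_moment_le => s x; rewrite exprMn sqr_sqrtr ?(ltW Cg0) //.
  have -> : powS n (- decay_exp) ^+ 2 = powS n (- (d%:R / 2 + 1)) :> R.
    by rewrite powS_exprn /decay_exp; congr powS; field.
  exact: grad_decay (tm_embeds M) (env_elliptic s) _ _ nN.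
have S0 : 0 <= \sum_(k < n.+1) K k by exact: sumr_ge0.
apply: nroot_le => //.
- by apply: site_mean_ge0 => x; apply: model_expect_ge0 => s; rewrite exprn_ge0.
- by rewrite -mulrA mulr_ge0 ?nroot_ge0 // (le_trans S0).
rewrite -mulrA exprMn nrootK ?(ltW C10) //.
apply: (@le_trans _ _ (C1 * (\sum_(k < n.+1) K k) ^+ (2 * p.+1))); last first.
  by rewrite ler_wpM2l ?(ltW C10) // lerXn2r ?nnegrE // (le_trans S0).
apply: le_trans (ler_wpM2l (ltW C10) (es_variance_minkowski K0 termK)).
rewrite -site_meanZ; apply: le_site_mean => x.
under eq_expect do rewrite normr_exprn_even.
apply: ES; [exact: tm_law_ge0|exact: tm_law_sum|exact: evolved_depends_on|exact: expect_evolved].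
Qed.

Definition dipole_bound (C del : R) := 0 < C /\
  forall (V : finZmodType) (e : 'I_d -> V) N a, box_embeds e N -> elliptic alpha beta a ->
  forall n E, (n <= N)%N ->
  dot (heat e beta a n (dipole e E)) (heat e beta a n (dipole e E)) <= C * powS n (- (1 + del)).

Definition first_exp (del : R) (p : nat) : R := decay_exp - (2 * decay_exp - 1 - del) / (2 * p%:R).

Lemma sensitivity_le_grad_norm C del p : dipole_bound C del -> exists2 C' : R, 0 < C' &
  forall (M : torus_model d alpha beta) t k, (t <= tm_size M)%N ->
  sensitivity M p.+1 t k <= (C' * powS t (- first_exp del p.+1) * grad_norm M (2 * p.+1) k) ^+ (2 * p.+1).
Proof.
move=> [C0 HC]; have [Cg Cg0 Hg] := heat_kernel_grad_decay d_gt0 alpha_gt0 le_ab.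
set q := (2 * p.+1)%N; have q0 : (0 < q)%N by rewrite muln_gt0.
exists (nroot q (Cg ^+ p * C)); first by rewrite /nroot powR_gt0 // mulr_gt0 // exprn_gt0.
move=> M t k tN.
have P0 : 0 < Cg ^+ p * C by rewrite mulr_gt0 // exprn_gt0.
rewrite !exprMn nrootK ?(ltW P0) // grad_normX //.
have -> : powS t (- first_exp del p.+1) ^+ q = powS t (- (d%:R / 2 + 1)) ^+ p * powS t (- (1 + del)) :> R.
  rewrite !powS_exprn -powSD; congr powS; rewrite /first_exp /decay_exp /q natrM -[p.+1%:R]natr1.
  have : 0 < p%:R + 1 :> R by rewrite natr1 ltr0n.
  by move: (p%:R) => P Pp; field; rewrite gt_eqF.
set G := Cg * powS t (- (d%:R / 2 + 1)); set D := C * powS t (- (1 + del)).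
have -> : Cg ^+ p * C * (powS t (- (d%:R / 2 + 1)) ^+ p * powS t (- (1 + del))) *
   (#|tm_site M|%:R^-1 * \sum_E expect (tm_law M) (fun s => `|ediff (tm_dir M) E (evolved s k)| ^+ q)) =
   G ^+ p * (#|tm_site M|%:R^-1 * \sum_E (D * expect (tm_law M) (fun s => `|ediff (tm_dir M) E (evolved s k)| ^+ q))).
  by rewrite -mulr_sumr /G /D exprMn; ring.
have G0 : 0 <= G by rewrite mulr_ge0 ?powS_ge0 // ltW.
apply: (@le_trans _ _ (site_mean (fun x => expect (tm_law M) (fun s => G ^+ p *
   \sum_E kernel_grad (M := M) s t x E ^+ 2 * (ediff (tm_dir M) E (evolved (resample E s) k) ^+ 2) ^+ p.+1)))).
  apply: le_site_mean => x; apply: le_model_expect => s; apply: le_trans (sum_exprn_le_weights _ _ _) _; [by move=> ?; rewrite sqr_ge0|by move=> ?; rewrite sqr_ge0|].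
  rewrite ler_wpM2r //.
    by apply: sumr_ge0 => E _; apply: mulr_ge0; [exact: sqr_ge0|apply: exprn_ge0; exact: sqr_ge0].
  rewrite lerXn2r ?nnegrE //; first by apply: sumr_ge0 => E _; exact: sqr_ge0.
  exact: Hg _ _ _ _ (tm_embeds M) (env_elliptic s) _ _ tN.
under [X in site_mean X <= _]eq_fun do rewrite expectZ.
rewrite site_meanZ ler_wpM2l ?exprn_ge0 // /site_mean ler_wpM2l ?invr_ge0 ?ler0n //.
under eq_bigr do rewrite expect_sum.
rewrite exchange_big /=; apply: ler_sum => E _.
rewrite -(expect_resample _ E (fun s => `|ediff (tm_dir M) E (evolved s k)| ^+ q)) -expectZ -expect_sum.
apply: le_model_expect => s; rewrite -mulr_suml sum_kernel_grad_sqr /q normr_exprn_even -exprM ler_wpM2r //.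
  by rewrite exprM exprn_ge0 // sqr_ge0.
exact: HC _ _ _ _ (tm_embeds M) (env_elliptic s) _ _ tN.
Qed.

Lemma grad_norm_le_dissipation p : exists2 C : R, 0 < C & forall (M : torus_model d alpha beta) n,
  grad_norm M (2 * p.+1) n ^+ (2 * p.+1) <= C * (sol_norm M (2 * p.+1) n ^+ (2 * p.+1) - sol_norm M (2 * p.+1) n.+1 ^+ (2 * p.+1)).
Proof.
set q := (2 * p.+1)%N; have q0 : (0 < q)%N by rewrite muln_gt0.
pose k := 4 * alpha / c / 2 ^+ q; have k0 : 0 < k by rewrite !divr_gt0 ?exprn_gt0 // mulr_gt0.
exists k^-1; first by rewrite invr_gt0.
move=> M n; rewrite ler_pdivlMl // grad_normX // !sol_normX // /site_mean -mulrBr mulrCA ler_wpM2l ?invr_ge0 ?ler0n //.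
rewrite -!expect_sum -expectB -expectZ; apply: le_model_expect => s; have := heat_step_dissipation (tm_dir M) d_gt0 alpha_gt0 le_ab (env_elliptic s) p (evolved s n).
rewrite -/q -/k /q; under eq_bigr do rewrite -normr_exprn_even.
under [X in _ <= X - _ -> _]eq_bigr do rewrite -normr_exprn_even.
by under [X in _ <= _ - X -> _]eq_bigr do rewrite -normr_exprn_even.
Qed.

Lemma sol_norm0_le q (M : torus_model d alpha beta) : (0 < q)%N -> sol_norm M q 0 <= 2 * d%:R * beta.
Proof.
move=> q0; have b0 : 0 < beta := beta_gt0 alpha_gt0 le_ab.
have drift_bound_ge0 : 0 <= 2 * d%:R * beta by rewrite mulr_ge0 ?mulr_ge0 // ltW.
apply: nroot_le => //; first by apply: site_mean_ge0 => x; apply: model_expect_ge0 => s; rewrite exprn_ge0.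
rewrite -[leRHS](site_mean_cst M); apply: le_site_mean => x.
rewrite -[leRHS](expect_model_cst M); apply: le_model_expect => s; rewrite lerXn2r ?nnegrE //.
exact: (normr_ldrift_le _ _ alpha_gt0 le_ab (env_elliptic s) (tm_xi_le M)).
Qed.

Lemma sol_norm_antimono p (M : torus_model d alpha beta) n m : (m <= n)%N -> sol_norm M (2 * p.+1) n <= sol_norm M (2 * p.+1) m.
Proof.
have [C C0 h] := grad_norm_le_dissipation p.
have st k : sol_norm M (2 * p.+1) k.+1 <= sol_norm M (2 * p.+1) k.
  have hk0 := le_trans (exprn_ge0 (2 * p.+1) (grad_norm_ge0 M (2 * p.+1) k)) (h M k).
  rewrite pmulr_rge0 // subr_ge0 in hk0.
  by rewrite -(@ler_pXn2r _ (2 * p.+1)) ?nnegrE ?sol_norm_ge0.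
move=> /subnK <-; elim: (n - m)%N => [|j IH]; first exact: lexx.
by apply: le_trans IH; rewrite addSn; exact: st.
Qed.

End OneStep.

(** * Sequences satisfying a convolution inequality *)

Section Sequences.
Variable R : realType.
Implicit Types (a b v g : nat -> R).

Lemma powR2N_lt1 (x : R) : 0 < x -> 2 `^ (- x) < 1 :> R.
Proof.
move=> x0; rewrite powRN invf_lt1 ?powR_gt0 //.
have := @gt0_ltr_powR R x x0 1 2; rewrite !nnegrE ler01 ler0n ltr1n powR1; exact.
Qed.

(* The sum of the geometric series of ratio 2^-x. *)
Definition geom_cst (x : R) : R := (1 - 2 `^ (- x))^-1.

Lemma geom_cst_gt0 x : 0 < x -> 0 < geom_cst x.
Proof. by move=> x0; rewrite invr_gt0 subr_gt0 powR2N_lt1. Qed.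

Lemma geom_cstE x : 0 < x -> geom_cst x = 1 + geom_cst x * 2 `^ (- x).
Proof. by move=> x0; rewrite /geom_cst; field; rewrite subr_eq0 gt_eqF // powR2N_lt1. Qed.

Lemma dyadic_sum_le (D eta : R) b Nb : 0 < eta -> 0 <= D -> (forall s, 0 <= b s) ->
  (forall m, (m <= Nb)%N -> \sum_(m <= s < (2 * m).+1) b s <= D * powS m (- eta)) ->
  forall m n, (n <= Nb.+1)%N -> \sum_(m <= s < n) b s <= geom_cst eta * D * powS m (- eta).
Proof.
move=> eta0 D0 b0 blk; have K0 := geom_cst_gt0 eta0; have := geom_cstE eta0.
set K := geom_cst eta in K0 * => K1.
move=> m n nN; have [k] := ubnP (n - m)%N; elim: k m => // k IH m km.
have [nm|mn] := leqP n m; first by rewrite big_geq // !mulr_ge0 ?powS_ge0 // ltW.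
have mN : (m <= Nb)%N by rewrite -ltnS (leq_trans mn).
have [n2|n2] := leqP n (2 * m).+1.
  apply: (@le_trans _ _ (D * powS m (- eta))).
    apply: le_trans (blk m mN); rewrite [leRHS](@big_cat_nat _ _ _ n) ?(ltnW mn) //= lerDl.
    by rewrite sumr_ge0.
  by rewrite ler_wpM2r ?powS_ge0 // ler_peMl // K1 lerDl mulr_ge0 ?powR_ge0 // ltW.
rewrite (@big_cat_nat _ _ _ (2 * m).+1) /=; [|lia|exact: ltnW].
apply: (@le_trans _ _ (D * powS m (- eta) + K * D * powS (2 * m).+1 (- eta))).
  apply: lerD; first exact: blk.
  by apply: IH; lia.
by rewrite powS_doubleS {2}K1; apply: le_of_eq; ring.
Qed.

Lemma sum_block_le b m : (forall k, (m <= k)%N -> b k <= b m) ->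
  \sum_(m <= s < (2 * m).+1) b s <= m.+1%:R * b m.
Proof.
move=> h; apply: (@le_trans _ _ (\sum_(m <= s < (2 * m).+1) b m)).
  by apply: ler_sum_nat => s /andP[ms _]; exact: h.
have -> : m.+1 = ((2 * m).+1 - m)%N by lia.
by rewrite sumr_const_nat -[b m *+ _]mulr_natl.
Qed.

Lemma sum_powS_tail_le (x : R) m n : 0 < x -> \sum_(m <= s < n) powS s (- (1 + x)) <= geom_cst x * powS m (- x).
Proof.
move=> x0; have := @dyadic_sum_le 1 x (fun s => powS s (- (1 + x))) n x0 ler01 (fun s => powS_ge0 _ _).
rewrite mulr1; apply => // l _; apply: le_trans (sum_block_le _) _.
  by move=> i li; apply: powS_antimono => //; lra.
by rewrite mul1r -powSr1 -powSD; apply: ler_powS; lra.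
Qed.

Lemma sum_powS_divergent_le (th : R) n : 0 < th <= 1 -> \sum_(0 <= s < n) powS s (th - 1) <= geom_cst th * powS n th.
Proof.
move=> /andP[th0 th1]; have K0 := geom_cst_gt0 th0; have := geom_cstE th0.
set K := geom_cst th in K0 * => K1.
apply: (@le_trans _ _ (K * n%:R `^ th)); last first.
  by rewrite ler_pM2l // ge0_ler_powR ?nnegrE ?ler0n ?ler_nat // ltW.
elim/ltn_ind: n => n IH; have [->|n0] := posnP n.
  by rewrite big_geq // powR0 ?mulr0 // gt_eqF.
pose m := n./2; have mn : (m < n)%N by rewrite /m; lia.
have n_le : (n <= (2 * m).+1)%N by rewrite /m; lia.
have n_ge : (2 * m <= n)%N by rewrite /m; lia.
rewrite (@big_cat_nat _ _ _ m) //=; last exact: ltnW.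
apply: (@le_trans _ _ (K * m%:R `^ th + n%:R `^ th)).
  apply: lerD; first exact: IH.
  apply: (@le_trans _ _ (\sum_(m <= s < (2 * m).+1) powS s (th - 1))).
    rewrite [leRHS](@big_cat_nat _ _ _ n) ?(ltnW mn) //= lerDl sumr_ge0 // => i _.
    exact: powS_ge0.
  apply: le_trans (sum_block_le _) _; first by move=> k mk; apply: powS_antimono => //; lra.
  rewrite -powSr1 -powSD addrC subrK ge0_ler_powR ?nnegrE ?ler0n ?ler_nat //; exact: ltW.
rewrite [K in leRHS]K1 mulrDl mul1r addrC lerD2l -mulrA ler_pM2l // powRN mulrC ler_pdivlMr ?powR_gt0 //.
by rewrite -powRM ?ler0n // -natrM ge0_ler_powR ?nnegrE ?ler0n ?ler_nat ?(ltW th0) // mulnC.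
Qed.

Lemma sum_block_holder q b m : (0 < q)%N -> (forall s, 0 <= b s) ->
  \sum_(m <= s < (2 * m).+1) b s <= powS m (1 - q%:R^-1) * nroot q (\sum_(m <= s < (2 * m).+1) b s ^+ q).
Proof.
move=> q0 b0; set X := \sum_(m <= s < _) b s ^+ q.
have X0 : 0 <= X by rewrite sumr_ge0 // => s _; rewrite exprn_ge0.
rewrite -(@ler_pXn2r _ q) ?nnegrE //; last 2 first.
- by rewrite sumr_ge0.
- by rewrite mulr_ge0 ?powS_ge0 ?nroot_ge0.
rewrite exprMn [nroot q X ^+ q]nrootK // powS_exprn.
have -> : (1 - q%:R^-1) * q%:R = q%:R - 1 :> R.
  by have : q%:R != 0 :> R; [rewrite pnatr_eq0 -lt0n|move: (q%:R : R) => z z0; field].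
have eqn : ((2 * m).+1 - m = m.+1)%N by lia.
have block_reindex (F : nat -> R) : \sum_(m <= s < (2 * m).+1) F s = \sum_(i < m.+1) F (m + i)%N.
  rewrite -{1}(add0n m) big_addn big_mkord eqn; apply: eq_bigr => i _; by rewrite addnC.
rewrite /X !block_reindex; have w0 : 0 < m.+1%:R :> R by rewrite ltr0n.
have := @jensen_exprn R 'I_m.+1 (fun=> m.+1%:R^-1) (fun i => b (m + i)%N) q.-1.
have w0V : 0 < m.+1%:R^-1 :> R by rewrite invr_gt0.
have weights_sum1 : \sum_(i < m.+1) m.+1%:R^-1 = 1 :> R.
  by rewrite sumr_const card_ord -[_^-1 *+ _]mulr_natl divff // gt_eqF.
move=> /(_ (fun i => ltW w0V) weights_sum1 (fun i => b0 _)).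
rewrite -!mulr_sumr exprMn prednK //; set Y := _ ^+ q; set Z := \sum_i _ => h.
rewrite /Y exprVn ler_pdivrMl ?exprn_gt0 // in h; apply: (le_trans h).
rewrite powSD [powS m (-1)]powSN powSr1 /powS powR_mulrn ?ler0n //.
by rewrite mulrA.
Qed.

End Sequences.

Section Gronwall.
Variable R : realType.
Implicit Types (a b v g : nat -> R).

Lemma sum_convolution_le (b g : nat -> R) m M' n : (forall s, 0 <= b s) -> (forall s, 0 <= g s) ->
  \sum_(m <= k < n.+1) \sum_(M' <= s < k) g (k.-1 - s)%N * b s <=
  (\sum_(0 <= t < n) g t) * \sum_(M' <= s < n) b s.
Proof.
move=> b0 g0; have gb_ge0 t s : 0 <= g t * b s by rewrite mulr_ge0.
apply: (@le_trans _ _ (\sum_(m <= k < n.+1) \sum_(M' <= s < n | (s < k)%N) g (k.-1 - s)%N * b s)).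
  apply: ler_sum_nat => k /andP[_ kn]; rewrite (@big_nat_widen _ _ _ _ _ n) //.
rewrite (exchange_big_dep xpredT) //= mulr_sumr; apply: ler_sum_nat => s /andP[_ sn].
rewrite -mulr_suml ler_wpM2r //.
apply: (@le_trans _ _ (\sum_(0 <= k < n.+1 | (s < k)%N) g (k.-1 - s)%N)).
  rewrite (big_nat_widenl m 0) // [leRHS](bigID (fun k => (m <= k)%N)) /= lerDl.
  by rewrite sumr_ge0.
rewrite -[X in X <= _](big_nat_widenl s.+1 0 n.+1 xpredT) // -{1}(add0n s.+1) big_addn subSS.
rewrite [leRHS](@big_cat_nat _ _ _ (n - s)) ?leq_subr //=.
rewrite -[leLHS]addr0 lerD ?sumr_ge0 //.
by apply: ler_sum => t _; rewrite addnS /= addnK.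
Qed.

Lemma dyadic_average_le (gm C : R) a v g b (kap : nat -> nat -> R) M : 0 <= gm -> 0 <= C ->
  (forall s, 0 <= v s) -> (forall s, 0 <= b s) -> (forall s, 0 <= g s) ->
  (forall m n, (m <= n)%N -> a n <= a m) ->
  (forall k, (M < k <= (2 * M).+1)%N -> a k <= C * (powS k (- gm) + \sum_(s < k) kap (k.-1 - s)%N s)) ->
  (forall t s, (t + s <= 2 * M)%N -> (s < M./2)%N -> kap t s <= powS t (- gm) * v s) ->
  (forall t s, (t + s <= 2 * M)%N -> kap t s <= g t * b s) ->
  a (2 * M).+1 <= C * (2 `^ gm * powS M (- gm) * (1 + \sum_(0 <= s < M./2) v s) +
     M.+1%:R^-1 * ((\sum_(0 <= t < (2 * M).+1) g t) * \sum_(M./2 <= s < (2 * M).+1) b s)).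
Proof.
move=> gm0 C0 v0 b0 g0 amono ha k1 k2.
set M' := M./2; have M'M : (M' <= M)%N by rewrite /M'; lia.
have w0 : 0 < M.+1%:R :> R by rewrite ltr0n.
set A := 2 `^ gm * powS M (- gm) * (1 + \sum_(0 <= s < M') v s).
set B := (\sum_(0 <= t < (2 * M).+1) g t) * _.
suff h : M.+1%:R * a (2 * M).+1 <= C * (M.+1%:R * A + B).
  rewrite -(ler_pM2l w0); apply: (le_trans h); apply: le_of_eq.
  by field; rewrite -natr1 in w0 *; rewrite ?(gt_eqF w0).
apply: (@le_trans _ _ (\sum_(M.+1 <= k < (2 * M).+2) a k)).
  have -> : M.+1%:R * a (2 * M).+1 = \sum_(M.+1 <= k < (2 * M).+2) a (2 * M).+1.
    by rewrite sumr_const_nat -[a _ *+ _]mulr_natl; congr (_%:R * _); clear; lia.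
  by apply: ler_sum_nat => k /andP[_ k2']; apply: amono.
apply: (@le_trans _ _ (\sum_(M.+1 <= k < (2 * M).+2) C * (A + \sum_(M' <= s < k) g (k.-1 - s)%N * b s))).
  apply: ler_sum_nat => k /andP[dipole_kernel k2M]; apply: (le_trans (ha k _)); first by rewrite dipole_kernel -ltnS.
  rewrite ler_wpM2l //.
  have two1 : 1 <= 2 `^ gm :> R by rewrite -[leLHS](powRr0 2) ler_powR // ler1n.
  have scale_le : powS k (- gm) <= 2 `^ gm * powS M (- gm).
    apply: (@le_trans _ _ (powS M (- gm))); first by apply: powS_antimono; rewrite ?oppr_le0 // ltnW.
    by rewrite ler_peMl ?powS_ge0.
  rewrite -(big_mkord xpredT (fun s => kap (k.-1 - s)%N s)) (@big_cat_nat _ _ _ M') //=; last first.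
    by rewrite (leq_trans M'M) // ltnW.
  rewrite addrA; apply: lerD.
    rewrite /A mulrDr mulr1 lerD // mulr_sumr; apply: ler_sum_nat => s /andP[_ sM].
    apply: (le_trans (k1 _ _ _ sM)); first by clear -sM dipole_kernel k2M M'M; lia.
    rewrite ler_wpM2r // -[gm in X in _ <= X * _]opprK; apply: powS_scale_le; rewrite ?oppr_le0 //.
    by clear -sM dipole_kernel; move: sM; rewrite /M'; lia.
  by apply: ler_sum_nat => s /andP[_ sk]; apply: k2; clear -sk k2M; lia.
rewrite -mulr_sumr ler_wpM2l // big_split /= sumr_const_nat -[A *+ _]mulr_natl.
have -> : ((2 * M).+2 - M.+1 = M.+1)%N by clear; lia.
by rewrite lerD2l; apply: sum_convolution_le.
Qed.

Lemma antimono_half_decay a (sg X : R) n : 0 <= sg -> 0 <= X ->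
  (forall m n, (m <= n)%N -> a n <= a m) -> (0 < n)%N ->
  a (2 * (n.-1)./2).+1 <= X * powS (n.-1)./2 (- sg) -> a n <= X * (2 `^ sg * 2 `^ sg) * powS n (- sg).
Proof.
move=> sg0 X0 amono n0 aX; apply: le_trans (amono (2 * (n.-1)./2).+1 n _) _; first by lia.
apply: le_trans aX _; rewrite -!mulrA ler_wpM2l //.
apply: (@le_trans _ _ (2 `^ sg * powS (2 * (n.-1)./2).+1 (- sg))).
  by apply: powS_le_half => //; lia.
by rewrite ler_pM2l ?powR_gt0 //; apply: powS_le_half => //; lia.
Qed.

Section Dissipative.
Variables (q : nat) (C : R) (a b : nat -> R).
Hypotheses (q_gt0 : (0 < q)%N) (C_gt0 : 0 < C).
Hypotheses (a_ge0 : forall n, 0 <= a n) (b_ge0 : forall n, 0 <= b n).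
Hypothesis dissip : forall n, b n ^+ q <= C * (a n ^+ q - a n.+1 ^+ q).
Local Notation C1 := (nroot q C).
Let C1_ge0 : 0 <= C1 := nroot_ge0 q C.

Lemma dissipation_block_sum_le m :
  \sum_(m <= s < (2 * m).+1) b s <= powS m (1 - q%:R^-1) * (C1 * a m).
Proof.
apply: le_trans (sum_block_holder m q_gt0 b_ge0) _; rewrite ler_wpM2l ?powS_ge0 //.
apply: nroot_le => //; [by rewrite sumr_ge0 // => s _; rewrite exprn_ge0|exact: mulr_ge0|].
rewrite exprMn nrootK ?(ltW C_gt0) //.
apply: (@le_trans _ _ (\sum_(m <= s < (2 * m).+1) C * (a s ^+ q - a s.+1 ^+ q))).
  by apply: ler_sum_nat => s _; exact: dissip.
rewrite -mulr_sumr ler_wpM2l ?(ltW C_gt0) // -[X in X <= _]opprK -sumrN.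
under eq_bigr do rewrite opprB.
by rewrite telescope_sumr; [rewrite opprB gerBl exprn_ge0|lia].
Qed.

Lemma dissipation_term_le s : b s <= C1 * a s.
Proof.
rewrite -(@ler_pXn2r _ q) ?nnegrE ?mulr_ge0 // exprMn nrootK ?(ltW C_gt0) //.
by apply: le_trans (dissip s) _; rewrite ler_pM2l // gerBl exprn_ge0.
Qed.

Hypothesis a_antimono : forall m n, (m <= n)%N -> a n <= a m.
Variables (sg L : R) (n : nat).
Hypotheses (sg_gt : 1 - q%:R^-1 < sg) (L_ge0 : 0 <= L).
Hypothesis a_le : forall k, (k <= n)%N -> a k <= L * powS k (- sg).
Let eps := sg - (1 - q%:R^-1).
Let eps_gt0 : 0 < eps. Proof. by rewrite subr_gt0. Qed.
Let tail_cst_ge0 : 0 <= geom_cst eps * (C1 * L).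
Proof. by rewrite !mulr_ge0 // ltW // geom_cst_gt0. Qed.

Lemma dissipation_tail_le m k : (k <= n.+1)%N ->
  \sum_(m <= s < k) b s <= geom_cst eps * (C1 * L) * powS m (- eps).
Proof.
apply: (dyadic_sum_le eps_gt0 (mulr_ge0 C1_ge0 L_ge0) b_ge0) => j jn.
apply: le_trans (dissipation_block_sum_le j) _.
have -> : powS j (- eps) = powS j (1 - q%:R^-1) * powS j (- sg).
  by rewrite -powSD /eps; congr powS; ring.
by rewrite [leRHS]mulrCA -mulrA !ler_wpM2l ?powS_ge0 // a_le.
Qed.

Lemma dissipation_sum_le m k : (k <= n.+1)%N ->
  \sum_(0 <= s < k) b s <= m%:R * (C1 * a 0%N) + geom_cst eps * (C1 * L) * powS m (- eps).
Proof.
move=> kn; have head_le j : \sum_(0 <= s < j) b s <= j%:R * (C1 * a 0%N).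
  rewrite mulr_natl -[j in leRHS]subn0 -sumr_const_nat; apply: ler_sum_nat => s _.
  by rewrite (le_trans (dissipation_term_le s)) // ler_wpM2l // a_antimono.
have [km|mk] := leqP k m; last by rewrite (@big_cat_nat _ _ _ m) ?(ltnW mk) //= lerD // dissipation_tail_le.
apply: (@le_trans _ _ (m%:R * (C1 * a 0%N))); last by rewrite lerDl mulr_ge0 ?powS_ge0.
by apply: le_trans (head_le k) _; rewrite ler_wpM2r ?ler_nat // mulr_ge0.
Qed.

Lemma dissipative_convolution_block_le th m M : 0 <= sg -> 0 < th <= 1 -> 1 - sg <= th -> (2 * M < n)%N ->
  (forall k, (k <= n)%N -> a k <= C * (powS k (- sg) + \sum_(s < k) powS (k.-1 - s) (- sg) * b s)) ->
  a (2 * M).+1 <= (C * 2 `^ sg * (1 + m%:R * (C1 * a 0%N)) + geom_cst eps * C1 * C *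
    (2 `^ sg * powS m (- eps) + geom_cst th * 2 `^ th * 2 `^ eps * powS M (- (q%:R^-1 - th))) * L) * powS M (- sg).
Proof.
move=> sg0 /andP[th0 th1] sgth Mn conv.
apply: le_trans (dyadic_average_le (g := fun t => powS t (- sg)) (kap := fun t s => powS t (- sg) * b s)
    sg0 (ltW C_gt0) b_ge0 b_ge0 (fun t => powS_ge0 _ _) a_antimono _ (fun t s _ _ => lexx _) (fun t s _ => lexx _)) _.
  by move=> k /andP[_ kM]; apply: conv; exact: leq_trans Mn.
have middle_le : \sum_(M./2 <= s < (2 * M).+1) b s <= geom_cst eps * (C1 * L) * (2 `^ eps * powS M (- eps)).
  apply: le_trans (dissipation_tail_le _ (leqW Mn)) _; rewrite ler_wpM2l //.
  by apply: powS_le_half (ltW eps_gt0) (ltn_double_half M).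
have kernel_le : \sum_(0 <= t < (2 * M).+1) powS t (- sg) <= geom_cst th * (2 `^ th * powS M th).
  rewrite -powS_doubleS; apply: (@le_trans _ _ (\sum_(0 <= t < (2 * M).+1) powS t (th - 1))).
    by apply: ler_sum_nat => t _; apply: ler_powS; lra.
  by apply: sum_powS_divergent_le; rewrite th0.
have head_le := dissipation_sum_le m (_ : (M./2 <= n.+1)%N); rewrite [leRHS]mulrDl.
have -> : C * 2 `^ sg * (1 + m%:R * (C1 * a 0%N)) * powS M (- sg) + geom_cst eps * C1 * C *
    (2 `^ sg * powS m (- eps) + geom_cst th * 2 `^ th * 2 `^ eps * powS M (- (q%:R^-1 - th))) * L * powS M (- sg) =
  C * (2 `^ sg * powS M (- sg) * (1 + (m%:R * (C1 * a 0%N) + geom_cst eps * (C1 * L) * powS m (- eps))) +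
    geom_cst th * 2 `^ th * (geom_cst eps * (C1 * L) * 2 `^ eps) * (powS M (- sg) * powS M (- (q%:R^-1 - th)))) by ring.
rewrite ler_pM2l // lerD //.
  by apply: ler_wpM2l; rewrite ?mulr_ge0 ?powR_ge0 // lerD2l head_le //; clear -Mn; lia.
have -> : powS M (- sg) * powS M (- (q%:R^-1 - th)) = powS M th * powS M (- eps) * M.+1%:R^-1.
  by rewrite -[M.+1%:R]powSr1 -powSN -!powSD; congr powS; rewrite /eps; ring.
have -> : geom_cst th * 2 `^ th * (geom_cst eps * (C1 * L) * 2 `^ eps) * (powS M th * powS M (- eps) * M.+1%:R^-1) =
  M.+1%:R^-1 * ((geom_cst th * (2 `^ th * powS M th)) * (geom_cst eps * (C1 * L) * (2 `^ eps * powS M (- eps)))) by ring.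
rewrite ler_wpM2l ?invr_ge0 // ler_pM // sumr_ge0 // => t _; exact: powS_ge0.
Qed.

End Dissipative.

(* A priori bound: with L the best constant in a n <= L (n+1)^-sg, averaging over a dyadic block gives L <= K + L/4. *)
Lemma le_powS_absorb (sg D : R) a n : 0 <= D -> (forall k, 0 <= a k) ->
  (forall L, 0 <= L -> (forall k, (k <= n)%N -> a k <= L * powS k (- sg)) ->
    forall k, (k <= n)%N -> a k * powS k sg <= D + L / 4) ->
  a n <= 2 * D * powS n (- sg).
Proof.
move=> D0 a0 absorb; pose L : R := \big[Num.max/0]_(k < n.+1) (a k * powS k sg).
have L0 : 0 <= L by exact: bigmax_ge_id.
have aL k : (k <= n)%N -> a k <= L * powS k (- sg).
  move=> kn; rewrite powSN ler_pdivlMr ?powS_gt0 //.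
  by rewrite /L (@le_bigmax _ _ _ 0 (fun k : 'I_n.+1 => a k * powS k sg) (Ordinal (kn : (k < n.+1)%N))).
suff L_le : L <= D + L / 4 by apply: le_trans (aL n (leqnn _)) _; rewrite ler_wpM2r ?powS_ge0 //; lra.
apply/bigmax_leP; split=> [|k _]; first by rewrite addr_ge0 ?divr_ge0.
by apply: (absorb L) => //; rewrite -ltnS.
Qed.

Lemma ex_summation_exponent (sg iq : R) : 0 < iq <= 1 -> 1 - iq < sg ->
  exists th, [/\ 0 < th, th <= 1, 1 - sg <= th & th < iq].
Proof.
move=> /andP[iq0 iq1] sgq.
by have [sg1|sg1] := leP 0 (1 - sg); [exists ((1 - sg + iq) / 2)|exists (iq / 2)]; split; lra.
Qed.

Lemma convolution_gronwall (q : nat) (sg C : R) : (0 < q)%N -> 0 < C -> 1 - q%:R^-1 < sg -> 0 <= sg ->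
  exists2 K : R, 0 < K & forall N a b, (forall n, 0 <= a n) -> (forall n, 0 <= b n) ->
  (forall m n, (m <= n)%N -> a n <= a m) -> a 0%N <= C ->
  (forall n, b n ^+ q <= C * (a n ^+ q - a n.+1 ^+ q)) ->
  (forall n, (n <= N)%N -> a n <= C * (powS n (- sg) + \sum_(s < n) powS (n.-1 - s) (- sg) * b s)) ->
  forall n, (n <= N)%N -> a n <= K * powS n (- sg).
Proof.
move=> q0 C0 sgq sg0; set iq : R := q%:R^-1 in sgq; pose eps := sg - (1 - iq).
have eps0 : 0 < eps by rewrite subr_gt0.
have iq_itv : 0 < iq <= 1 by rewrite /iq invr_gt0 ltr0n q0 invf_le1 ?ltr0n // ler1n.
have [th [th0 th1 sgth thiq]] := ex_summation_exponent iq_itv sgq.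
have tw0 (x : R) : 0 < 2 `^ x :> R by rewrite powR_gt0.
have C10 : 0 < nroot q C by rewrite powR_gt0.
pose G := geom_cst eps * nroot q C * C; pose H := geom_cst th * 2 `^ th * 2 `^ eps.
have G0 : 0 < G by rewrite !mulr_gt0 ?geom_cst_gt0.
have H0 : 0 < H by rewrite !mulr_gt0 ?geom_cst_gt0.
pose four_sg : R := 2 `^ sg * 2 `^ sg; have four_sg0 : 0 < four_sg by rewrite mulr_gt0.
pose small := (4 * four_sg * (G * (2 `^ sg + H)))^-1.
have small0 : 0 < small by rewrite invr_gt0 mulr_gt0 ?(mulr_gt0 G0) ?(addr_gt0 _ H0) ?mulr_gt0.
have [m0 hm0] := powS_le_eventually eps0 small0.
have iqth0 : 0 < iq - th by rewrite subr_gt0.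
have [M0 hM0] := powS_le_eventually iqth0 small0.
pose D1 := C * 2 `^ sg * (1 + m0%:R * (nroot q C * C)).
pose D2 := C * powS (2 * M0).+2 sg.
have D10 : 0 < D1 by rewrite !mulr_gt0 // ltr_pwDl // !mulr_ge0 // ltW.
have D20 : 0 < D2 by rewrite mulr_gt0 // powS_gt0.
exists (2 * (D1 * four_sg + D2)); first by rewrite mulr_gt0 // addr_gt0 // mulr_gt0.
have D1g0 : 0 < D1 * four_sg by rewrite mulr_gt0.
move=> N a b a0 b0 amono aC dissip conv n nN.
apply: le_powS_absorb => // [|L L0 aL k kn]; first by rewrite addr_ge0 // ltW.
have [k0|k0] := leqP k (2 * M0).+2.
  apply: (@le_trans _ _ D2); last by rewrite addrAC lerDr addr_ge0 ?divr_ge0 ?(ltW D1g0).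
  by rewrite ler_pM ?powS_ge0 //; [exact: le_trans (amono _ _ _) aC|exact: powS_mono].
apply: (@le_trans _ _ (D1 * four_sg + L / 4)); last by rewrite lerD2r lerDl ltW.
have -> : D1 * four_sg + L / 4 = (D1 + L / (4 * four_sg)) * four_sg.
  by rewrite mulrDl; congr (_ + _); field; rewrite gt_eqF.
rewrite -ler_pdivlMr ?powS_gt0 // -powSN.
have k_gt0 : (0 < k)%N by exact: leq_trans k0.
apply: (antimono_half_decay sg0 _ amono k_gt0).
  by rewrite addr_ge0 ?(ltW D10) // divr_ge0 // mulr_ge0 // ltW.
set M := (k.-1)./2; have Mk : (M0 <= M)%N && (2 * M < k)%N by rewrite /M; clear -k0; lia.
case/andP: Mk => M0M Mk; have {}conv j (jn : (j <= n)%N) := conv j (leq_trans jn nN).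
have := dissipative_convolution_block_le q0 C0 a0 b0 dissip amono sgq L0 aL m0 sg0
  (introT andP (conj th0 th1)) sgth (leq_trans Mk kn) conv.
move=> /le_trans; apply; rewrite ler_wpM2r ?powS_ge0 // lerD //.
  by rewrite ler_wpM2l ?mulr_ge0 ?(ltW C0) ?(ltW (tw0 _)) // lerD2l !ler_wpM2l ?(ltW C10).
rewrite [leLHS]mulrC ler_wpM2l //; have -> : (4 * four_sg)^-1 = G * (2 `^ sg * small + H * small).
  by rewrite /small; field; rewrite ?gt_eqF ?addr_gt0.
by rewrite ler_wpM2l ?(ltW G0) // lerD // ler_wpM2l ?hm0 ?hM0 // ltW.
Qed.

End Gronwall.

Section SharpGronwall.
Variable R : realType.
Implicit Types (a b v g : nat -> R).

Lemma weighted_sum_le (ups w C : R) N b : 0 <= ups -> ups < w -> 0 <= C -> (forall n, 0 <= b n) ->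
  (forall m, (m <= N)%N -> \sum_(m <= s < (2 * m).+1) b s <= C * powS m (- w)) ->
  forall n, (n <= N.+1)%N -> \sum_(0 <= s < n) powS s ups * b s <= geom_cst (w - ups) * (C * 2 `^ ups).
Proof.
move=> up0 upw C0 b0 blk n nN.
have := @dyadic_sum_le R (C * 2 `^ ups) (w - ups) (fun s => powS s ups * b s) N.
rewrite subr_gt0 => /(_ upw (mulr_ge0 C0 (powR_ge0 _ _)) (fun s => mulr_ge0 (powS_ge0 _ _) (b0 _))).
move=> /(_ _ 0%N n nN); rewrite powS0l mulr1; apply => m mN.
apply: (@le_trans _ _ (\sum_(m <= s < (2 * m).+1) 2 `^ ups * powS m ups * b s)).
  apply: ler_sum_nat => s /andP[_ sm]; rewrite ler_wpM2r // -powS_doubleS; apply: powS_mono => //.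
  exact: ltnW.
rewrite -mulr_sumr; have -> : powS m (- (w - ups)) = powS m ups * powS m (- w) by rewrite -powSD; congr powS; ring.
have -> : C * 2 `^ ups * (powS m ups * powS m (- w)) = 2 `^ ups * powS m ups * (C * powS m (- w)) by ring.
by rewrite ler_wpM2l ?blk // mulr_ge0 ?powS_ge0 ?powR_ge0.
Qed.

(* Far from the diagonal the kernel carries the rate gm, at the price of a weight (s+1)^ups;
   near it the kernel only has the rate sg, but there the blocks of b are small. *)
Lemma convolution_gronwall_sharp (gm sg ups w th C : R) : 0 <= gm -> 0 <= ups -> ups < w -> 0 <= th ->
  gm <= 1 - th + w -> 0 < C ->
  (forall n, \sum_(0 <= t < n) powS t (- sg) <= C * powS n th) ->
  exists2 K : R, 0 < K & forall N a b (kap : nat -> nat -> R), (forall n, 0 <= b n) ->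
  (forall m n, (m <= n)%N -> a n <= a m) -> a 0%N <= C ->
  (forall m, (m <= N)%N -> \sum_(m <= s < (2 * m).+1) b s <= C * powS m (- w)) ->
  (forall n, (n <= N)%N -> a n <= C * (powS n (- gm) + \sum_(s < n) kap (n.-1 - s)%N s)) ->
  (forall t s, (t + s < N)%N -> kap t s <= C * powS t (- gm) * (powS s ups * b s)) ->
  (forall t s, (t + s < N)%N -> kap t s <= C * powS t (- sg) * b s) ->
  forall n, (n <= N)%N -> a n <= K * powS n (- gm).
Proof.
move=> gm0 up0 upw th0 gmw C0 sumg; have w0 : 0 < w by exact: le_lt_trans up0 upw.
have tw0 (x : R) : 0 < 2 `^ x :> R by rewrite powR_gt0.
have G0 := geom_cst_gt0 w0; have Gu0 : 0 < geom_cst (w - ups) by rewrite geom_cst_gt0 // subr_gt0.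
pose A1 := 2 `^ gm * (1 + C * (geom_cst (w - ups) * (C * 2 `^ ups))).
pose A2 := C * (C * 2 `^ th) * (geom_cst w * C * 2 `^ w).
have A10 : 0 < A1 by rewrite mulr_gt0 // ltr_pwDl // !mulr_ge0 // ltW.
have A20 : 0 < A2 by rewrite !mulr_gt0.
pose D := C * (A1 + A2); have D0 : 0 < D by rewrite mulr_gt0 // addr_gt0.
have D40 : 0 < D * (2 `^ gm * 2 `^ gm) by rewrite mulr_gt0 // mulr_gt0.
exists (C + D * (2 `^ gm * 2 `^ gm)); first by rewrite addr_gt0.
move=> N a b kap b0 amono aC blk conv far near n nN; have [->|n0] := posnP n.
  by rewrite powS0l mulr1 (le_trans aC) // lerDl ltW.
apply: (@le_trans _ _ (D * (2 `^ gm * 2 `^ gm) * powS n (- gm))); last first.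
  by rewrite ler_wpM2r ?powS_ge0 // lerDr ltW.
apply: antimono_half_decay => //; first exact: ltW.
set M := (n.-1)./2; have MN : (2 * M < N)%N by apply: leq_trans nN; rewrite /M; clear -n0; lia.
have vb s : 0 <= C * (powS s ups * b s) by rewrite !mulr_ge0 ?powS_ge0 // ltW.
have g0 t : 0 <= C * powS t (- sg) by rewrite mulr_ge0 ?powS_ge0 // ltW.
have /le_trans -> // : a (2 * M).+1 <= C * (2 `^ gm * powS M (- gm) *
    (1 + \sum_(0 <= s < M./2) C * (powS s ups * b s)) + M.+1%:R^-1 *
    ((\sum_(0 <= t < (2 * M).+1) C * powS t (- sg)) * \sum_(M./2 <= s < (2 * M).+1) b s)).
  apply: (dyadic_average_le gm0 (ltW C0) vb b0 g0 amono (kap := kap)) => [k /andP[_ kM]|t s ts _|t s ts].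
  - by apply: conv; exact: leq_trans kM MN.
  - by rewrite mulrCA mulrA; apply: far; exact: leq_ltn_trans MN.
  - by apply: near; exact: leq_ltn_trans MN.
rewrite -!mulr_sumr -[leRHS]mulrA ler_pM2l // mulrDl lerD //.
  rewrite /A1 mulrAC ler_wpM2r ?powS_ge0 // ler_pM2l // lerD2l ler_pM2l //.
  by apply: (weighted_sum_le up0 upw (ltW C0) b0 blk); clear -MN; lia.
have tail_le : \sum_(M./2 <= s < (2 * M).+1) b s <= geom_cst w * C * (2 `^ w * powS M (- w)).
  have := @dyadic_sum_le R C w b N w0 (ltW C0) b0 blk M./2 (2 * M).+1.
  move=> /(_ _) /le_trans; apply; first by clear -MN; lia.
  by rewrite ler_wpM2l ?mulr_ge0 ?(ltW G0) ?(ltW C0) //; exact: powS_le_half (ltW w0) (ltn_double_half M).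
have kernel_le : \sum_(0 <= t < (2 * M).+1) powS t (- sg) <= C * (2 `^ th * powS M th).
  by rewrite -powS_doubleS; exact: sumg.
rewrite ler_pdivrMl ?ltr0n // -mulrA.
apply: (@le_trans _ _ (C * (C * (2 `^ th * powS M th) * (geom_cst w * C * (2 `^ w * powS M (- w)))))).
  by rewrite ler_pM2l // ler_pM ?sumr_ge0 // => t _; exact: powS_ge0.
apply: (@le_trans _ _ (A2 * powS M (th - w))); first by rewrite powSD /A2; apply: le_of_eq; ring.
by rewrite mulrCA ler_pM2l // -[M.+1%:R]powSr1 -powSD; apply: ler_powS; lra.
Qed.

End SharpGronwall.

(** * Cubes *)

Section Cubes.
Variables (V : zmodType) (d : nat) (e : 'I_d -> V).
Implicit Types (x y z : V) (k : 'I_d -> nat) (r l : nat).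
Local Notation lattice_pt := (lattice_pt e).

Definition cube z l (y : V) : bool :=
  [exists k : {ffun 'I_d -> 'I_l}, y == z + lattice_pt (fun i => k i)].

Lemma cubeP z l y : reflect (exists2 k, (forall i, k i < l)%N & y = z + lattice_pt k) (cube z l y).
Proof.
apply: (iffP existsP) => [[k /eqP ->]|[k kl ->]]; first by exists (fun i => nat_of_ord (k i)).
exists [ffun i => Ordinal (kl i)]; apply/eqP; congr (_ + _).
by apply: eq_bigr => i _; rewrite ffunE.
Qed.

Lemma lattice_ptD k (l : 'I_d -> nat) : lattice_pt (fun i => k i + l i)%N = lattice_pt k + lattice_pt l.
Proof. by rewrite /lattice_pt -big_split; apply: eq_bigr => i _; rewrite mulrnDr. Qed.

Lemma lattice_pt1 i : lattice_pt (fun j => (j == i)) = e i.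
Proof.
by rewrite /lattice_pt (bigD1 i) //= eqxx mulr1n big1 ?addr0 // => j /negPf ->; rewrite mulr0n.
Qed.

Definition diag_pt r : V := lattice_pt (fun=> r).
Lemma diag_ptS r : diag_pt r.+1 = diag_pt r + diag_pt 1.
Proof. by rewrite /diag_pt -lattice_ptD; apply: eq_bigr => i _; rewrite addn1. Qed.

Definition sup_ball r x y := cube (x - diag_pt r) (2 * r).+1 y.

Lemma sup_ball_refl r x : sup_ball r x x.
Proof.
apply/cubeP; exists (fun=> r) => [i|]; last by rewrite -/(diag_pt r) subrK.
by rewrite ltnS leq_pmull.
Qed.

Lemma sup_ball_up r x i y : sup_ball r (x + e i) y -> sup_ball r.+1 x y.
Proof.
case/cubeP => k kl ->; apply/cubeP; exists (fun j => k j + (1 + (j == i)))%N.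
  by move=> j; have := kl j; case: (j == i) => /=; clear; lia.
rewrite lattice_ptD lattice_ptD lattice_pt1 -/(diag_pt 1) diag_ptS opprD; set X := lattice_pt k; rewrite [diag_pt 1 + e i]addrC.
by rewrite !addrA [RHS](ACl (1*5*2*4*(3*6)))/= addNr addr0.
Qed.

Lemma sup_ball_down r x i y : sup_ball r (x - e i) y -> sup_ball r.+1 x y.
Proof.
case/cubeP => k kl ->; apply/cubeP; exists (fun j => k j + (j != i))%N.
  by move=> j; have := kl j; case: (j != i) => /=; clear; lia.
rewrite lattice_ptD diag_ptS; have -> : lattice_pt (fun j => (j != i)) = diag_pt 1 - e i.
  rewrite -(lattice_pt1 i) /diag_pt -[lattice_pt (fun=> 1%N)](subrK (lattice_pt (fun j => (j == i)))) addrK.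
  apply/eqP; rewrite eq_sym subr_eq -lattice_ptD; apply/eqP; apply: eq_bigr => j _.
  by case: (j == i).
rewrite opprD addrA; set X := lattice_pt k; set Y := diag_pt 1; set Z := diag_pt r.
by rewrite !addrA [RHS](ACl (1*6*2*4*(3*5)))/= addNr addr0.
Qed.

Lemma sup_ball_S r x y : sup_ball r x y -> sup_ball r.+1 x y.
Proof.
case/cubeP => k kl ->; apply/cubeP; exists (fun j => k j + 1)%N.
  by move=> j; have := kl j; clear; lia.
rewrite lattice_ptD -/(diag_pt 1) diag_ptS opprD !addrA; set X := lattice_pt k.
by rewrite (addrAC _ X (diag_pt 1)) subrK.
Qed.

Lemma sup_ball_mono r r' x y : (r <= r')%N -> sup_ball r x y -> sup_ball r' x y.
Proof. by move=> /subnK <- h; elim: (r' - r)%N => // j; rewrite addSn; exact: sup_ball_S. Qed.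

Lemma sup_ball_sym r x y : sup_ball r x y -> sup_ball r y x.
Proof.
case/cubeP => k kl ->; apply/cubeP; exists (fun i => 2 * r - k i)%N.
  by move=> i; rewrite ltnS leq_subr.
have -> : lattice_pt (fun i => (2 * r - k i)%N) = diag_pt r + diag_pt r - lattice_pt k.
  apply/eqP; rewrite eq_sym subr_eq /diag_pt -!lattice_ptD; apply/eqP; apply: eq_bigr => i _.
  by congr (_ *+ _); have := kl i; clear; lia.
by rewrite addrA [_ + (_ + diag_pt r)]addrA subrK [_ + diag_pt r]addrAC subrK addrK.
Qed.

Lemma sup_ball_cube r z l x y : cube z l x -> sup_ball r x y -> cube (z - diag_pt r) (l + 2 * r) y.
Proof.
case/cubeP => k kl -> /cubeP[k' kl' ->]; apply/cubeP; exists (fun j => k j + k' j)%N.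
  by move=> j; have := kl j; have := kl' j; clear; lia.
by rewrite lattice_ptD !addrA (addrAC z (lattice_pt k)).
Qed.

Lemma heat_ldrift_local (R : realFieldType) (beta : R) (xi : 'I_d -> R) a b n x : (forall E : V * 'I_d, sup_ball n.+1 x E.1 -> a E = b E) ->
  heat_ldrift e beta xi a n x = heat_ldrift e beta xi b n x.
Proof.
elim: n x => [|n IH] x h.
  rewrite /heat_ldrift /= /ldrift; apply: eq_bigr => i _; rewrite !h //=; last exact: sup_ball_refl.
  by apply: (@sup_ball_down 0 x i); exact: sup_ball_refl.
have nbr_b m i : sup_ball m.+1 x (x - e i).
  by apply: (@sup_ball_down m x i); exact: sup_ball_refl.
rewrite /heat_ldrift /= -!/(heat_ldrift e beta xi _ n) /heat_step /scaled_lap /lap.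
rewrite (IH x); last by move=> E hE; apply: h; exact: sup_ball_S.
congr (_ - _ * _); apply: eq_bigr => i _.
rewrite !h ?sup_ball_refl ?nbr_b //=.
rewrite (IH (x + e i)); last by move=> E hE; apply: h; exact: sup_ball_up hE.
by rewrite (IH (x - e i)) //; move=> E hE; apply: h; exact: sup_ball_down hE.
Qed.

Lemma heat_delta_local (R : realFieldType) (beta : R) a n x y :
  ~~ sup_ball n y x -> heat e beta a n (delta x) y = 0.
Proof.
elim: n y => [|n IH] y far; first by rewrite /= /delta; case: eqP far => // ->; rewrite sup_ball_refl.
have IHy : heat e beta a n (delta x) y = 0 by apply: IH; apply: contra far; exact: sup_ball_S.
have IHup i : heat e beta a n (delta x) (y + e i) = 0 by apply: IH; apply: contra far; exact: sup_ball_up.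
have IHdown i : heat e beta a n (delta x) (y - e i) = 0 by apply: IH; apply: contra far; exact: sup_ball_down.
rewrite -[LHS]/(heat_step e beta a (heat e beta a n (delta x)) y) /heat_step /scaled_lap /lap IHy.
by rewrite big1 ?mulr0 ?subr0 // => i _; rewrite IHup IHdown subr0 !mulr0 addr0.
Qed.

Lemma heat_dipole_local (R : realFieldType) (beta : R) a n E y :
  ~~ sup_ball n.+1 y E.1 -> heat e beta a n (dipole e E) y = 0.
Proof.
move=> far; rewrite /dipole heatB !heat_delta_local ?subrr //; apply: contra far; first exact: sup_ball_S.
by move=> /sup_ball_sym /sup_ball_up /sup_ball_sym.
Qed.

End Cubes.

Section FiniteCubes.
Variables (V : finZmodType) (d : nat) (e : 'I_d -> V).
Implicit Types (z : V) (l : nat).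
Local Notation lattice_pt := (lattice_pt e).
Local Notation cube := (cube e).

Lemma sum_cube_le (R : realFieldType) (F : V -> R) z l : (forall x, 0 <= F x) ->
  \sum_(y | cube z l y) F y <= \sum_(k : {ffun 'I_d -> 'I_l}) F (z + lattice_pt (fun i => k i)).
Proof.
move=> F0; rewrite (partition_big (fun k : {ffun 'I_d -> 'I_l} => z + lattice_pt (fun i => k i)) (cube z l)) /=.
  apply: ler_sum => y /existsP[k /eqP yk]; rewrite (bigD1 k) /=; last by rewrite yk.
  by rewrite yk lerDl sumr_ge0.
by move=> k _; apply/existsP; exists k.
Qed.

Lemma card_cube_le z l : (#|[pred y | cube z l y]| <= l ^ d)%N.
Proof.
have := leq_imset_card (fun k : {ffun 'I_d -> 'I_l} => z + lattice_pt (fun i => k i)) (mem {ffun 'I_d -> 'I_l}).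
rewrite card_ffun !card_ord; apply: leq_trans; apply: subset_leq_card.
by apply/fintype.subsetP => y /existsP[k /eqP ->]; apply/imsetP; exists k.
Qed.

End FiniteCubes.

(** * Dipole kernels as operators *)

Section Operator.
Variables (R : realType) (d : nat) (alpha beta C del : R).
Hypotheses (d_gt0 : (0 < d)%N) (alpha_gt0 : 0 < alpha) (le_ab : alpha <= beta).
Hypotheses (del_ge0 : 0 <= del) (HC : @dipole_bound R d alpha beta C del).
Local Notation c := (spec_bound d beta).
Let c0 : 0 < c := spec_bound_gt0 d_gt0 alpha_gt0 le_ab.

Section Fixed.
Variables (V : finZmodType) (e : 'I_d -> V) (N : nat) (a : V * 'I_d -> R).
Hypotheses (tor : box_embeds e N) (ha : elliptic alpha beta a).
Local Notation heat := (heat e beta).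
Implicit Types (E F : V * 'I_d) (w : V * 'I_d -> R) (Q : pred (V * 'I_d)).

Definition dipole_kernel t E F := ediff e E (heat a t (dipole e F)).
Let dipole_comb Q w x := \sum_(E | Q E) w E * dipole e E x.

Lemma heat_sum_cond n (Q : pred (V * 'I_d)) (f : V * 'I_d -> V -> R) x :
  heat a n (fun y => \sum_(E | Q E) f E y) x = \sum_(E | Q E) heat a n (f E) x.
Proof.
rewrite big_mkcond /=.
have -> : (fun y => \sum_(E | Q E) f E y) = fun y => \sum_E (if Q E then 1 else 0) * f E y.
  by apply/funext => y; rewrite big_mkcond; apply: eq_bigr => E _; case: ifP; rewrite ?mul1r ?mul0r.
rewrite heat_sum; apply: eq_bigr => E _; rewrite heatZ; by case: ifP; rewrite ?mul1r ?mul0r.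
Qed.

Lemma sum_dipole_kernel Q w t F : \sum_(E | Q E) dipole_kernel t E F * w E = ediff e F (heat a t (dipole_comb Q w)).
Proof.
rewrite -dot_dipole /dot /dipole_comb; under [RHS]eq_bigr do rewrite heat_sum_cond mulr_sumr.
rewrite [RHS]exchange_big /=; apply: eq_bigr => E _.
under eq_bigr do rewrite heatZ mulrCA.
by rewrite -mulr_sumr mulrC -/(dot (dipole e F) _) dot_heat dotC dot_dipole.
Qed.

Lemma dot_dipole_comb Q w f : dot (dipole_comb Q w) f = \sum_(E | Q E) w E * ediff e E f.
Proof.
rewrite /dot /dipole_comb; under eq_bigr do rewrite mulr_suml.
rewrite exchange_big /=; apply: eq_bigr => E _; rewrite -dot_dipole /dot mulr_sumr.
by apply: eq_bigr => x _; rewrite mulrA.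
Qed.

Lemma heat_dipole_comb_decay Q w m : dot (heat a m (dipole_comb Q w)) (heat a m (dipole_comb Q w)) <=
  c / alpha / m.+1%:R * \sum_(E | Q E) w E ^+ 2.
Proof.
set X := dot _ _; set W := \sum_(E | Q E) _; set K := c / alpha / m.+1%:R.
have W0 : 0 <= W by rewrite sumr_ge0 // => E _; rewrite sqr_ge0.
have K0 : 0 < K by rewrite divr_gt0 ?ltr0n // divr_gt0.
have X0 : 0 <= X by exact: dot_ge0.
have X_sqr_le : X ^+ 2 <= W * (K * X).
  have -> : X ^+ 2 = (\sum_(E | Q E) w E * ediff e E (heat a m (heat a m (dipole_comb Q w)))) ^+ 2.
    by rewrite -dot_dipole_comb dot_heat.
  apply: le_trans (sum_CauchySchwarz _ _ _) _; rewrite -/W ler_wpM2l //.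
  apply: (@le_trans _ _ (gradsq e (heat a m (heat a m (dipole_comb Q w))))).
    by apply: ler_sum_cond => E; exact: sqr_ge0.
  have := gradsq_heat_decay e d_gt0 alpha_gt0 le_ab ha (heat a m (dipole_comb Q w)) m.
  by rewrite -/X /K mulrAC.
have [Xp|Xn] := ltP 0 X; last by rewrite (le_trans Xn) // mulr_ge0 // ltW.
by move: X_sqr_le; rewrite expr2 mulrA ler_pM2r // mulrC.
Qed.

Lemma dipole_kernel_energy_le Q w t : \sum_(F | Q F) (\sum_(E | Q E) dipole_kernel t E F * w E) ^+ 2 <=
  (2 * (c / alpha) * powS t (- 1)) ^+ 2 * \sum_(E | Q E) w E ^+ 2.
Proof.
under eq_bigr do rewrite sum_dipole_kernel.
pose m := t./2; have mt : (m <= t)%N := leq_half t.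
set W := \sum_(E | Q E) w E ^+ 2; have W0 : 0 <= W by rewrite sumr_ge0 // => E _; rewrite sqr_ge0.
apply: (@le_trans _ _ (gradsq e (heat a t (dipole_comb Q w)))).
  by apply: ler_sum_cond => E; exact: sqr_ge0.
have -> : heat a t (dipole_comb Q w) = heat a (t - m) (heat a m (dipole_comb Q w)) by rewrite -heat_addn subnK.
apply: le_trans (gradsq_heat_decay e d_gt0 alpha_gt0 le_ab ha _ _) _.
have q0 : 0 < c / alpha by exact: divr_gt0.
have inv_late : (t - m).+1%:R^-1 <= 2 * powS t (- 1) :> R.
  rewrite powSN powSr1 -[2]invrK -invfM lef_pV2 ?posrE ?mulr_gt0 ?invr_gt0 ?ltr0n //.
  by rewrite ler_pdivrMl // -natrM ler_nat /m; clear; lia.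
have inv_early : m.+1%:R^-1 <= 2 * powS t (- 1) :> R.
  rewrite powSN powSr1 -[2]invrK -invfM lef_pV2 ?posrE ?mulr_gt0 ?invr_gt0 ?ltr0n //.
  by rewrite ler_pdivrMl // -natrM ler_nat /m; clear; lia.
have comb_decay := heat_dipole_comb_decay Q w m; rewrite -/W in comb_decay.
apply: (@le_trans _ _ ((c / alpha * (c / alpha / m.+1%:R * W)) / (t - m).+1%:R)).
  by rewrite ler_wpM2r ?invr_ge0 // ler_pM2l.
have -> : c / alpha * (c / alpha / m.+1%:R * W) / (t - m).+1%:R =
  (c / alpha) ^+ 2 * W * (m.+1%:R^-1 * (t - m).+1%:R^-1) by ring.
have -> : (2 * (c / alpha) * powS t (- 1)) ^+ 2 * W = (c / alpha) ^+ 2 * W * ((2 * powS t (- 1)) * (2 * powS t (- 1))) by ring.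
apply: ler_wpM2l; first by apply: mulr_ge0 => //; exact: sqr_ge0.
by apply: ler_pM; rewrite ?invr_ge0.
Qed.

Lemma dipole_kernel_le t E F : (t <= N)%N -> dipole_kernel t E F ^+ 2 <= (C * 2 `^ (1 + del) * powS t (- (1 + del))) ^+ 2.
Proof.
move=> tN; pose m := t./2; have mt : (m <= t)%N := leq_half t.
have -> : dipole_kernel t E F = dot (heat a m (dipole e E)) (heat a (t - m) (dipole e F)).
  by rewrite /dipole_kernel -dot_dipole -{1}(subnKC mt) heat_addn dot_heat.
apply: le_trans (dot_CauchySchwarz _ _) _; case: HC => C0 H.
have s0 : 0 <= 1 + del by rewrite addr_ge0.
rewrite expr2; apply: ler_pM; rewrite ?dot_ge0 // -[leRHS]mulrA.
  apply: le_trans (H _ _ _ _ tor ha m E (leq_trans mt tN)) _; rewrite ler_pM2l //.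
  by apply: powS_le_half => //; exact: ltn_double_half.
apply: le_trans (H _ _ _ _ tor ha (t - m)%N F (leq_trans (leq_subr _ _) tN)) _; rewrite ler_pM2l //.
by apply: powS_le_half => //; rewrite /m; clear; lia.
Qed.

Lemma dipole_kernel_hs_le Q w t (B : R) : (t <= N)%N -> #|Q|%:R <= B ->
  \sum_(F | Q F) (\sum_(E | Q E) dipole_kernel t E F * w E) ^+ 2 <=
  (C * 2 `^ (1 + del) * (B * powS t (- (1 + del)))) ^+ 2 * \sum_(E | Q E) w E ^+ 2.
Proof.
move=> tN QB; have B0 : 0 <= B by exact: le_trans QB.
set W := \sum_(E | Q E) w E ^+ 2; have W0 : 0 <= W by rewrite sumr_ge0 // => E _; rewrite sqr_ge0.
set D := (C * 2 `^ (1 + del) * powS t (- (1 + del))) ^+ 2.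
have D0 : 0 <= D by rewrite sqr_ge0.
have sum_cst_le (x : R) : 0 <= x -> \sum_(E | Q E) x <= B * x.
  by move=> x0; rewrite sumr_const -[x *+ _]mulr_natl ler_wpM2r.
apply: (@le_trans _ _ (\sum_(F | Q F) B * D * W)).
  apply: ler_sum => F _; apply: le_trans (sum_CauchySchwarz _ _ _) _; rewrite -/W ler_wpM2r //.
  apply: le_trans (sum_cst_le D D0); apply: ler_sum => E _; exact: dipole_kernel_le.
apply: le_trans (sum_cst_le _ _) _; first by apply: mulr_ge0 => //; exact: mulr_ge0.
by rewrite /D; apply: le_of_eq; ring.
Qed.

Definition op_cst := 2 * (c / alpha) + C * 2 `^ (1 + del).
Definition op_norm (B : R) t := Num.min (powS t (- 1)) (B * powS t (- (1 + del))).

Lemma op_cst_gt0 : 0 < op_cst.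
Proof.
case: HC => C0 _; apply: addr_gt0; first by rewrite mulr_gt0 // divr_gt0.
by rewrite mulr_gt0 // powR_gt0.
Qed.

Lemma op_norm_ge0 (B : R) t : 0 <= B -> 0 <= op_norm B t.
Proof. by move=> B0; rewrite le_min powS_ge0 mulr_ge0 // powS_ge0. Qed.

Lemma dipole_kernel_op_le Q w t (B : R) : (t <= N)%N -> #|Q|%:R <= B ->
  \sum_(F | Q F) (\sum_(E | Q E) dipole_kernel t E F * w E) ^+ 2 <=
  (op_cst * op_norm B t) ^+ 2 * \sum_(E | Q E) w E ^+ 2.
Proof.
move=> tN QB; have B0 : 0 <= B by exact: le_trans QB.
case: (HC) => C0 _; have q0 : 0 < c / alpha by exact: divr_gt0.
have t0 : 0 < 2 `^ (1 + del) :> R by rewrite powR_gt0.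
have W0 : 0 <= \sum_(E | Q E) w E ^+ 2 by rewrite sumr_ge0 // => E _; rewrite sqr_ge0.
rewrite /op_norm minEle; case: ifP => _.
  apply: le_trans (dipole_kernel_energy_le Q w t) _; apply: ler_wpM2r => //; apply: ler_sqr_nneg.
    by rewrite mulr_ge0 ?powS_ge0 // mulr_ge0 // ltW.
  by rewrite ler_wpM2r ?powS_ge0 // lerDl mulr_ge0 // ltW.
apply: le_trans (dipole_kernel_hs_le w tN QB) _; apply: ler_wpM2r => //; apply: ler_sqr_nneg.
  by rewrite mulr_ge0 ?mulr_ge0 ?powS_ge0 // ltW.
by rewrite ler_wpM2r ?mulr_ge0 ?powS_ge0 // lerDr mulr_ge0 // ltW.
Qed.

Definition dipole_energy (b : V * 'I_d -> R) t Q := \sum_(E | Q E) dot (heat b t (dipole e E)) (heat b t (dipole e E)).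

Lemma dipole_energy_compare (b : V * 'I_d -> R) t Q (B : R) (l : 'I_t.+1 -> R) :
  elliptic alpha beta b -> (forall E, ~~ Q E -> a E = b E) -> (t <= N)%N -> #|Q|%:R <= B ->
  (forall k, 0 < l k) -> \sum_k l k = 1 ->
  dipole_energy a t Q <= \sum_(k < t.+1) (if (k < t)%N then (beta / c * (op_cst * op_norm B k)) ^+ 2 * dipole_energy b (t.-1 - k) Q
     else dipole_energy b t Q) / l k.
Proof.
move=> hb ab tN QB l0 l1.
pose f x F k := if (k < t)%N then c^-1 * \sum_(E | Q E) dipole_kernel k E F * ((b E - a E) * heat b (t.-1 - k) (dipole e E) x)
  else heat b t (dipole e F) x.
have heat_dipoleE x F : heat a t (dipole e F) x = \sum_(k < t.+1) f x F k.
  rewrite big_ord_recr /= /f ltnn; have := duhamel e beta b a t (dipole e F) (delta x).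
  rewrite !dot_delta => /eqP; rewrite subr_eq => /eqP h.
  have -> : heat a t (dipole e F) x = c^-1 * \sum_(k < t) \sum_E (b E - a E) * ediff e E (heat b (t.-1 - k) (delta x)) *
      ediff e E (heat a k (dipole e F)) + heat b t (dipole e F) x by rewrite h; ring.
  congr (_ + _); rewrite mulr_sumr; apply: eq_bigr => k _; rewrite ltn_ord; congr (_ * _); apply/esym.
  rewrite [RHS](bigID Q) /= [X in _ = _ + X]big1 ?addr0; last first.
    by move=> E /ab ->; rewrite subrr !mul0r.
  apply: eq_bigr => E _; rewrite -!dot_dipole (dotC _ (heat b _ _)) -dot_heat dot_delta /dipole_kernel -dot_dipole.
  by rewrite [RHS]mulrC mulrA.
apply: (@le_trans _ _ (\sum_(F | Q F) \sum_x \sum_(k < t.+1) f x F k ^+ 2 / l k)).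
  by apply: ler_sum => F _; apply: ler_sum => x _; rewrite -expr2 heat_dipoleE; exact: sqr_sum_le_weights.
under eq_bigr do rewrite exchange_big /=.
rewrite exchange_big /=; apply: ler_sum => k _.
under eq_bigr do rewrite -mulr_suml.
rewrite -mulr_suml ler_wpM2r ?invr_ge0 ?(ltW (l0 _)) // /f; case: ifP => kt; last first.
  by apply: ler_sum => F _; apply: ler_sum => x _; rewrite expr2.
rewrite exchange_big /=; have kN : (k <= N)%N by rewrite (leq_trans _ tN) // ltnW.
apply: (@le_trans _ _ (\sum_x c^-1 ^+ 2 * ((op_cst * op_norm B k) ^+ 2 *
  \sum_(E | Q E) ((b E - a E) * heat b (t.-1 - k) (dipole e E) x) ^+ 2))).
  apply: ler_sum => x _; under eq_bigr do rewrite exprMn.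
  by rewrite -mulr_sumr ler_wpM2l ?sqr_ge0 //; exact: dipole_kernel_op_le.
rewrite -!mulr_sumr exchange_big /=.
have -> : (beta / c * (op_cst * op_norm B k)) ^+ 2 * dipole_energy b (t.-1 - k) Q =
  c^-1 ^+ 2 * ((op_cst * op_norm B k) ^+ 2 * (beta ^+ 2 * dipole_energy b (t.-1 - k) Q)) by ring.
rewrite ler_wpM2l ?sqr_ge0 // ler_wpM2l ?sqr_ge0 // /dipole_energy mulr_sumr; apply: ler_sum => E _.
rewrite /dot mulr_sumr; apply: ler_sum => x _; rewrite exprMn -expr2 ler_wpM2r ?sqr_ge0 //.
rewrite -real_normK ?num_real // ler_sqr_nneg //.
by apply: (norm_diff_le (alpha := alpha) (beta := beta)) => //; rewrite gerBl ltW.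
Qed.

End Fixed.
End Operator.

Section OperatorNormConvolution.
Variables (R : realType) (gm del eps : R).
Hypotheses (gm_ge1 : 1 <= gm) (del_gt0 : 0 < del) (gm_lt : gm < 1 + del).
Hypotheses (eps_gt0 : 0 < eps) (eps_le1 : eps <= 1).
Implicit Types (B : R) (t k : nat).

Lemma op_norm_interpolation B k : 0 < B ->
  op_norm del B k <= B `^ eps * powS k (- (1 + eps * del)).
Proof.
move=> B0; have norm_gt0 : 0 < op_norm del B k by rewrite lt_min powS_gt0 mulr_gt0 // powS_gt0.
have -> : op_norm del B k = op_norm del B k `^ (1 - eps) * op_norm del B k `^ eps.
  by rewrite -powRD ?subrK ?powRr1 ?(ltW norm_gt0) // gt_eqF // implybT.
apply: (@le_trans _ _ ((powS k (- 1)) `^ (1 - eps) * (B * powS k (- (1 + del))) `^ eps)).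
  apply: ler_pM; rewrite ?powR_ge0 // ge0_ler_powR ?nnegrE ?subr_ge0 ?(ltW eps_gt0) ?(ltW norm_gt0) //.
  - exact: powS_ge0.
  - by rewrite ge_min lexx.
  - by rewrite mulr_ge0 ?powS_ge0 // ltW.
  - by rewrite ge_min lexx orbT.
rewrite powRM ?powS_ge0 ?(ltW B0) // mulrCA ler_wpM2l ?powR_ge0 //.
rewrite /powS -!powRrM -powRD ?pnatr_eq0 ?implybT //.
by apply: le_of_eq; congr (_ `^ _); ring.
Qed.

Lemma op_norm_early_sum_le B t : 0 < B ->
  \sum_(k < t | (k < t./2)%N) op_norm del B k * powS (t.-1 - k) (- gm) <=
  B `^ eps * (2 `^ gm * geom_cst (eps * del)) * powS t (- gm).
Proof.
move=> B0; apply: (@le_trans _ _ (\sum_(k < t | (k < t./2)%N)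
    (B `^ eps * powS k (- (1 + eps * del))) * (2 `^ gm * powS t (- gm)))).
  apply: ler_sum => k kh; apply: ler_pM; rewrite ?powS_ge0 ?op_norm_ge0 ?op_norm_interpolation ?(ltW B0) //.
  apply: powS_le_half; first exact: le_trans gm_ge1.
  by have := ltn_ord k; clear -kh; lia.
rewrite -mulr_suml -mulr_sumr.
have -> : B `^ eps * (2 `^ gm * geom_cst (eps * del)) * powS t (- gm) =
  B `^ eps * geom_cst (eps * del) * (2 `^ gm * powS t (- gm)) by ring.
rewrite ler_wpM2r ?mulr_ge0 ?powS_ge0 ?powR_ge0 // ler_wpM2l ?powR_ge0 //.
apply: le_trans (ler_sum_cond _ _ (fun k : 'I_t => powS_ge0 k (- (1 + eps * del)))) _.
rewrite -(big_mkord xpredT (fun k => powS k (- (1 + eps * del)))).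
by have := sum_powS_tail_le 0 t (mulr_gt0 eps_gt0 del_gt0); rewrite powS0l mulr1.
Qed.

Lemma op_norm_late_sum_le B t th : 0 < B -> B <= powS t ((1 + del - gm) / 2) ->
  0 < th <= 1 -> th <= (1 + del - gm) / 2 ->
  \sum_(k < t | ~~ (k < t./2)%N) op_norm del B k * powS (t.-1 - k) (- gm) <=
  2 `^ (1 + del) * geom_cst th * powS t (- gm).
Proof.
move=> B0 Bt th01 th_le; have [th0 th1] := andP th01; set lim := (1 + del - gm) / 2 in Bt th_le.
have late k : ~~ (k < t./2)%N -> (k < t)%N ->
    op_norm del B k <= 2 `^ (1 + del) * powS t (lim - (1 + del)).
  move=> kh kt; apply: (@le_trans _ _ (B * powS k (- (1 + del)))); first by rewrite ge_min lexx orbT.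
  have -> : 2 `^ (1 + del) * powS t (lim - (1 + del)) = powS t lim * (2 `^ (1 + del) * powS t (- (1 + del))).
    by rewrite powSD; ring.
  by apply: ler_pM; rewrite ?powS_ge0 ?(ltW B0) //; apply: powS_le_half; [by rewrite addr_ge0 // ltW|clear -kh; lia].
apply: (@le_trans _ _ (\sum_(k < t) 2 `^ (1 + del) * powS t (lim - (1 + del)) * powS (t.-1 - k) (- gm))).
  apply: le_trans (ler_sum_cond _ (fun k : 'I_t => ~~ (k < t./2)%N) _); last first.
    by move=> k; rewrite !mulr_ge0 ?powS_ge0 ?powR_ge0.
  by apply: ler_sum => k kh; rewrite ler_wpM2r ?powS_ge0 ?late.
have sum_le : \sum_(k < t) powS (t.-1 - k) (- gm) <= geom_cst th * powS t th.
  apply: (@le_trans _ _ (\sum_(k < t) powS k (th - 1))); last first.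
    by rewrite -(big_mkord xpredT (fun k => powS k (th - 1))); exact: sum_powS_divergent_le.
  rewrite [leLHS](reindex_inj rev_ord_inj) /=; apply: ler_sum => k _.
  have -> : (t.-1 - (t - k.+1) = k)%N by have := ltn_ord k; clear; lia.
  by apply: ler_powS; move: gm_ge1; lra.
rewrite -mulr_sumr -!mulrA ler_wpM2l ?powR_ge0 //.
apply: le_trans (ler_wpM2l (powS_ge0 _ _) sum_le) _.
rewrite mulrCA ler_wpM2l ?(ltW (geom_cst_gt0 th0)) // -powSD; apply: ler_powS; rewrite /lim in th_le *; lra.
Qed.

End OperatorNormConvolution.

Lemma op_norm_convolution_le (R : realType) (gm del eps : R) : 1 <= gm -> 0 < del -> gm < 1 + del ->
  0 < eps <= 1 -> exists2 C : R, 0 < C & forall (B : R) t, 1 <= B -> B <= powS t ((1 + del - gm) / 2) ->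
  \sum_(k < t) op_norm del B k * powS (t.-1 - k) (- gm) <= C * B `^ eps * powS t (- gm).
Proof.
move=> gm1 del0 gmd /andP[eps0 eps1]; pose th : R := Num.min ((1 + del - gm) / 2) 1.
have th01 : 0 < th <= 1 by rewrite lt_min ltr01 andbT ge_min lexx orbT andbT divr_gt0 // subr_gt0.
have th_le : th <= (1 + del - gm) / 2 by rewrite ge_min lexx.
exists (2 `^ gm * geom_cst (eps * del) + 2 `^ (1 + del) * geom_cst th).
  by rewrite addr_gt0 ?mulr_gt0 ?geom_cst_gt0 ?powR_gt0 ?mulr_gt0 //; case/andP: th01.
move=> B t B1 Bt; have B0 : 0 < B by exact: lt_le_trans B1.
have B_eps : 1 <= B `^ eps by rewrite -[leLHS](powRr0 B) ler_powR // ltW.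
rewrite (bigID (fun k : 'I_t => (k < t./2)%N)) /= !mulrDl; apply: lerD.
  by apply: le_trans (op_norm_early_sum_le gm1 del0 eps0 eps1 t B0) _; apply: le_of_eq; ring.
apply: le_trans (op_norm_late_sum_le gm1 del0 B0 Bt th01 th_le) _.
rewrite ler_wpM2r ?powS_ge0 // ler_peMr // mulr_ge0 ?powR_ge0 // ltW // geom_cst_gt0 //.
by case/andP: th01.
Qed.

(** * Decorrelation *)

Section Decorrelation.
Variables (R : realType) (d : nat) (alpha beta C del : R).
Hypotheses (d_gt0 : (0 < d)%N) (alpha_gt0 : 0 < alpha) (le_ab : alpha <= beta).
Hypotheses (del_ge0 : 0 <= del) (HC : @dipole_bound R d alpha beta C del).
Local Notation c := (spec_bound d beta).
Let c0 : 0 < c := spec_bound_gt0 d_gt0 alpha_gt0 le_ab.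
Variable M : torus_model d alpha beta.
Local Notation V := (tm_site M).
Local Notation e := (tm_dir M).
Local Notation ed := (V * 'I_d)%type.
Local Notation Om := {ffun ed * option bool -> tm_state M}.
Local Notation expect := (@expect R (tm_state M) (ed * option bool)%type (tm_law M)).
Implicit Types (s : Om) (E : ed) (z : V).

Definition resampled_grad s k E := ediff e E (evolved (resample E s) k).
Definition heat_dipole_sqr s t E := dot (heat_dipole s t E) (heat_dipole s t E).

Lemma sensitivity1E t k : sensitivity M 1 t k = #|V|%:R^-1 * \sum_E expect (fun s => heat_dipole_sqr s t E * resampled_grad s k E ^+ 2).
Proof.
rewrite /sensitivity /site_mean; congr (_ * _).
under eq_bigr => x _ do under eq_expect => s do rewrite expr1.
under eq_bigr do rewrite expect_sum.
rewrite exchange_big /=; apply: eq_bigr => E _; rewrite -expect_sum; apply: eq_expect => s.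
by rewrite -mulr_suml sum_kernel_grad_sqr.
Qed.

Lemma sum_translated_box (F : ed -> R) l :
  \sum_z \sum_(k : {ffun 'I_d -> 'I_l}) \sum_i F (z + lattice_pt e (fun j => k j), i) = (l ^ d)%:R * \sum_E F E.
Proof.
rewrite exchange_big /= sum_edges.
under eq_bigr => k _ do rewrite (sum_translate (fun z => \sum_i F (z, i))).
by rewrite sumr_const card_ffun !card_ord -[X in X = _]mulr_natl.
Qed.

Lemma expect_ediff_translate q k x i : expect (fun s => `|ediff e (x, i) (evolved s k)| ^+ q) = expect (fun s => `|ediff e (0, i) (evolved s k)| ^+ q).
Proof.
rewrite -[RHS](expect_translate x); apply: eq_expect => s; rewrite /ediff /= !evolved_translate.
by rewrite !add0r (addrC (e i)).
Qed.

Lemma sum_dir_resampled_grad q k x : (0 < q)%N -> \sum_i expect (fun s => `|resampled_grad s k (x, i)| ^+ q) = grad_norm M q k ^+ q.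
Proof.
move=> q0; rewrite grad_normX // sum_edges.
have stationary y : \sum_i expect (fun s => `|ediff e (y, i) (evolved s k)| ^+ q) = \sum_i expect (fun s => `|ediff e (x, i) (evolved s k)| ^+ q).
  by apply: eq_bigr => i _; rewrite !(expect_ediff_translate q k _ i).
under [X in _ = _ * X]eq_bigr do rewrite stationary.
rewrite sumr_const -[X in _ = _ * X]mulr_natl mulKf ?gt_eqF ?card_gt0 //.
by apply: eq_bigr => i _; rewrite /resampled_grad (expect_resample _ (x, i) (fun s => `|ediff e (x, i) (evolved s k)| ^+ q)).
Qed.

Definition halo k z : pred ed := fun E => cube e (z - diag_pt e k.+2) (k.+1 + 2 * k.+2) E.1.
Definition halo_bound k : R := d%:R * ((k.+1 + 2 * k.+2) ^ d)%:R.

Lemma card_halo_le k z : #|halo k z|%:R <= halo_bound k.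
Proof.
rewrite /halo_bound -natrM ler_nat mulnC -sum1_card.
have -> : \sum_(i in halo k z) 1%N = \sum_(x | cube e (z - diag_pt e k.+2) (k.+1 + 2 * k.+2) x) \sum_(i < d) 1%N.
  rewrite pair_big /=; apply: eq_big => [[x i]|//]; by rewrite /in_mem /= andbT.
under eq_bigr do rewrite sum1_card card_ord.
by rewrite sum_nat_const leq_mul2r card_cube_le orbT.
Qed.

Lemma mean_dipole_energy_le Cg t k : (t <= tm_size M)%N ->
  (forall s x, gradsq e (heat e beta (env s) t (delta x)) <= Cg) ->
  #|V|%:R^-1 * \sum_z expect (fun s => dipole_energy beta e (env s) t (halo k z)) <= ((k.+1 + 2 * k.+2) ^ d)%:R * Cg.
Proof.
move=> tN hg; set L := (k.+1 + 2 * k.+2)%N; rewrite -expect_sum -expectZ.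
rewrite -[leRHS](expect_model_cst M); apply: le_model_expect => s; rewrite ler_pdivrMl ?card_gt0 //.
have d0 E : 0 <= heat_dipole_sqr s t E by exact: dot_ge0.
apply: (@le_trans _ _ (\sum_z \sum_(k' : {ffun 'I_d -> 'I_L}) \sum_i heat_dipole_sqr s t (z - diag_pt e k.+2 + lattice_pt e (fun j => k' j), i))).
  apply: ler_sum => z _; rewrite /dipole_energy /halo.
  have -> : \sum_(E | cube e (z - diag_pt e k.+2) L E.1) heat_dipole_sqr s t E =
    \sum_(x | cube e (z - diag_pt e k.+2) L x) \sum_i heat_dipole_sqr s t (x, i).
    rewrite big_mkcond (sum_edges (fun E => if cube e (z - diag_pt e k.+2) L E.1 then heat_dipole_sqr s t E else 0)) [RHS]big_mkcond /=.
    by apply: eq_bigr => x _; case: ifP => // _; rewrite big1.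
  by apply: (sum_cube_le e (F := fun x => \sum_i heat_dipole_sqr s t (x, i))) => x; rewrite sumr_ge0.
rewrite (sum_translate (fun z => \sum_(k' : {ffun 'I_d -> 'I_L}) \sum_i heat_dipole_sqr s t (z + lattice_pt e (fun j => k' j), i)) (- diag_pt e k.+2)).
rewrite sum_translated_box mulrCA; apply: ler_wpM2l => //.
have -> : \sum_E heat_dipole_sqr s t E = \sum_x gradsq e (heat e beta (env s) t (delta x)).
  by rewrite /gradsq [RHS]exchange_big; apply: eq_bigr => E _; rewrite /heat_dipole_sqr -sum_kernel_grad_sqr.
rewrite mulr_natl -sumr_const; apply: ler_sum => x _; exact: hg.
Qed.

Definition box_grad k q z s : R :=
  nroot q (\sum_(j : {ffun 'I_d -> 'I_k.+1} * 'I_d) `|resampled_grad s k (z + lattice_pt e (fun i => j.1 i), j.2)| ^+ q) ^+ 2.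

Definition box_deps k z (j : ed * option bool) : bool := (halo k z j.1 && (j.2 == None)) || (j.2 == Some false).

Lemma box_grad_depends_on k q z : depends_on (box_deps k z) (box_grad k q z).
Proof.
move=> s t st; congr (nroot q _ ^+ 2); apply: eq_bigr => -[k' i] _ /=.
set edge := (z + _, i); congr (`|_| ^+ q); rewrite /resampled_grad /ediff.
have E_cube : cube e z k.+1 edge.1 by apply/existsP; exists k'.
have local E' : sup_ball e k.+2 edge.1 E'.1 -> env (resample edge s) E' = env (resample edge t) E'.
  move=> h; rewrite /env !ffunE /swap_index /=; case: ifP => [_|_] /=.
    by rewrite st // /box_deps /= orbT.
  by rewrite st // /box_deps /= /halo (sup_ball_cube E_cube h).
rewrite /evolved; congr (_ - _); apply: heat_ldrift_local => E' h; apply: local.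
  exact: sup_ball_up h.
exact: sup_ball_S.
Qed.

Lemma dipole_energy_swap_depends_on k z t : depends_on (predC (box_deps k z)) (fun s => dipole_energy beta e (env (swap_copies (halo k z) true s)) t (halo k z)).
Proof.
move=> s s' st; congr (dipole_energy beta e _ t _); apply/funext => E; rewrite /env !ffunE /swap_index /=.
case: ifP => QE /=; rewrite st //=.
  by rewrite /box_deps /= andbF.
by rewrite /box_deps /= QE.
Qed.

Lemma expect_box_grad_le k p z : expect (box_grad k (2 * p.+1) z) <= (nroot (2 * p.+1) ((k.+1 ^ d)%:R) * grad_norm M (2 * p.+1) k) ^+ 2.
Proof.
set q := (2 * p.+1)%N; have q0 : (0 < q)%N by rewrite muln_gt0.
have S0 s : 0 <= \sum_(j : {ffun 'I_d -> 'I_k.+1} * 'I_d) `|resampled_grad s k (z + lattice_pt e (fun i => j.1 i), j.2)| ^+ q.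
  by rewrite sumr_ge0 // => j _; rewrite exprn_ge0.
rewrite -(@ler_pXn2r _ p.+1) ?nnegrE ?sqr_ge0 //; last first.
  by apply: model_expect_ge0 => s; exact: sqr_ge0.
have := expect_exprn_le (@tm_law_ge0 _ _ _ _ M) (@tm_law_sum _ _ _ _ M) p (fun s => sqr_ge0 _ : 0 <= box_grad k q z s).
move/le_trans; apply.
rewrite -exprM exprMn [X in _ <= X * _]nrootK //.
have -> : expect (fun s => box_grad k q z s ^+ p.+1) = \sum_(k' : {ffun 'I_d -> 'I_k.+1}) grad_norm M q k ^+ q.
  transitivity (expect (fun s => \sum_(k' : {ffun 'I_d -> 'I_k.+1}) \sum_i `|resampled_grad s k (z + lattice_pt e (fun i => k' i), i)| ^+ q)).
    by apply: eq_expect => s; rewrite /box_grad -exprM [LHS]nrootK // pair_bigA.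
  rewrite expect_sum; apply: eq_bigr => k' _; rewrite expect_sum; exact: sum_dir_resampled_grad.
by rewrite sumr_const card_ffun !card_ord -[X in X <= _]mulr_natl.
Qed.

Lemma sum_box_le k q z t s : (k < tm_size M)%N -> (0 < q)%N ->
  \sum_(k' : {ffun 'I_d -> 'I_k.+1}) \sum_i
     heat_dipole_sqr s t (z + lattice_pt e (fun j => k' j), i) * resampled_grad s k (z + lattice_pt e (fun j => k' j), i) ^+ 2 <=
  dipole_energy beta e (env s) t (halo k z) * box_grad k q z s.
Proof.
move=> kN q0; pose J := ({ffun 'I_d -> 'I_k.+1} * 'I_d)%type.
pose h (j : J) : ed := (z + lattice_pt e (fun i => j.1 i), j.2).
have h_inj : injective h.
  move=> [k1 i1] [k2 i2] [] /addrI /(tm_embeds M) k12 ->; congr (_, _).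
  by apply/ffunP => i; apply/val_inj; apply: k12 => j; exact: leq_trans (ltn_ord _) kN.
have dipole_ge0 E : 0 <= heat_dipole_sqr s t E by exact: dot_ge0.
have grad_le (j : J) : resampled_grad s k (h j) ^+ 2 <= box_grad k q z s.
  rewrite -[X in X <= _]real_normK ?num_real //; apply: ler_sqr_nneg => //.
  rewrite -(@ler_pXn2r _ q) ?nnegrE ?nroot_ge0 // nrootK; last first.
    by rewrite sumr_ge0 // => i _; rewrite exprn_ge0.
  - by [].
  by rewrite (bigD1 j) //= lerDl sumr_ge0 // => i _; rewrite exprn_ge0.
rewrite pair_bigA /=; apply: (@le_trans _ _ (\sum_(j : J) heat_dipole_sqr s t (h j) * box_grad k q z s)).
  by apply: ler_sum => j _; apply: ler_wpM2l; [exact: dipole_ge0|exact: grad_le].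
rewrite -mulr_suml ler_wpM2r ?sqr_ge0 // /dipole_energy [leRHS]big_mkcond /=.
have fE E : 0 <= (if halo k z E then heat_dipole_sqr s t E else 0) by case: ifP.
apply: le_trans (ler_sum_inj h_inj fE).
apply: ler_sum => j _; suff -> : halo k z (h j) by [].
apply: (@sup_ball_cube _ _ e k.+2 z k.+1 (h j).1); last exact: sup_ball_refl.
by apply/existsP; exists j.1.
Qed.

Definition duhamel_time t (j : 'I_t.+1) : nat := if (j < t)%N then (t.-1 - j)%N else t.
Definition duhamel_factor k t (j : 'I_t.+1) : R :=
  if (j < t)%N then beta / c * (op_cst d alpha beta C del * op_norm del (halo_bound k) j) else 1.

Lemma duhamel_time_le t (j : 'I_t.+1) : (duhamel_time j <= t)%N.
Proof. by rewrite /duhamel_time; case: ifP => // _; lia. Qed.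

(* Resampling the conductances in the halo makes the dipole energy independent of [box_grad]. *)
Lemma expect_box_decorrelated_le p t k z (l : 'I_t.+1 -> R) : (t + k < tm_size M)%N ->
  (forall j, 0 < l j) -> \sum_j l j = 1 ->
  \sum_(k' : {ffun 'I_d -> 'I_k.+1}) \sum_i expect (fun s =>
     heat_dipole_sqr s t (z + lattice_pt e (fun j => k' j), i) * resampled_grad s k (z + lattice_pt e (fun j => k' j), i) ^+ 2) <=
  \sum_(j < t.+1) duhamel_factor k j ^+ 2 / l j *
     (expect (fun s => dipole_energy beta e (env s) (duhamel_time j) (halo k z)) *
      (nroot (2 * p.+1) ((k.+1 ^ d)%:R) * grad_norm M (2 * p.+1) k) ^+ 2).
Proof.
move=> tkN l0 l1; set q := (2 * p.+1)%N; have q0 : (0 < q)%N by rewrite muln_gt0.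
have tN : (t <= tm_size M)%N by clear -tkN; lia.
have kN : (k < tm_size M)%N by clear -tkN; lia.
under eq_bigr do rewrite -expect_sum; rewrite -expect_sum.
apply: (@le_trans _ _ (expect (fun s => \sum_(j < t.+1) duhamel_factor k j ^+ 2 / l j *
    (dipole_energy beta e (env (swap_copies (halo k z) true s)) (duhamel_time j) (halo k z) * box_grad k q z s)))).
  apply: le_model_expect => s; apply: le_trans (sum_box_le z t s kN q0) _.
  have agree E : ~~ halo k z E -> env s E = env (swap_copies (halo k z) true s) E.
    by move=> /negPf QE; rewrite /env ffunE /swap_index /= QE.
  have compare := dipole_energy_compare d_gt0 alpha_gt0 le_ab del_ge0 HC (tm_embeds M) (env_elliptic s)
    (env_elliptic (swap_copies (halo k z) true s)) agree tN (card_halo_le k z) l0 l1.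
  apply: (@le_trans _ _ (_ * box_grad k q z s)); first by apply: ler_wpM2r compare; exact: sqr_ge0.
  rewrite mulr_suml; apply: ler_sum => j _; rewrite /duhamel_factor /duhamel_time.
  by case: ifP => _; rewrite ?expr1n; apply: le_of_eq; ring.
rewrite expect_sum; apply: ler_sum => j _; rewrite expectZ; apply: ler_wpM2l.
  by apply: mulr_ge0; [exact: sqr_ge0|rewrite invr_ge0 ltW].
under eq_expect do rewrite mulrC.
rewrite (expect_indep (@tm_law_sum _ _ _ _ M) (@box_grad_depends_on k q z)
  (@dipole_energy_swap_depends_on k z (duhamel_time j))) mulrC.
rewrite (expect_swap _ (halo k z) true (fun s => dipole_energy beta e (env s) (duhamel_time j) (halo k z))).
apply: ler_wpM2l; last exact: expect_box_grad_le.
by apply: model_expect_ge0 => s; rewrite sumr_ge0 // => E _; exact: dot_ge0.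
Qed.

Lemma sensitivity_decorrelated_weights Cg p t k (l : 'I_t.+1 -> R) : (t + k < tm_size M)%N ->
  (forall j s x, (j <= tm_size M)%N -> gradsq e (heat e beta (env s) j (delta x)) <= Cg * powS j (- (2 * decay_exp R d))) ->
  (forall j, 0 < l j) -> \sum_j l j = 1 ->
  sensitivity M 1 t k <= \sum_(j < t.+1) (k.+1 ^ d)%:R^-1 * (((k.+1 + 2 * k.+2) ^ d)%:R *
     (Cg * powS (duhamel_time j) (- (2 * decay_exp R d)))) * duhamel_factor k j ^+ 2 *
     (nroot (2 * p.+1) ((k.+1 ^ d)%:R) * grad_norm M (2 * p.+1) k) ^+ 2 / l j.
Proof.
move=> tkN grad_decay l0 l1; set A := (nroot _ _ * grad_norm M _ k) ^+ 2.
have box_gt0 : 0 < (k.+1 ^ d)%:R :> R by rewrite ltr0n expn_gt0.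
pose F E := expect (fun s => heat_dipole_sqr s t E * resampled_grad s k E ^+ 2).
rewrite sensitivity1E -[\sum_E _](mulKf (lt0r_neq0 box_gt0)) -(sum_translated_box F).
apply: (@le_trans _ _ (#|V|%:R^-1 * ((k.+1 ^ d)%:R^-1 * \sum_z \sum_(j < t.+1) duhamel_factor k j ^+ 2 / l j *
     (expect (fun s => dipole_energy beta e (env s) (duhamel_time j) (halo k z)) * A)))).
  rewrite ler_pM2l ?invr_gt0 ?card_gt0 // ler_pM2l ?invr_gt0 //; apply: ler_sum => z _.
  exact: expect_box_decorrelated_le.
rewrite exchange_big /= mulr_sumr mulr_sumr; apply: ler_sum => j _; rewrite -mulr_sumr -mulr_suml.
have timeN : (duhamel_time j <= tm_size M)%N.
  by apply: leq_trans (duhamel_time_le j) _; clear -tkN; lia.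
have := mean_dipole_energy_le k timeN (fun s x => grad_decay _ s x timeN).
set S := \sum_z _; set L := ((_ ^ d)%:R) => mean_le.
have -> : #|V|%:R^-1 * ((k.+1 ^ d)%:R^-1 * (duhamel_factor k j ^+ 2 / l j * (S * A))) =
  (k.+1 ^ d)%:R^-1 * (duhamel_factor k j ^+ 2 / l j * A) * (#|V|%:R^-1 * S) by ring.
have weight_ge0 : 0 <= (k.+1 ^ d)%:R^-1 * (duhamel_factor k j ^+ 2 / l j * A).
  by rewrite mulr_ge0 ?invr_ge0 ?(ltW box_gt0) // mulr_ge0 ?sqr_ge0 // divr_ge0 ?sqr_ge0 ?(ltW (l0 j)).
by apply: le_trans (ler_wpM2l weight_ge0 mean_le) _; apply: le_of_eq; ring.
Qed.

End Decorrelation.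

Section DecorrelatedSensitivity.
Variables (R : realType) (d : nat) (alpha beta C del : R).
Hypotheses (d_gt1 : (1 < d)%N) (alpha_gt0 : 0 < alpha) (le_ab : alpha <= beta).
Hypotheses (del_gt0 : 0 < del) (HC : @dipole_bound R d alpha beta C del).
Let d_gt0 : (0 < d)%N := ltnW d_gt1.
Local Notation c := (spec_bound d beta).
Let c0 : 0 < c := spec_bound_gt0 d_gt0 alpha_gt0 le_ab.
Local Notation decay_exp := (decay_exp R d).
Local Notation torus_model := (torus_model d alpha beta).

Lemma decay_exp_ge1 : 1 <= decay_exp.
Proof. by rewrite /decay_exp; have : 2%:R <= d%:R :> R; [rewrite ler_nat|lra]. Qed.

Lemma sol_norm_first_decay m : 0 <= first_exp d del (2 ^ m) <= decay_exp -> 1 - (2 * 2 ^ m)%:R^-1 < first_exp d del (2 ^ m) ->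
  exists2 C1 : R, 0 < C1 & forall (M : torus_model) n, (n <= tm_size M)%N ->
  sol_norm M (2 * 2 ^ m) n <= C1 * powS n (- first_exp d del (2 ^ m)).
Proof.
set q := (2 * 2 ^ m)%N; set sg := first_exp d del (2 ^ m); move=> /andP[sg0 sgg] sgq.
have q0 : (0 < q)%N by rewrite muln_gt0 expn_gt0.
have [C1 C10 H1] := sol_norm_le_sensitivity d_gt0 alpha_gt0 le_ab m.
have pE : (2 ^ m = (2 ^ m).-1.+1)%N by rewrite prednK // expn_gt0.
have [C2 C20 H2] := sensitivity_le_grad_norm d_gt0 alpha_gt0 le_ab (2 ^ m).-1 HC.
have [C3 C30 H3] := grad_norm_le_dissipation d_gt0 alpha_gt0 le_ab (2 ^ m).-1.
rewrite -pE -/q -/sg in H2 H3.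
pose K := C1 + C1 * C2 + C3 + 2 * d%:R * beta.
have b0 : 0 < beta := beta_gt0 alpha_gt0 le_ab.
have db : 0 < 2 * d%:R * beta by rewrite !mulr_gt0 // ltr0n.
have m12 : 0 < C1 * C2 by exact: mulr_gt0.
have K0 : 0 < K by rewrite !addr_gt0.
have [C4 C40 H4] := convolution_gronwall q0 K0 sgq sg0; exists C4 => // M n nN.
apply: (H4 (tm_size M) (sol_norm M q) (grad_norm M q)) => //.
- by move=> k; exact: sol_norm_ge0.
- by move=> k; exact: grad_norm_ge0.
- by move=> i j ij; rewrite /q pE; exact: sol_norm_antimono.
- apply: le_trans (sol_norm0_le alpha_gt0 le_ab M q0) _; rewrite /K; lra.
- move=> k; apply: le_trans (H3 M k) _; rewrite ler_wpM2r //; last by rewrite /K; lra.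
  by rewrite -(pmulr_rge0 _ C30); apply: le_trans (H3 M k); rewrite exprn_ge0 // grad_norm_ge0.
move=> k kN; apply: (le_trans (H1 M k (fun s => C2 * powS (k.-1 - s) (- sg) * grad_norm M q s) kN _ _)).
- by move=> s _; rewrite mulr_ge0 ?grad_norm_ge0 // mulr_ge0 ?powS_ge0 // ltW.
- by move=> s sk; apply: H2; rewrite (leq_trans (leq_subr _ _)) // (leq_trans (leq_pred _)).
have S0 : 0 <= \sum_(s < k) powS (k.-1 - s) (- sg) * grad_norm M q s.
  by rewrite sumr_ge0 // => s _; rewrite mulr_ge0 ?powS_ge0 ?grad_norm_ge0.
have -> : \sum_(s < k) C2 * powS (k.-1 - s) (- sg) * grad_norm M q s = C2 * \sum_(s < k) powS (k.-1 - s) (- sg) * grad_norm M q s.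
  by rewrite mulr_sumr; apply: eq_bigr => s _; rewrite mulrA.
have powS_le : powS k (- decay_exp) <= powS k (- sg) :> R by apply: ler_powS; rewrite lerN2.
have powS_pos := powS_ge0 k (- sg) : 0 <= _ :> R.
rewrite !mulrDr mulrA; apply: lerD.
  by apply: ler_pM; rewrite ?powS_ge0 ?(ltW C10) // /K; lra.
by apply: ler_wpM2r => //; rewrite /K; lra.
Qed.

Lemma sensitivity_jensen (M : torus_model) p t k : sensitivity M 1 t k ^+ p.+1 <= sensitivity M p.+1 t k.
Proof.
pose X x s := \sum_E kernel_grad (M := M) s t x E ^+ 2 * ediff (tm_dir M) E (evolved (resample E s) k) ^+ 2.
have X0 x s : 0 <= X x s by rewrite sumr_ge0 // => E _; rewrite mulr_ge0 ?sqr_ge0.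
have sens1E : sensitivity M 1 t k = \sum_x #|tm_site M|%:R^-1 * expect (tm_law M) (X x).
  by rewrite /sensitivity /site_mean mulr_sumr; apply: eq_bigr => x _; congr (_ * _); apply: eq_expect => s; rewrite expr1.
have sensE : sensitivity M p.+1 t k = \sum_x #|tm_site M|%:R^-1 * expect (tm_law M) (fun s => X x s ^+ p.+1).
  by rewrite /sensitivity /site_mean mulr_sumr.
have card_inv_gt0 : 0 < #|tm_site M|%:R^-1 :> R by rewrite invr_gt0 card_gt0.
rewrite sens1E sensE; apply: (@le_trans _ _ (\sum_x #|tm_site M|%:R^-1 * expect (tm_law M) (X x) ^+ p.+1)).
  apply: jensen_exprn => [x| |x]; first exact: ltW.
    by rewrite sumr_const -[LHS]mulr_natl divff // gt_eqF // card_gt0.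
  exact: model_expect_ge0.
apply: ler_sum => x _; rewrite ler_pM2l //; apply: expect_exprn_le => //; [exact: tm_law_ge0|exact: tm_law_sum].
Qed.

Lemma halo_bound_le k : 1 <= halo_bound R d k <= d%:R * 5 ^+ d * powS k d%:R.
Proof.
rewrite /halo_bound; apply/andP; split.
  by rewrite -natrM ler1n muln_gt0 d_gt0 expn_gt0 addSn.
rewrite -mulrA ler_wpM2l // /powS powR_mulrn ?ler0n // -exprMn -natrM -natrX ler_nat.
by rewrite leq_exp2r //; clear; lia.
Qed.

Local Notation grad_box p M k := (nroot (2 * p.+1) ((k.+1 ^ d)%:R) * grad_norm M (2 * p.+1) k).
Local Notation duhamel_factor := (duhamel_factor d alpha beta C del).

Lemma sqrt_sensitivity_decorrelated_le Cg p (M : torus_model) t k : 0 < Cg -> (t + k < tm_size M)%N ->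
  (forall j s x, (j <= tm_size M)%N ->
    gradsq (tm_dir M) (heat (tm_dir M) beta (env s) j (delta x)) <= Cg * powS j (- (2 * decay_exp))) ->
  sensitivity M 1 t k <= (Num.sqrt (Cg * 5 ^+ d) * grad_box p M k *
    \sum_(j < t.+1) duhamel_factor k j * powS (duhamel_time j) (- decay_exp)) ^+ 2.
Proof.
move=> Cg0 tk grad_decay; set A := Num.sqrt _; set B := _ * grad_norm M _ k; rewrite mulr_sumr.
have factor_ge0 (j : 'I_t.+1) : 0 <= duhamel_factor k j.
  have O0 := op_cst_gt0 d_gt0 alpha_gt0 le_ab HC; have b0 := beta_gt0 alpha_gt0 le_ab.
  rewrite /duhamel_factor; case: ifP => // _.
  rewrite mulr_ge0 ?divr_ge0 ?(ltW b0) ?(ltW c0) // mulr_ge0 ?(ltW O0) // op_norm_ge0 //.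
  by rewrite mulr_ge0.
have B0 : 0 <= B by rewrite mulr_ge0 ?nroot_ge0 ?grad_norm_ge0.
apply: (le_exprn_sum_weights (n := 1)) => [j|l l0 l1|]; last by rewrite card_ord.
  by apply: mulr_ge0; apply: mulr_ge0; rewrite ?sqrtr_ge0 ?powS_ge0.
apply: le_trans (sensitivity_decorrelated_weights d_gt0 alpha_gt0 le_ab (ltW del_gt0) HC p tk grad_decay l0 l1) _.
apply: ler_sum => j _; rewrite -/B; set f := duhamel_factor k j; set tj := duhamel_time j.
have -> : l j * (A * B * (f * powS tj (- decay_exp)) / l j) ^+ 2 =
    A ^+ 2 * powS tj (- (2 * decay_exp)) * f ^+ 2 * B ^+ 2 / l j.
  have -> : powS tj (- (2 * decay_exp)) = powS tj (- decay_exp) ^+ 2 :> R by rewrite powS_exprn; congr powS; ring.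
  by field; rewrite gt_eqF.
rewrite ler_wpM2r ?invr_ge0 ?(ltW (l0 j)) // !ler_wpM2r ?sqr_ge0 // !mulrA ler_wpM2r ?powS_ge0 //.
rewrite /A sqr_sqrtr ?mulr_ge0 ?exprn_ge0 ?(ltW Cg0) // [Cg * _]mulrC ler_wpM2r ?(ltW Cg0) //.
rewrite ler_pdivrMl ?ltr0n ?expn_gt0 // -natrX -natrM ler_nat mulnC -expnMn leq_exp2r //.
by clear; lia.
Qed.

Lemma halo_bound_gt0 k : 0 < halo_bound R d k.
Proof. by case/andP: (halo_bound_le k) => /(lt_le_trans ltr01). Qed.

Lemma halo_bound_powR_le eps k : 0 < eps ->
  halo_bound R d k `^ eps <= (d%:R * 5 ^+ d) `^ eps * powS k (d%:R * eps).
Proof.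
move=> eps0; have /andP[_ le_k] := halo_bound_le k.
rewrite /powS powRrM -powRM ?powR_ge0 ?mulr_ge0 ?exprn_ge0 // ge0_ler_powR ?nnegrE ?(ltW eps0) //.
exact: ltW (halo_bound_gt0 k).
Qed.

Lemma sensitivity_decorrelated p eps : 0 < eps <= 1 -> decay_exp < 1 + del -> exists2 K : R, 0 < K &
  forall (M : torus_model) t k, (t + k < tm_size M)%N -> halo_bound R d k <= powS t ((1 + del - decay_exp) / 2) ->
  sensitivity M 1 t k <= (K * powS t (- decay_exp) * (powS k (d%:R * eps + d%:R / (2 * p.+1)%:R) * grad_norm M (2 * p.+1) k)) ^+ 2.
Proof.
move=> heps gd; have [eps0 _] := andP heps.
have [Cg Cg0 grad_decay] := heat_kernel_grad_decay d_gt0 alpha_gt0 le_ab.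
have [K K0 convolution_le] := op_norm_convolution_le decay_exp_ge1 del_gt0 gd heps.
pose L := beta / c * op_cst d alpha beta C del.
have L0 : 0 < L by rewrite mulr_gt0 ?(op_cst_gt0 d_gt0 alpha_gt0 le_ab HC) // divr_gt0 // (beta_gt0 alpha_gt0 le_ab).
pose D : R := (d%:R * 5 ^+ d) `^ eps.
have D0 : 0 < D by rewrite powR_gt0 // mulr_gt0 ?exprn_gt0 // ltr0n.
have LK0 : 0 < L * K + 1 by rewrite addr_gt0 // mulr_gt0.
pose A := Num.sqrt (Cg * 5 ^+ d); have A0 : 0 < A by rewrite sqrtr_gt0 mulr_gt0 // exprn_gt0.
exists (A * ((L * K + 1) * D)); first by rewrite !mulr_gt0.
move=> M t k tk Qt; have /andP[Q1 _] := halo_bound_le k; have Q0 := halo_bound_gt0 k.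
have gradM j s x : (j <= tm_size M)%N ->
    gradsq (tm_dir M) (heat (tm_dir M) beta (env s) j (delta x)) <= Cg * powS j (- (2 * decay_exp)).
  move=> jN; have -> : 2 * decay_exp = d%:R / 2 + 1 by rewrite /decay_exp; field.
  exact: grad_decay _ _ _ _ (tm_embeds M) (env_elliptic s) _ _ jN.
apply: le_trans (sqrt_sensitivity_decorrelated_le p Cg0 tk gradM) _; rewrite -/A.
have B0 : 0 <= grad_box p M k by rewrite mulr_ge0 ?nroot_ge0 ?grad_norm_ge0.
have sum_le : \sum_(j < t.+1) duhamel_factor k j * powS (duhamel_time j) (- decay_exp) <=
    (L * K + 1) * (D * powS k (d%:R * eps) * powS t (- decay_exp)).
  apply: (@le_trans _ _ ((L * K + 1) * (halo_bound R d k `^ eps * powS t (- decay_exp)))); last first.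
    by rewrite ler_pM2l // ler_wpM2r ?powS_ge0 // halo_bound_powR_le.
  rewrite big_ord_recr /duhamel_factor /duhamel_time /= ltnn mul1r [leRHS]mulrDl mul1r lerD //; last first.
    by rewrite ler_peMl ?powS_ge0 // -[leLHS](powRr0 (halo_bound R d k)) ler_powR // ltW.
  under eq_bigr do rewrite ltn_ord mulrA -/L -mulrA.
  by rewrite -mulr_sumr -[leRHS]mulrA ler_pM2l // mulrA convolution_le.
apply: ler_sqr_nneg.
  rewrite !mulr_ge0 ?(ltW A0) ?nroot_ge0 ?grad_norm_ge0 // sumr_ge0 // => j _.
  rewrite mulr_ge0 ?powS_ge0 // /duhamel_factor; case: ifP => // _.
  by rewrite mulrA mulr_ge0 ?(ltW L0) // op_norm_ge0 // ltW.
apply: le_trans (ler_wpM2l (mulr_ge0 (ltW A0) B0) sum_le) _; apply: le_of_eq.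
have -> : nroot (2 * p.+1) ((k.+1 ^ d)%:R) = powS k (d%:R / (2 * p.+1)%:R) :> R.
  by rewrite /nroot natrX -powR_mulrn ?ler0n // -powRrM.
by rewrite powSD; ring.
Qed.

Lemma sensitivity1_le_grad_norm p : exists2 K : R, 0 < K &
  forall (M : torus_model) t k, (t <= tm_size M)%N ->
  sensitivity M 1 t k <= (K * powS t (- first_exp d del p.+1) * grad_norm M (2 * p.+1) k) ^+ 2.
Proof.
have [K K0 sens_le] := sensitivity_le_grad_norm d_gt0 alpha_gt0 le_ab p HC; exists K => // M t k tN.
rewrite -(@ler_pXn2r _ p.+1) ?nnegrE ?sqr_ge0 ?sensitivity_ge0 // -exprM.
exact: le_trans (sensitivity_jensen M p t k) (sens_le M t k tN).
Qed.

Lemma sensitivity_two_bounds p eps : 0 < eps <= 1 -> decay_exp < 1 + del -> 0 <= decay_exp - first_exp d del p.+1 ->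
  (decay_exp - first_exp d del p.+1) <= (1 + del - decay_exp) / 2 * eps -> exists2 K : R, 0 < K &
  forall (M : torus_model) t k, (t + k < tm_size M)%N ->
  sensitivity M 1 t k <= (K * powS t (- decay_exp) * (powS k (d%:R * eps + d%:R / (2 * p.+1)%:R) * grad_norm M (2 * p.+1) k)) ^+ 2 /\
  sensitivity M 1 t k <= (K * powS t (- first_exp d del p.+1) * grad_norm M (2 * p.+1) k) ^+ 2.
Proof.
move=> heps gd gs0 gse; have /andP[eps0 eps1] := heps.
have [K1 K10 decorrelated] := sensitivity_decorrelated p heps gd.
have [K2 K20 sens_le] := sensitivity1_le_grad_norm p.
set q := (2 * p.+1)%N in decorrelated sens_le *; set sg := first_exp d del p.+1 in sens_le gs0 gse *.
pose D : R := (d%:R * 5 ^+ d) `^ eps.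
have KD0 : 0 < K2 * D by rewrite mulr_gt0 // powR_gt0 // mulr_gt0 ?exprn_gt0 // ltr0n.
exists (K1 + K2 * D + K2); first by rewrite !addr_gt0.
move=> M t k tk; have tN : (t <= tm_size M)%N by clear -tk; lia.
have B0 : 0 <= grad_norm M q k := grad_norm_ge0 _ _ _.
set X := powS k (d%:R * eps + d%:R / q%:R); have X0 : 0 <= X := powS_ge0 _ _.
have mono (K x y : R) : 0 < K -> K <= K1 + K2 * D + K2 -> 0 <= x -> 0 <= y ->
    (K * x * y) ^+ 2 <= ((K1 + K2 * D + K2) * x * y) ^+ 2.
  move=> K0 le_K x0 y0; apply: ler_sqr_nneg; first by rewrite !mulr_ge0 // ltW.
  by rewrite !ler_wpM2r.
split; last by apply: le_trans (sens_le M t k tN) _; apply: mono; rewrite ?powS_ge0 //; lra.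
have [Qt|tQ] := leP (halo_bound R d k) (powS t ((1 + del - decay_exp) / 2)).
  by apply: le_trans (decorrelated M t k tk Qt) _; apply: mono; rewrite ?mulr_ge0 ?powS_ge0 //; lra.
have far : powS t (decay_exp - sg) <= D * X.
  apply: (@le_trans _ _ (D * powS k (d%:R * eps))); last first.
    by rewrite ler_wpM2l ?powR_ge0 // /X; apply: ler_powS; rewrite lerDl divr_ge0.
  apply: le_trans (halo_bound_powR_le k eps0); apply: le_trans (ler_powS _ gse) _.
  by rewrite /powS [leLHS]powRrM ge0_ler_powR ?nnegrE ?powR_ge0 ?(ltW eps0) ?(ltW (halo_bound_gt0 k)) ?(ltW tQ).
apply: le_trans (sens_le M t k tN) _; apply: (@le_trans _ _ ((K2 * D * powS t (- decay_exp) * (X * grad_norm M q k)) ^+ 2)).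
  apply: ler_sqr_nneg; first by rewrite !mulr_ge0 ?powS_ge0 // ltW.
  have -> : powS t (- sg) = powS t (- decay_exp) * powS t (decay_exp - sg) :> R by rewrite -powSD; congr powS; ring.
  have -> : K2 * D * powS t (- decay_exp) * (X * grad_norm M q k) =
    K2 * (powS t (- decay_exp) * (D * X)) * grad_norm M q k by ring.
  by rewrite ler_wpM2r // ler_pM2l // ler_wpM2l ?powS_ge0.
by apply: mono; rewrite ?mulr_ge0 ?powS_ge0 //; lra.
Qed.

Lemma sol_norm_optimal_decay p eps w1 th K : 0 < eps <= 1 -> decay_exp < 1 + del -> 0 <= decay_exp - first_exp d del p.+1 ->
  (decay_exp - first_exp d del p.+1) <= (1 + del - decay_exp) / 2 * eps ->
  d%:R * eps + d%:R / (2 * p.+1)%:R < w1 -> 0 <= th -> decay_exp <= 1 - th + w1 -> 0 < K ->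
  (forall n, \sum_(0 <= t < n) powS t (- first_exp d del p.+1) <= K * powS n th) ->
  (forall (M : torus_model) m, (m <= tm_size M)%N ->
     \sum_(m <= s < (2 * m).+1 | (s <= tm_size M)%N) grad_norm M (2 * p.+1) s <= K * powS m (- w1)) ->
  exists2 L : R, 0 < L & forall (M : torus_model) n, (n <= tm_size M)%N -> sol_norm M 2 n <= L * powS n (- decay_exp).
Proof.
move=> heps gd gs0 gse upw th0 gw K0 sumg blk; have /andP[eps0 eps1] := heps.
have [K1 K10 two_bounds] := sensitivity_two_bounds heps gd gs0 gse.
have [K3 K30 sol_le] := sol_norm_le_sensitivity d_gt0 alpha_gt0 le_ab 0.
set q := (2 * p.+1)%N in upw blk two_bounds *; set sg := first_exp d del p.+1 in sumg two_bounds *.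
set ups := d%:R * eps + d%:R / q%:R in upw two_bounds.
have b0 : 0 < 2 * d%:R * beta by rewrite !mulr_gt0 ?ltr0n // (beta_gt0 alpha_gt0 le_ab).
pose L := K + K1 + K3 + 2 * d%:R * beta; have L0 : 0 < L by rewrite !addr_gt0.
have decay0 : 0 <= decay_exp by exact: le_trans ler01 decay_exp_ge1.
have ups0 : 0 <= ups by rewrite addr_ge0 ?divr_ge0 // mulr_ge0 // ltW.
have sumgL n : \sum_(0 <= t < n) powS t (- sg) <= L * powS n th.
  by apply: (le_trans (sumg n)); rewrite ler_wpM2r ?powS_ge0 // /L; lra.
have [K2 K20 decay] := convolution_gronwall_sharp decay0 ups0 upw th0 gw L0 sumgL.
exists K2 => // M n nN; pose kap t s := Num.sqrt (sensitivity M 1 t s).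
have kap_le t s x y : 0 <= x -> 0 <= y -> sensitivity M 1 t s <= (K1 * x * y) ^+ 2 -> kap t s <= L * x * y.
  move=> x0 y0 sens_le; have K1xy : 0 <= K1 * x * y by rewrite !mulr_ge0 // ltW.
  apply: le_trans (sqrtr_le_sqr K1xy sens_le) _; rewrite !ler_wpM2r // /L; lra.
pose b s := if (s <= tm_size M)%N then grad_norm M q s else 0.
have bE t s : (t + s < tm_size M)%N -> b s = grad_norm M q s.
  by move=> ts; rewrite /b (leq_trans (leq_addl t s)) // ltnW.
apply: (decay (tm_size M) (sol_norm M 2) b kap) => //.
- by move=> s; rewrite /b; case: ifP => // _; exact: grad_norm_ge0.
- by move=> i j; rewrite -[2%N]/(2 * 1)%N; exact: sol_norm_antimono.
- by apply: le_trans (sol_norm0_le alpha_gt0 le_ab M (isT : (0 < 2)%N)) _; rewrite /L; lra.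
- move=> m mN; have := blk M m mN; rewrite big_mkcond /= => /le_trans; apply.
  by rewrite ler_wpM2r ?powS_ge0 // /L; lra.
- move=> k kN; apply: le_trans (sol_le M k (fun s => kap (k.-1 - s)%N s) kN _ _) _ => [s _|s _|].
  + exact: sqrtr_ge0.
  + by rewrite /kap muln1 sqr_sqrtr ?sensitivity_ge0.
  by rewrite ler_wpM2r ?addr_ge0 ?powS_ge0 ?sumr_ge0 // /L; [move=> s _; exact: sqrtr_ge0|lra].
- move=> t s ts; rewrite (bE _ _ ts); apply: kap_le; rewrite ?mulr_ge0 ?powS_ge0 ?grad_norm_ge0 //.
  by have [] := two_bounds M t s ts.
move=> t s ts; rewrite (bE _ _ ts); apply: kap_le; rewrite ?powS_ge0 ?grad_norm_ge0 //.
by have [] := two_bounds M t s ts.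
Qed.

End DecorrelatedSensitivity.

Lemma sum_block_grad_norm_le (R : realType) (d : nat) (alpha beta : R) p :
  (0 < d)%N -> 0 < alpha -> alpha <= beta -> exists2 C : R, 0 < C & forall (M : torus_model d alpha beta) m,
  \sum_(m <= s < (2 * m).+1) grad_norm M (2 * p.+1) s <=
  C * powS m (1 - (2 * p.+1)%:R^-1) * sol_norm M (2 * p.+1) m.
Proof.
move=> d0 alpha0 le_ab; have [C C0 dissip] := grad_norm_le_dissipation d0 alpha0 le_ab p.
exists (nroot (2 * p.+1) C); first by rewrite powR_gt0.
move=> M m; rewrite -mulrA mulrCA.
exact: (dissipation_block_sum_le _ C0 (sol_norm_ge0 M _) (grad_norm_ge0 M _) (dissip M)).
Qed.

Lemma sum_block_grad_norm_decay (R : realType) (d : nat) (alpha beta : R) p K1 sg :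
  (0 < d)%N -> 0 < alpha -> alpha <= beta ->
  (forall (M : torus_model d alpha beta) n, (n <= tm_size M)%N -> sol_norm M (2 * p.+1) n <= K1 * powS n (- sg)) ->
  exists2 K : R, 0 < K & forall (M : torus_model d alpha beta) m, (m <= tm_size M)%N ->
  \sum_(m <= s < (2 * m).+1 | (s <= tm_size M)%N) grad_norm M (2 * p.+1) s <=
  K * K1 * powS m (1 - (2 * p.+1)%:R^-1 - sg).
Proof.
move=> d0 alpha0 le_ab sol_le; have [K K0 block_le] := sum_block_grad_norm_le p d0 alpha0 le_ab.
exists K => // M m mN; apply: le_trans (ler_sum_cond _ _ (grad_norm_ge0 M _)) _; apply: le_trans (block_le M m) _.
rewrite [powS m (_ - sg)]powSD [leRHS]mulrACA.
by rewrite ler_wpM2l ?mulr_ge0 ?powS_ge0 ?sol_le // ltW.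
Qed.

Lemma variance_decay_ge3 (R : realType) (d : nat) (alpha beta : R) :
  (2 < d)%N -> 0 < alpha -> alpha <= beta -> exists2 C : R, 0 < C &
  forall (M : torus_model d alpha beta) n, (n <= tm_size M)%N -> sol_norm M 2 n <= C * powS n (- decay_exp R d).
Proof.
move=> d_gt2 alpha0 le_ab; have d0 : (0 < d)%N by exact: leq_trans d_gt2.
have d1 : (1 < d)%N by exact: ltnW.
have dR : 3 <= d%:R :> R by rewrite ler_nat.
pose w : R := (d%:R / 2 - 1) / 2; pose del : R := 2 * w; pose eps : R := w / (4 * d%:R).
have w0 : 0 < w by rewrite /w; lra.
have eps0 : 0 < eps by rewrite divr_gt0 // mulr_gt0 //; lra.
have d_eps : d%:R * eps = w / 4 by rewrite /eps; field; lra.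
have decayE : decay_exp R d = 1 + w by rewrite /decay_exp /w; field.
have [C C0 dipole_decay] := heat_dipole_decay d0 alpha0 le_ab.
have HC : dipole_bound d alpha beta C del.
  split => // V e N a emb ha n E nN; have := dipole_decay V e N a emb ha n E nN.
  by rewrite (_ : d%:R / 2 = 1 + del) // /del /w; field.
have min0 : 0 < Num.min w 1 by rewrite lt_min w0 /=.
have [m [p pE]] := exists_pow2_inv_le (divr_gt0 (mulr_gt0 eps0 min0) (ltr0n R 2)). set rho : R := _^-1 => rho_le.
have rho0 : 0 < rho by rewrite invr_gt0 ltr0n.
have rho_eps : rho <= w / 2 * eps.
  have : eps * Num.min w 1 <= eps * w by rewrite ler_pM2l // ge_min lexx.
  by move: rho_le; lra.
have rho_half : rho <= eps / 2.
  have : eps * Num.min w 1 <= eps * 1 by rewrite ler_pM2l // ge_min lexx orbT.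
  by move: rho_le; lra.
have eps_w : eps <= w by rewrite /eps ler_pdivrMr ?ler_peMr //; lra.
have eps1 : eps <= 1 by rewrite /eps ler_pdivrMr ?mul1r /w; lra.
have d_rho : d%:R * rho <= w / 8.
  have : d%:R * rho <= d%:R * (eps / 2) by rewrite ler_wpM2l.
  by rewrite mulrA d_eps; lra.
have first_expE : first_exp d del p.+1 = 1 + w - rho.
  rewrite /first_exp decayE /rho natrM; congr (_ - _).
  by rewrite (_ : 2 * (1 + w) - 1 - del = 1) ?mul1r // /del; ring.
have [K1 K10 sol_le] : exists2 K : R, 0 < K & forall (M : torus_model d alpha beta) n, (n <= tm_size M)%N ->
    sol_norm M (2 * p.+1) n <= K * powS n (- first_exp d del p.+1).
  rewrite -pE; apply: (sol_norm_first_decay d1 alpha0 le_ab HC); rewrite pE first_expE ?decayE -/rho; lra.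
have [K2 K20 block_le] := sum_block_grad_norm_decay d0 alpha0 le_ab sol_le.
pose K := geom_cst (w - rho) + K2 * K1.
have G0 : 0 < geom_cst (w - rho) by rewrite geom_cst_gt0 //; lra.
have K120 : 0 < K2 * K1 by exact: mulr_gt0.
apply: (sol_norm_optimal_decay (p := p) (eps := eps) (w1 := w) (th := 0) (K := K) d1 alpha0 le_ab (_ : 0 < del) HC);
  rewrite ?first_expE ?decayE -/rho ?eps0 ?addr_gt0 //; try by rewrite /del; lra.
- move=> n; rewrite powSr0 mulr1; have -> : 1 + w - rho = 1 + (w - rho) by ring.
  have := sum_powS_tail_le 0 n (_ : 0 < w - rho); rewrite powS0l mulr1 => /(_ _) /le_trans; apply; first lra.
  by rewrite /K lerDl ltW.
move=> M k kN; apply: le_trans (block_le M k kN) _.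
have -> : 1 - rho - first_exp d del p.+1 = - w by rewrite first_expE; ring.
by rewrite ler_wpM2r ?powS_ge0 // /K lerDr ltW.
Qed.

(** * Hole filling in dimension two *)

Section Grid.
Variable R : realType.
Implicit Types (F J : nat -> R) (f A B : nat -> nat -> R).

Lemma abel_summation F J p k : \sum_(p.+1 <= i < (p.+1 + k).+1) F i * (J i.-1 - J i) =
  \sum_(p.+1 <= i < (p.+1 + k)) J i * (F i.+1 - F i) + J p * F p.+1 - J (p.+1 + k)%N * F (p.+1 + k)%N.
Proof.
elim: k => [|k IH].
  by rewrite addn0 big_nat1 [X in X + _ - _]big_geq //= add0r; ring.
rewrite addnS big_nat_recr /=; last by rewrite leqW // leq_addr.
rewrite IH [in RHS]big_nat_recr /=; last by rewrite leq_addr.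
by ring.
Qed.

Lemma normr_sub_le_sum F p i : (p <= i)%N -> `|F i - F p| <= \sum_(p <= k < i) `|F k.+1 - F k|.
Proof.
move=> pi; rewrite -telescope_sumr //; exact: ler_norm_sum.
Qed.

Lemma sum_nat_le (b : nat -> R) p k m : (k <= m)%N -> (forall i, 0 <= b i) ->
  \sum_(p <= i < k) b i <= \sum_(p <= i < m) b i.
Proof.
move=> km b0; have [pk|kp] := leqP p k; last by rewrite big_geq ?sumr_ge0 // ltnW.
by rewrite [leRHS](@big_cat_nat _ _ _ k) //= lerDl sumr_ge0.
Qed.

Lemma sum_nat_sqr (b : nat -> R) p k : (\sum_(p <= i < p + k) b i) ^+ 2 <= k%:R * \sum_(p <= i < p + k) b i ^+ 2.
Proof.
have shift F : \sum_(p <= i < p + k) F i = \sum_(i < k) F (p + i)%N :> R.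
  rewrite -{1}(add0n p) big_addn addKn big_mkord.
  by apply: eq_bigr => i _; rewrite addnC.
rewrite !shift; have := @sum_CauchySchwarz R 'I_k xpredT (fun=> 1) (fun i => b (p + i)%N).
under eq_bigr do rewrite mul1r; move/le_trans; apply.
by under [X in X * _ <= _]eq_bigr do rewrite expr1n; rewrite sumr_const card_ord.
Qed.

Lemma sum_nat_sub (b : nat -> R) p p' k m : (p <= p')%N -> (k <= m)%N -> (forall i, 0 <= b i) ->
  \sum_(p' <= i < k) b i <= \sum_(p <= i < m) b i.
Proof.
move=> pp km b0; apply: le_trans (sum_nat_le p km b0).
have [pk|kp] := leqP p' k; last by rewrite big_geq ?sumr_ge0 // ltnW.
by rewrite [leRHS](@big_cat_nat _ _ _ p') //= lerDr sumr_ge0.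
Qed.

Lemma sum_ends F p k : \sum_(p <= i < p + k.+2) F i =
  F p + \sum_(p.+1 <= i < p.+1 + k) F i + F (p.+1 + k)%N.
Proof.
have -> : (p + k.+2)%N = (p.+1 + k).+1 by clear; lia.
rewrite big_ltn; last by rewrite addSn ltnS leqW // leq_addr.
by rewrite big_nat_recr /= ?addrA // leq_addr.
Qed.

Lemma sum_sides_sqr_le (g1 g2 g3 g4 : nat -> R) p k :
  (\sum_(p <= i < p + k) (`|g1 i| + `|g2 i|) + \sum_(p <= i < p + k) (`|g3 i| + `|g4 i|)) ^+ 2 <=
  4 * k%:R * (\sum_(p <= i < p + k) (g1 i ^+ 2 + g2 i ^+ 2) + \sum_(p <= i < p + k) (g3 i ^+ 2 + g4 i ^+ 2)).
Proof.
have two_sqr (x y : R) : (x + y) ^+ 2 <= 2 * (x ^+ 2 + y ^+ 2) by have := sqr_ge0 (x - y); lra.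
have pair_le (h1 h2 : nat -> R) : (\sum_(p <= i < p + k) (`|h1 i| + `|h2 i|)) ^+ 2 <=
    2 * k%:R * \sum_(p <= i < p + k) (h1 i ^+ 2 + h2 i ^+ 2).
  apply: le_trans (sum_nat_sqr _ _ _) _; rewrite -mulrA mulrCA; apply: ler_wpM2l => //.
  rewrite mulr_sumr; apply: ler_sum => i _; apply: le_trans (two_sqr _ _) _.
  by rewrite !real_normK ?num_real.
apply: le_trans (two_sqr _ _) _; have := pair_le g1 g2; have := pair_le g3 g4.
move: (k%:R : R) => l; lra.
Qed.

Definition line_lap (a g : nat -> R) i := a i * (g i - g i.+1) + a i.-1 * (g i - g i.-1).

Lemma line_energy_le (alpha beta m S : R) (a g : nat -> R) p k :
  0 <= alpha -> (forall i, alpha <= a i <= beta) -> `|g p.+1 - m| <= S -> `|g (p.+1 + k)%N - m| <= S ->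
  alpha * \sum_(p.+1 <= i < p.+1 + k) (g i.+1 - g i) ^+ 2 <=
  \sum_(p.+1 <= i < (p.+1 + k).+1) (g i - m) * line_lap a g i +
  beta * ((`|g p.+1 - g p| + `|g (p.+1 + k).+1 - g (p.+1 + k)%N|) * S).
Proof.
move=> al0 ha gP gU; have a_ge0 i : 0 <= a i by have /andP[h _] := ha i; exact: le_trans h.
have parts : \sum_(p.+1 <= i < (p.+1 + k).+1) (g i - m) * line_lap a g i =
    \sum_(p.+1 <= i < p.+1 + k) a i * (g i.+1 - g i) ^+ 2 + a p * (g p.+1 - g p) * (g p.+1 - m) -
    a (p.+1 + k)%N * (g (p.+1 + k).+1 - g (p.+1 + k)%N) * (g (p.+1 + k)%N - m).
  transitivity (\sum_(p.+1 <= i < (p.+1 + k).+1) (g i - m) * (a i.-1 * (g i.-1.+1 - g i.-1) - a i * (g i.+1 - g i))).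
    apply: eq_big_nat => i /andP[Pi _]; congr (_ * _); rewrite /line_lap prednK; last exact: leq_trans Pi.
    by ring.
  rewrite (abel_summation (fun i => g i - m) (fun i => a i * (g i.+1 - g i))); congr (_ + _ - _).
  by apply: eq_bigr => i _; ring.
have boundary i y z : `|z| <= S -> `|a i * y * z| <= beta * (`|y| * S).
  by move=> zS; rewrite !normrM (ger0_norm (a_ge0 i)) -mulrA ler_pM ?ler_wpM2l //; case/andP: (ha i).
have := boundary p (g p.+1 - g p) _ gP; have := boundary (p.+1 + k)%N (g (p.+1 + k).+1 - g (p.+1 + k)%N) _ gU.
have energy : alpha * \sum_(p.+1 <= i < p.+1 + k) (g i.+1 - g i) ^+ 2 <=
    \sum_(p.+1 <= i < p.+1 + k) a i * (g i.+1 - g i) ^+ 2.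
  rewrite mulr_sumr; apply: ler_sum => i _; rewrite ler_wpM2r ?sqr_ge0 //; by case/andP: (ha i).
rewrite parts !ler_norml => /andP[_ hU] /andP[hP _]; lra.
Qed.

Section Square.
Variable f : nat -> nat -> R.
Definition hdiff i j := f i.+1 j - f i j.
Definition vdiff i j := f i j.+1 - f i j.
Definition square_energy p k := \sum_(p <= j < (p + k).+1) \sum_(p <= i < p + k) hdiff i j ^+ 2 +
  \sum_(p <= i < (p + k).+1) \sum_(p <= j < p + k) vdiff i j ^+ 2.
Definition grid_lap A B i j := line_lap (A^~ j) (f^~ j) i + line_lap (B i) (f i) j.

Lemma square_energy_normal p k : square_energy p.+1 k +
  (\sum_(p.+1 <= j < (p.+1 + k).+1) (hdiff p j ^+ 2 + hdiff (p.+1 + k) j ^+ 2) +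
   \sum_(p.+1 <= i < (p.+1 + k).+1) (vdiff i p ^+ 2 + vdiff i (p.+1 + k) ^+ 2)) <= square_energy p k.+2.
Proof.
rewrite /square_energy addrACA.
have ext (g : nat -> nat -> R) : (forall i j, 0 <= g i j) ->
  \sum_(p.+1 <= j < (p.+1 + k).+1) (\sum_(p.+1 <= i < p.+1 + k) g i j + (g p j + g (p.+1 + k)%N j)) <=
  \sum_(p <= j < (p + k.+2).+1) \sum_(p <= i < p + k.+2) g i j.
  move=> g0; have s0 j : 0 <= \sum_(p <= i < p + k.+2) g i j by rewrite sumr_ge0.
  apply: (@le_trans _ _ (\sum_(p.+1 <= j < (p.+1 + k).+1) \sum_(p <= i < p + k.+2) g i j)).
    by apply: ler_sum_nat => j _; rewrite (sum_ends (fun i => g i j)) addrCA addrA.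
  by apply: sum_nat_sub => //; clear; lia.
apply: lerD; rewrite -big_split /=; first by apply: (ext (fun i j => hdiff i j ^+ 2)) => *; exact: sqr_ge0.
by apply: (ext (fun j i => vdiff i j ^+ 2)) => *; exact: sqr_ge0.
Qed.

Lemma square_energy_contour p k : square_energy p.+1 k + (\sum_(p <= i < p + k.+2) (hdiff i p ^+ 2 + hdiff i (p + k.+2) ^+ 2) +
   \sum_(p <= j < p + k.+2) (vdiff p j ^+ 2 + vdiff (p + k.+2) j ^+ 2)) <= square_energy p k.+2.
Proof.
rewrite /square_energy addrACA.
have ext (g : nat -> nat -> R) : (forall i j, 0 <= g i j) ->
  \sum_(p.+1 <= j < (p.+1 + k).+1) \sum_(p.+1 <= i < p.+1 + k) g i j +
  \sum_(p <= i < p + k.+2) (g i p + g i (p + k.+2)%N) <=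
  \sum_(p <= j < (p + k.+2).+1) \sum_(p <= i < p + k.+2) g i j.
  move=> g0; have split_ends (G : nat -> R) : \sum_(p <= j < (p + k.+2).+1) G j =
    G p + \sum_(p.+1 <= j < (p.+1 + k).+1) G j + G (p + k.+2)%N.
    rewrite -addnS sum_ends addnS; congr (_ + G _); clear; lia.
  rewrite split_ends big_split /= addrCA addrA lerD2r lerD2l.
  by apply: ler_sum_nat => j _; apply: sum_nat_sub => //; clear; lia.
apply: lerD; first by apply: (ext (fun i j => hdiff i j ^+ 2)) => *; exact: sqr_ge0.
by apply: (ext (fun j i => vdiff i j ^+ 2)) => *; exact: sqr_ge0.
Qed.

Definition contour_var p k := \sum_(p <= i < p + k) (`|hdiff i p| + `|hdiff i (p + k)|) +
  \sum_(p <= j < p + k) (`|vdiff p j| + `|vdiff (p + k) j|).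
Definition contour_flux p k := \sum_(p.+1 <= j < (p.+1 + k).+1) (`|hdiff p j| + `|hdiff (p.+1 + k) j|) +
  \sum_(p.+1 <= i < (p.+1 + k).+1) (`|vdiff i p| + `|vdiff i (p.+1 + k)|).

Lemma contour_flux_var_le p k : contour_flux p k.+2 * contour_var p.+1 k.+2 <=
  4 * k.+3%:R * (square_energy p k.+4 - square_energy p.+2 k).
Proof.
have normal := square_energy_normal p k.+2; set normal_sum := (X in _ + X <= _) in normal.
have contour := square_energy_contour p.+1 k; set contour_sum := (X in _ + X <= _) in contour.
have flux_le : contour_flux p k.+2 ^+ 2 <= 4 * k.+3%:R * normal_sum.
  have := sum_sides_sqr_le (hdiff p) (hdiff (p.+1 + k.+2)) (vdiff^~ p) (vdiff^~ (p.+1 + k.+2)%N) p.+1 k.+3.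
  by rewrite addnS.
have var_le : contour_var p.+1 k.+2 ^+ 2 <= 4 * k.+3%:R * contour_sum.
  apply: le_trans (sum_sides_sqr_le _ _ _ _ _ _) _; apply: ler_wpM2r; last by rewrite ler_pM2l // ler_nat.
  by rewrite addr_ge0 // sumr_ge0 // => i _; rewrite addr_ge0 ?sqr_ge0.
have K0 : 0 <= 4 * k.+3%:R :> R by rewrite mulr_ge0.
apply: (@le_trans _ _ (4 * k.+3%:R * (normal_sum + contour_sum))).
  have young (x y a b : R) : x ^+ 2 <= a -> y ^+ 2 <= b -> x * y <= a + b.
    by have := sqr_ge0 (x - y); have := sqr_ge0 x; have := sqr_ge0 y; lra.
  by rewrite [leRHS]mulrDr; exact: young.
by rewrite ler_wpM2l //; lra.
Qed.

Lemma contour_oscillation_le p k i : (p <= i <= p + k)%N ->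
  `|f i p - f p p| <= contour_var p k /\ `|f i (p + k)%N - f p p| <= contour_var p k.
Proof.
move=> /andP[pi ik]; rewrite /contour_var !big_split /=.
have sums_ge0 (g : nat -> R) : 0 <= \sum_(p <= i < p + k) `|g i| by rewrite sumr_ge0.
have := sums_ge0 (hdiff^~ p); have := sums_ge0 (hdiff^~ (p + k)%N).
have := sums_ge0 (vdiff p); have := sums_ge0 (vdiff (p + k)).
have row j : `|f i j - f p j| <= \sum_(p <= i < p + k) `|hdiff i j|.
  apply: le_trans (normr_sub_le_sum (f^~ j) pi) _.
  exact: (sum_nat_le (b := fun i => `|hdiff i j|)).
have col : `|f p (p + k)%N - f p p| <= \sum_(p <= j < p + k) `|vdiff p j|.
  exact: (normr_sub_le_sum (f p) (leq_addr k p)).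
have := ler_normD (f i (p + k)%N - f p (p + k)%N) (f p (p + k)%N - f p p); rewrite addrA subrK.
by have := row p; have := row (p + k)%N; move: col; split; lra.
Qed.

End Square.

Lemma contour_var_tr f p k : contour_var (fun i j => f j i) p k = contour_var f p k.
Proof. exact: addrC. Qed.

Lemma square_energy_le_lap alpha beta A B f p k : 0 <= alpha ->
  (forall i j, alpha <= A i j <= beta) -> (forall i j, alpha <= B i j <= beta) ->
  alpha * square_energy f p.+1 k <=
  \sum_(p.+1 <= j < (p.+1 + k).+1) \sum_(p.+1 <= i < (p.+1 + k).+1) (f i j - f p.+1 p.+1) * grid_lap f A B i j +
  beta * (contour_flux f p k * contour_var f p.+1 k).
Proof.
move=> al0 hA hB; set P := p.+1; set U := (P + k)%N; set m := f P P; set S := contour_var f P k.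
have osc i : (P <= i < U.+1)%N -> [/\ `|f P i - m| <= S, `|f U i - m| <= S, `|f i P - m| <= S & `|f i U - m| <= S].
  move=> hi; have [] := contour_oscillation_le f hi; have [] := contour_oscillation_le (fun i j => f j i) hi.
  by rewrite contour_var_tr.
have -> : \sum_(P <= j < U.+1) \sum_(P <= i < U.+1) (f i j - m) * grid_lap f A B i j =
    \sum_(P <= j < U.+1) \sum_(P <= i < U.+1) (f i j - m) * line_lap (A^~ j) (f^~ j) i +
    \sum_(P <= i < U.+1) \sum_(P <= j < U.+1) (f i j - m) * line_lap (B i) (f i) j.
  rewrite [X in _ = _ + X]exchange_big_nat /= -big_split /=; apply: eq_bigr => j _.
  by rewrite -big_split /=; apply: eq_bigr => i _; rewrite /grid_lap mulrDr.
rewrite /square_energy /contour_flux -/P -/U mulrDr mulrDl [beta * (_ + _)]mulrDr addrACA.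
apply: lerD; rewrite mulr_suml !mulr_sumr -big_split /=; apply: ler_sum_nat => i hi; have [oP oU oB oT] := osc i hi.
  exact: (line_energy_le (g := f^~ i) al0 (fun j => hA j i)).
exact: (line_energy_le (g := f i) al0 (hB i)).
Qed.

Lemma caccioppoli alpha beta A B f p k G1 G2 : 0 < alpha -> (forall i j, alpha <= A i j <= beta) ->
  (forall i j, alpha <= B i j <= beta) -> (forall i j, `|f i j| <= G1) ->
  (forall i j, (0 < i)%N -> (0 < j)%N -> `|grid_lap f A B i j| <= G2) ->
  alpha * square_energy f p.+1 k.+2 <= (k.+3)%:R ^+ 2 * (2 * G1 * G2) +
   beta * (4 * k.+3%:R) * (square_energy f p k.+4 - square_energy f p.+2 k).
Proof.
move=> al0 hA hB hf hg.
have be0 : 0 <= beta by have /andP[h1 h2] := hA 0%N 0%N; exact: le_trans (ltW al0) (le_trans h1 h2).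
apply: le_trans (square_energy_le_lap f p k.+2 (ltW al0) hA hB) _; apply: lerD; last first.
  by rewrite -mulrA ler_wpM2l // contour_flux_var_le.
apply: (@le_trans _ _ (\sum_(p.+1 <= j < (p.+1 + k.+2).+1) \sum_(p.+1 <= i < (p.+1 + k.+2).+1) 2 * G1 * G2)).
  apply: ler_sum_nat => j /andP[j0 _]; apply: ler_sum_nat => i /andP[i0 _].
  apply: le_trans (ler_norm _) _; rewrite normrM.
  apply: ler_pM => //; last by apply: hg; [exact: leq_trans i0|exact: leq_trans j0].
  by apply: le_trans (ler_normB _ _) _; have := hf i j; have := hf p.+1 p.+1; lra.
rewrite !sumr_const_nat; have -> : ((p.+1 + k.+2).+1 - p.+1 = k.+3)%N by clear; lia.
by rewrite -mulrnA -[leLHS]mulr_natl natrM expr2.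
Qed.

End Grid.

Section HoleFilling.
Variable R : realType.

Lemma sum_two_step_diff_le (en : nat -> R) s : (forall r, (r <= (2 * s).+1)%N -> en r <= en r.+1) ->
  \sum_(s.+1 <= r < (2 * s).+2) (en r.+1 - en r.-1) <= 2 * (en (2 * s).+2 - en s).
Proof.
move=> mono; have -> : \sum_(s.+1 <= r < (2 * s).+2) (en r.+1 - en r.-1) =
    \sum_(s.+1 <= r < (2 * s).+2) (en r.+1 - en r) + \sum_(s.+1 <= r < (2 * s).+2) (en r - en r.-1).
  by rewrite -big_split; apply: eq_bigr => r _ /=; ring.
rewrite telescope_sumr; last by clear; lia.
rewrite big_add1 /= telescope_sumr; last by clear; lia.
have := mono s; have := mono (2 * s).+1 (leqnn _); have -> : (s <= (2 * s).+1)%N by clear; lia.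
move=> h1 /(_ isT) h2; lra.
Qed.

Lemma hole_filling_step (al be src : R) (en : nat -> R) s : 0 < al -> 0 < be -> 0 <= src ->
  (forall r, (r <= (2 * s).+1)%N -> en r <= en r.+1) ->
  (forall r, (0 < r <= (2 * s).+1)%N -> al * en r <= (2 * r).+1%:R ^+ 2 * src +
     be * (2 * r).+1%:R * (en r.+1 - en r.-1)) ->
  en s <= (8 * be / (al + 8 * be)) * en (2 * s).+2 + 16 * s.+1%:R ^+ 2 * (src / al).
Proof.
move=> al0 be0 src0 mono rec; have s_gt0 : 0 < s.+1%:R :> R by rewrite ltr0n.
have mono2 r r' : (r <= r' <= (2 * s).+2)%N -> en r <= en r'.
  move=> /andP[/subnK <-]; elim: (r' - r)%N => [|k IH] h; first exact: lexx.
  apply: le_trans (IH _) _; first by move: h; rewrite addSn; exact: ltnW.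
  by rewrite addSn; apply: mono; move: h; rewrite addSn.
have averaged : s.+1%:R * (al * en s) <=
    s.+1%:R * ((4 * s.+1%:R) ^+ 2 * src) + be * (4 * s.+1%:R) * (2 * (en (2 * s).+2 - en s)).
  have -> : s.+1%:R * (al * en s) = \sum_(s.+1 <= r < (2 * s).+2) al * en s.
    by rewrite sumr_const_nat -[RHS]mulr_natl; congr (_%:R * _); clear; lia.
  apply: (@le_trans _ _ (\sum_(s.+1 <= r < (2 * s).+2) ((4 * s.+1%:R) ^+ 2 * src + be * (4 * s.+1%:R) * (en r.+1 - en r.-1)))).
    apply: ler_sum_nat => r /andP[sr rs].
    apply: (@le_trans _ _ (al * en r)).
      by rewrite ler_pM2l //; apply: mono2; clear -sr rs; lia.
    have r_le : (2 * r).+1%:R <= 4 * s.+1%:R :> R by rewrite -natrM ler_nat; clear -rs; lia.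
    apply: le_trans (rec r _) _; first by clear -sr rs; lia.
    apply: lerD; first by apply: ler_wpM2r => //; apply: ler_sqr_nneg.
    apply: ler_wpM2r; last by rewrite ler_pM2l.
    rewrite subr_ge0; apply: mono2; clear -sr rs; lia.
  rewrite big_split /= -mulr_sumr; apply: lerD.
    rewrite sumr_const_nat; have -> : ((2 * s).+2 - s.+1 = s.+1)%N by clear; lia.
    by rewrite -[src *+ _]mulr_natl mulrCA.
  by rewrite -mulr_sumr ler_wpM2l ?sum_two_step_diff_le // !mulr_ge0 // ltW.
have filled : al * en s <= (4 * s.+1%:R) ^+ 2 * src + 8 * be * (en (2 * s).+2 - en s).
  by rewrite -(ler_pM2l s_gt0); apply: (le_trans averaged); apply: le_of_eq; ring.
have D0 : 0 < al + 8 * be by lra.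
rewrite -(ler_pM2l D0); apply: (@le_trans _ _ (8 * be * en (2 * s).+2 + (4 * s.+1%:R) ^+ 2 * src)); first by lra.
have -> : (al + 8 * be) * (8 * be / (al + 8 * be) * en (2 * s).+2 + 16 * s.+1%:R ^+ 2 * (src / al)) =
  8 * be * en (2 * s).+2 + (4 * s.+1%:R) ^+ 2 * src * ((al + 8 * be) / al).
  by field; rewrite !gt_eqF.
rewrite lerD2l ler_peMr //; first by rewrite mulr_ge0 // sqr_ge0.
by rewrite ler_pdivlMr //; lra.
Qed.

Lemma hole_filling_iter (th K : R) (en : nat -> R) J : 0 <= th <= 1 -> 0 <= K ->
  (forall s, ((2 * s).+2 <= 3 * 2 ^ J - 2)%N -> en s <= th * en (2 * s).+2 + s.+1%:R ^+ 2 * K) ->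
  en 1%N <= th ^+ J * en (3 * 2 ^ J - 2)%N + J%:R * ((3 * 2 ^ J)%:R ^+ 2 * K).
Proof.
move=> /andP[th0 th1] K0 h; suff H j : (j <= J)%N ->
  en 1%N <= th ^+ j * en (3 * 2 ^ j - 2)%N + j%:R * ((3 * 2 ^ J)%:R ^+ 2 * K) by exact: H.
elim: j => [_|j IH jJ]; first by rewrite expn0 muln1 expr0 mul1r mul0r addr0.
apply: (le_trans (IH (ltnW jJ))).
have lt2 : (2 ^ j.+1 <= 2 ^ J)%N by rewrite leq_exp2l.
have pow2_gt0 : (0 < 2 ^ j)%N by rewrite expn_gt0.
rewrite expnS in lt2; have := h (3 * 2 ^ j - 2)%N.
have -> : ((2 * (3 * 2 ^ j - 2)).+2 = 3 * 2 ^ j.+1 - 2)%N by rewrite expnS; clear -pow2_gt0; lia.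
rewrite expnS; have -> : (3 * (2 * 2 ^ j) - 2 <= 3 * 2 ^ J - 2)%N by clear -lt2 pow2_gt0; lia.
move=> /(_ isT) hs; have B : ((3 * 2 ^ j - 2).+1%:R ^+ 2 * K) <= (3 * 2 ^ J)%:R ^+ 2 * K :> R.
  by apply: ler_wpM2r => //; apply: ler_sqr_nneg => //; rewrite ler_nat; clear -lt2 pow2_gt0; lia.
have thj0 : 0 <= th ^+ j by rewrite exprn_ge0.
have thj1 : th ^+ j <= 1 by rewrite exprn_ile1.
have B0 : 0 <= (3 * 2 ^ J)%:R ^+ 2 * K :> R by rewrite mulr_ge0 // sqr_ge0.
have := ler_wpM2l thj0 (le_trans hs (lerD (lexx _) B)).
rewrite mulrDr [th ^+ j * (th * _)]mulrA -exprSr => hh.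
have := ler_wpM2r B0 thj1; rewrite mul1r => h2.
rewrite -[j.+1%:R]natr1 mulrDl mul1r; lra.
Qed.

End HoleFilling.

Section KernelSup.
Variables (R : realType) (d : nat) (alpha beta : R).
Hypotheses (d_gt0 : (0 < d)%N) (alpha_gt0 : 0 < alpha) (le_ab : alpha <= beta).
Let beta_ge0 : 0 <= beta := ltW (beta_gt0 alpha_gt0 le_ab).

Lemma lap_form_ge0 (V : finZmodType) (e : 'I_d -> V) a f : elliptic alpha beta a -> 0 <= dot f (lap e a f).
Proof.
move=> ha; rewrite dot_lap sumr_ge0 // => E _.
by rewrite -mulrA -expr2 mulr_ge0 ?sqr_ge0 // (elliptic_ge0 alpha_gt0 ha).
Qed.

Lemma lap_form_CauchySchwarz (V : finZmodType) (e : 'I_d -> V) a f g : elliptic alpha beta a ->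
  dot f (lap e a g) ^+ 2 <= dot f (lap e a f) * dot g (lap e a g).
Proof.
move=> ha; rewrite !dot_lap.
have := sum_CauchySchwarz_weights xpredT (fun E => ediff e E f) (fun E => ediff e E g) (elliptic_ge0 alpha_gt0 ha).
by under [X in _ <= X * _ -> _]eq_bigr do rewrite expr2 mulrA;
   under [X in _ <= _ * X -> _]eq_bigr do rewrite expr2 mulrA.
Qed.

Lemma normr_le_of_sqr (X Y A B : R) : X ^+ 2 <= A * B -> 0 <= A -> 0 <= B -> A <= Y -> B <= Y -> `|X| <= Y.
Proof.
move=> XAB A0 B0 AY BY; rewrite -(@ler_pXn2r _ 2) ?nnegrE ?normr_ge0 ?(le_trans A0) // real_normK ?num_real //.
by apply: (le_trans XAB); rewrite expr2; apply: ler_pM.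
Qed.

Lemma heat_kernel_sup_decay : exists2 C : R, 0 < C &
  forall (V : finZmodType) (e : 'I_d -> V) N a, box_embeds e N -> elliptic alpha beta a ->
  forall n y x, (n <= N)%N -> `|heat e beta a n (delta y) x| <= C * powS n (- (d%:R / 2)).
Proof.
have [C C0 decay] := heat_kernel_decay d_gt0 alpha_gt0 le_ab.
exists (C * 2 `^ (d%:R / 2)); first by rewrite mulr_gt0 // powR_gt0.
move=> V e N a emb ha n y x nN.
have half_le k z : (k <= n)%N -> (n < 2 * k.+1)%N -> dot (heat e beta a k (delta z)) (heat e beta a k (delta z)) <=
    C * 2 `^ (d%:R / 2) * powS n (- (d%:R / 2)).
  move=> kn nk; apply: le_trans (decay V e N a emb ha k z (leq_trans kn nN)) _.
  by rewrite -mulrA ler_pM2l // powS_le_half // divr_ge0.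
have -> : heat e beta a n (delta y) x = dot (heat e beta a n./2 (delta x)) (heat e beta a (n - n./2) (delta y)).
  by rewrite -dot_heat dot_delta -heat_addn subnKC // leq_half.
apply: normr_le_of_sqr (dot_CauchySchwarz _ _) (dot_ge0 _) (dot_ge0 _) _ _; apply: half_le; clear; lia.
Qed.

Lemma lap_heat_kernel_sup_decay : exists2 C : R, 0 < C &
  forall (V : finZmodType) (e : 'I_d -> V) N a, box_embeds e N -> elliptic alpha beta a ->
  forall n y x, (n <= N)%N -> `|lap e a (heat e beta a n (delta y)) x| <= C * powS n (- (d%:R / 2 + 1)).
Proof.
have [C C0 grad_decay] := heat_kernel_grad_decay d_gt0 alpha_gt0 le_ab.
exists (beta * (C * 2 `^ (d%:R / 2 + 1))).
  by rewrite mulr_gt0 ?(beta_gt0 alpha_gt0 le_ab) // mulr_gt0 // powR_gt0.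
move=> V e N a emb ha n y x nN.
have half_le k z : (k <= n)%N -> (n < 2 * k.+1)%N ->
    dot (heat e beta a k (delta z)) (lap e a (heat e beta a k (delta z))) <=
    beta * (C * 2 `^ (d%:R / 2 + 1)) * powS n (- (d%:R / 2 + 1)).
  move=> kn nk; apply: (@le_trans _ _ (beta * gradsq e (heat e beta a k (delta z)))).
    rewrite dot_lap /gradsq mulr_sumr; apply: ler_sum => E _; rewrite -mulrA -expr2 ler_wpM2r ?sqr_ge0 //.
    by case/andP: (ha E).
  rewrite -mulrA ler_wpM2l //; apply: le_trans (grad_decay V e N a emb ha k z (leq_trans kn nN)) _.
  by rewrite -mulrA ler_pM2l // powS_le_half // addr_ge0 ?divr_ge0.
have -> : lap e a (heat e beta a n (delta y)) x =
    dot (heat e beta a n./2 (delta x)) (lap e a (heat e beta a (n - n./2) (delta y))).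
  by rewrite -dot_heat dot_delta -lap_heat -heat_addn subnKC // leq_half.
apply: normr_le_of_sqr (lap_form_CauchySchwarz _ _ _ ha) (lap_form_ge0 _ _ ha) (lap_form_ge0 _ _ ha) _ _;
  apply: half_le; clear; lia.
Qed.

End KernelSup.

Section GradientSup.
Variables (R : realType) (alpha beta : R).
Hypotheses (alpha_gt0 : 0 < alpha) (le_ab : alpha <= beta).
Let d2 : (0 < 2)%N. Proof. by []. Qed.
Let b0 : 0 < beta := beta_gt0 alpha_gt0 le_ab.

Section Square.
Variables (V : finZmodType) (e : 'I_2 -> V) (a : V * 'I_2 -> R) (w : V -> R) (z : V).
Let i1 : 'I_2 := lift ord0 ord0.
Definition grid_pt i j : V := z + (e ord0 *+ i + e i1 *+ j).
Let gf i j := w (grid_pt i j).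
Let gA i j := a (grid_pt i j, ord0).
Let gB i j := a (grid_pt i j, i1).

Lemma grid_ptH i j : grid_pt i.+1 j = grid_pt i j + e ord0.
Proof. by rewrite /grid_pt mulrSr -!addrA; congr (_ + (_ + _)); rewrite addrC. Qed.
Lemma grid_ptV i j : grid_pt i j.+1 = grid_pt i j + e i1.
Proof. by rewrite /grid_pt mulrSr !addrA. Qed.

Lemma grid_lapE i j : grid_lap gf gA gB i.+1 j.+1 = lap e a w (grid_pt i.+1 j.+1).
Proof.
rewrite /grid_lap /line_lap /lap big_ord_recl big_ord_recl big_ord0 addr0 /gf /gA /gB /=.
rewrite -[lift ord0 ord0]/i1 -grid_ptH -grid_ptV.
have -> : grid_pt i.+1 j.+1 - e ord0 = grid_pt i j.+1 by rewrite grid_ptH addrK.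
by have -> : grid_pt i.+1 j.+1 - e i1 = grid_pt i.+1 j by rewrite grid_ptV addrK.
Qed.

Lemma hdiffE i j : hdiff gf i j = ediff e (grid_pt i j, ord0) w.
Proof. by rewrite /hdiff /ediff /gf grid_ptH. Qed.
Lemma vdiffE i j : vdiff gf i j = ediff e (grid_pt i j, i1) w.
Proof. by rewrite /vdiff /ediff /gf grid_ptV. Qed.

Lemma square_energy_le_gradsq N m : box_embeds e N -> (m < N)%N -> square_energy gf 0 m <= gradsq e w.
Proof.
move=> emb mN; have inj : injective (fun p : 'I_m.+1 * 'I_m.+1 => grid_pt p.1 p.2).
  move=> [i j] [k l] /= /addrI ijkl.
  pose F (p q : nat) (t : 'I_2) := if t == ord0 then p else q.
  have latF p q : lattice_pt e (F p q) = e ord0 *+ p + e i1 *+ q.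
    by rewrite /lattice_pt big_ord_recl big_ord_recl big_ord0 addr0.
  have Fl (p q : 'I_m.+1) t : (F p q t < N)%N.
    by rewrite /F; case: ifP => _; exact: leq_trans (ltn_ord _) mN.
  have := emb (F i j) (F k l) (Fl i j) (Fl k l); rewrite !latF => /(_ ijkl) E.
  by have := E ord0; have := E i1; rewrite /F /= => /val_inj -> /val_inj ->.
have rows_le (g : V -> R) : (forall x, 0 <= g x) -> \sum_(j < m.+1) \sum_(i < m) g (grid_pt i j) <= \sum_x g x.
  move=> g0; apply: le_trans (ler_sum_inj inj g0).
  rewrite -(pair_bigA _ (fun i j : 'I_m.+1 => g (grid_pt i j))) /= [leRHS]exchange_big /=.
  by apply: ler_sum => j _; rewrite [leRHS]big_ord_recr /= lerDl.
have cols_le (g : V -> R) : (forall x, 0 <= g x) -> \sum_(i < m.+1) \sum_(j < m) g (grid_pt i j) <= \sum_x g x.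
  move=> g0; apply: le_trans (ler_sum_inj inj g0).
  rewrite -(pair_bigA _ (fun i j : 'I_m.+1 => g (grid_pt i j))) /=.
  by apply: ler_sum => j _; rewrite [leRHS]big_ord_recr /= lerDl.
rewrite /gradsq sum_edges exchange_big /= big_ord_recl big_ord_recl big_ord0 addr0 -/i1 /square_energy add0n.
apply: lerD; rewrite big_mkord.
  apply: le_trans (rows_le (fun x => ediff e (x, ord0) w ^+ 2) _) => [|x]; last exact: sqr_ge0.
  by apply: ler_sum => j _; rewrite big_mkord; apply: ler_sum => i _; rewrite hdiffE.
apply: le_trans (cols_le (fun x => ediff e (x, i1) w ^+ 2) _) => [|x]; last exact: sqr_ge0.
by apply: ler_sum => j _; rewrite big_mkord; apply: ler_sum => i _; rewrite vdiffE.
Qed.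

Definition centred_energy rho r := square_energy gf (rho - r) (2 * r).

Lemma ediff_le_centred_energy rho i : (0 < rho)%N -> ediff e (grid_pt rho rho, i) w ^+ 2 <= centred_energy rho 1.
Proof.
case: rho => // r _; rewrite /centred_energy subn1 muln1 /= /square_energy.
have s0 (F : nat -> R) p q k : (forall i, 0 <= F i) -> (p <= k < q)%N -> F k <= \sum_(p <= i < q) F i.
  move=> F0 /andP[pk kq]; rewrite (@big_cat_nat _ _ _ k) //=; last exact: ltnW.
  by rewrite [X in _ + X]big_ltn // addrCA lerDl addr_ge0 // sumr_ge0.
have r1 : (r <= r.+1 < r + 2)%N by rewrite leqnSn addn2 /=.
have r_itv : (r <= r.+1 < (r + 2).+1)%N by rewrite leqnSn addn2 /=.
have sq0 (F : nat -> nat -> R) : (forall i j, 0 <= F i j) -> F r.+1 r.+1 <= \sum_(r <= j < (r + 2).+1) \sum_(r <= i < r + 2) F i j.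
  move=> F0; apply: le_trans (s0 (fun j => \sum_(r <= i < r + 2) F i j) _ _ _ _ r_itv) => [|j].
    exact: (s0 (fun i => F i r.+1)).
  by rewrite sumr_ge0.
have [->|->] : i = ord0 \/ i = i1.
  by case: i => [[|[|]]] // h; [left|right]; exact: val_inj.
- rewrite -hdiffE; apply: le_trans (sq0 (fun i j => hdiff gf i j ^+ 2) _) _ => [*|]; first exact: sqr_ge0.
  by rewrite lerDl sumr_ge0 // => k _; rewrite sumr_ge0 // => l _; rewrite sqr_ge0.
- rewrite -vdiffE; apply: le_trans (sq0 (fun i j => vdiff gf j i ^+ 2) _) _ => [*|]; first exact: sqr_ge0.
  by rewrite lerDr sumr_ge0 // => k _; rewrite sumr_ge0 // => l _; rewrite sqr_ge0.
Qed.

Lemma centred_energy_mono rho r : (r < rho)%N -> centred_energy rho r <= centred_energy rho r.+1.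
Proof.
move=> lt_r; rewrite /centred_energy; have -> : (rho - r = (rho - r.+1).+1)%N by clear -lt_r; lia.
have -> : (2 * r.+1 = (2 * r).+2)%N by clear; lia.
apply: le_trans (square_energy_normal gf _ _); rewrite lerDl.
by rewrite addr_ge0 // sumr_ge0 // => i _; rewrite addr_ge0 // sqr_ge0.
Qed.

Lemma centred_energy_rec G1 G2 rho r : elliptic alpha beta a -> (forall x, `|w x| <= G1) -> (forall x, `|lap e a w x| <= G2) ->
  (0 < r < rho)%N -> alpha * centred_energy rho r <= (2 * r).+1%:R ^+ 2 * (2 * G1 * G2) +
   4 * beta * (2 * r).+1%:R * (centred_energy rho r.+1 - centred_energy rho r.-1).
Proof.
move=> ha hw hl; case: r => // r /= lt_r; rewrite /centred_energy.
have -> : (rho - r.+1 = (rho - r.+2).+1)%N by clear -lt_r; lia.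
have -> : (rho - r = (rho - r.+2).+2)%N by clear -lt_r; lia.
have [-> ->] : (2 * r.+1 = (2 * r).+2)%N /\ (2 * r.+2 = (2 * r).+4)%N by clear; split; lia.
have := @caccioppoli R alpha beta gA gB gf (rho - r.+2) (2 * r) G1 G2 alpha_gt0
  (fun i j => ha _) (fun i j => ha _) (fun i j => hw _).
rewrite [beta * (4 * _)]mulrCA [4 * (beta * _)]mulrA; apply.
by case=> // i [|j] // _ _; rewrite grid_lapE.
Qed.

End Square.

Let th := 8 * (4 * beta) / (alpha + 8 * (4 * beta)).
Let th_bnd : 0 < th < 1.
Proof.
have bb := b0; have D0 : 0 < alpha + 8 * (4 * beta) by rewrite addr_gt0 // !mulr_gt0.
by rewrite /th divr_gt0 ?ltr_pdivrMr ?mulr_gt0 // mul1r ltrDr.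
Qed.

Lemma ediff_sqr_le_hole_filling (V : finZmodType) (e : 'I_2 -> V) a N w G1 G2 E J : box_embeds e N -> elliptic alpha beta a ->
  (forall x, `|w x| <= G1) -> (forall x, `|lap e a w x| <= G2) -> (6 * 2 ^ J <= N)%N ->
  ediff e E w ^+ 2 <= th ^+ J * gradsq e w + J%:R * ((3 * 2 ^ J)%:R ^+ 2 * (16 * (2 * G1 * G2 / alpha))).
Proof.
move=> emb ha hw hl JN; set rho := (3 * 2 ^ J - 2)%N.
have pow2_gt0 : (0 < 2 ^ J)%N by rewrite expn_gt0.
have rho_gt0 : (0 < rho)%N by rewrite /rho; clear -pow2_gt0; lia.
have G10 : 0 <= G1 := le_trans (normr_ge0 _) (hw 0).
have G20 : 0 <= G2 := le_trans (normr_ge0 _) (hl 0).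
pose z := E.1 - (e ord0 *+ rho + e (lift ord0 ord0) *+ rho).
have centre : grid_pt e z rho rho = E.1 by rewrite /grid_pt subrK.
have E_le : ediff e E w ^+ 2 <= centred_energy e w z rho 1.
  by have := ediff_le_centred_energy e w z E.2 rho_gt0; rewrite centre -surjective_pairing.
have src0 : 0 <= 2 * G1 * G2 by rewrite !mulr_ge0.
have K0 : 0 <= 16 * (2 * G1 * G2 / alpha) by rewrite mulr_ge0 // divr_ge0 // ltW.
have th01 : 0 <= th <= 1 by case/andP: th_bnd => /ltW -> /ltW ->.
have step s : ((2 * s).+2 <= rho)%N -> centred_energy e w z rho s <= th * centred_energy e w z rho (2 * s).+2 + s.+1%:R ^+ 2 * (16 * (2 * G1 * G2 / alpha)).
  move=> srho; rewrite [s.+1%:R ^+ 2 * _]mulrCA [16 * _]mulrA.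
  apply: hole_filling_step => //; first by rewrite mulr_gt0.
  - by move=> r rs; apply: centred_energy_mono; exact: leq_trans srho.
  - by move=> r /andP[r0 rs]; apply: (centred_energy_rec z ha hw hl); rewrite r0 (leq_trans _ srho).
apply: (le_trans E_le); apply: le_trans (hole_filling_iter th01 K0 step) _.
rewrite lerD2r; apply: ler_wpM2l; first by rewrite exprn_ge0 //; case/andP: th01.
rewrite -/rho /centred_energy subnn; apply: (square_energy_le_gradsq _ _ emb); rewrite /rho; clear -JN pow2_gt0; lia.
Qed.

Lemma ex_powR64_ge (x : R) : 0 < x < 1 -> exists2 del : R, 0 < del <= 3^-1 & x <= 64 `^ (- del).
Proof.
move=> x01; have ln64 : 0 < ln 64 :> R by rewrite ln_gt0 // ltr1n.
have lnx : ln x < 0 by rewrite ln_lt0.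
exists (Num.min 3^-1 (- ln x / ln 64)).
  by rewrite ge_min lexx lt_min invr_gt0 ltr0n divr_gt0 // oppr_gt0.
apply: (@le_trans _ _ (64 `^ (ln x / ln 64))); last first.
  by apply: ler_powR; rewrite ?ler1n // lerNr ge_min -mulNr lexx orbT.
by rewrite /powR pnatr_eq0 /= divfK ?gt_eqF // lnK // posrE; case/andP: x01.
Qed.

Lemma exprn_trunc_log_le (x del : R) n J : 0 <= x -> 0 < del <= 3^-1 -> x <= 64 `^ (- del) ->
  (n.+1 < 64 ^ J.+1)%N -> x ^+ J <= 64 * powS n (- del).
Proof.
move=> x0 /andP[del0 del3] xdel nJ.
apply: (@le_trans _ _ ((64 `^ (- del)) ^+ J)); first by rewrite lerXn2r ?nnegrE ?powR_ge0.
have -> : (64 `^ (- del)) ^+ J = 64 `^ del * (64 ^ J.+1)%:R `^ (- del) :> R.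
  rewrite natrX -!powR_mulrn ?powR_ge0 // -!powRrM -powRD ?pnatr_eq0 ?implybT //; congr powR.
  by rewrite -natr1; ring.
apply: ler_pM; rewrite ?powR_ge0 //.
  rewrite -[leRHS](@powRr1 _ 64) //; apply: ler_powR; [by rewrite ler1n|lra].
rewrite /powS !powRN lef_pV2 ?posrE ?powR_gt0 ?ltr0n ?expn_gt0 //.
by apply: ge0_ler_powR; rewrite ?nnegrE ?ler0n ?(ltW del0) // ler_nat ltnW.
Qed.

Lemma sqr_trunc_log_le n J : (64 ^ J <= n.+1)%N -> J%:R * (3 * 2 ^ J)%:R ^+ 2 <= 9 * powS n (2 / 3) :> R.
Proof.
move=> Jn; apply: (@le_trans _ _ (9 * (16 ^ J)%:R)).
  have J_le : (J <= 2 ^ J)%N by rewrite ltnW // ltn_expl.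
  have -> : (16 ^ J = (2 ^ J) ^ 4)%N by rewrite -[16%N]/(2 ^ 4)%N -!expnM mulnC.
  rewrite -natrX -!natrM ler_nat; move: (2 ^ J)%N J_le => q Jq.
  rewrite expnMn mulnCA leq_mul2l /= [X in (_ <= X)%N](expnD q 2 2) leq_mul2r; apply/orP; right.
  by apply: (leq_trans Jq); case: (q) => // k; rewrite -mulnn leq_pmulr.
rewrite ler_pM2l // -(@ler_pXn2r _ 3) ?nnegrE ?powS_ge0 // powS_divX //.
rewrite -natrX -expnM mulnC expnM; have -> : (16 ^ 3 = 64 ^ 2)%N by [].
by rewrite -expnM mulnC expnM natrX /powS powR_mulrn // lerXn2r ?nnegrE ?ler0n // ler_nat.
Qed.

Lemma powS_le_scale n k (s t : R) : (n.+1 <= k)%N -> t <= s + 1 -> powS n (- s) <= k%:R * powS n (- t).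
Proof.
move=> nk ts; have -> : powS n (- s) = powS n (t - s) * powS n (- t) :> R by rewrite -powSD; congr powS; ring.
rewrite ler_wpM2r ?powS_ge0 //; apply: (@le_trans _ _ (powS n 1)); first by apply: ler_powS; lra.
by rewrite powSr1 ler_nat.
Qed.

Lemma ediff_sqr_le_gradsq (V : finZmodType) (e : 'I_2 -> V) (f : V -> R) E : ediff e E f ^+ 2 <= gradsq e f.
Proof. by rewrite /gradsq (bigD1 E) //= lerDl sumr_ge0 // => F _; rewrite sqr_ge0. Qed.

Lemma heat_kernel_ediff_decay : exists2 del : R, 0 < del & exists2 C : R, 0 < C &
  forall (V : finZmodType) (e : 'I_2 -> V) N a, box_embeds e N -> elliptic alpha beta a ->
  forall n y E, (n <= N)%N -> ediff e E (heat e beta a n (delta y)) ^+ 2 <= C * powS n (- (2 + del)).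
Proof.
have /andP[th0 th1] := th_bnd; have [del del03 th_le] := ex_powR64_ge th_bnd.
have /andP[del0 del3] := del03.
have [C1 C10 sup_decay] := heat_kernel_sup_decay d2 alpha_gt0 le_ab.
have [C2 C20 lap_decay] := lap_heat_kernel_sup_decay d2 alpha_gt0 le_ab.
have [Cg Cg0 grad_decay] := heat_kernel_grad_decay d2 alpha_gt0 le_ab.
have exp1 : - (2%:R / 2) = - 1 :> R by field.
have exp2 : - (2%:R / 2 + 1) = - 2 :> R by field.
rewrite exp1 in sup_decay; rewrite exp2 in lap_decay grad_decay.
pose K := 9 * (16 * (2 * C1 * C2 / alpha)); have K0 : 0 < K by rewrite !mulr_gt0 ?invr_gt0.
exists del => //; exists (64 * Cg + K); first by rewrite addr_gt0 // mulr_gt0.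
move=> V e N a emb ha n y E nN; set w := heat e beta a n (delta y).
have grad_w : gradsq e w <= Cg * powS n (- 2) := grad_decay V e N a emb ha n y nN.
have grad_ge0 : 0 <= gradsq e w by rewrite sumr_ge0 // => F _; rewrite sqr_ge0.
have [n64|n64] := ltnP n.+1 64.
  apply: le_trans (ediff_sqr_le_gradsq e w E) _; apply: (le_trans grad_w).
  apply: (@le_trans _ _ (64 * Cg * powS n (- (2 + del)))); last by rewrite ler_wpM2r ?powS_ge0 // lerDl ltW.
  by rewrite [leRHS]mulrAC [leRHS]mulrC ler_pM2l // powS_le_scale //; [exact: ltnW|lra].
pose J := trunc_log 64 n.+1.
have /andP[J1 J2] : (64 ^ J <= n.+1 < 64 ^ J.+1)%N by rewrite trunc_logP // trunc_log_ltn.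
have J0 : (0 < J)%N by rewrite lt0n; apply/eqP => J0; move: J2 n64; rewrite J0 expn1; clear; lia.
have JN : (6 * 2 ^ J <= N)%N.
  have pow2_gt0 : (0 < 2 ^ J)%N by rewrite expn_gt0.
  have scale_le : (32 * 2 ^ J <= 64 ^ J)%N.
    by rewrite -[64%N]/(32 * 2)%N expnMn leq_mul2r -{1}(expn1 32) leq_exp2l // J0 orbT.
  by move: scale_le J1 nN pow2_gt0; clear; lia.
apply: le_trans (ediff_sqr_le_hole_filling E emb ha (fun x => sup_decay V e N a emb ha n y x nN)
  (fun x => lap_decay V e N a emb ha n y x nN) JN) _.
rewrite [leRHS]mulrDl; apply: lerD.
  apply: le_trans (ler_pM _ grad_ge0 (exprn_trunc_log_le (ltW th0) del03 th_le J2) grad_w) _.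
    by rewrite exprn_ge0 // ltW.
  by rewrite (_ : - (2 + del) = - del - 2 :> R) ?powSD; [apply: le_of_eq; ring|ring].
have src_ge0 : 0 <= 16 * (2 * (C1 * powS n (- 1)) * (C2 * powS n (- 2)) / alpha).
  by rewrite mulr_ge0 // divr_ge0 ?(ltW alpha_gt0) // !mulr_ge0 ?powS_ge0 // ltW.
rewrite mulrA; apply: le_trans (ler_wpM2r src_ge0 (sqr_trunc_log_le J1)) _.
have -> : 9 * powS n (2 / 3) * (16 * (2 * (C1 * powS n (- 1)) * (C2 * powS n (- 2)) / alpha)) =
  K * (powS n (2 / 3) * powS n (- 1) * powS n (- 2)) by rewrite /K; ring.
by rewrite -!powSD ler_pM2l //; apply: ler_powS; lra.
Qed.

Lemma ex_dipole_bound_2d : exists2 del : R, 0 < del & exists C, @dipole_bound R 2 alpha beta C del.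
Proof.
have [del del0 [C C0 H]] := heat_kernel_ediff_decay; exists (del / 2); first by rewrite divr_gt0.
have sC : 0 < Num.sqrt C by rewrite sqrtr_gt0.
exists (2 * Num.sqrt C); split; first by rewrite mulr_gt0.
move=> V e N a tor ha n E nN; set h := heat e beta a n (dipole e E).
have hediff x : h x = ediff e E (heat e beta a n (delta x)) by rewrite -[LHS]dot_delta dot_heat dotC dot_dipole.
have sC0 := ltW sC; have C0' := ltW C0; have hb x : `|h x| <= Num.sqrt C * powS n (- (1 + del / 2)).
  rewrite -(@ler_pXn2r _ 2) ?nnegrE ?normr_ge0 ?mulr_ge0 ?powS_ge0 // real_normK ?num_real //.
  rewrite exprMn sqr_sqrtr // powS_exprn hediff; apply: le_trans (H V e N a tor ha n x E nN) _.
  by apply: le_of_eq; congr (_ * powS _ _); field.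
apply: (@le_trans _ _ (\sum_x Num.sqrt C * powS n (- (1 + del / 2)) * `|h x|)).
  apply: ler_sum => x _; rewrite -expr2 -real_normK ?num_real // expr2; apply: ler_wpM2r => //.
rewrite -mulr_sumr mulrC -[2 * _ * _]mulrA; apply: ler_wpM2r; first by rewrite mulr_ge0 ?powS_ge0 // ltW.
apply: le_trans (heat_l1_le e d2 alpha_gt0 le_ab ha _ _) _.
apply: (@le_trans _ _ (\sum_x (delta (E.1 + e E.2) x + delta E.1 x))).
  by apply: ler_sum => x _; rewrite /dipole; apply: le_trans (ler_normB _ _) _; rewrite !ger0_norm // /delta ler0n.
by rewrite big_split /= !sum_delta.
Qed.

End GradientSup.

(** * Weighted estimates and total variation *)

Section Davies.
Variables (R : realType) (V : finZmodType) (d : nat) (e : 'I_d -> V) (alpha beta : R).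
Hypotheses (d_gt0 : (0 < d)%N) (alpha_gt0 : 0 < alpha) (le_ab : alpha <= beta).
Local Notation c := (spec_bound d beta).
Let c0 : 0 < c := spec_bound_gt0 d_gt0 alpha_gt0 le_ab.
Variable a : V * 'I_d -> R.
Hypothesis ha : elliptic alpha beta a.

(* The cross term of the carre du champ is absorbed by the dissipation, up to the logarithmic gradient of the weight. *)
Lemma weighted_edge_le (k px py fx fy : R) : 0 < px -> 0 < py -> (py - px) ^+ 2 <= k * (px * py) ->
  - ((px + py) / 2) * (fy - fx) ^+ 2 - (py - px) * (fx + fy) * (fy - fx) <= k * (px * fx ^+ 2 + py * fy ^+ 2).
Proof.
move=> px0 py0 h; set P := px + py; have P0 : 0 < P by rewrite addr_gt0.
set q := py - px in h *; set s := fx + fy; set D := fy - fx; set B := px * fx ^+ 2 + py * fy ^+ 2.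
have k0 : 0 <= k.
  by have := le_trans (sqr_ge0 q) h; rewrite pmulr_lge0 // mulr_gt0.
have upper : q ^+ 2 * s ^+ 2 <= k * (px * py) * (2 * (fx ^+ 2 + fy ^+ 2)).
  apply: ler_pM; rewrite ?sqr_ge0 //; have := sqr_ge0 (fx - fy); rewrite /s; lra.
have lower : k * (px * py) * (2 * (fx ^+ 2 + fy ^+ 2)) <= 2 * P * (k * B).
  have -> : 2 * P * (k * B) = k * (2 * (P * B)) by ring.
  rewrite -mulrA; apply: ler_wpM2l => //.
  have -> : 2 * (P * B) = px * py * (2 * (fx ^+ 2 + fy ^+ 2)) + 2 * ((px * fx) ^+ 2 + (py * fy) ^+ 2).
    by rewrite /P /B; ring.
  by rewrite lerDl mulr_ge0 // addr_ge0 // sqr_ge0.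
have twoP_gt0 : 0 < 2 * P by rewrite mulr_gt0.
rewrite -(ler_pM2l twoP_gt0) -subr_ge0.
have -> : 2 * P * (k * B) - 2 * P * (- (P / 2) * D ^+ 2 - q * s * D) =
  2 * P * (k * B) - q ^+ 2 * s ^+ 2 + (q * s + P * D) ^+ 2 by field.
by rewrite addr_ge0 ?sqr_ge0 // subr_ge0 (le_trans upper).
Qed.

Lemma sum_edge_ends (F : V -> R) : \sum_E (F E.1 + F (E.1 + e E.2)) = 2 * d%:R * \sum_x F x.
Proof.
rewrite (sum_edges (fun E => F E.1 + F (E.1 + e E.2))) exchange_big /=.
under eq_bigr => i _ do rewrite big_split /= (sum_translate F (e i)).
by rewrite sumr_const card_ord -[LHS]mulr_natl; ring.
Qed.

Lemma weighted_heat_step_le (k : R) (w f : V -> R) : 0 <= k -> (forall x, 0 < w x) ->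
  (forall E, (w (E.1 + e E.2) - w E.1) ^+ 2 <= k * (w E.1 * w (E.1 + e E.2))) ->
  \sum_x w x * heat_step e beta a f x ^+ 2 <= (1 + k / 2) * \sum_x w x * f x ^+ 2.
Proof.
move=> k0 w0 hw.
have ab E : a E <= beta by case/andP: (ha E).
have b0 : 0 < beta := beta_gt0 alpha_gt0 le_ab.
have scaled_sqr := weighted_scaled_lap_sqr_le e d_gt0 alpha_gt0 le_ab ha f (fun x => ltW (w0 x)).
pose X E := a E * (w E.1 + w (E.1 + e E.2)) * ediff e E f ^+ 2.
pose Y E := a E * (w (E.1 + e E.2) - w E.1) * (f E.1 + f (E.1 + e E.2)) * ediff e E f.
have expand : \sum_x w x * heat_step e beta a f x ^+ 2 = \sum_x w x * f x ^+ 2 - 2 * dot (fun x => w x * f x) (scaled_lap e beta a f) + \sum_x w x * scaled_lap e beta a f x ^+ 2.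
  by rewrite /dot mulr_sumr -sumrB -big_split /=; apply: eq_bigr => x _; rewrite /heat_step; ring.
have cross : 2 * dot (fun x => w x * f x) (scaled_lap e beta a f) = c^-1 * \sum_E (X E + Y E).
  rewrite /scaled_lap dotZr dot_lap mulrCA; congr (_ * _); rewrite mulr_sumr; apply: eq_bigr => E _.
  by rewrite /X /Y /ediff; ring.
have cross_le : \sum_E (- (X E / 2) - Y E) <= \sum_E beta * k * (w E.1 * f E.1 ^+ 2 + w (E.1 + e E.2) * f (E.1 + e E.2) ^+ 2).
  apply: ler_sum => E _; have := weighted_edge_le (f E.1) (f (E.1 + e E.2)) (w0 E.1) (w0 (E.1 + e E.2)) (hw E).
  move=> /(ler_wpM2l (elliptic_ge0 alpha_gt0 ha E)) h; rewrite /X /Y /ediff.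
  apply: (@le_trans _ _ (a E * (k * (w E.1 * f E.1 ^+ 2 + w (E.1 + e E.2) * f (E.1 + e E.2) ^+ 2)))).
    by apply: le_trans h; apply: le_of_eq; field.
  rewrite -[leRHS]mulrA; apply: ler_wpM2r => //.
  by rewrite mulr_ge0 // addr_ge0 // mulr_ge0 ?sqr_ge0 // ltW.
rewrite -mulr_sumr (sum_edge_ends (fun x => w x * f x ^+ 2)) in cross_le.
have c_inv_ge0 : 0 <= c^-1 by rewrite invr_ge0 ltW.
move: cross_le => /(ler_wpM2l c_inv_ge0).
have -> : c^-1 * (beta * k * (2 * d%:R * \sum_x w x * f x ^+ 2)) = k / 2 * \sum_x w x * f x ^+ 2.
  rewrite spec_boundE; field; rewrite gt_eqF //=; have := d_gt0; rewrite lt0n -(pnatr_eq0 R); by move=> ->.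
rewrite expand cross mulrDl mul1r.
have -> : c^-1 * \sum_E (- (X E / 2) - Y E) = (2 * c)^-1 * (\sum_E X E) - c^-1 * \sum_E (X E + Y E).
  rewrite [(2 * c)^-1]invfM mulrC [2^-1 * _]mulrC; rewrite mulrC -mulrA -mulrBr; congr (_ * _).
  by rewrite mulr_sumr -sumrB; apply: eq_bigr => E _; field.
move: scaled_sqr; rewrite -/X.
set lapsq := \sum_x _; set X_half := (2 * c)^-1 * _; set XY := c^-1 * _; set growth := k / 2 * _; set step := \sum_x _.
by clearbody lapsq X_half XY growth step; lra.
Qed.

Lemma weighted_heat_le (k : R) (w f : V -> R) n : 0 <= k -> (forall x, 0 < w x) ->
  (forall E, (w (E.1 + e E.2) - w E.1) ^+ 2 <= k * (w E.1 * w (E.1 + e E.2))) ->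
  \sum_x w x * heat e beta a n f x ^+ 2 <= (1 + k / 2) ^+ n * \sum_x w x * f x ^+ 2.
Proof.
move=> k0 w0 hw; elim: n => [|n IH]; first by rewrite expr0 mul1r.
apply: le_trans (weighted_heat_step_le _ k0 w0 hw) _; rewrite exprS -mulrA; apply: ler_wpM2l => //.
by rewrite addr_ge0 // divr_ge0.
Qed.

Definition tdist m x y : nat := \sum_(k < m) ~~ sup_ball e k y x.

Lemma tdist_lip m x y y' : (forall r, sup_ball e r y x -> sup_ball e r.+1 y' x) -> (tdist m x y' <= (tdist m x y).+1)%N.
Proof.
move=> h; case: m => [|m]; first by rewrite /tdist big_ord0.
rewrite /tdist big_ord_recl /= -[X in (_ <= X)%N]add1n; apply: leq_add; first by case: (sup_ball _ _ _ _).
rewrite [X in (_ <= X)%N]big_ord_recr /=; apply: leq_trans (leq_addr _ _).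
apply: leq_sum => k _; have := h k; rewrite /bump /= add1n.
by case: (sup_ball e k y x) => [/(_ isT) ->|_] //; exact: leq_b1.
Qed.

Lemma tdist_gt m x y r : (r < m)%N -> ~~ sup_ball e r y x -> (r < tdist m x y)%N.
Proof.
move=> rm h; rewrite /tdist -(subnKC rm) big_split_ord /=; apply: leq_trans (leq_addr _ _).
have -> : (\sum_(i < r.+1) ~~ sup_ball e i y x = \sum_(i < r.+1) 1)%N.
  apply: eq_bigr => i _; rewrite (contra _ h) //; apply: sup_ball_mono; by rewrite -ltnS.
by rewrite sum1_card card_ord.
Qed.

Lemma tdist_refl m x : tdist m x x = 0%N.
Proof. by rewrite /tdist big1 // => k _; rewrite sup_ball_refl. Qed.

Definition dist_weight (r : R) p m x y := (1 + (tdist m x y)%:R / r) ^+ p.+1.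

Lemma exprn_log_lip (s t r : R) p : 1 <= s -> s <= t -> t <= s + r^-1 -> 1 <= r ->
  (t ^+ p.+1 - s ^+ p.+1) ^+ 2 <= p.+1%:R ^+ 2 * 2 ^+ p.+1 / r ^+ 2 * (s ^+ p.+1 * t ^+ p.+1).
Proof.
move=> s1 st ts r1; have r0 : 0 < r by lra.
have s0 : 0 <= s by lra. have t0 : 0 <= t by lra. have t1 : 1 <= t by lra.
have ri : r^-1 <= 1 by rewrite invf_le1.
have t_le2s : t <= 2 * s by lra.
have sub_le : t ^+ p.+1 - s ^+ p.+1 <= p.+1%:R * t ^+ p.+1 / r.
  have := exprn_tangent_le p t0 s0 => tangent.
  apply: (@le_trans _ _ (p.+1%:R * t ^+ p * (t - s))).
    by rewrite -[t - s]opprB mulrN; lra.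
  apply: ler_pM; rewrite ?subr_ge0 ?mulr_ge0 ?exprn_ge0 //; last lra.
  by apply: ler_wpM2l => //; rewrite exprS ler_peMl // exprn_ge0.
have sub_ge0 : 0 <= t ^+ p.+1 - s ^+ p.+1 by rewrite subr_ge0 lerXn2r ?nnegrE.
apply: le_trans (ler_sqr_nneg sub_ge0 sub_le) _; rewrite expr_div_n exprMn.
have tX_le : t ^+ p.+1 <= 2 ^+ p.+1 * s ^+ p.+1 by rewrite -exprMn lerXn2r ?nnegrE // mulr_ge0.
have -> : p.+1%:R ^+ 2 * 2 ^+ p.+1 / r ^+ 2 * (s ^+ p.+1 * t ^+ p.+1) =
  p.+1%:R ^+ 2 / r ^+ 2 * ((2 ^+ p.+1 * s ^+ p.+1) * t ^+ p.+1) by ring.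
rewrite mulrAC; apply: ler_wpM2l; first by rewrite divr_ge0 // ?sqr_ge0.
by rewrite expr2; apply: ler_wpM2r => //; rewrite exprn_ge0.
Qed.

Lemma dist_weight_ge1 r p m x y : 1 <= r -> 1 <= dist_weight r p m x y.
Proof. by move=> r1; rewrite /dist_weight exprn_ege1 // lerDl divr_ge0 //; lra. Qed.

Lemma dist_weight_lip r p m x E : 1 <= r -> (dist_weight r p m x (E.1 + e E.2) - dist_weight r p m x E.1) ^+ 2 <=
  p.+1%:R ^+ 2 * 2 ^+ p.+1 / r ^+ 2 * (dist_weight r p m x E.1 * dist_weight r p m x (E.1 + e E.2)).
Proof.
move=> r1; have r0 : 0 < r by lra.
have step_up : (tdist m x (E.1 + e E.2)%R <= (tdist m x E.1).+1)%N.
  by apply: tdist_lip => k h; apply: (@sup_ball_down _ _ _ _ _ E.2); rewrite addrK.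
have step_down : (tdist m x E.1 <= (tdist m x (E.1 + e E.2)%R).+1)%N by apply: tdist_lip => k; exact: sup_ball_up.
have g1 k : 1 <= 1 + k%:R / r by rewrite lerDl divr_ge0 //; lra.
have lip (k l : nat) : (l <= k.+1)%N -> 1 + l%:R / r <= 1 + k%:R / r + r^-1.
  by move=> lk; rewrite -addrA lerD2l -[X in _ + X]mul1r -mulrDl ler_pM2r ?invr_gt0 // natr1 ler_nat.
have mon (k l : nat) : (l <= k)%N -> 1 + l%:R / r <= 1 + k%:R / r.
  by move=> lk; rewrite lerD2l ler_pM2r ?invr_gt0 // ler_nat.
have [h|h] := leqP (tdist m x E.1) (tdist m x (E.1 + e E.2)).
  by apply: exprn_log_lip => //; [exact: mon|exact: lip].
rewrite -sqrrN opprB [X in _ * X]mulrC; apply: exprn_log_lip => //; [exact/mon/ltnW|exact: lip].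
Qed.

Lemma weighted_heat_dipole_le p m n (E : V * 'I_d) :
  \sum_y dist_weight (powS n 2^-1) p m E.1 y * heat e beta a n (dipole e E) y ^+ 2 <= expR (p.+1%:R ^+ 2 * 2 ^+ p.+1) * (4 * 2 ^+ p.+1).
Proof.
set r := powS n 2^-1; set K := p.+1%:R ^+ 2 * 2 ^+ p.+1.
have r1 : 1 <= r by rewrite -(powSr0 R n) ler_powS.
have rsqr : r ^+ 2 = n.+1%:R by rewrite /r powS_exprn mulVf // powSr1.
have K0 : 0 <= K by rewrite mulr_ge0 ?sqr_ge0 // exprn_ge0.
have k0 : 0 <= K / r ^+ 2 by rewrite divr_ge0 // sqr_ge0.
apply: le_trans (weighted_heat_le _ _ k0 (fun y => lt_le_trans ltr01 (dist_weight_ge1 p m E.1 y r1)) (fun F => dist_weight_lip p m E.1 F r1)) _.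
have w0 x : 0 <= dist_weight r p m E.1 x by apply: le_trans (dist_weight_ge1 p m E.1 x r1).
apply: ler_pM; first by rewrite exprn_ge0 // addr_ge0 // divr_ge0.
- by rewrite sumr_ge0 // => x _; rewrite mulr_ge0 ?sqr_ge0.
- apply: (@le_trans _ _ (expR (K / n.+1%:R) ^+ n.+1)).
    have x1 : 1 + K / r ^+ 2 / 2 <= expR (K / n.+1%:R).
      by apply: le_trans (expR_ge1Dx _); rewrite -rsqr lerD2l ler_pdivrMr // ler_peMr // ler1n.
    have x0 : 1 <= 1 + K / r ^+ 2 / 2 by rewrite lerDl divr_ge0.
    apply: (@le_trans _ _ ((1 + K / r ^+ 2 / 2) ^+ n.+1)); last by rewrite lerXn2r ?nnegrE ?expR_ge0 //; lra.
    by rewrite [leRHS]exprS ler_peMl // exprn_ge0 // (le_trans ler01).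
  by rewrite -expRM_natl mulrC divfK.
apply: (@le_trans _ _ (\sum_x 2 * (dist_weight r p m E.1 x * delta (E.1 + e E.2) x + dist_weight r p m E.1 x * delta E.1 x))).
  apply: ler_sum => x _; rewrite -mulrDr [2 * _]mulrCA; apply: ler_wpM2l => //.
  by rewrite /dipole /delta; case: eqP; case: eqP; rewrite /= ?mulr1n ?mulr0n; lra.
have sum_weight_delta y : \sum_x dist_weight r p m E.1 x * delta y x = dist_weight r p m E.1 y.
  by under eq_bigr do rewrite mulrC; exact: dot_delta.
rewrite -mulr_sumr big_split /= !sum_weight_delta.
have weight_base : dist_weight r p m E.1 E.1 = 1 by rewrite /dist_weight tdist_refl mul0r addr0 expr1n.
have weight_nbr : dist_weight r p m E.1 (E.1 + e E.2) <= 2 ^+ p.+1.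
  rewrite /dist_weight lerXn2r ?nnegrE // ?addr_ge0 ?divr_ge0 //; first lra.
  have l1 : (tdist m E.1 (E.1 + e E.2)%R <= 1)%N.
    rewrite -[1%N]/(0.+1) -(tdist_refl m E.1).
    by apply: tdist_lip => k h; apply: (@sup_ball_down _ _ _ _ _ E.2); rewrite addrK.
  have : (tdist m E.1 (E.1 + e E.2))%:R / r <= 1.
    by rewrite ler_pdivrMr ?mul1r; [apply: le_trans r1; rewrite -[leRHS]/(1%:R) ler_nat|lra].
  lra.
have : 1 <= 2 ^+ p.+1 :> R by rewrite exprn_ege1 // ler1n.
by rewrite weight_base; lra.
Qed.

Lemma sum_ediff_heat_exprn_le n p (D : R) (f : V -> R) : 0 <= D -> (forall E, \sum_y `|heat e beta a n (dipole e E) y| <= D) ->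
  \sum_E `|ediff e E (heat e beta a n f)| ^+ p.+1 <= D ^+ p * (2 * d%:R * \sum_x `|f x| ^+ p.+1).
Proof.
move=> D0 l1_le; pose H E := heat e beta a n (dipole e E).
have edgeE E : ediff e E (heat e beta a n f) = \sum_y H E y * f y by rewrite -dot_dipole dot_heat.
apply: (@le_trans _ _ (\sum_E D ^+ p * \sum_y `|H E y| * `|f y| ^+ p.+1)).
  apply: ler_sum => E _; rewrite edgeE.
  apply: (@le_trans _ _ ((\sum_y `|H E y| * `|f y|) ^+ p.+1)).
    rewrite lerXn2r ?nnegrE ?normr_ge0 ?sumr_ge0 //.
    by apply: le_trans (ler_norm_sum _ _ _) _; apply: ler_sum => y _; rewrite normrM.
  apply: le_trans (sum_exprn_le_weights _ _ _) _ => //.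
  apply: ler_wpM2r; first by rewrite sumr_ge0 // => y _; rewrite mulr_ge0 ?exprn_ge0.
  by rewrite lerXn2r ?nnegrE ?sumr_ge0 ?l1_le.
rewrite -mulr_sumr; apply: ler_wpM2l; first by rewrite exprn_ge0.
rewrite exchange_big /= mulr_sumr; apply: ler_sum => y _; rewrite -mulr_suml; apply: ler_wpM2r; first by rewrite exprn_ge0.
pose k := heat e beta a n (delta y).
have k0 x : 0 <= k x by apply: (heat_ge0 e d_gt0 alpha_gt0 le_ab ha) => z; rewrite ler0n.
apply: (@le_trans _ _ (\sum_E (k E.1 + k (E.1 + e E.2)))).
  apply: ler_sum => E _; have -> : H E y = ediff e E k.
    by rewrite /H -[LHS]dot_delta dot_heat dotC dot_dipole.
  by apply: le_trans (ler_normB _ _) _; rewrite !ger0_norm // addrC.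
by rewrite sum_edge_ends /k sum_heat sum_delta mulr1.
Qed.

End Davies.

Section TotalVariation.
Variables (R : realType) (alpha beta C del : R).
Hypotheses (alpha_gt0 : 0 < alpha) (le_ab : alpha <= beta).
Hypotheses (del_gt0 : 0 < del) (del_le1 : del <= 1) (HC : @dipole_bound R 2 alpha beta C del).
Let d2 : (0 < 2)%N. Proof. by []. Qed.

Lemma sqr_sum_sup_ball_le (V : finZmodType) (e : 'I_2 -> V) r x (P : pred V) (f : V -> R) : (forall y, P y -> sup_ball e r y x) ->
  (\sum_(y | P y) `|f y|) ^+ 2 <= (2 * r).+1%:R ^+ 2 * \sum_(y | P y) f y ^+ 2.
Proof.
move=> h; have := @sum_CauchySchwarz R V P (fun=> 1) (fun y => `|f y|).
under eq_bigr do rewrite mul1r; move/le_trans; apply.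
have -> : \sum_(y | P y) `|f y| ^+ 2 = \sum_(y | P y) f y ^+ 2.
  by apply: eq_bigr => y _; rewrite real_normK ?num_real.
under [X in X * _ <= _]eq_bigr do rewrite expr1n; apply: ler_wpM2r.
  by rewrite sumr_ge0 // => y _; rewrite sqr_ge0.
rewrite sumr_const -natrX ler_nat; apply: leq_trans (card_cube_le e (x - diag_pt e r) (2 * r).+1).
by apply: subset_leq_card; apply/fintype.subsetP => y yP; rewrite inE; apply: sup_ball_sym; exact: h.
Qed.

Let dipole_cst_gt0 : 0 < C. Proof. by case: HC. Qed.

Lemma sum_near_heat_dipole_le (V : finZmodType) (e : 'I_2 -> V) N a n E r : box_embeds e N -> elliptic alpha beta a ->
  (n <= N)%N -> r%:R <= powS n (2^-1 + del / 4) ->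
  \sum_(y | sup_ball e r y E.1) `|heat e beta a n (dipole e E) y| <= Num.sqrt (9 * C) * powS n (- (del / 4)).
Proof.
move=> emb ha nN; set h := heat e beta a n (dipole e E); set s := powS n _ => rs.
have s1 : 1 <= s.
  by rewrite -(powSr0 R n); apply: ler_powS; rewrite addr_ge0 ?invr_ge0 ?divr_ge0 // ltW.
rewrite -(@ler_pXn2r _ 2) ?nnegrE ?mulr_ge0 ?sqrtr_ge0 ?powS_ge0 ?sumr_ge0 //.
rewrite exprMn sqr_sqrtr ?mulr_ge0 ?(ltW dipole_cst_gt0) //.
apply: (le_trans (@sqr_sum_sup_ball_le V e r E.1 (fun y => sup_ball e r y E.1) h (fun y hy => hy))).
apply: (@le_trans _ _ ((3 * s) ^+ 2 * (C * powS n (- (1 + del))))).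
  apply: ler_pM; [exact: sqr_ge0|by rewrite sumr_ge0 // => y _; exact: sqr_ge0| |].
    by apply: ler_sqr_nneg => //; rewrite -natr1 natrM; lra.
  have [_ decay] := HC; apply: le_trans (decay V e N a emb ha n E nN); rewrite -/h /dot.
  by under [leRHS]eq_bigr do rewrite -expr2; apply: ler_sum_cond => y; exact: sqr_ge0.
rewrite exprMn /s !powS_exprn; set X := powS n _; set Y := powS n _; set Z := powS n _.
have -> : Z = X * Y by rewrite -powSD; congr powS; field.
by apply: le_of_eq; ring.
Qed.

Lemma far_heat_dipole_sqr_le (V : finZmodType) (e : 'I_2 -> V) a n E r p y : powS n (2^-1 + del / 4) < r.+1%:R ->
  ~~ sup_ball e r y E.1 ->
  heat e beta a n (dipole e E) y ^+ 2 <= powS n (- (p.+1%:R * (del / 4))) *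
    (dist_weight e (powS n 2^-1) p n.+1 E.1 y * heat e beta a n (dipole e E) y ^+ 2).
Proof.
move=> sr yr; have [yn|yn] := boolP (sup_ball e n.+1 y E.1); last first.
  by rewrite heat_dipole_local // expr0n !mulr0.
have rn : (r < n.+1)%N.
  by rewrite ltnNge; apply/negP => nr; move: yr; rewrite (sup_ball_mono nr yn).
have weight_ge : powS n (p.+1%:R * (del / 4)) <= dist_weight e (powS n 2^-1) p n.+1 E.1 y.
  have -> : powS n (p.+1%:R * (del / 4)) = powS n (del / 4) ^+ p.+1 :> R by rewrite powS_exprn; congr powS; ring.
  rewrite /dist_weight lerXn2r ?nnegrE ?powS_ge0 // ?addr_ge0 ?divr_ge0 ?powS_ge0 //.
  apply: (@le_trans _ _ ((tdist e n.+1 E.1 y)%:R / powS n 2^-1)); last by lra.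
  rewrite ler_pdivlMr ?powS_gt0 // -powSD addrC; apply: ltW; apply: (lt_le_trans sr).
  by rewrite ler_nat (tdist_gt rn yr).
rewrite [leRHS]mulrA ler_peMl ?sqr_ge0 //.
by rewrite -[leLHS](powS_mulN n (p.+1%:R * (del / 4))) [leLHS]mulrC ler_wpM2l ?powS_ge0.
Qed.

Lemma sum_far_heat_dipole_le p : 2 + del / 2 <= p.+1%:R * (del / 4) -> exists2 K : R, 0 < K &
  forall (V : finZmodType) (e : 'I_2 -> V) a n E r, elliptic alpha beta a -> powS n (2^-1 + del / 4) < r.+1%:R ->
  \sum_(y | ~~ sup_ball e r y E.1) `|heat e beta a n (dipole e E) y| <= K * powS n (- (del / 4)).
Proof.
move=> hp; pose K : R := expR (p.+1%:R ^+ 2 * 2 ^+ p.+1) * (4 * 2 ^+ p.+1).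
have K0 : 0 < K by rewrite mulr_gt0 ?expR_gt0 // mulr_gt0 // exprn_gt0.
exists (Num.sqrt (9 * K)); first by rewrite sqrtr_gt0 mulr_gt0.
move=> V e a n E r ha sr; set h := heat e beta a n (dipole e E).
pose Q y := ~~ sup_ball e r y E.1 && sup_ball e n.+1 y E.1.
have -> : \sum_(y | ~~ sup_ball e r y E.1) `|h y| = \sum_(y | Q y) `|h y|.
  rewrite (bigID (fun y => sup_ball e n.+1 y E.1)) /= [X in _ + X]big1 ?addr0 // => y /andP[_ ny].
  by rewrite /h heat_dipole_local ?normr0.
rewrite -(@ler_pXn2r _ 2) ?nnegrE ?mulr_ge0 ?sqrtr_ge0 ?powS_ge0 ?sumr_ge0 //.
rewrite exprMn sqr_sqrtr ?mulr_ge0 ?(ltW K0) //.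
apply: (le_trans (@sqr_sum_sup_ball_le V e n.+1 E.1 Q h _)) => [y /andP[]//|].
have root_ge1 : 1 <= powS n 2^-1 :> R by rewrite -[leLHS](powSr0 R n); apply: ler_powS; rewrite invr_ge0.
have h_sqr_le : \sum_(y | Q y) h y ^+ 2 <= powS n (- (p.+1%:R * (del / 4))) * K.
  apply: (@le_trans _ _ (\sum_(y | Q y) powS n (- (p.+1%:R * (del / 4))) *
      (dist_weight e (powS n 2^-1) p n.+1 E.1 y * h y ^+ 2))).
    by apply: ler_sum => y /andP[yr _]; exact: far_heat_dipole_sqr_le yr.
  rewrite -mulr_sumr ler_wpM2l ?powS_ge0 //.
  apply: le_trans (weighted_heat_dipole_le e d2 alpha_gt0 le_ab ha p n.+1 n E).
  apply: ler_sum_cond => y; rewrite mulr_ge0 ?sqr_ge0 //.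
  exact: le_trans (dist_weight_ge1 _ _ _ _ _ root_ge1).
apply: (@le_trans _ _ ((3 * powS n 1) ^+ 2 * (powS n (- (p.+1%:R * (del / 4))) * K))).
  apply: ler_pM; rewrite ?sqr_ge0 ?sumr_ge0 //; first by move=> y _; exact: sqr_ge0.
  by apply: ler_sqr_nneg => //; rewrite powSr1 -natrM ler_nat; clear; lia.
rewrite exprMn !powS_exprn -natrX; have -> : (3 ^ 2)%:R * powS n (1 * 2) * (powS n (- (p.+1%:R * (del / 4))) * K) =
  9 * K * (powS n (1 * 2) * powS n (- (p.+1%:R * (del / 4)))) :> R by ring.
rewrite -powSD ler_wpM2l ?mulr_ge0 ?(ltW K0) //.
by apply: ler_powS; move: hp; set X := p.+1%:R * _; clearbody X; lra.
Qed.

Lemma heat_dipole_l1_decay : exists2 K : R, 0 < K &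
  forall (V : finZmodType) (e : 'I_2 -> V) N a, box_embeds e N -> elliptic alpha beta a ->
  forall n E, (n <= N)%N -> \sum_y `|heat e beta a n (dipole e E) y| <= K * powS n (- (del / 4)).
Proof.
have [p hp] : exists p, 2 + del / 2 <= p.+1%:R * (del / 4).
  exists (Num.truncn (10 / del)); have := truncnS_gt (10 / del); rewrite ltr_pdivrMr //.
  by rewrite mulrA; move: (_ * del) => z; have := del_le1; lra.
have [K K0 far_le] := sum_far_heat_dipole_le hp.
exists (Num.sqrt (9 * C) + K); first by rewrite addr_gt0 // sqrtr_gt0 mulr_gt0.
move=> V e N a emb ha n E nN; pose r := Num.truncn (powS n (2^-1 + del / 4) : R).
rewrite (bigID (fun y => sup_ball e r y E.1)) /= mulrDl; apply: lerD.
  by apply: sum_near_heat_dipole_le emb ha nN _; rewrite truncn_le ?powS_ge0.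
by apply: far_le => //; exact: truncnS_gt.
Qed.

Lemma grad_norm_le_l1 p (M : torus_model 2 alpha beta) n k (D : R) : 0 <= D ->
  (forall s E, \sum_y `|heat (tm_dir M) beta (env (M := M) s) n (dipole (tm_dir M) E) y| <= D) ->
  grad_norm M p.+1 (n + k) ^+ p.+1 <= 4 * D ^+ p * sol_norm M p.+1 k ^+ p.+1.
Proof.
move=> D0 l1_le; rewrite grad_normX // sol_normX // /site_mean mulrCA ler_wpM2l ?invr_ge0 //.
rewrite -(expect_sum (tm_law M) xpredT (fun E st => `|ediff (tm_dir M) E (evolved st (n + k))| ^+ p.+1)).
rewrite -(expect_sum (tm_law M) xpredT (fun x st => `|evolved st k x| ^+ p.+1)) -expectZ.
apply: le_model_expect => st.
have := sum_ediff_heat_exprn_le d2 alpha_gt0 le_ab (env_elliptic st) p (evolved st k) D0 (l1_le st).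
by rewrite -heat_addn => /le_trans; apply; apply: le_of_eq; ring.
Qed.

Lemma grad_norm_le_half_time p : exists2 K : R, 0 < K & forall (M : torus_model 2 alpha beta) n, (n <= tm_size M)%N ->
  grad_norm M (2 * p.+1) n <= K * powS n (- (del / 8)) * sol_norm M (2 * p.+1) (n - n./2).
Proof.
have [C1 C10 l1_decay] := heat_dipole_l1_decay; set q := (2 * p.+1)%N.
have q0 : (0 < q)%N by rewrite muln_gt0.
have qE : q = (2 * p).+1.+1 by rewrite /q; lia.
exists (nroot q 4 * (C1 + 1) * 2); first by rewrite !mulr_gt0 ?powR_gt0 // addr_gt0.
move=> M n nN; pose s := n./2; have sn : (s <= n)%N := leq_half n.
pose D := C1 * powS s (- (del / 4)); have D0 : 0 <= D by rewrite mulr_ge0 ?powS_ge0 // ltW.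
have X0 : 0 <= nroot q 4 * (C1 + 1) * 2 * powS n (- (del / 8)).
  by rewrite !mulr_ge0 ?powS_ge0 ?nroot_ge0 // addr_ge0 // ltW.
rewrite -(@ler_pXn2r _ q) ?nnegrE ?grad_norm_ge0 ?(mulr_ge0 X0) ?sol_norm_ge0 //.
apply: (@le_trans _ _ (4 * D ^+ q.-1 * sol_norm M q (n - s) ^+ q)).
  rewrite -{1}(subnKC sn) {1 2}qE /= -qE; apply: grad_norm_le_l1 => // st E.
  by apply: (l1_decay _ _ _ _ (tm_embeds M) (env_elliptic st)); exact: leq_trans nN.
rewrite [leRHS]exprMn ler_wpM2r ?exprn_ge0 ?sol_norm_ge0 //.
have -> : nroot q 4 * (C1 + 1) * 2 * powS n (- (del / 8)) = nroot q 4 * ((C1 + 1) * (2 * powS n (- (del / 8)))) by ring.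
rewrite [leRHS]exprMn [nroot q 4 ^+ q]nrootK // ler_wpM2l // !exprMn.
apply: ler_pM; rewrite ?exprn_ge0 ?powS_ge0 ?(ltW C10) //.
  apply: (@le_trans _ _ ((C1 + 1) ^+ q.-1)).
    by rewrite lerXn2r ?nnegrE ?addr_ge0 ?(ltW C10) // lerDl.
  by rewrite -{2}(prednK q0) exprS ler_peMl ?exprn_ge0 ?addr_ge0 ?lerDr ?(ltW C10).
have half_le : powS s (- (del / 4)) <= 2 * powS n (- (del / 4)) :> R.
  have dl := del_le1; apply: le_trans (powS_le_half _ (ltn_double_half n)) _; first by rewrite divr_ge0 ?ltW.
  rewrite ler_wpM2r ?powS_ge0 // -[leRHS](@powRr1 _ 2) //; apply: ler_powR; [by rewrite ler1n|lra].
apply: (@le_trans _ _ ((2 * powS n (- (del / 4))) ^+ q.-1)); first by rewrite lerXn2r ?nnegrE ?mulr_ge0 ?powS_ge0.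
rewrite exprMn !powS_exprn; apply: ler_pM; rewrite ?exprn_ge0 ?powS_ge0 //.
  by rewrite -{2}(prednK q0) exprS ler_peMl ?exprn_ge0 // ler1n.
apply: ler_powS; rewrite qE /= -[(2 * p).+2%:R]natr1; have : 1 <= (2 * p).+1%:R :> R by rewrite ler1n.
move: ((2 * p).+1%:R : R) => z z1; have : 0 <= del * (z - 1) by rewrite mulr_ge0 ?subr_ge0 // ltW.
lra.
Qed.

Lemma grad_norm_full_decay p (K sg : R) : 0 < K -> 0 <= sg <= 1 ->
  (forall (M : torus_model 2 alpha beta) n, (n <= tm_size M)%N -> sol_norm M (2 * p.+1) n <= K * powS n (- sg)) ->
  exists2 K' : R, 0 < K' & forall (M : torus_model 2 alpha beta) n, (n <= tm_size M)%N ->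
    grad_norm M (2 * p.+1) n <= K' * powS n (- (sg + del / 8)).
Proof.
move=> K0 /andP[sg0 sg1] sol_le; have [C1 C10 grad_le] := grad_norm_le_half_time p.
exists (C1 * (2 * K)); first by rewrite !mulr_gt0.
move=> M n nN; apply: (le_trans (grad_le M n nN)).
have half_le : powS (n - n./2) (- sg) <= 2 * powS n (- sg) :> R.
  apply: le_trans (powS_le_half sg0 (_ : (n < _)%N)) _; first by clear; lia.
  by rewrite ler_wpM2r ?powS_ge0 // -[leRHS](@powRr1 _ 2) //; apply: ler_powR; rewrite ?ler1n.
have sol_half := le_trans (sol_le M _ (leq_trans (leq_subr _ _) nN)) (ler_wpM2l (ltW K0) half_le).
have C1_ge0 : 0 <= C1 * powS n (- (del / 8)) by rewrite mulr_ge0 ?powS_ge0 // ltW.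
apply: le_trans (ler_wpM2l C1_ge0 sol_half) _.
by rewrite [sg + _]addrC opprD powSD; apply: le_of_eq; ring.
Qed.

End TotalVariation.

(** * Variance decay of the evolved drift *)

Lemma dipole_bound_le (R : realType) d (alpha beta C del del' : R) : del' <= del ->
  dipole_bound d alpha beta C del -> dipole_bound d alpha beta C del'.
Proof.
move=> dd [C0 H]; split => // V e N a tor ha n E nN; apply: le_trans (H V e N a tor ha n E nN) _.
by rewrite ler_pM2l //; apply: ler_powS; lra.
Qed.

Lemma sum_block_decay_le (R : realType) (b : nat -> R) (K w : R) N k : 0 <= K -> 0 <= w ->
  (forall s, (s <= N)%N -> b s <= K * powS s (- (1 + w))) ->
  \sum_(k <= s < (2 * k).+1 | (s <= N)%N) b s <= K * powS k (- w).
Proof.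
move=> K0 w0 b_le; apply: (@le_trans _ _ (\sum_(k <= s < (2 * k).+1) K * powS k (- (1 + w)))).
  rewrite big_mkcond /=; apply: ler_sum_nat => s /andP[ks _]; case: ifP => sN.
    by apply: le_trans (b_le s sN) _; rewrite ler_wpM2l // powS_antimono // oppr_le0 addr_ge0.
  by rewrite mulr_ge0 ?powS_ge0.
rewrite sumr_const_nat; have -> : ((2 * k).+1 - k = k.+1)%N by clear; lia.
by rewrite -[leLHS]mulr_natl -(powSr1 R) mulrCA -powSD opprD addNKr.
Qed.

Lemma ex_small_dipole_bound_2d (R : realType) (alpha beta : R) : 0 < alpha -> alpha <= beta ->
  exists C, exists2 del : R, 0 < del <= 1 / 2 & dipole_bound 2 alpha beta C del.
Proof.
move=> alpha0 le_ab; have [del del0 [C dip]] := ex_dipole_bound_2d alpha0 le_ab.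
exists C, (Num.min del (1 / 2)); first by rewrite lt_min del0 ge_min lexx orbT andbT /=; lra.
by apply: dipole_bound_le dip; rewrite ge_min lexx.
Qed.

Lemma variance_decay2 (R : realType) (alpha beta : R) :
  0 < alpha -> alpha <= beta -> exists2 C : R, 0 < C &
  forall (M : torus_model 2 alpha beta) n, (n <= tm_size M)%N -> sol_norm M 2 n <= C * powS n (- decay_exp R 2).
Proof.
move=> alpha0 le_ab; have d1 : (1 < 2)%N by [].
have decayE : decay_exp R 2 = 1 by rewrite /decay_exp; field.
have [C [del /andP[del0 del_half] HC]] := ex_small_dipole_bound_2d alpha0 le_ab.
have del1 : del <= 1 by lra.
pose w := del / 16; have w0 : 0 < w by rewrite divr_gt0.
pose eps := w / 8; have eps0 : 0 < eps by rewrite divr_gt0.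
have [m [p pE]] := exists_pow2_inv_le (mulr_gt0 (divr_gt0 del0 (ltr0n R 2)) eps0). set rho : R := _^-1 => rho_le.
have rho0 : 0 < rho by rewrite invr_gt0 ltr0n.
have rho_w : rho < w / 4.
  have : del / 2 * eps <= 1 * eps by rewrite ler_pM2r //; lra.
  by move: rho_le w0; rewrite /eps; lra.
pose gap := (1 - del) * rho; have gap0 : 0 < gap by rewrite mulr_gt0 //; lra.
have gap_lt : gap < rho by rewrite gtr_pMl //; lra.
have first_expE : first_exp 2 del p.+1 = 1 - gap.
  by rewrite /first_exp decayE /gap /rho natrM; congr (_ - _ * _); ring.
have [K1 K10 sol_le] : exists2 K : R, 0 < K & forall (M : torus_model 2 alpha beta) n, (n <= tm_size M)%N ->
    sol_norm M (2 * p.+1) n <= K * powS n (- (1 - gap)).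
  rewrite -first_expE -pE; apply: (sol_norm_first_decay d1 alpha0 le_ab HC); rewrite pE first_expE ?decayE -/rho; rewrite /w in rho_w; lra.
have gap01 : 0 <= 1 - gap <= 1 by rewrite /w in rho_w; lra.
have [K2 K20 grad_le] := grad_norm_full_decay alpha0 le_ab del0 del1 HC K10 gap01 sol_le.
have G0 := geom_cst_gt0 w0; pose K := geom_cst w + K2; have K0 : 0 < K by rewrite addr_gt0.
apply: (sol_norm_optimal_decay (p := p) (eps := eps) (w1 := w) (th := w) (K := K) d1 alpha0 le_ab del0 HC) => //;
  rewrite ?first_expE ?decayE -/rho ?eps0 //.
- by rewrite /eps /w; lra.
- by lra.
- by lra.
- by rewrite (_ : (1 + del - 1) / 2 * eps = del / 2 * eps); [lra|ring].
- by rewrite /eps; lra.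
- exact: ltW.
- by lra.
- move=> n; apply: (@le_trans _ _ (\sum_(0 <= t < n) powS t (w - 1))).
    by apply: ler_sum => t _; apply: ler_powS; lra.
  apply: le_trans (sum_powS_divergent_le _ _) _; first by rewrite w0 /w; lra.
  by rewrite ler_wpM2r ?powS_ge0 // /K lerDl ltW.
move=> M k kN; apply: (@le_trans _ _ (K2 * powS k (- w))).
  apply: sum_block_decay_le => [||s sN]; [exact: ltW|exact: ltW|].
  apply: le_trans (grad_le M s sN) _; rewrite ler_pM2l //.
  by apply: ler_powS; rewrite /w in rho_w *; lra.
by rewrite ler_wpM2r ?powS_ge0 // /K lerDr ltW.
Qed.

Lemma variance_decay (R : realType) (d : nat) (alpha beta : R) :
  (1 < d)%N -> 0 < alpha -> alpha <= beta -> exists2 C : R, 0 < C &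
  forall (M : torus_model d alpha beta) n, (n <= tm_size M)%N -> sol_norm M 2 n <= C * powS n (- decay_exp R d).
Proof.
case: d => [|[|[|d]]] // _ ? ?; first exact: variance_decay2.
exact: variance_decay_ge3.
Qed.

(** * Expectations and square-integrable functions *)

Lemma cvg_sum (R : realType) (I : Type) (s : seq I) (F : I -> nat -> R) (l : I -> R) :
  (forall i, F i k @[k --> \oo] --> l i) -> \sum_(i <- s) F i k @[k --> \oo] --> \sum_(i <- s) l i.
Proof. by move=> F_cvg; apply: cvg_big => //; exact: add_continuous. Qed.

Section RealIntegral.
Context (dd : measure_display) (T : measurableType dd) (R : realType).
Variables (mu : {measure set T -> \bar R}) (D : set T).
Hypothesis mD : measurable D.
Implicit Types f g : T -> R.

Definition Rintegrable f := mu.-integrable D (EFin \o f).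

Lemma Rintegrable_measurable f : Rintegrable f -> measurable_fun D f.
Proof. by move=> /integrableP[/measurable_EFinP]. Qed.

Lemma eq_Rintegrable f g : {in D, f =1 g} -> Rintegrable f -> Rintegrable g.
Proof. by move=> fg; apply: eq_integrable => // x Dx /=; rewrite fg. Qed.

Lemma le_Rintegrable f g : measurable_fun D f -> (forall x, D x -> `|f x| <= g x) ->
  Rintegrable g -> Rintegrable f.
Proof.
move=> mf fg; apply: le_integrable => //; first exact/measurable_EFinP.
move=> x Dx /=; rewrite lee_fin; exact: le_trans (fg x Dx) (ler_norm _).
Qed.

Lemma RintegrableD f g : Rintegrable f -> Rintegrable g -> Rintegrable (fun x => f x + g x).
Proof. by move=> hf hg; have := integrableD mD hf hg; apply: eq_Rintegrable. Qed.

Lemma RintegrableZl k f : Rintegrable f -> Rintegrable (fun x => k * f x).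
Proof. by move=> hf; have := integrableZl mD k hf; apply: eq_Rintegrable. Qed.

Lemma RintegrableN f : Rintegrable f -> Rintegrable (fun x => - f x).
Proof. by move=> hf; apply: eq_Rintegrable (RintegrableZl (- 1) hf) => x _; rewrite mulN1r. Qed.

Lemma RintegrableB f g : Rintegrable f -> Rintegrable g -> Rintegrable (fun x => f x - g x).
Proof. by move=> hf hg; apply: RintegrableD => //; exact: RintegrableN. Qed.

Lemma Rintegrable_norm f : Rintegrable f -> Rintegrable (fun x => `|f x|).
Proof. exact: integrable_norm. Qed.

Lemma RintegralN f : Rintegrable f -> \int[mu]_(x in D) (- f x) = - \int[mu]_(x in D) f x.
Proof.
by move=> h; rewrite -mulN1r -RintegralZl //; apply: eq_Rintegral => x _; rewrite mulN1r.
Qed.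

Lemma Rintegrable_sum (I : Type) (s : seq I) (F : I -> T -> R) : (forall i, Rintegrable (F i)) ->
  Rintegrable (fun x => \sum_(i <- s) F i x).
Proof.
move=> hF; elim: s => [|i s IH]; first by apply: eq_Rintegrable (integrable0 mu D) => x _; rewrite big_nil.
by apply: eq_Rintegrable (RintegrableD (hF i) IH) => x _; rewrite big_cons.
Qed.

Lemma Rintegral_sum (I : Type) (s : seq I) (F : I -> T -> R) : (forall i, Rintegrable (F i)) ->
  \int[mu]_(x in D) (\sum_(i <- s) F i x) = \sum_(i <- s) \int[mu]_(x in D) F i x.
Proof.
move=> hF; elim: s => [|i s IH].
  by under eq_Rintegral do rewrite big_nil; rewrite big_nil Rintegral_cst // mul0r.
under eq_Rintegral do rewrite big_cons.
by rewrite big_cons -IH (RintegralD mD (hF i) (Rintegrable_sum s hF)).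
Qed.

Lemma integral_EFin f : Rintegrable f -> (\int[mu]_(x in D) (f x)%:E)%E = (\int[mu]_(x in D) f x)%:E.
Proof. by move=> h; rewrite /Rintegral fineK //; exact: integrable_fin_num. Qed.

Lemma eq_ae_Rintegral f g : measurable_fun D g -> Rintegrable f -> {ae mu, forall x, D x -> f x = g x} ->
  Rintegrable g /\ \int[mu]_(x in D) f x = \int[mu]_(x in D) g x.
Proof.
move=> mg hf fg; have mf := Rintegrable_measurable hf.
have eq_int (h h' : T -> R) : measurable_fun D h -> measurable_fun D h' -> {ae mu, forall x, D x -> h x = h' x} ->
    (\int[mu]_(x in D) (h x)%:E = \int[mu]_(x in D) (h' x)%:E)%E.
  move=> mh mh' hh'; apply: ae_eq_integral => //; try exact/measurable_EFinP.
  by apply: filterS hh' => x hx Dx /=; rewrite hx.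
split; last by rewrite /Rintegral (eq_int _ _ mf mg fg).
case/integrableP: hf => _ f_fin; apply/integrableP; split; first exact/measurable_EFinP.
move: f_fin; congr (_ < _)%E.
apply: (eq_int (fun x => `|f x|) (fun x => `|g x|)); try exact: measurableT_comp.
by apply: filterS fg => x hx Dx; rewrite hx.
Qed.

Lemma cvg_Rintegral_dominated (F : nat -> T -> R) f g : (forall n, measurable_fun D (F n)) -> measurable_fun D f ->
  Rintegrable g -> (forall n x, D x -> `|F n x| <= g x) -> (forall x, D x -> F n x @[n --> \oo] --> f x) ->
  \int[mu]_(x in D) F n x @[n --> \oo] --> \int[mu]_(x in D) f x.
Proof.
move=> mF mf ig F_le_g F_cvg.
have ae_cvg : {ae mu, forall x, D x -> (F n x)%:E @[n --> \oo] --> (f x)%:E}.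
  by apply: aeW => x Dx; apply: cvg_EFin; [near=> n|exact: F_cvg].
have ae_dom : {ae mu, forall x n, D x -> (`|(F n x)%:E| <= (g x)%:E)%E}.
  by apply: aeW => x n Dx; rewrite lee_fin; exact: F_le_g.
have [f_int _ cvg_int] := dominated_convergence mD (fun n => (measurable_EFinP _ _).2 (mF n))
  ((measurable_EFinP _ _).2 mf) ae_cvg ig ae_dom.
by rewrite integral_EFin // in cvg_int; exact: (fine_cvg cvg_int).
Unshelve. all: by end_near. Qed.

End RealIntegral.

Section SquareIntegrable.
Context (dd : measure_display) (T : measurableType dd) (R : realType).
Variable P : probability T R.
Implicit Types (b f g h : T -> R).
Local Notation itg := (Rintegrable P setT).
Let mT : measurable [set: T]. Proof. exact: measurableT. Qed.

Definition L2 f := measurable_fun setT f /\ itg (fun w => f w ^+ 2).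

Lemma Rintegral_prob_cst k : \int[P]_w k = k.
Proof. by rewrite Rintegral_cst // [X in fine X](probability_setT P) mulr1. Qed.

Lemma Rintegrable_cst k : itg (fun=> k).
Proof. exact: finite_measure_integrable_cst. Qed.

Lemma bounded_Rintegrable f K : measurable_fun setT f -> (forall w, `|f w| <= K) -> itg f.
Proof. by move=> mf h; apply: (le_Rintegrable mT) _ _ (Rintegrable_cst K). Qed.

Lemma L2_mul_Rintegrable f g : L2 f -> L2 g -> itg (fun w => f w * g w).
Proof.
move=> [mf f2] [mg g2]; apply: (le_Rintegrable mT) _ _ (RintegrableD mT f2 g2); first exact: measurable_funM.
move=> w _; rewrite normrM -[f w ^+ 2]real_normK ?num_real // -[g w ^+ 2]real_normK ?num_real //.
by have := sqr_ge0 (`|f w| - `|g w|); have := normr_ge0 (f w); have := normr_ge0 (g w); nra.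
Qed.

Lemma bounded_L2 f K : measurable_fun setT f -> (forall w, `|f w| <= K) -> L2 f.
Proof.
move=> mf h; split => //; apply: (@bounded_Rintegrable _ (K ^+ 2)); first exact: measurable_funX.
move=> w; rewrite ger0_norm ?sqr_ge0 // -real_normK ?num_real // lerXn2r ?nnegrE //.
exact: le_trans (h w).
Qed.

Lemma L2_cst k : L2 (fun=> k).
Proof. exact: (@bounded_L2 _ `|k|). Qed.

Lemma L2_Rintegrable f : L2 f -> itg f.
Proof. by move=> hf; apply: (eq_Rintegrable mT) _ (L2_mul_Rintegrable hf (L2_cst 1)) => // w _; rewrite mulr1. Qed.

Lemma bounded_mul_L2 b K f : measurable_fun setT b -> (forall w, `|b w| <= K) -> L2 f -> L2 (fun w => b w * f w).
Proof.
move=> mb hb [mf f2]; split; first exact: measurable_funM.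
apply: (le_Rintegrable mT) _ _ (RintegrableZl mT (K ^+ 2) f2); first by apply: measurable_funX; exact: measurable_funM.
move=> w _; rewrite ger0_norm ?sqr_ge0 // exprMn ler_wpM2r ?sqr_ge0 // -real_normK ?num_real //.
by rewrite lerXn2r ?nnegrE // (le_trans _ (hb w)).
Qed.

Lemma L2Z k f : L2 f -> L2 (fun w => k * f w).
Proof. by apply: (@bounded_mul_L2 _ `|k|). Qed.

Lemma L2D f g : L2 f -> L2 g -> L2 (fun w => f w + g w).
Proof.
move=> hf hg; split; first by apply: measurable_funD; [case: hf|case: hg].
have sum_int := RintegrableD mT (RintegrableD mT hf.2 hg.2) (RintegrableZl mT 2 (L2_mul_Rintegrable hf hg)).
by apply: (eq_Rintegrable mT) _ sum_int => w _; ring.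
Qed.

Lemma eq_L2 f g : f =1 g -> L2 f -> L2 g. Proof. by move=> /funext ->. Qed.

Lemma L2B f g : L2 f -> L2 g -> L2 (fun w => f w - g w).
Proof. by move=> hf hg; apply: eq_L2 (L2D hf (L2Z (- 1) hg)) => w; ring. Qed.

Lemma L2_sum (I : finType) (F : I -> T -> R) : (forall i, L2 (F i)) -> L2 (fun w => \sum_i F i w).
Proof.
move=> h; have H (s : seq I) : L2 (fun w => \sum_(i <- s) F i w); last exact: H.
elim: s => [|i s IH]; first by apply: eq_L2 (L2_cst 0) => w; rewrite big_nil.
by apply: eq_L2 (L2D (h i) IH) => w; rewrite big_cons.
Qed.

Lemma L2_sqr_ge0 f : 0 <= \int[P]_w (f w ^+ 2).
Proof. by apply: Rintegral_ge0 => w _; exact: sqr_ge0. Qed.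

Lemma L2_young f g k : 0 < k -> L2 f -> L2 g ->
  `|\int[P]_w (f w * g w)| <= k * \int[P]_w (f w ^+ 2) + k^-1 * \int[P]_w (g w ^+ 2).
Proof.
move=> k0 hf hg; apply: le_trans (le_normr_Rintegral mT (L2_mul_Rintegrable hf hg)) _.
rewrite -RintegralZl // -?RintegralZl //; try by [case: hf|case: hg].
have f_int := RintegrableZl mT k hf.2; have g_int := RintegrableZl mT k^-1 hg.2.
rewrite -RintegralD //; apply: le_Rintegral => //; first exact/Rintegrable_norm/L2_mul_Rintegrable.
  exact: RintegrableD.
move=> w _; rewrite normrM -[f w ^+ 2]real_normK ?num_real // -[g w ^+ 2]real_normK ?num_real //.
move: (normr_ge0 (f w)) (normr_ge0 (g w)); move: `|f w| `|g w| => x y x0 y0.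
have : 0 <= k^-1 * (k * x - y) ^+ 2 by rewrite mulr_ge0 ?sqr_ge0 // invr_ge0 ltW.
have -> : k^-1 * (k * x - y) ^+ 2 = k * x ^+ 2 + k^-1 * y ^+ 2 - 2 * (x * y) by field; rewrite gt_eqF.
by have := mulr_ge0 x0 y0; lra.
Qed.

Lemma L2_CauchySchwarz f g : L2 f -> L2 g ->
  (\int[P]_w (f w * g w)) ^+ 2 <= \int[P]_w (f w ^+ 2) * \int[P]_w (g w ^+ 2).
Proof.
move=> hf hg; have fg_int := L2_mul_Rintegrable hf hg; apply: discriminant_le => t.
have -> : \int[P]_w (f w ^+ 2) - 2 * t * \int[P]_w (f w * g w) + t ^+ 2 * \int[P]_w (g w ^+ 2) =
    \int[P]_w ((f w - t * g w) ^+ 2); last exact: L2_sqr_ge0.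
  have f2_int := hf.2; have cross_int := RintegrableZl mT (- (2 * t)) fg_int.
  have g2_int := RintegrableZl mT (t ^+ 2) hg.2.
  transitivity (\int[P]_w ((f w ^+ 2 + (- (2 * t)) * (f w * g w)) + t ^+ 2 * g w ^+ 2)).
    rewrite (RintegralD mT (RintegrableD mT f2_int cross_int) g2_int) (RintegralD mT f2_int cross_int).
    by rewrite (RintegralZl _ mT fg_int) (RintegralZl _ mT hg.2) mulNr.
  by apply: eq_Rintegral => w _; ring.
Qed.

Lemma Lfun_L2P f : f \in Lfun P 2%:E <-> L2 f.
Proof.
split=> [hf|[mf f2]].
  split; last exact: Lfun2_integrable_sqr.
  by move: hf; rewrite inE => /andP[]; rewrite inE.
rewrite inE; apply/andP; split; first by rewrite inE.
rewrite inE /= /finite_norm Lnorm.unlock; apply: poweR_lty.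
case/integrableP: f2 => _; congr (_ < _)%E.
apply: eq_integral => w _ /=; congr EFin.
by rewrite powR_mulrn ?normr_ge0 // normrX.
Qed.

Lemma norm2_L2E f : L2 f -> norm2 P f = (Num.sqrt (\int[P]_w (f w ^+ 2)))%:E.
Proof.
move=> [mf f2]; rewrite /norm2 Lnorm.unlock.
have -> : (\int[P]_x `|(EFin \o f) x| `^ 2 = \int[P]_x (f x ^+ 2)%:E)%E.
  apply: eq_integral => w _ /=; congr EFin.
  by rewrite powR_mulrn ?normr_ge0 // real_normK ?num_real.
by rewrite integral_EFin //= powR12_sqrt // L2_sqr_ge0.
Qed.

Lemma expectationE f : itg f -> ('E_P[f] = (\int[P]_w f w)%:E)%E.
Proof. by move=> h; rewrite unlock integral_EFin. Qed.

End SquareIntegrable.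

(** * Density of simple functions *)

Section Indicators.
Context (dd : measure_display) (T : measurableType dd) (R : realType).
Variable P : probability T R.

Lemma L2_indic (B : set T) : measurable B -> L2 P (\1_B).
Proof.
move=> mB; apply: (@bounded_L2 _ _ _ _ _ 1); first exact: measurable_indic.
by move=> w; rewrite indicE; case: (w \in B); rewrite ?normr1 ?normr0.
Qed.

Lemma Rintegral_indic (B : set T) : measurable B -> \int[P]_w \1_B w = fine (P B).
Proof. by move=> mB; rewrite /Rintegral integral_indic // setIT. Qed.

Lemma sum_indic_disjoint (F : (set T)^nat) n w : trivIset setT F ->
  \sum_(i < n) \1_(F i) w = \1_(\bigcup_(i < n) F i) w :> R.
Proof.
move=> tF; have [[k /= kn Fk]|nF] := pselect ((\bigcup_(i < n) F i) w).
  rewrite (bigD1 (Ordinal kn)) //= big1 => [|i ik]; first by rewrite !indicE !mem_set ?addr0 //; exists k.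
  rewrite indicE memNset // => Fi; have := @tF i k I I (ex_intro _ w (conj Fi Fk)).
  by move=> ik_eq; move: ik; rewrite -val_eqE /= ik_eq eqxx.
rewrite big1 ?indicE ?(memNset nF) // => i _; rewrite indicE memNset // => Fi.
by apply: nF; exists i => /=.
Qed.

Lemma cvg_sum_indic_bigcup (F : (set T)^nat) w : trivIset setT F ->
  (\sum_(i < n) \1_(F i) w : R) @[n --> \oo] --> (\1_(\bigcup_k F k) w : R).
Proof.
move=> tF; apply: cvg_near_cst; have [[k _ Fk]|nF] := pselect ((\bigcup_k F k) w); near=> n.
  have kn : (k < n)%N by near: n; exact: nbhs_infty_gt.
  by rewrite sum_indic_disjoint // !indicE !mem_set //; exists k.
rewrite sum_indic_disjoint // !indicE (memNset nF) memNset // => -[k _ Fk].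
by apply: nF; exists k.
Unshelve. all: by end_near. Qed.

End Indicators.

Section ClosedSubspace.
Context (dd : measure_display) (T : measurableType dd) (R : realType).
Variables (P : probability T R) (G : set (set T)).
Hypotheses (G_setI : setI_closed G) (G_generates : @measurable _ T = <<s G >>) (G_setT : G setT).
Local Notation L2 := (L2 P).
Implicit Types f g : T -> R.
Let mT : measurable [set: T]. Proof. exact: measurableT. Qed.

Section Subspace.
Variable Q : (T -> R) -> Prop.
Hypothesis Q_linear : forall a f g, L2 f -> L2 g -> Q f -> Q g -> Q (fun w => a * f w + g w).
Hypothesis Q_closed : forall f, L2 f ->
  (forall eps, 0 < eps -> exists g, [/\ L2 g, Q g & \int[P]_w ((f w - g w) ^+ 2) <= eps]) -> Q f.
Hypothesis Q_indic : forall B, G B -> Q (\1_B).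

Lemma closed_subspace_dominated f g (F : nat -> T -> R) : L2 f -> (forall n, L2 (F n)) -> (forall n, Q (F n)) ->
  Rintegrable P setT g -> (forall n w, (f w - F n w) ^+ 2 <= g w) -> (forall w, F n w @[n --> \oo] --> f w) -> Q f.
Proof.
move=> hf hF QF ig F_le F_cvg; apply: Q_closed => // eps eps0.
have : \int[P]_w ((f w - F n w) ^+ 2) @[n --> \oo] --> \int[P]_w (0 : R).
  apply: (cvg_Rintegral_dominated mT _ _ ig) => // [n|n w _|w _].
  - exact: measurable_funX (L2B hf (hF n)).1.
  - by rewrite ger0_norm ?sqr_ge0.
  have diff_cvg : f w - F n w @[n --> \oo] --> 0.
    by rewrite -(subrr (f w)); apply: cvgB => //; exact: cvg_cst.
  by have := cvgM diff_cvg diff_cvg; rewrite mul0r; exact.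
rewrite Rintegral_prob_cst => /cvgrPdist_le /(_ _ eps0) [n _ /(_ n (leqnn n))].
by rewrite /= sub0r normrN ger0_norm ?L2_sqr_ge0 // => le_eps; exists (F n).
Qed.

Lemma closed_subspace0 : Q (fun=> 0).
Proof.
have := Q_linear (- 1) (L2_indic P mT) (L2_indic P mT) (Q_indic G_setT) (Q_indic G_setT).
by congr Q; apply/funext => w; rewrite mulN1r addNr.
Qed.

Lemma closed_subspace_sum (I : Type) (s : seq I) (k : I -> R) (F : I -> T -> R) :
  (forall i, L2 (F i)) -> (forall i, Q (F i)) -> Q (fun w => \sum_(i <- s) k i * F i w).
Proof.
move=> hF QF; suff [] : L2 (fun w => \sum_(i <- s) k i * F i w) /\ Q (fun w => \sum_(i <- s) k i * F i w) by [].
elim: s => [|i s [L2_tail Q_tail]].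
  under eq_fun do rewrite big_nil.
  by split; [exact: L2_cst|exact: closed_subspace0].
under eq_fun do rewrite big_cons.
by split; [exact: L2D (L2Z (k i) (hF i)) L2_tail|exact: Q_linear].
Qed.

Lemma closed_subspace_indicC (B : set T) : measurable B -> Q (\1_B) -> Q (\1_(~` B)).
Proof.
move=> mB QB; have := Q_linear (- 1) (L2_indic P mB) (L2_indic P mT) QB (Q_indic G_setT).
congr Q; apply/funext => w; rewrite !indicE in_setT in_setC.
by case: (w \in B); rewrite /= ?mulr1 ?mulr0 ?addNr ?add0r.
Qed.

Lemma closed_subspace_indic_bigcup (F : (set T)^nat) : (forall n, measurable (F n)) -> trivIset setT F ->
  (forall n, Q (\1_(F n))) -> Q (\1_(\bigcup_k F k)).
Proof.
move=> mF tF QF; have L2F n := L2_indic P (mF n).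
apply: (@closed_subspace_dominated _ (fun=> 1) (fun n w => \sum_(i < n) 1 * \1_(F i) w)).
- by apply: L2_indic; exact: bigcupT_measurable.
- by move=> n; apply: L2_sum => i; exact: L2Z.
- by move=> n; exact: closed_subspace_sum.
- exact: Rintegrable_cst.
- by move=> n w; under eq_bigr do rewrite mul1r; rewrite sum_indic_disjoint.
move=> w; under eq_fun do under eq_bigr do rewrite mul1r.
exact: cvg_sum_indic_bigcup.
Qed.

Lemma closed_subspace_indic (B : set T) : measurable B -> Q (\1_B).
Proof.
rewrite G_generates => /(dynkin_induction (P := fun B => Q (\1_B)) G_generates G_setI); apply.
- exact: Q_indic.
- exact: Q_indic.
- exact: closed_subspace_indicC.
exact: closed_subspace_indic_bigcup.
Qed.

Import HBNNSimple.

Lemma closed_subspace_nneg f : L2 f -> (forall w, 0 <= f w) -> Q f.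
Proof.
move=> hf f0; have mf : measurable_fun setT (EFin \o f) by apply/measurable_EFinP; case: hf.
pose F := nnsfun_approx mT mf.
have F_cvg w : F n w @[n --> \oo] --> f w.
  exact: (fine_cvg (cvg_nnsfun_approx mT mf (fun x _ => f0 x) (I : setT w))).
have F_le n w : F n w <= f w.
  rewrite -(cvg_lim (@Rhausdorff R) (F_cvg w)); apply: nondecreasing_cvgn_le; last by apply/cvg_ex; exists (f w).
  by move=> m m' mm'; have /lefP := nd_nnsfun_approx mT mf mm'; apply.
have sqr_le n w : `|F n w ^+ 2| <= f w ^+ 2.
  by rewrite ger0_norm ?sqr_ge0 // ler_sqr_nneg // fun_ge0.
apply: (closed_subspace_dominated hf _ _ hf.2 _ F_cvg) => [n|n|n w]; last first.
- by apply: ler_sqr_nneg; rewrite ?subr_ge0 // gerBl fun_ge0.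
- have mpre y : measurable (F n @^-1` [set y]) by exact: measurable_funPTI.
  have -> : (F n : T -> R) = (fun w => \sum_(y <- finmap.enum_fset (fset_set (range (F n)))) y * \1_(F n @^-1` [set y]) w).
    by apply/funext => w; rewrite fimfunE fsbig_finite.
  by apply: closed_subspace_sum => y; [exact: L2_indic|exact: closed_subspace_indic].
have mFn : measurable_fun setT (F n) by [].
by split => //; apply: (le_Rintegrable mT) hf.2; [exact: measurable_funX|].
Qed.

Lemma closed_subspace_full f : L2 f -> Q f.
Proof.
move=> hf; have L2_abs : L2 (fun w => `|f w|).
  split; first by apply: measurableT_comp => //; case: hf.
  by apply: eq_Rintegrable hf.2 => // w _; rewrite real_normK ?num_real.
have Q_abs : Q (fun w => `|f w|) by apply: closed_subspace_nneg.
have Q_shifted : Q (fun w => `|f w| + f w).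
  by apply: closed_subspace_nneg => [|w]; [exact: L2D|have := ler_norm (- f w); rewrite normrN; lra].
have := Q_linear (- 1) L2_abs (L2D L2_abs hf) Q_abs Q_shifted.
by congr Q; apply/funext => w; ring.
Qed.

End Subspace.

Section BoundedFunctionals.
Variables (l : nat -> (T -> R) -> R) (K : R).
Hypothesis K_ge0 : 0 <= K.
Hypothesis l_linear : forall k a f g, L2 f -> L2 g -> l k (fun w => a * f w + g w) = a * l k f + l k g.
Hypothesis l_bounded : forall k f, L2 f -> l k f ^+ 2 <= K * \int[P]_w (f w ^+ 2).
Hypothesis l_indic : forall B, G B -> l k (\1_B) @[k --> \oo] --> 0.

Lemma bounded_functionals_cvg0 f : L2 f -> l k f @[k --> \oo] --> 0.
Proof.
apply: (@closed_subspace_full (fun f => l k f @[k --> \oo] --> 0)) => // [a {}f g hf hg f_cvg g_cvg|{}f hf approx].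
  under eq_fun => k do rewrite l_linear //.
  by rewrite -[0]addr0 -{1}(mulr0 a); apply: cvgD => //; exact: cvgMr.
apply/cvgrPdist_le => eps eps0; have eps2 : 0 < eps / 2 by rewrite divr_gt0.
have K1 : 0 < K + 1 by rewrite ltr_wpDl.
have [|g [hg /cvgrPdist_le g_cvg fg_le]] := approx ((eps / 2) ^+ 2 / (K + 1)); first by rewrite divr_gt0 ?exprn_gt0.
near=> k; rewrite sub0r normrN.
have -> : l k f = l k (fun w => (- 1) * g w + f w) + l k g by rewrite l_linear // mulN1r addrAC addNr add0r.
rewrite [leRHS]splitr; apply: le_trans (ler_normD _ _) _; apply: lerD; last first.
  by rewrite -normrN -sub0r; near: k; exact: g_cvg.
rewrite -(@ler_pXn2r _ 2) ?nnegrE ?(ltW eps2) // real_normK ?num_real //.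
apply: le_trans (l_bounded k (L2D (L2Z (- 1) hg) hf)) _.
have -> : \int[P]_w ((- 1 * g w + f w) ^+ 2) = \int[P]_w ((f w - g w) ^+ 2).
  by apply: eq_Rintegral => w _; rewrite mulN1r addrC.
apply: le_trans (ler_wpM2l K_ge0 fg_le) _.
by rewrite mulrCA ler_piMr ?exprn_ge0 ?(ltW eps2) // ler_pdivrMr // mul1r lerDl.
Unshelve. all: by end_near. Qed.

End BoundedFunctionals.

End ClosedSubspace.

(** * Shift invariance of the environment *)

Section Environment.
Variables (R : realType) (alpha beta : R) (hab : alpha <= beta) (d : nat).
Local Notation Om := (Omega hab d).
Local Notation site := (site d).
Local Notation edge := (edge d).
Local Notation tau := (@Defs.shift R alpha beta hab d).
Implicit Types (w : Om) (x y z : site) (i : 'I_d).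

Lemma cond_bounds w x i : alpha <= cond w x i <= beta.
Proof. by rewrite /cond; case: (w (x, i)). Qed.

Lemma cond_shift z w x i : cond (tau z w) x i = cond w (x + z) i.
Proof. by []. Qed.

Lemma shiftD y z w : tau y (tau z w) = tau (y + z) w.
Proof. by apply/funext => -[x i]; rewrite /tau /= addrA. Qed.

Lemma shift0 w : tau 0 w = w.
Proof. by apply/funext => -[x i]; rewrite /tau /= addr0. Qed.

Lemma shiftNK z w : tau z (tau (- z) w) = w.
Proof. by rewrite shiftD subrr shift0. Qed.

Lemma measurable_coord (e : edge) (A : set (conductance hab)) :
  measurable A -> measurable ([set w | A (w e)] : set Om).
Proof. by move=> mA; apply: sub_sigma_algebra; exists e, A. Qed.

Lemma measurable_cond x i : measurable_fun setT (fun w : Om => cond w x i).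
Proof.
move=> _ B mB; rewrite setTI.
apply: (@measurable_coord (x, i) (@conductance_val R alpha beta hab @^-1` B)).
by exists B => //; rewrite setTI.
Qed.

Lemma measurable_shift z : measurable_fun setT (tau z).
Proof.
apply: (@measurability _ _ Om Om setT (tau z) (@cylinders R alpha beta hab d)) => //.
move=> _ [_ [e [A [mA ->]] <-]]; rewrite setTI.
exact: (@measurable_coord (e.1 + z, e.2)).
Qed.

HB.instance Definition _ z := isMeasurableFun.Build _ _ _ _ (tau z) (measurable_shift z).

(* Finite-dimensional cylinders: the pi-system on which a product measure is prescribed. *)
Definition fin_cylinder (s : seq edge) (A : edge -> set (conductance hab)) : set Om :=
  [set w | forall e, e \in s -> A e (w e)].
Definition fin_cylinders : set (set Om) :=
  [set C | exists s A, [/\ uniq s, forall e, measurable (A e) & C = fin_cylinder s A]].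

Lemma fin_cylinder_nil A : fin_cylinder [::] A = setT.
Proof. by apply/seteqP; split. Qed.

Lemma fin_cylinder_cons e s A : fin_cylinder (e :: s) A = [set w | A e (w e)] `&` fin_cylinder s A.
Proof.
apply/seteqP; split => w /= h.
  by split; [apply: h; rewrite mem_head|move=> e' es; apply: h; rewrite inE es orbT].
by move=> e'; rewrite inE => /orP[/eqP ->|]; [exact: h.1|exact: h.2].
Qed.

Lemma measurable_fin_cylinder s A : (forall e, measurable (A e)) -> measurable (fin_cylinder s A).
Proof.
move=> mA; elim: s => [|e s IH]; first by rewrite fin_cylinder_nil; exact: measurableT.
by rewrite fin_cylinder_cons; apply: measurableI => //; exact: measurable_coord.
Qed.

Lemma fin_cylinders_setI : setI_closed fin_cylinders.
Proof.
move=> _ _ [s [A [us mA ->]]] [t [B [ut mB ->]]].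
pose C e := (if e \in s then A e else setT) `&` (if e \in t then B e else setT).
exists (undup (s ++ t)), C; split; first exact: undup_uniq.
  by move=> e; apply: measurableI; case: ifP => _ //; exact: measurableT.
apply/seteqP; split => w /=.
  by move=> [in_s in_t] e _; split; case: ifP => // es; [exact: in_s|exact: in_t].
move=> h; split => e es.
  by have := h e; rewrite mem_undup mem_cat es /= => /(_ isT) []; rewrite es.
by have := h e; rewrite mem_undup mem_cat es orbT => /(_ isT) [_]; rewrite es.
Qed.

Lemma fin_cylinders_generate : @measurable _ Om = <<s fin_cylinders >>.
Proof.
apply/seteqP; split.
  apply: smallest_sub; first exact: smallest_sigma_algebra.
  move=> _ [e [A [mA ->]]]; apply: sub_sigma_algebra; exists [:: e], (fun=> A); split => //.
  by rewrite fin_cylinder_cons fin_cylinder_nil setIT.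
apply: smallest_sub; first exact: sigma_algebra_measurable.
by move=> _ [s [A [_ mA ->]]]; exact: measurable_fin_cylinder.
Qed.

Lemma fin_cylinders_setT : fin_cylinders setT.
Proof. by exists [::], (fun=> setT); split => //; rewrite fin_cylinder_nil. Qed.

Variables (nu : probability (conductance hab) R) (P : probability Om R).
Hypothesis hP : product_measure nu P.

Lemma prob_fin_cylinder s A : uniq s -> (forall e, measurable (A e)) -> P (fin_cylinder s A) = (\prod_(e <- s) nu (A e))%E.
Proof. exact: hP. Qed.

Lemma preimage_shift_fin_cylinder z s A : tau z @^-1` fin_cylinder s A =
  fin_cylinder [seq (e.1 + z, e.2) | e <- s] (fun e => A (e.1 - z, e.2)).
Proof.
apply/seteqP; split => w /= H e.
  by case/mapP => -[x i] es -> /=; rewrite addrK; exact: H.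
by case: e => x i es; have := H (x + z, i) (map_f (fun e : edge => (e.1 + z, e.2)) es); rewrite /= addrK.
Qed.

Lemma prob_shift_fin_cylinder z s A : uniq s -> (forall e, measurable (A e)) ->
  P (tau z @^-1` fin_cylinder s A) = P (fin_cylinder s A).
Proof.
move=> us mA; rewrite preimage_shift_fin_cylinder !prob_fin_cylinder //.
  by rewrite big_map; apply: eq_bigr => -[x i] _; rewrite /= addrK.
by rewrite map_inj_uniq // => -[x i] [y j] [/addIr -> ->].
Qed.

Lemma prob_shift z (B : set Om) : measurable B -> P (tau z @^-1` B) = P B.
Proof.
move=> mB.
have := @measure_unique _ R Om fin_cylinders (fun=> setT) fin_cylinders_generate fin_cylinders_setI _ _
  (pushforward P (tau z)) P _ _ B mB; apply.
- by move=> _; exact: fin_cylinders_setT.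
- by rewrite bigcup_const.
- by move=> _ [s [A [us mA ->]]]; exact: prob_shift_fin_cylinder.
by move=> _; have : (P setT < +oo)%E by rewrite probability_setT ltry.
Qed.

Local Notation itg := (Rintegrable P setT).
Local Notation L2 := (L2 P).
Implicit Types (f g : Om -> R).

Lemma measurable_comp_shift z f : measurable_fun setT f -> measurable_fun setT (fun w => f (tau z w)).
Proof. by move=> mf; apply: (measurableT_comp mf); exact: measurable_shift. Qed.

Let int_shift z (f : Om -> \bar R) : measurable_fun setT f ->
  (forall w, 0 <= f w)%E -> (\int[P]_w f (tau z w) = \int[P]_w f w)%E.
Proof.
move=> mf f0; rewrite -[LHS](@ge0_integral_pushforward _ _ _ _ _ _ (measurable_shift z) P setT f) //.
by apply: eq_measure_integral => A mA _; exact: prob_shift.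
Qed.

Lemma Rintegrable_shift z f : itg f -> itg (fun w => f (tau z w)).
Proof.
move=> hf; have mf := Rintegrable_measurable hf; apply/integrableP; split.
  by apply/measurable_EFinP; exact: measurable_comp_shift.
have := int_shift z (f := fun w => `|f w|%:E); move=> /= ->; first by case/integrableP: hf.
- by apply/measurable_EFinP; exact: measurableT_comp.
- by move=> w; rewrite lee_fin.
Qed.

Lemma Rintegral_shift z f : itg f -> \int[P]_w f (tau z w) = \int[P]_w f w.
Proof.
move=> hf; have mf := Rintegrable_measurable hf; have mT : measurable [set: Om] := measurableT.
have pos g : itg g -> (forall w, 0 <= g w) -> \int[P]_w g (tau z w) = \int[P]_w g w.
  move=> hg g0; rewrite /Rintegral (int_shift z (f := fun w => (g w)%:E)) //.
    by apply/measurable_EFinP; exact: Rintegrable_measurable hg.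
have ip : itg (fun w => `|f w| + f w) by apply: RintegrableD => //; exact: Rintegrable_norm.
have := pos _ ip; rewrite (RintegralD mT (Rintegrable_norm hf) hf).
have hs := Rintegrable_shift z hf; rewrite (RintegralD mT (Rintegrable_norm hs) hs) (pos (fun w => `|f w|)) //; last exact: Rintegrable_norm.
by move=> H; apply: (@addrI _ (\int[P]_w (`|f w|))); apply: H => w; have := ler_norm (- f w); rewrite normrN; lra.
Qed.

Lemma L2_shift z f : L2 f -> L2 (fun w => f (tau z w)).
Proof.
by move=> [mf f2]; split; [exact: measurable_comp_shift|exact: (Rintegrable_shift z f2)].
Qed.

End Environment.

Section Mixing.
Variables (R : realType) (alpha beta : R) (hab : alpha <= beta) (d : nat).
Local Notation Om := (Omega hab d).
Local Notation edge := (edge d).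
Local Notation tau := (@Defs.shift R alpha beta hab d).
Variables (nu : probability (conductance hab) R) (P : probability Om R).
Hypothesis hP : product_measure nu P.
Variable i0 : 'I_d.
Local Notation L2 := (L2 P).
Implicit Types (f g : Om -> R).
Let mT : measurable [set: Om]. Proof. exact: measurableT. Qed.
Local Notation ev k := (unit_vec i0 *+ k).

Definition shift_cov k f g : R := \int[P]_w (f (tau (ev k) w) * g w) - \int[P]_w f w * \int[P]_w g w.

Lemma sqr_Rintegral_le f : L2 f -> (\int[P]_w f w) ^+ 2 <= \int[P]_w (f w ^+ 2).
Proof.
move=> hf; have := L2_CauchySchwarz hf (L2_cst P 1).
by under eq_Rintegral do rewrite mulr1; rewrite expr1n Rintegral_prob_cst mulr1.
Qed.

Lemma shift_cov_sqr_le k f g : L2 f -> L2 g ->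
  shift_cov k f g ^+ 2 <= 4 * (\int[P]_w (f w ^+ 2) * \int[P]_w (g w ^+ 2)).
Proof.
move=> hf hg; set X := _ * Rintegral _ _ _.
have mixed_le : (\int[P]_w (f (tau (ev k) w) * g w)) ^+ 2 <= X.
  by have := L2_CauchySchwarz (L2_shift hP (ev k) hf) hg; rewrite (Rintegral_shift hP (ev k) hf.2).
have means_le : (\int[P]_w f w * \int[P]_w g w) ^+ 2 <= X.
  by rewrite exprMn; apply: ler_pM; rewrite ?sqr_ge0 ?sqr_Rintegral_le.
rewrite /shift_cov; move: mixed_le means_le; move: (\int[P]_w (f _ * g w)) (_ * _) => x y.
by have := sqr_ge0 (x + y); lra.
Qed.

Lemma shift_cov_linearl k a f f' g : L2 f -> L2 f' -> L2 g ->
  shift_cov k (fun w => a * f w + f' w) g = a * shift_cov k f g + shift_cov k f' g.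
Proof.
move=> hf hf' hg; have fg := L2_mul_Rintegrable (L2_shift hP (ev k) hf) hg.
have f'g := L2_mul_Rintegrable (L2_shift hP (ev k) hf') hg.
have -> : shift_cov k (fun w => a * f w + f' w) g =
    \int[P]_w (a * (f (tau (ev k) w) * g w) + f' (tau (ev k) w) * g w) -
    \int[P]_w (a * f w + f' w) * \int[P]_w g w.
  by rewrite /shift_cov; congr (_ - _); apply: eq_Rintegral => w _; ring.
rewrite (RintegralD mT (RintegrableZl mT a fg) f'g) (RintegralZl a mT fg).
rewrite (RintegralD mT (RintegrableZl mT a (L2_Rintegrable hf)) (L2_Rintegrable hf')).
by rewrite (RintegralZl a mT (L2_Rintegrable hf)) /shift_cov; ring.
Qed.

Lemma shift_cov_linearr k a f g g' : L2 f -> L2 g -> L2 g' ->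
  shift_cov k f (fun w => a * g w + g' w) = a * shift_cov k f g + shift_cov k f g'.
Proof.
move=> hf hg hg'; have fg := L2_mul_Rintegrable (L2_shift hP (ev k) hf) hg.
have fg' := L2_mul_Rintegrable (L2_shift hP (ev k) hf) hg'.
have -> : shift_cov k f (fun w => a * g w + g' w) =
    \int[P]_w (a * (f (tau (ev k) w) * g w) + f (tau (ev k) w) * g' w) -
    \int[P]_w f w * \int[P]_w (a * g w + g' w).
  by rewrite /shift_cov; congr (_ - _); apply: eq_Rintegral => w _; ring.
rewrite (RintegralD mT (RintegrableZl mT a fg) fg') (RintegralZl a mT fg).
rewrite (RintegralD mT (RintegrableZl mT a (L2_Rintegrable hg)) (L2_Rintegrable hg')).
by rewrite (RintegralZl a mT (L2_Rintegrable hg)) /shift_cov; ring.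
Qed.

Lemma prob_fin_cylinder_disjoint s t A B : uniq s -> uniq t -> (forall e, measurable (A e)) -> (forall e, measurable (B e)) ->
  (forall e, e \in s -> e \notin t) -> P (@fin_cylinder R alpha beta hab d s A `&` fin_cylinder t B) = (P (fin_cylinder s A) * P (fin_cylinder t B))%E.
Proof.
move=> us ut mA mB disj; pose C e := if e \in s then A e else B e.
have mC e : measurable (C e) by rewrite /C; case: ifP.
have -> : fin_cylinder s A `&` fin_cylinder t B = fin_cylinder (s ++ t) C.
  apply/seteqP; split => w /=.
    move=> [in_s in_t] e; rewrite mem_cat /C => /orP[es|et]; first by rewrite es; exact: in_s.
    by case: ifP => [es|_]; [exact: in_s|exact: in_t].
  move=> h; split => e es; have := h e; rewrite mem_cat es ?orbT /C.
    by rewrite es; apply.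
  by move=> /(_ isT); case: ifP => // /disj; rewrite es.
rewrite (prob_fin_cylinder hP) //; last first.
  by rewrite cat_uniq us ut andbT /=; apply/hasPn => e et; apply/negP => /disj; rewrite et.
rewrite big_cat /= !(prob_fin_cylinder hP) //; congr (_ * _)%E; rewrite big_seq [RHS]big_seq; apply: eq_bigr => e es; rewrite /C.
  by rewrite es.
by case: ifP => // /disj; rewrite es.
Qed.

Lemma shift_cov_cylinders s A t B : uniq s -> uniq t -> (forall e, measurable (A e)) -> (forall e, measurable (B e)) ->
  shift_cov k (\1_(fin_cylinder s A)) (\1_(fin_cylinder t B)) @[k --> \oo] --> 0.
Proof.
move=> us ut mA mB; have mcyl := @measurable_fin_cylinder R alpha beta hab d.
pose extent (r : seq edge) := (\sum_(e <- r) absz (e.1 0%R i0))%N.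
have le_extent (r : seq edge) (e : edge) : e \in r -> (absz (e.1 0%R i0) <= extent r)%N.
  by move=> er; rewrite /extent (big_rem e er) /=; exact: leq_addr.
apply: cvg_near_cst; near=> k; have far : (extent s + extent t < k)%N by near: k; exact: nbhs_infty_gt.
pose s' := [seq (e.1 + ev k, e.2) | e : edge <- s]; pose A' (e : edge) := A (e.1 - ev k, e.2).
have mA' e : measurable (A' e) by exact: mA.
have us' : uniq s' by rewrite map_inj_uniq // => -[x i] [y j] [/addIr -> ->].
have -> : shift_cov k (\1_(fin_cylinder s A)) (\1_(fin_cylinder t B)) =
    \int[P]_w \1_(fin_cylinder s' A' `&` fin_cylinder t B) w -
    \int[P]_w \1_(fin_cylinder s A) w * \int[P]_w \1_(fin_cylinder t B) w.
  rewrite /shift_cov; congr (_ - _); apply: eq_Rintegral => w _.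
  by rewrite -preimage_shift_fin_cylinder indicI.
rewrite !Rintegral_indic //; try by [apply: mcyl|apply: measurableI; exact: mcyl].
rewrite prob_fin_cylinder_disjoint //.
  by rewrite -preimage_shift_fin_cylinder (prob_shift_fin_cylinder hP) // fineM ?fin_num_measure // ?subrr //; exact: mcyl.
move=> _ /mapP[e es ->]; apply/negP => et; move: far; rewrite ltnNge => /negP; apply.
have := leq_add (le_extent _ _ es) (le_extent _ _ et); apply: leq_trans.
have -> : (e.1 + ev k) 0 i0 = e.1 0 i0 + k%:Z by rewrite !mxE mulmxnE /unit_vec mxE !eqxx /= -natz.
by move: (e.1 0 i0); clear; lia.
Unshelve. all: by end_near. Qed.

Lemma shift_cov_cvg0 f g : L2 f -> L2 g -> shift_cov k f g @[k --> \oo] --> 0.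
Proof.
have cvg0 := @bounded_functionals_cvg0 _ _ _ P _ (@fin_cylinders_setI R alpha beta hab d)
  (@fin_cylinders_generate R alpha beta hab d) (@fin_cylinders_setT R alpha beta hab d).
move=> hf; apply: (cvg0 (fun k => shift_cov k f) (4 * \int[P]_w (f w ^+ 2))) => [|k a h h' hh hh'|k h hh|_ [t [B [ut mB ->]]]].
- by rewrite mulr_ge0 // L2_sqr_ge0.
- exact: shift_cov_linearr.
- by rewrite -mulrA; exact: shift_cov_sqr_le.
have L2_t := L2_indic P (@measurable_fin_cylinder R alpha beta hab d t B mB).
move: f hf; apply: (cvg0 (fun k h => shift_cov k h (\1_(fin_cylinder t B))) (4 * \int[P]_w (\1_(fin_cylinder t B) w ^+ 2))) => [|k a h h' hh hh'|k h hh|_ [s [A [us mA ->]]]].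
- by rewrite mulr_ge0 // L2_sqr_ge0.
- exact: shift_cov_linearl.
- by rewrite -mulrA [X in 4 * X]mulrC; exact: shift_cov_sqr_le.
exact: shift_cov_cylinders.
Qed.

Lemma shift_mixing f g : L2 f -> L2 g ->
  \int[P]_w (f (tau (ev k) w) * g w) @[k --> \oo] --> \int[P]_w f w * \int[P]_w g w.
Proof.
move=> hf hg; have -> : (fun k => \int[P]_w (f (tau (ev k) w) * g w)) =
    (fun k => shift_cov k f g + \int[P]_w f w * \int[P]_w g w) by apply/funext => k; rewrite subrK.
by rewrite -[X in _ --> X]add0r; apply: cvgD; [exact: shift_cov_cvg0|exact: cvg_cst].
Qed.

End Mixing.

(** * The generator on the space of environments *)

Section Generator.
Variables (R : realType) (alpha beta : R) (alpha_gt0 : 0 < alpha) (hab : alpha <= beta) (d : nat) (d_gt0 : (0 < d)%N).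
Local Notation Om := (Omega hab d).
Local Notation tau := (@Defs.shift R alpha beta hab d).
Variables (nu : probability (conductance hab) R) (P : probability Om R).
Hypothesis hP : product_measure nu P.
Local Notation itg := (Rintegrable P setT).
Local Notation L2 := (L2 P).
Local Notation Lop := (@opL R alpha beta hab d).
Local Notation c := (spec_bound d beta).
Local Notation av := (@unit_vec d).
Implicit Types (f g : Om -> R) (i : 'I_d).
Let mT : measurable [set: Om]. Proof. exact: measurableT. Qed.
Let c0 : 0 < c := spec_bound_gt0 d_gt0 alpha_gt0 hab.
Let b0 : 0 < beta := beta_gt0 alpha_gt0 hab.

Definition shift_diff i f (w : Om) : R := f (tau (av i) w) - f w.
Definition cond0 i (w : Om) : R := cond w 0 i.

Lemma cond0_bounds i w : alpha <= cond0 i w <= beta. Proof. exact: cond_bounds. Qed.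
Lemma cond0_ge0 i w : 0 <= cond0 i w.
Proof. by case/andP: (cond0_bounds i w) => h _; exact: le_trans (ltW alpha_gt0) h. Qed.
Lemma normr_cond0_le i w : `|cond0 i w| <= beta.
Proof. by rewrite ger0_norm ?cond0_ge0 //; case/andP: (cond0_bounds i w). Qed.
Lemma measurable_cond0 i : measurable_fun setT (cond0 i). Proof. exact: measurable_cond. Qed.
Lemma cond0_shift i w : cond0 i (tau (- av i) w) = cond w (- av i) i.
Proof. by rewrite /cond0 cond_shift add0r. Qed.

Lemma L2_cond0 i : L2 (cond0 i). Proof. exact: bounded_L2 (measurable_cond0 i) (normr_cond0_le i). Qed.
Lemma L2_cond0M i f : L2 f -> L2 (fun w => cond0 i w * f w).
Proof. exact: bounded_mul_L2 (measurable_cond0 i) (normr_cond0_le i). Qed.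
Lemma L2_shift_diff i f : L2 f -> L2 (shift_diff i f).
Proof. by move=> hf; apply: L2B => //; exact: (L2_shift hP). Qed.

Lemma shift_by_parts i (G z : Om -> R) : L2 G -> L2 z ->
  \int[P]_w (G w * shift_diff i z w) = \int[P]_w (z w * (G (tau (- av i) w) - G w)).
Proof.
move=> hG hz; have hzs := L2_shift hP (av i) hz; have hGs := L2_shift hP (- av i) hG.
have -> : \int[P]_w (G w * shift_diff i z w) = \int[P]_w (G w * z (tau (av i) w) - z w * G w).
  by apply: eq_Rintegral => w _; rewrite /shift_diff; ring.
have -> : \int[P]_w (z w * (G (tau (- av i) w) - G w)) = \int[P]_w (z w * G (tau (- av i) w) - z w * G w).
  by apply: eq_Rintegral => w _; ring.
rewrite !RintegralB //; try exact: L2_mul_Rintegrable.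
rewrite -(Rintegral_shift hP (- av i) (L2_mul_Rintegrable hG hzs)); congr (_ - _).
by apply: eq_Rintegral => w _; rewrite shiftNK mulrC.
Qed.

Lemma opL_div f w : Lop f w = \sum_i (cond0 i (tau (- av i) w) * shift_diff i f (tau (- av i) w) - cond0 i w * shift_diff i f w).
Proof.
by apply: eq_bigr => i _; rewrite cond0_shift /shift_diff shiftNK /cond0; ring.
Qed.

Lemma L2_opL f : L2 f -> L2 (Lop f).
Proof.
move=> hf; apply: eq_L2 (fun w => esym (opL_div f w)) _; apply: L2_sum => i.
have L2_flux := L2_cond0M i (L2_shift_diff i hf); exact: L2B (L2_shift hP (- av i) L2_flux) L2_flux.
Qed.

Lemma opL_dirichlet f g : L2 f -> L2 g -> \int[P]_w (g w * Lop f w) = \sum_i \int[P]_w (cond0 i w * shift_diff i f w * shift_diff i g w).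
Proof.
move=> hf hg; have L2_flux i := L2_cond0M i (L2_shift_diff i hf); have L2_flux_shift i := L2_shift hP (- av i) (L2_flux i).
have -> : \int[P]_w (g w * Lop f w) = \int[P]_w (\sum_i g w * (cond0 i (tau (- av i) w) * shift_diff i f (tau (- av i) w) - cond0 i w * shift_diff i f w)).
  by apply: eq_Rintegral => w _; rewrite opL_div mulr_sumr.
rewrite Rintegral_sum //; last by move=> i; apply: L2_mul_Rintegrable => //; exact: L2B (L2_flux_shift i) (L2_flux i).
by apply: eq_bigr => i _; rewrite shift_by_parts.
Qed.

Lemma opL_sym f g : L2 f -> L2 g -> \int[P]_w (g w * Lop f w) = \int[P]_w (f w * Lop g w).
Proof. by move=> hf hg; rewrite !opL_dirichlet //; apply: eq_bigr => i _; apply: eq_Rintegral => w _; rewrite mulrAC. Qed.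

Lemma opL_ge0 f : L2 f -> 0 <= \int[P]_w (f w * Lop f w).
Proof.
move=> hf; rewrite opL_dirichlet // sumr_ge0 // => i _; apply: Rintegral_ge0 => w _.
by rewrite -mulrA -expr2 mulr_ge0 ?sqr_ge0 // cond0_ge0.
Qed.

Lemma sqr_shift_sub_le z f : L2 f -> \int[P]_w ((f (tau z w) - f w) ^+ 2) <= 4 * \int[P]_w (f w ^+ 2).
Proof.
move=> hf; have hs := L2_shift hP z hf.
have f_int := RintegrableZl mT 2 hf.2; have fs_int := RintegrableZl mT 2 hs.2.
apply: (@le_trans _ _ (\int[P]_w (2 * f (tau z w) ^+ 2 + 2 * f w ^+ 2))).
  apply: le_Rintegral => //; [exact: (L2B hs hf).2|exact: RintegrableD|].
  by move=> w _; have := sqr_ge0 (f (tau z w) + f w); lra.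
by rewrite (RintegralD mT fs_int f_int) (RintegralZl 2 mT hs.2) (RintegralZl 2 mT hf.2) (Rintegral_shift hP z hf.2); lra.
Qed.

Lemma cond0_shift_diff_sqr_le i f : L2 f ->
  \int[P]_w ((cond0 i w * shift_diff i f w) ^+ 2) <= beta * \int[P]_w (cond0 i w * shift_diff i f w * shift_diff i f w).
Proof.
move=> hf; have hD := L2_shift_diff i hf; have hflux := L2_cond0M i hD.
have flux_int := L2_mul_Rintegrable hflux hD.
rewrite -(RintegralZl beta mT flux_int); apply: le_Rintegral => //; [exact: hflux.2|exact: RintegrableZl|].
move=> w _; have -> : (cond0 i w * shift_diff i f w) ^+ 2 = cond0 i w * (cond0 i w * shift_diff i f w * shift_diff i f w) by ring.
rewrite ler_wpM2r ?(andP (cond0_bounds i w)).2 //.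
by rewrite -mulrA -expr2 mulr_ge0 ?sqr_ge0 ?cond0_ge0.
Qed.

Lemma opL_le f : L2 f -> \int[P]_w (f w * Lop f w) <= c * \int[P]_w (f w ^+ 2).
Proof.
move=> hf; rewrite opL_dirichlet //; apply: (@le_trans _ _ (\sum_(i < d) beta * (4 * \int[P]_w (f w ^+ 2)))).
  apply: ler_sum => i _; have hD := L2_shift_diff i hf.
  apply: (@le_trans _ _ (beta * \int[P]_w (shift_diff i f w ^+ 2))); last by rewrite ler_pM2l // sqr_shift_sub_le.
  rewrite -(RintegralZl beta mT hD.2); apply: le_Rintegral => //; [exact: L2_mul_Rintegrable (L2_cond0M i hD) hD|exact: RintegrableZl hD.2|].
  by move=> w _; rewrite -mulrA -expr2 ler_wpM2r ?sqr_ge0 //; case/andP: (cond0_bounds i w).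
by rewrite sumr_const card_ord -[leLHS]mulr_natl spec_boundE; lra.
Qed.

Definition env_step f (w : Om) : R := f w - c^-1 * Lop f w.

Lemma L2_env_step f : L2 f -> L2 (env_step f).
Proof. by move=> hf; apply: L2B => //; apply: L2Z; exact: L2_opL. Qed.

Lemma env_step_sym f g : L2 f -> L2 g -> \int[P]_w (g w * env_step f w) = \int[P]_w (f w * env_step g w).
Proof.
have env_stepE (f1 g1 : Om -> R) : L2 f1 -> L2 g1 ->
    \int[P]_w (g1 w * env_step f1 w) = \int[P]_w (g1 w * f1 w) - c^-1 * \int[P]_w (g1 w * Lop f1 w).
  move=> hf1 hg1; have hL := L2_mul_Rintegrable hg1 (L2_opL hf1).
  rewrite -(RintegralZl _ mT hL) -RintegralB //; [|exact: L2_mul_Rintegrable|exact: RintegrableZl].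
  by apply: eq_Rintegral => w _; rewrite /env_step; ring.
move=> hf hg; rewrite !env_stepE // (opL_sym hf hg); congr (_ - _).
by apply: eq_Rintegral => w _; rewrite mulrC.
Qed.

Variable xi : 'rV[R]_d.
Local Notation dr := (@drift R alpha beta hab d xi).

Lemma driftE w : dr w = \sum_i (xi 0 i * cond0 i w - xi 0 i * cond0 i (tau (- av i) w)).
Proof. by apply: eq_bigr => i _; rewrite cond0_shift mulrBr. Qed.

Lemma L2_drift : L2 dr.
Proof.
apply: eq_L2 (fun w => esym (driftE w)) _; apply: L2_sum => i; apply: L2B; apply: L2Z; first exact: L2_cond0.
exact: L2_shift hP _ _ (L2_cond0 i).
Qed.

Lemma drift_by_parts z : L2 z -> \int[P]_w (z w * dr w) = - \sum_i \int[P]_w (xi 0 i * cond0 i w * shift_diff i z w).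
Proof.
move=> hz; have L2_coef i := L2Z (xi 0 i) (L2_cond0 i); have L2_coef_shift i := L2_shift hP (- av i) (L2_coef i).
have -> : \int[P]_w (z w * dr w) = \int[P]_w (\sum_i z w * (xi 0 i * cond0 i w - xi 0 i * cond0 i (tau (- av i) w))).
  by apply: eq_Rintegral => w _; rewrite driftE mulr_sumr.
rewrite Rintegral_sum //; last by move=> i; apply: L2_mul_Rintegrable => //; exact: L2B (L2_coef i) (L2_coef_shift i).
rewrite -sumrN; apply: eq_bigr => i _; rewrite (shift_by_parts i (L2_coef i) hz) -RintegralN //.
  by apply: eq_Rintegral => w _; ring.
by apply: L2_mul_Rintegrable => //; exact: L2B (L2_coef_shift i) (L2_coef i).
Qed.

Definition evolved_drift n := iter n env_step dr.
Definition drift_corr j : R := \int[P]_w (dr w * evolved_drift j w).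

Lemma L2_evolved_drift n : L2 (evolved_drift n).
Proof. by elim: n => [|n IH]; [exact: L2_drift|exact: L2_env_step]. Qed.

Lemma Rintegral_evolved_driftM (i j : nat) : \int[P]_w (evolved_drift i w * evolved_drift j w) = drift_corr (i + j).
Proof.
elim: i j => [|i IH] j //; rewrite addSnnS -IH.
have -> : \int[P]_w (evolved_drift i.+1 w * evolved_drift j w) = \int[P]_w (evolved_drift j w * env_step (evolved_drift i) w) by apply: eq_Rintegral => w _; rewrite mulrC.
by rewrite env_step_sym //; exact: L2_evolved_drift.
Qed.

Lemma drift_corr_double n : drift_corr n.*2 = \int[P]_w (evolved_drift n w ^+ 2).
Proof. by rewrite -addnn -Rintegral_evolved_driftM; apply: eq_Rintegral => w _; rewrite expr2. Qed.

Lemma drift_corr_doubleS n : drift_corr n.*2.+1 = drift_corr n.*2 - c^-1 * \int[P]_w (evolved_drift n w * Lop (evolved_drift n) w).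
Proof.
have hU := L2_evolved_drift n; have hm := L2_mul_Rintegrable hU (L2_opL hU).
rewrite -addnn -addnS -!Rintegral_evolved_driftM -(RintegralZl _ mT hm) -RintegralB //; [|exact: L2_mul_Rintegrable|exact: RintegrableZl hm].
by apply: eq_Rintegral => w _; rewrite /= /env_step; ring.
Qed.

Lemma drift_corr_doubleS_le n : drift_corr n.*2.+1 <= drift_corr n.*2.
Proof. by rewrite drift_corr_doubleS gerBl mulr_ge0 ?invr_ge0 ?(ltW c0) // opL_ge0 //; exact: L2_evolved_drift. Qed.

Lemma drift_corr_ge0 j : 0 <= drift_corr j.
Proof.
rewrite -(odd_double_half j); case: (odd j) => /=; rewrite ?add0n; last by rewrite drift_corr_double L2_sqr_ge0.
by rewrite add1n drift_corr_doubleS subr_ge0 drift_corr_double ler_pdivrMl // opL_le //; exact: L2_evolved_drift.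
Qed.

Lemma drift_corr_decay (C eta : R) : 0 <= eta -> 0 < C -> (forall n, \int[P]_w (evolved_drift n w ^+ 2) <= C * powS n (- eta)) ->
  forall j, drift_corr j <= C * 2 `^ eta * powS j (- eta).
Proof.
move=> eta0 C0 evolved_le j; have j_lt : (j < 2 * (j./2).+1)%N := ltn_double_half j.
have corr_le : drift_corr j <= drift_corr (j./2).*2.
  by rewrite -{1}(odd_double_half j); case: (odd j); rewrite ?add1n ?add0n // drift_corr_doubleS_le.
rewrite drift_corr_double in corr_le; apply: (le_trans corr_le); apply: (le_trans (evolved_le _)); rewrite -mulrA ler_pM2l //.
exact: powS_le_half.
Qed.

Definition partial_green m n w : R := c^-1 * \sum_(m <= j < n) evolved_drift j w.

Lemma L2_sum_evolved_drift m n : L2 (fun w => \sum_(m <= j < n) evolved_drift j w).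
Proof.
have -> : (fun w => \sum_(m <= j < n) evolved_drift j w) = (fun w => \sum_(j < n - m) evolved_drift (j + m) w).
  by apply/funext => w; rewrite -{1}[m]add0n big_addn big_mkord.
by apply: L2_sum => j; exact: L2_evolved_drift.
Qed.

Lemma L2_partial_green m n : L2 (partial_green m n).
Proof. by apply: L2Z; exact: L2_sum_evolved_drift. Qed.

Lemma opLD f g w : Lop (fun w => f w + g w) w = Lop f w + Lop g w.
Proof. by rewrite /opL -big_split; apply: eq_bigr => i _ /=; ring. Qed.
Lemma opLZ k f w : Lop (fun w => k * f w) w = k * Lop f w.
Proof. by rewrite /opL mulr_sumr; apply: eq_bigr => i _ /=; ring. Qed.

Lemma opL_partial_green m n w : (m <= n)%N -> Lop (partial_green m n) w = evolved_drift m w - evolved_drift n w.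
Proof.
move=> mn; rewrite -(subnK mn); elim: (n - m)%N => [|k IH].
  have -> : partial_green m (0 + m) = (fun w => 0 * evolved_drift 0 w) by apply/funext => v; rewrite /partial_green add0n big_geq // mulr0 mul0r.
  by rewrite opLZ mul0r add0n subrr.
have -> : partial_green m (k.+1 + m) = (fun w => partial_green m (k + m) w + c^-1 * evolved_drift (k + m) w).
  by apply/funext => v; rewrite /partial_green addSn big_nat_recr ?leq_addl //= mulrDr.
rewrite (opLD (partial_green m (k + m)) (fun w => c^-1 * evolved_drift (k + m) w)) (opLZ c^-1 (evolved_drift (k + m))) IH addSn -[evolved_drift (k + m).+1 w]/(env_step (evolved_drift (k + m)) w) /env_step; ring.
Qed.

Lemma evolved_drift_by_parts z m n : L2 z -> (m <= n)%N ->
  \int[P]_w (z w * evolved_drift m w) = \int[P]_w (z w * evolved_drift n w) +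
    \sum_i \int[P]_w (cond0 i w * shift_diff i (partial_green m n) w * shift_diff i z w).
Proof.
move=> hz mn; have hG := L2_partial_green m n.
rewrite -(opL_dirichlet hG hz) -RintegralD //.
- by apply: eq_Rintegral => w _; rewrite opL_partial_green //; ring.
- exact: L2_mul_Rintegrable hz (L2_evolved_drift n).
exact: L2_mul_Rintegrable hz (L2_opL hG).
Qed.

Lemma Rintegral_partial_green l m n : \int[P]_w (evolved_drift l w * partial_green m n w) = c^-1 * \sum_(m <= j < n) drift_corr (l + j).
Proof.
have prod_int j : itg (fun w => evolved_drift l w * evolved_drift j w).
  by apply: L2_mul_Rintegrable; exact: L2_evolved_drift.
transitivity (\int[P]_w (c^-1 * \sum_(m <= j < n) evolved_drift l w * evolved_drift j w)).
  by apply: eq_Rintegral => w _; rewrite -mulr_sumr mulrCA.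
rewrite RintegralZl ?Rintegral_sum //; last exact: Rintegrable_sum.
by under eq_bigr do rewrite Rintegral_evolved_driftM.
Qed.

Lemma partial_green_energy_le m n : (m <= n)%N -> \int[P]_w (partial_green m n w * Lop (partial_green m n) w) <= c^-1 * \sum_(m <= j < n) drift_corr (m + j).
Proof.
move=> mn; have hG := L2_partial_green m n.
have -> : \int[P]_w (partial_green m n w * Lop (partial_green m n) w) = \int[P]_w (evolved_drift m w * partial_green m n w - evolved_drift n w * partial_green m n w).
  by apply: eq_Rintegral => w _; rewrite opL_partial_green //; ring.
rewrite RintegralB //; try exact: L2_mul_Rintegrable (L2_evolved_drift _) hG.
rewrite !Rintegral_partial_green gerBl mulr_ge0 ?invr_ge0 ?(ltW c0) // sumr_ge0 // => j _; exact: drift_corr_ge0.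
Qed.

End Generator.

(** * The homogenized matrix as a series of correlations of the drift *)

Section Corrector.
Variables (R : realType) (alpha beta : R) (alpha_gt0 : 0 < alpha) (hab : alpha <= beta) (d : nat) (d_gt0 : (0 < d)%N).
Local Notation Om := (Omega hab d).
Local Notation site := (site d).
Local Notation tau := (@Defs.shift R alpha beta hab d).
Variables (nu : probability (conductance hab) R) (P : probability Om R).
Hypothesis hP : product_measure nu P.
Local Notation itg := (Rintegrable P setT).
Local Notation L2 := (L2 P).
Local Notation c := (spec_bound d beta).
Local Notation av := (@unit_vec d).
Local Notation cond0 := (@cond0 R alpha beta hab d).
Local Notation shift_diff := (@shift_diff R alpha beta hab d).
Implicit Types (f g z : Om -> R) (i : 'I_d) (x : site).
Let mT : measurable [set: Om]. Proof. exact: measurableT. Qed.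
Let c0 : 0 < c := spec_bound_gt0 d_gt0 alpha_gt0 hab.
Let b0 : 0 < beta := beta_gt0 alpha_gt0 hab.
Let i0 : 'I_d := Ordinal d_gt0.
Local Notation ev k := (unit_vec i0 *+ k).

Variable xi : 'rV[R]_d.
Local Notation dr := (@drift R alpha beta hab d xi).
Local Notation evolved_drift := (@evolved_drift R alpha beta hab d xi).
Local Notation drift_corr := (@drift_corr R alpha beta hab d P xi).
Local Notation partial_green := (@partial_green R alpha beta hab d xi).

Lemma cond0E i x w : cond0 i (tau x w) = cond w (0 + x) i. Proof. by []. Qed.
Lemma shift_diffE i f w : shift_diff i f w = f (tau (av i) w) - f w. Proof. by []. Qed.

Lemma qform_diag (w : Om) (v : 'rV[R]_d) : qform (Amat w 0) v = \sum_i cond0 i w * v 0 i ^+ 2.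
Proof.
rewrite /qform /Amat mul_mx_diag !mxE; apply: eq_bigr => i _.
by rewrite !mxE -/(cond0 i w) mulrAC -expr2 mulrC.
Qed.

Variables (phi : site -> Om -> R).
Hypothesis hphi : corrector P xi phi.

Definition corrector_incr i w := phi (av i) w.

Lemma corrector_incrE x i w : phi (x + av i) w - phi x w = corrector_incr i (tau x w).
Proof.
case: hphi => _ p0 st _ _; have := st 0 x w; rewrite add0r => /rowP /(_ i).
by rewrite !mxE add0r p0 subr0.
Qed.

Lemma L2_corrector_incr i : L2 (corrector_incr i).
Proof.
case: hphi => _ p0 _ /(_ 0 i) [h _] _; have := (Lfun_L2P P _).1 h; apply: eq_L2 => w.
by rewrite mxE add0r p0 subr0.
Qed.

Lemma Rintegral_corrector_incr i : \int[P]_w corrector_incr i w = 0.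
Proof.
case: hphi => _ p0 _ /(_ 0 i) [incr_Lfun incr_mean0] _; have hL := L2_Rintegrable ((Lfun_L2P P _).1 incr_Lfun).
rewrite (expectationE hL) in incr_mean0; case: incr_mean0 => <-; apply: eq_Rintegral => w _.
by rewrite mxE add0r p0 subr0.
Qed.

Definition corrector_flux i w := (xi 0 i + corrector_incr i w) * cond0 i w.

Lemma L2_corrector_flux i : L2 (corrector_flux i).
Proof.
have L2_prod := L2_cond0M alpha_gt0 i (L2D (L2_cst P (xi 0 i)) (L2_corrector_incr i)).
by apply: eq_L2 L2_prod => w; rewrite /corrector_flux mulrC.
Qed.

Lemma corrector_flux_div0 : {ae P, forall w, \sum_i (corrector_flux i w - corrector_flux i (tau (- av i) w)) = 0}.
Proof.
case: hphi => _ _ _ _; apply: filterS => w /(_ 0) /eqP; rewrite oppr_eq0 => /eqP div0.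
have fluxE i x : ((xi + grad (phi ^~ w) x) *m Amat w x) 0 i = corrector_flux i (tau x w).
  by rewrite /Amat mul_mx_diag !mxE corrector_incrE /corrector_flux cond0E add0r.
by rewrite -[RHS]div0; apply: eq_bigr => i _; rewrite !fluxE shift0 sub0r.
Qed.

Lemma corrector_weak_form z : L2 z -> \sum_i \int[P]_w (corrector_flux i w * shift_diff i z w) = 0.
Proof.
move=> hz; have L2_flux_shift i := L2_shift hP (- av i) (L2_corrector_flux i).
under eq_bigr => i _ do rewrite (shift_by_parts hP i (L2_corrector_flux i) hz).
have prod_int i : itg (fun w => z w * (corrector_flux i (tau (- av i) w) - corrector_flux i w)) by apply: L2_mul_Rintegrable => //; exact: L2B (L2_flux_shift i) (L2_corrector_flux i).
rewrite -Rintegral_sum // -[RHS](@Rintegral_prob_cst _ _ _ P 0); symmetry.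
apply: (proj2 (eq_ae_Rintegral mT _ (Rintegrable_cst P 0) _)); first exact: Rintegrable_measurable (Rintegrable_sum mT (index_enum _) prod_int).
apply: filterS corrector_flux_div0 => w div0 _; rewrite -mulr_sumr.
have -> : \sum_i (corrector_flux i (tau (- av i) w) - corrector_flux i w) = - \sum_i (corrector_flux i w - corrector_flux i (tau (- av i) w)).
  by rewrite -sumrN; apply: eq_bigr => i _; ring.
by rewrite div0 oppr0 mulr0.
Qed.

Lemma corrector_cocycle k x w : phi (ev k) (tau x w) = phi (x + ev k) w - phi x w.
Proof.
case: hphi => _ p0 _ _ _; elim: k => [|k IH]; first by rewrite mulr0n addr0 p0 subrr.
rewrite mulrSr; have := corrector_incrE (ev k) i0 (tau x w); rewrite shiftD -[ev k + x]addrC => incr_at_x.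
have := corrector_incrE (x + ev k) i0 w; rewrite -[x + ev k + av i0]addrA => incr_at_0.
by move: incr_at_x incr_at_0 IH; lra.
Qed.

Definition far_corrector k w := - phi (ev k) w.

Lemma L2_far_corrector k : L2 (far_corrector k).
Proof.
case: hphi => _ p0 _ _ _; elim: k => [|k IH].
  by apply: eq_L2 (L2_cst P 0) => w; rewrite /far_corrector mulr0n p0 oppr0.
apply: eq_L2 (L2B IH (L2_shift hP (ev k) (L2_corrector_incr i0))) => w.
by have := corrector_incrE (ev k) i0 w; rewrite /far_corrector mulrSr; lra.
Qed.

Lemma shift_diff_far_corrector k i w : shift_diff i (far_corrector k) w = corrector_incr i w - corrector_incr i (tau (ev k) w).
Proof.
rewrite shift_diffE /far_corrector corrector_cocycle; have := corrector_incrE (ev k) i w; rewrite [av i + _]addrC /corrector_incr; lra.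
Qed.

Lemma corrector_incr_mixing i h : L2 h -> \int[P]_w (h w * corrector_incr i (tau (ev k) w)) @[k --> \oo] --> 0.
Proof.
move=> hh; have := shift_mixing hP i0 (L2_corrector_incr i) hh; rewrite Rintegral_corrector_incr mul0r => m.
by under eq_fun => k do under eq_Rintegral => w _ do rewrite mulrC.
Qed.

Lemma corrector_incr_mixing_sum (h : 'I_d -> Om -> R) : (forall i, L2 (h i)) ->
  \sum_i \int[P]_w (h i w * corrector_incr i (tau (ev k) w)) @[k --> \oo] --> 0.
Proof.
by move=> hh; have := @cvg_sum _ _ (index_enum _) _ _ (fun i => corrector_incr_mixing i (hh i)); rewrite big1_eq; exact.
Qed.

Lemma Rintegral_shift_diff_far k i h : L2 h -> \int[P]_w (h w * shift_diff i (far_corrector k) w) = \int[P]_w (h w * corrector_incr i w) - \int[P]_w (h w * corrector_incr i (tau (ev k) w)).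
Proof.
move=> hh; rewrite -RintegralB //; [|exact: L2_mul_Rintegrable (L2_corrector_incr i)|exact: L2_mul_Rintegrable (L2_shift hP _ (L2_corrector_incr i))].
by apply: eq_Rintegral => w _; rewrite shift_diff_far_corrector mulrBr.
Qed.

Lemma corrector_flux_orthogonal : \sum_i \int[P]_w (corrector_flux i w * corrector_incr i w) = 0.
Proof.
have shifted_eq k : \sum_i \int[P]_w (corrector_flux i w * corrector_incr i (tau (ev k) w)) = \sum_i \int[P]_w (corrector_flux i w * corrector_incr i w).
  have := corrector_weak_form (L2_far_corrector k); under eq_bigr => i _ do rewrite (Rintegral_shift_diff_far k i (L2_corrector_flux i)).
  by rewrite sumrB => /eqP; rewrite subr_eq0 => /eqP.
have := corrector_incr_mixing_sum L2_corrector_flux; under eq_fun => k do rewrite shifted_eq.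
by move=> mixing; apply/esym; apply: cvg_unique mixing _; [exact: Rhausdorff|exact: cvg_cst].
Qed.

Definition corrector_energy := \sum_i \int[P]_w (xi 0 i * cond0 i w * corrector_incr i w).

Let axi i : L2 (fun w => xi 0 i * cond0 i w). Proof. by apply: L2Z; exact: L2_cond0. Qed.

Lemma itg_qform : itg (fun w => qform (Amat w 0) xi).
Proof.
have sum_int : itg (fun w => \sum_i xi 0 i * cond0 i w * xi 0 i).
  by apply: Rintegrable_sum => // i; apply: L2_mul_Rintegrable; [exact: axi|exact: L2_cst].
by apply: (eq_Rintegrable mT) _ sum_int => w _; rewrite qform_diag; apply: eq_bigr => i _; ring.
Qed.

Lemma homogenized_energyE : itg (fun w => qform (Amat w 0) (xi + grad (phi ^~ w) 0)) /\
  \int[P]_w (qform (Amat w 0) (xi + grad (phi ^~ w) 0)) = \int[P]_w qform (Amat w 0) xi + corrector_energy.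
Proof.
have grad0E w i : grad (phi ^~ w) 0 0 i = corrector_incr i w.
  by rewrite mxE; have := corrector_incrE 0 i w; rewrite shift0.
have lin_int i : itg (fun w => xi 0 i * cond0 i w * corrector_incr i w) by apply: L2_mul_Rintegrable; [exact: axi|exact: L2_corrector_incr].
have quad_int i : itg (fun w => corrector_flux i w * corrector_incr i w) by apply: L2_mul_Rintegrable; [exact: L2_corrector_flux|exact: L2_corrector_incr].
have sum_lin_int := Rintegrable_sum mT (index_enum _) lin_int; have sum_quad_int := Rintegrable_sum mT (index_enum _) quad_int.
have expand w : qform (Amat w 0) xi + \sum_i xi 0 i * cond0 i w * corrector_incr i w + \sum_i corrector_flux i w * corrector_incr i w =
   qform (Amat w 0) (xi + grad (phi ^~ w) 0).
  rewrite !qform_diag -!big_split /=; apply: eq_bigr => i _.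
  by rewrite [(xi + _) 0 i]mxE grad0E /corrector_flux; ring.
have total_int := RintegrableD mT (RintegrableD mT itg_qform sum_lin_int) sum_quad_int.
split; first by apply: (eq_Rintegrable mT) _ total_int => w _; exact: expand.
have -> : \int[P]_w (qform (Amat w 0) (xi + grad (phi ^~ w) 0)) = \int[P]_w (qform (Amat w 0) xi + \sum_i xi 0 i * cond0 i w * corrector_incr i w + \sum_i corrector_flux i w * corrector_incr i w).
  by apply: eq_Rintegral => w _; rewrite expand.
rewrite (RintegralD mT (RintegrableD mT itg_qform sum_lin_int) sum_quad_int) (RintegralD mT itg_qform sum_lin_int) !Rintegral_sum //.
by rewrite corrector_flux_orthogonal addr0.
Qed.

Lemma corrector_by_parts z : L2 z -> \sum_i \int[P]_w (cond0 i w * shift_diff i z w * corrector_incr i w) = \int[P]_w (z w * dr w).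
Proof.
move=> hz; have hD i := L2_shift_diff hP i hz.
have := corrector_weak_form hz; have -> : \sum_i \int[P]_w (corrector_flux i w * shift_diff i z w) =
  \sum_i (\int[P]_w (xi 0 i * cond0 i w * shift_diff i z w) + \int[P]_w (cond0 i w * shift_diff i z w * corrector_incr i w)).
  apply: eq_bigr => i _; rewrite -RintegralD //.
  - by apply: eq_Rintegral => w _; rewrite /corrector_flux; ring.
  - exact: L2_mul_Rintegrable (axi i) (hD i).
  - exact: L2_mul_Rintegrable (L2_cond0M alpha_gt0 i (hD i)) (L2_corrector_incr i).
rewrite big_split /= (drift_by_parts alpha_gt0 hP xi hz) => h; lra.
Qed.

Variables (eta Cm : R).
Hypotheses (eta_gt0 : 0 < eta) (Cm_gt0 : 0 < Cm).
Hypothesis hmm : forall j, drift_corr j <= Cm * powS j (- (1 + eta)).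

Definition tail_bound (M : nat) : R := geom_cst eta * Cm * powS M (- eta).

Lemma drift_corr_tail_le M M' : \sum_(M <= j < M') drift_corr (M + j) <= tail_bound M.
Proof.
have eta0 := eta_gt0.
apply: (@le_trans _ _ (\sum_(M <= j < M') Cm * powS j (- (1 + eta)))).
  apply: ler_sum => j _; apply: le_trans (hmm _) _; rewrite ler_pM2l //; apply: powS_antimono; [lra|exact: leq_addl].
rewrite -mulr_sumr; apply: le_trans (ler_wpM2l (ltW Cm_gt0) (sum_powS_tail_le M M' eta0)) _.
by rewrite /tail_bound mulrCA mulrA.
Qed.

Definition incr_norm := 4 * \sum_i \int[P]_w (corrector_incr i w ^+ 2).

Lemma far_corrector_evolved_cvg k : \int[P]_w (far_corrector k w * evolved_drift M w) @[M --> \oo] --> 0.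
Proof.
apply/cvgrPdist_le => eps eps0; set Z := \int[P]_w (far_corrector k w ^+ 2).
have Z0 : 0 <= Z := L2_sqr_ge0 _ _.
have Z1 : 0 < Z * Cm + 1 by rewrite ltr_wpDl // mulr_ge0 // ltW.
have exponent_gt0 : 0 < 1 + eta by rewrite addr_gt0.
have [M0 powS_small] := @powS_le_eventually R (1 + eta) (eps ^+ 2 / (Z * Cm + 1)) exponent_gt0 (divr_gt0 (exprn_gt0 2 eps0) Z1).
exists M0 => // M /= M0M; rewrite sub0r normrN.
have cauchy_schwarz := L2_CauchySchwarz (L2_far_corrector k) (L2_evolved_drift alpha_gt0 hP xi M); rewrite -/Z -(drift_corr_double alpha_gt0 hP) in cauchy_schwarz.
rewrite -(@ler_pXn2r _ 2) ?nnegrE ?(ltW eps0) // real_normK ?num_real //; apply: (le_trans cauchy_schwarz).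
have M0_le : (M0 <= M.*2)%N by rewrite -addnn; exact: leq_trans M0M (leq_addr _ _).
have corr_le := le_trans (hmm M.*2) (ler_wpM2l (ltW Cm_gt0) (powS_small _ M0_le)).
apply: le_trans (ler_wpM2l Z0 corr_le) _.
have -> : Z * (Cm * (eps ^+ 2 / (Z * Cm + 1))) = eps ^+ 2 * (Z * Cm) / (Z * Cm + 1) by ring.
by rewrite ler_pdivrMr // ler_wpM2l ?sqr_ge0 // lerDl.
Qed.

Lemma far_corrector_diff_sqr_le k i :
  \int[P]_w (shift_diff i (far_corrector k) w ^+ 2) <= 4 * \int[P]_w (corrector_incr i w ^+ 2).
Proof.
apply: le_trans (sqr_shift_sub_le hP (ev k) (L2_corrector_incr i)); apply: le_of_eq.
by apply: eq_Rintegral => w _; rewrite shift_diff_far_corrector -sqrrN opprB.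
Qed.

Lemma far_corrector_evolved_le k M del : 0 < del ->
  `|\int[P]_w (far_corrector k w * evolved_drift M w)| <= del * incr_norm + del^-1 * (beta * (c^-1 * tail_bound M)).
Proof.
move=> del0; apply/ler_addgt0Pr => eps eps0.
have [M1 _ far_small] := (cvgrPdist_le _ _).1 (far_corrector_evolved_cvg k) eps eps0.
pose M' := maxn M M1; have MM' : (M <= M')%N := leq_maxl _ _.
have := far_small M' (leq_maxr _ _); rewrite /= sub0r normrN => {}far_small.
have hz := L2_far_corrector k; have hG := L2_partial_green alpha_gt0 hP xi M M'.
have hDz i := L2_shift_diff hP i hz; have hflux i := L2_cond0M alpha_gt0 i (L2_shift_diff hP i hG).
rewrite (evolved_drift_by_parts alpha_gt0 hP xi hz MM') addrC.
apply: le_trans (ler_normD _ _) _; apply: lerD => //; apply: le_trans (ler_norm_sum _ _ _) _.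
pose energy i := \int[P]_w (cond0 i w * shift_diff i (partial_green M M') w * shift_diff i (partial_green M M') w).
apply: (@le_trans _ _ (\sum_i (del * (4 * \int[P]_w (corrector_incr i w ^+ 2)) + del^-1 * (beta * energy i)))).
  apply: ler_sum => i _; under eq_Rintegral do rewrite mulrC.
  apply: le_trans (L2_young del0 (hDz i) (hflux i)) _.
  apply: lerD; [rewrite ler_pM2l //|rewrite ler_pM2l ?invr_gt0 //]; first exact: far_corrector_diff_sqr_le.
  exact: (cond0_shift_diff_sqr_le alpha_gt0 hP i (L2_partial_green alpha_gt0 hP xi M M')).
rewrite big_split /= -!mulr_sumr; apply: lerD => //.
rewrite ler_pM2l ?invr_gt0 // ler_pM2l // -(opL_dirichlet alpha_gt0 hP hG hG).
apply: le_trans (partial_green_energy_le alpha_gt0 d_gt0 hP xi MM') _; rewrite ler_pM2l ?invr_gt0 //; exact: drift_corr_tail_le.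
Qed.

Lemma corrector_energy_far k : corrector_energy =
  \sum_i \int[P]_w (xi 0 i * cond0 i w * corrector_incr i (tau (ev k) w)) - \int[P]_w (far_corrector k w * dr w).
Proof.
rewrite (drift_by_parts alpha_gt0 hP xi (L2_far_corrector k)). rewrite opprK -big_split; apply: eq_bigr => i _ /=.
by rewrite (Rintegral_shift_diff_far k i (axi i)) addrC subrK.
Qed.

Lemma partial_green_far k M : c^-1 * \sum_(0 <= j < M) drift_corr j =
  \int[P]_w (far_corrector k w * dr w) - \int[P]_w (far_corrector k w * evolved_drift M w) +
  \sum_i \int[P]_w (cond0 i w * shift_diff i (partial_green 0 M) w * corrector_incr i (tau (ev k) w)).
Proof.
have hG := L2_partial_green alpha_gt0 hP xi 0 M.
have := evolved_drift_by_parts alpha_gt0 hP xi (L2_far_corrector k) (leq0n M); rewrite -[evolved_drift 0]/dr => ->.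
rewrite [X in X - _]addrC addrK -big_split /=.
have -> : c^-1 * \sum_(0 <= j < M) drift_corr j = \int[P]_w (partial_green 0 M w * dr w).
  transitivity (\int[P]_w (evolved_drift 0 w * partial_green 0 M w)); first by rewrite (Rintegral_partial_green alpha_gt0 hP).
  by apply: eq_Rintegral => w _; rewrite mulrC.
rewrite -(corrector_by_parts hG); apply: eq_bigr => i _.
by rewrite (Rintegral_shift_diff_far k i (L2_cond0M alpha_gt0 i (L2_shift_diff hP i hG))) subrK.
Qed.

Lemma corrector_energy_partial_le M del : 0 < del ->
  `|corrector_energy + c^-1 * \sum_(0 <= j < M) drift_corr j| <= del * incr_norm + del^-1 * (beta * (c^-1 * tail_bound M)).
Proof.
move=> del0; apply/ler_addgt0Pr => eps eps0; have hG := L2_partial_green alpha_gt0 hP xi 0 M.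
have : (\sum_i \int[P]_w (xi 0 i * cond0 i w * corrector_incr i (tau (ev k) w)) +
    \sum_i \int[P]_w (cond0 i w * shift_diff i (partial_green 0 M) w * corrector_incr i (tau (ev k) w))) @[k --> \oo] --> 0.
  rewrite -[X in _ --> X]addr0; apply: cvgD; apply: corrector_incr_mixing_sum; first exact: axi.
  by move=> i; exact: (L2_cond0M alpha_gt0 i (L2_shift_diff hP i hG)).
move=> /cvgrPdist_le /(_ eps eps0) [k _ /(_ k (leqnn k))]; rewrite /= sub0r normrN => boundary_le.
rewrite (corrector_energy_far k) (partial_green_far k M).
set X := \int[P]_w (_ * dr w); set Y := \int[P]_w (_ * _); set b := \sum_i _; set b' := \sum_i _.
have -> : b - X + (X - Y + b') = - Y + (b + b') by ring.
apply: le_trans (ler_normD _ _) _; rewrite normrN; apply: lerD boundary_le; exact: far_corrector_evolved_le.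
Qed.

Lemma corrector_energy_cvg : c^-1 * (\sum_(0 <= j < M) drift_corr j) @[M --> \oo] --> - corrector_energy.
Proof.
have incr_ge0 : 0 <= incr_norm by rewrite mulr_ge0 // sumr_ge0 // => i _; exact: L2_sqr_ge0.
pose B := incr_norm + beta * (c^-1 * (geom_cst eta * Cm)).
have B0 : 0 < B.
  apply: ltr_wpDl => //; apply: mulr_gt0 => //; apply: mulr_gt0; first by rewrite invr_gt0.
  by apply: mulr_gt0 => //; exact: geom_cst_gt0.
apply/cvgrPdist_le => eps eps0; have eta2 : 0 < eta / 2 by rewrite divr_gt0.
have [M0 powS_small] := @powS_le_eventually R (eta / 2) (eps / B) eta2 (divr_gt0 eps0 B0).
exists M0 => // M /= M0M; rewrite -normrN opprB opprK addrC.
apply: le_trans (corrector_energy_partial_le M (powS_gt0 M (- (eta / 2)))) _.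
suff -> : powS M (- (eta / 2)) * incr_norm + (powS M (- (eta / 2)))^-1 * (beta * (c^-1 * tail_bound M)) =
    B * powS M (- (eta / 2)) by rewrite mulrC -ler_pdivlMr // powS_small.
have sqrE : powS M (- eta) = powS M (- (eta / 2)) * powS M (- (eta / 2)) :> R by rewrite -powSD; congr powS; field.
rewrite /tail_bound sqrE /B; have : powS M (- (eta / 2)) != 0 :> R by rewrite gt_eqF ?powS_gt0.
by move: (powS M _) c^-1 => s c_inv s0; field.
Qed.

End Corrector.

Lemma homogenized_matrix_series (R : realType) (alpha beta : R) (alpha_gt0 : 0 < alpha) (hab : alpha <= beta) (d : nat) (d_gt0 : (0 < d)%N)
  (nu : probability (conductance hab) R) (P : probability (Omega hab d) R) (xi : 'rV[R]_d) (A : 'M[R]_d) (eta Cm : R) :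
  product_measure nu P -> homogenized_matrix P A -> 0 < eta -> 0 < Cm ->
  (forall j, drift_corr P xi j <= Cm * powS j (- (1 + eta))) ->
  (spec_bound d beta)^-1 * (\sum_(0 <= j < M) drift_corr P xi j) @[M --> \oo] -->
    \int[P]_w qform (Amat w 0) xi - qform A xi.
Proof.
move=> hP [_ /(_ xi) [phi [hphi energyE]]] eta0 Cm0 corr_le.
have [energy_int qformE] := homogenized_energyE alpha_gt0 d_gt0 hP hphi.
rewrite (expectationE energy_int) qformE in energyE; case: energyE => ->.
by rewrite opprD addNKr; exact: (corrector_energy_cvg alpha_gt0 d_gt0 hP hphi eta0 Cm0 corr_le).
Qed.

(** * Transfer of the variance decay from finite tori *)

Section BinLaw.
Context (dd : measure_display) (T : measurableType dd) (R : realType).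
Variables (nu : probability T R) (S : finType) (bin : T -> S).
Hypothesis mbin : forall s, measurable [set x | bin x = s].

Definition bin_law s : R := fine (nu [set x | bin x = s]).

Lemma bin_law_ge0 s : 0 <= bin_law s. Proof. exact: fine_ge0. Qed.

Lemma bin_lawE s : nu [set x | bin x = s] = (bin_law s)%:E.
Proof. by rewrite /bin_law fineK // fin_num_measure. Qed.

Lemma sum_fiber_indic (F : S -> R) x : \sum_s F s * \1_[set y | bin y = s] x = F (bin x).
Proof.
rewrite (bigD1 (bin x)) //= big1 ?addr0 => [|s bin_neq]; first by rewrite indicE mem_set ?mulr1.
by rewrite indicE memNset ?mulr0 // => /esym /eqP; exact/negP.
Qed.

Let fiber_integrable k s : Rintegrable nu setT (fun x => k * \1_[set y | bin y = s] x).
Proof. by apply: RintegrableZl => //; exact: L2_Rintegrable (L2_indic nu (mbin s)). Qed.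

Lemma Rintegrable_bin (F : S -> R) : Rintegrable nu setT (fun x => F (bin x)).
Proof.
apply: (eq_Rintegrable measurableT) (fun x _ => sum_fiber_indic F x) _.
exact: (Rintegrable_sum measurableT _ (fun s => fiber_integrable (F s) s)).
Qed.

Lemma Rintegral_bin (F : S -> R) : \int[nu]_x F (bin x) = \sum_s F s * bin_law s.
Proof.
under eq_Rintegral do rewrite -sum_fiber_indic.
rewrite Rintegral_sum //; apply: eq_bigr => s _.
by rewrite RintegralZl // ?Rintegral_indic //; exact: L2_Rintegrable (L2_indic nu (mbin s)).
Qed.

Lemma sum_bin_law : \sum_s bin_law s = 1.
Proof.
by have := Rintegral_bin (fun=> 1); rewrite Rintegral_prob_cst => ->; apply: eq_bigr => s _; rewrite mul1r.
Qed.

End BinLaw.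

Section Sample.
Variables (R : realType) (alpha beta : R) (hab : alpha <= beta) (d : nat).
Local Notation Om := (Omega hab d).
Local Notation edge := (edge d).
Variables (nu : probability (conductance hab) R) (P : probability Om R) (S : finType) (bin : conductance hab -> S).
Hypotheses (mbin : forall s, measurable [set x | bin x = s]) (hP : product_measure nu P).
Variables (J : finType) (pos : J -> edge).
Hypothesis pos_inj : injective pos.

Definition sample (w : Om) : {ffun J -> S} := [ffun j => bin (w (pos j))].

Let sample_side (s : {ffun J -> S}) (e : edge) : set (conductance hab) :=
  if [pick j | pos j == e] is Some j then [set x | bin x = s j] else setT.

Let sample_side_pos s j : sample_side s (pos j) = [set x | bin x = s j].
Proof. by rewrite /sample_side; case: pickP => [k /eqP /pos_inj ->|/(_ j)] //; rewrite eqxx. Qed.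

Let measurable_sample_side s e : measurable (sample_side s e).
Proof. by rewrite /sample_side; case: pickP => // _; exact: measurableT. Qed.

Let sample_fiberE s : [set w | sample w = s] = fin_cylinder (map pos (enum J)) (sample_side s).
Proof.
apply/seteqP; split => w /= => [sample_eq e /mapP[j _ ->]|in_cylinder].
  by rewrite sample_side_pos /= -sample_eq ffunE.
apply/ffunP => j; rewrite ffunE.
by have := in_cylinder (pos j) (map_f pos (mem_enum J j)); rewrite sample_side_pos.
Qed.

Lemma measurable_sample s : measurable [set w | sample w = s].
Proof. by rewrite sample_fiberE; exact: measurable_fin_cylinder. Qed.

Lemma bin_law_sample s : bin_law P sample s = \prod_j bin_law nu bin (s j).
Proof.
rewrite /bin_law sample_fiberE (prob_fin_cylinder hP) //; last by rewrite map_inj_uniq ?enum_uniq.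
rewrite big_map big_enum /=; under eq_bigr do rewrite sample_side_pos (bin_lawE nu mbin).
by rewrite prodEFin.
Qed.

Lemma Rintegral_sample (F : {ffun J -> S} -> R) : \int[P]_w F (sample w) = expect (bin_law nu bin) F.
Proof.
rewrite (Rintegral_bin P measurable_sample); apply: eq_bigr => s _.
by rewrite bin_law_sample mulrC.
Qed.

End Sample.

Section LatticeDrift.
Variables (R : realType) (alpha beta : R) (hab : alpha <= beta) (d : nat) (xi : 'rV[R]_d).
Local Notation lattice_drift := (heat_ldrift (@unit_vec d) beta (xi 0)).

Lemma evolved_drift_lattice n (w : Omega hab d) x :
  evolved_drift xi n (Defs.shift x w) = lattice_drift (fun e => conductance_val (w e)) n x.
Proof.
elim: n x => [|n IH] x; first by apply: eq_bigr => i _; rewrite !cond_shift add0r [- _ + x]addrC.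
rewrite [LHS]/= /env_step /= IH; congr (_ - _ * _); apply: eq_bigr => i _.
by rewrite !cond_shift !shiftD !IH add0r ![_ + x]addrC.
Qed.

Lemma cvg_lattice_drift (a_ : nat -> edge d -> R) a : (forall e, a_ k e @[k --> \oo] --> a e) ->
  forall n x, lattice_drift (a_ k) n x @[k --> \oo] --> lattice_drift a n x.
Proof.
move=> a_cvg; elim=> [|n IH] x.
  by apply: cvg_sum => i; apply: cvgM; [exact: cvg_cst|apply: cvgB; exact: a_cvg].
apply: cvgB; first exact: IH.
apply: cvgM; first exact: cvg_cst.
by apply: cvg_sum => i; apply: cvgD; apply: cvgM; try exact: a_cvg; apply: cvgB; exact: IH.
Qed.

End LatticeDrift.

Section Rounding.
Variables (R : realType) (alpha beta : R) (hab : alpha <= beta) (m : nat).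
Local Notation cond_t := (conductance hab).

Definition bin_index (t : R) : nat := \sum_(j < m) (j.+1%:R * (beta - alpha) <= (t - alpha) * m.+1%:R)%R.
Definition bin_value (s : 'I_m.+1) : R := alpha + (beta - alpha) * (s%:R / m.+1%:R).

Lemma bin_index_lt t : (bin_index t < m.+1)%N.
Proof.
rewrite ltnS; apply: (@leq_trans (\sum_(j < m) 1)%N); last by rewrite sum1_card card_ord.
by apply: leq_sum => j _; exact: leq_b1.
Qed.

Definition round_cond (x : cond_t) : 'I_m.+1 := Ordinal (bin_index_lt (conductance_val x)).

Let m_gt0 : 0 < m.+1%:R :> R. Proof. by rewrite ltr0n. Qed.
Let gap_ge0 : 0 <= beta - alpha. Proof. by rewrite subr_ge0. Qed.

Lemma bin_value_bounds s : alpha <= bin_value s <= beta.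
Proof.
have frac_le1 : s%:R / m.+1%:R <= 1 :> R by rewrite ler_pdivrMr // mul1r ler_nat ltnW.
have frac_ge0 : 0 <= s%:R / m.+1%:R :> R by rewrite divr_ge0 // ltW.
by rewrite /bin_value lerDl mulr_ge0 //= -lerBrDl; apply: le_trans (ler_wpM2l gap_ge0 frac_le1) _; rewrite mulr1.
Qed.

Lemma sum_threshold (z : R) : 0 <= z -> \sum_(j < m) ((j.+1%:R : R) <= z)%R%:R = (minn m (Num.truncn z))%:R :> R.
Proof.
move=> z0; elim: m => [|k IH]; first by rewrite big_ord0 min0n.
rewrite big_ord_recr /= IH -truncn_ge_nat // -natrD; congr _%:R.
by case: leqP => h; rewrite ?addn1 ?addn0; lia.
Qed.

(* With y = t - alpha and D = beta - alpha, the bin of t is the integer part of y (m + 1) / D, capped at m. *)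
Lemma bin_error_le (y D : R) : 0 <= y -> y <= D ->
  `|D * (\sum_(j < m) (j.+1%:R * D <= y * m.+1%:R)%R)%N%:R - y * m.+1%:R| <= D.
Proof.
move=> y0 yD; have D0 := le_trans y0 yD.
have [D_le0|D_gt0] := leP D 0.
  have D_eq0 : D = 0 by apply/eqP; rewrite eq_le D_le0 D0.
  have -> : y = 0 by apply/eqP; rewrite eq_le y0 andbT -D_eq0.
  by rewrite D_eq0 !mul0r subrr normr0.
have scaled_ge0 : 0 <= y * m.+1%:R / D by rewrite divr_ge0 ?mulr_ge0.
have -> : (\sum_(j < m) (j.+1%:R * D <= y * m.+1%:R)%R = minn m (Num.truncn (y * m.+1%:R / D)))%N.
  apply/eqP; rewrite -(eqr_nat R) natr_sum -sum_threshold //; apply/eqP; apply: eq_bigr => j _.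
  by rewrite ler_pdivlMr.
set k := Num.truncn _; have trunc_le : k%:R * D <= y * m.+1%:R by rewrite -ler_pdivlMr // truncn_le.
have lt_trunc : y * m.+1%:R < k%:R * D + D by rewrite -[X in _ + X]mul1r -mulrDl natr1 -ltr_pdivrMr // truncnS_gt.
have le_cap : y * m.+1%:R <= m%:R * D + D by rewrite -[X in _ + X]mul1r -mulrDl natr1 mulrC ler_pM2l.
rewrite ler_norml [D * _]mulrC; case: (leqP m k) => mk; last first.
  by move: trunc_le lt_trunc; move: (k%:R * D) (y * _) => X Y; lra.
have cap_le : m%:R * D <= k%:R * D by rewrite ler_pM2r // ler_nat.
by move: le_cap (le_trans cap_le trunc_le); move: (m%:R * D) (y * _) => X Y; lra.
Qed.

Lemma round_cond_le (x : cond_t) : `|bin_value (round_cond x) - conductance_val x| <= (beta - alpha) / m.+1%:R.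
Proof.
have /andP[x_ge x_le] : alpha <= conductance_val x <= beta by case: x.
rewrite -(ler_pM2r m_gt0) divfK ?gt_eqF // -[X in _ * X](gtr0_norm m_gt0) -normrM.
have -> : (bin_value (round_cond x) - conductance_val x) * m.+1%:R =
    (beta - alpha) * (bin_index (conductance_val x))%:R - (conductance_val x - alpha) * m.+1%:R.
  by rewrite /bin_value /=; field; rewrite gt_eqF.
by apply: bin_error_le; rewrite ?subr_ge0 // lerD2r.
Qed.

Lemma measurable_conductance_val : measurable_fun setT (fun x : cond_t => conductance_val x : R).
Proof. by move=> _ B mB; rewrite setTI; exists B => //; rewrite setTI. Qed.

Lemma measurable_round_cond s : measurable [set x | round_cond x = s].
Proof.
pose above (j : 'I_m) := [set x : cond_t | j.+1%:R * (beta - alpha) <= (conductance_val x - alpha) * m.+1%:R].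
have m_above j : measurable (above j).
  have -> : above j = setT `&` (fun x : cond_t => (conductance_val x - alpha) * m.+1%:R) @^-1`
      `[j.+1%:R * (beta - alpha), +oo[%classic by apply/seteqP; split => x /=; rewrite ?in_itv /= ?andbT; [|case].
  by apply: measurable_funM => //; first by apply: measurable_funB => //; exact: measurable_conductance_val.
have m_count : measurable_fun setT (fun x : cond_t => \sum_(j < m) \1_(above j) x : R).
  by apply: measurable_sum => j; exact: measurable_indic.
have countE (x : cond_t) : \sum_(j < m) \1_(above j) x = (bin_index (conductance_val x))%:R :> R.
  rewrite /bin_index natr_sum; apply: eq_bigr => j _; rewrite indicE; congr ((_ : bool)%:R).
  by apply/idP/idP => [/set_mem|?] //; apply/mem_set.
have -> : [set x | round_cond x = s] = setT `&` (fun x : cond_t => \sum_(j < m) \1_(above j) x : R) @^-1` [set s%:R].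
  apply/seteqP; split => x /=; first by move=> <-; split => //; rewrite countE.
  by move=> [_]; rewrite countE => /eqP; rewrite eqr_nat => /eqP ?; exact: val_inj.
exact: m_count.
Qed.

End Rounding.

Section TorusModel.
Variables (R : realType) (alpha beta : R) (alpha_gt0 : 0 < alpha) (hab : alpha <= beta) (d : nat) (d_gt0 : (0 < d)%N).
Variables (nu : probability (conductance hab) R) (P : probability (Omega hab d) R).
Hypothesis hP : product_measure nu P.
Variable xi : 'rV[R]_d.
Hypothesis hxi : forall i, `|xi 0 i| <= 1.
Variables (n m : nat).
Local Notation p := (2 * n).+2.
Local Notation V := 'rV['I_p.+2]_d.
Local Notation site := (site d).
Local Notation edge := (edge d).
Local Notation av := (@unit_vec d).
Implicit Types (x : V).

Definition torus_dir (i : 'I_d) : V := delta_mx 0 i.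

Lemma torus_dir_embeds : box_embeds torus_dir n.
Proof.
have latE k j : (lattice_pt torus_dir k) 0 j = (k j)%:R.
  rewrite /lattice_pt summxE (bigD1 j) //= big1 ?addr0 => [|i ij]; rewrite mulmxnE /torus_dir mxE ?eqxx //.
  by rewrite eq_sym (negPf ij) andbF mul0rn.
move=> k l kN lN /rowP h j; have := h j; rewrite !latE => /(congr1 val).
by rewrite !Zp_nat /= !modn_small //; [have := lN j|have := kN j]; lia.
Qed.

Definition coord_nat x (j : 'I_d) : nat := x 0 j.
Definition centred_rep x : site := \row_j ((coord_nat x j)%:Z - n.+1%:Z).
Definition copy_index (o : option bool) : nat := if o is Some b then b.+1 else 0.
Definition copy_embedding (j : (V * 'I_d) * option bool) : edge := (centred_rep j.1.1 + const_mx (copy_index j.2 * p.+2)%N%:Z, j.1.2).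

Lemma coord_nat_lt x j : (coord_nat x j < p.+2)%N. Proof. exact: ltn_ord. Qed.

Lemma copy_index_inj : injective copy_index.
Proof. by move=> [[]|] [[]|]. Qed.

Lemma copy_embedding_inj : injective copy_embedding.
Proof.
move=> [[x i] o] [[y j] o'] [] /rowP emb_eq ->.
have index_eq k : (copy_index o * p.+2 + coord_nat x k = copy_index o' * p.+2 + coord_nat y k)%N.
  by have := emb_eq k; rewrite !mxE /=; lia.
have digits_eq k : coord_nat x k = coord_nat y k /\ copy_index o = copy_index o'.
  have mod_eq := congr1 (modn^~ p.+2) (index_eq k); have div_eq := congr1 (divn^~ p.+2) (index_eq k).
  rewrite /= !modnMDl !modn_small ?coord_nat_lt // in mod_eq.
  by rewrite /= !divnMDl // !divn_small ?coord_nat_lt // !addn0 in div_eq.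
have -> : o = o' by apply: copy_index_inj; case: (digits_eq (Ordinal d_gt0)).
have -> // : x = y.
by apply/rowP => k; apply: val_inj; case: (digits_eq k).
Qed.

Definition rounded_torus : torus_model d alpha beta :=
  @TorusModel R d alpha beta V torus_dir n torus_dir_embeds 'I_m.+1 (bin_law nu (@round_cond R alpha beta hab m))
    (bin_law_ge0 nu _) (sum_bin_law nu (@measurable_round_cond R alpha beta hab m)) (@bin_value R alpha beta m)
    (@bin_value_bounds R alpha beta hab m) (xi 0) hxi.

Local Notation lattice_drift := (heat_ldrift av beta (xi 0)).
Local Notation smp := (sample (@round_cond R alpha beta hab m) copy_embedding).
Definition rounded_cond (w : Omega hab d) (e : edge) : R := bin_value alpha beta (round_cond m (w e)).

Lemma env_sampleE w x i : env (M := rounded_torus) (smp w) (x, i) = rounded_cond w (centred_rep x, i).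
Proof.
by rewrite /env /= ffunE /copy_embedding /= /rounded_cond mul0n (_ : const_mx _ = 0) ?addr0 //; apply/rowP => j; rewrite !mxE.
Qed.

Lemma coord_nat_up x i j : (coord_nat x i < p.+1)%N -> coord_nat (x + torus_dir i) j = (coord_nat x j + (j == i))%N.
Proof.
rewrite /coord_nat => h; rewrite !mxE eqxx andTb; case: (eqVneq j i) => [->|_]; last by rewrite addr0 addn0.
by rewrite /= modn_small addn1.
Qed.

Lemma coord_nat_down x i j : (0 < coord_nat x i)%N -> (coord_nat (x - torus_dir i) j + (j == i))%N = coord_nat x j.
Proof.
move=> h; have lt : (coord_nat (x - torus_dir i) i < p.+1)%N.
  have := ltn_ord ((x - torus_dir i) 0 i); rewrite ltnS leq_eqVlt => /orP[/eqP E|//].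
  have : coord_nat (x - torus_dir i + torus_dir i) i = 0%N by rewrite /coord_nat mxE /= E !mxE !eqxx /= addn1 modnn.
  by rewrite subrK => h0; rewrite h0 in h.
by rewrite -(coord_nat_up j lt) subrK.
Qed.

Lemma centred_rep_up x i : (coord_nat x i < p.+1)%N -> centred_rep (x + torus_dir i) = centred_rep x + av i.
Proof.
by move=> h; apply/rowP => j; rewrite !mxE coord_nat_up // eqxx /=; case: (j == i) => /=; lia.
Qed.

Lemma centred_rep_down x i : (0 < coord_nat x i)%N -> centred_rep (x - torus_dir i) = centred_rep x - av i.
Proof.
move=> h; apply/rowP => j; rewrite !mxE -(coord_nat_down j h) eqxx /=; case: (j == i) => /=; lia.
Qed.

Lemma evolved_sampleE w k x : (forall j, k < coord_nat x j < p.+1 - k)%N ->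
  evolved (M := rounded_torus) (smp w) k x = lattice_drift (rounded_cond w) k (centred_rep x).
Proof.
move: k x; apply: (@heat_ldrift_transfer _ V _ _ torus_dir av _ _ centred_rep
  (fun k x => forall j, k < coord_nat x j < p.+1 - k)%N).
- by move=> k x inside j; have := inside j; clear; lia.
- move=> k x i inside; have /andP[gt_k lt_k] := inside i.
  have up j := @coord_nat_up x i j (leq_trans lt_k (leq_subr _ _)).
  have down j := @coord_nat_down x i j (leq_ltn_trans (leq0n _) gt_k).
  split=> j; have := inside j; first by rewrite up; case: (j == i); clear; lia.
  by move: (down j); move: (coord_nat x j) (coord_nat (x - torus_dir i) j) => t s; case: (j == i); clear; lia.
- move=> k x i inside; have /andP[gt_k lt_k] := inside i.
  by split; [apply: centred_rep_up; lia|apply: centred_rep_down; lia].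
exact: env_sampleE.
Qed.

Definition torus_centre : V := const_mx (inord n.+1).

Let torus_centreE j : coord_nat torus_centre j = n.+1.
Proof. by rewrite /coord_nat mxE inordK //; lia. Qed.

Lemma lattice_drift_origin w : lattice_drift (rounded_cond w) n 0 ^+ 2 = `|evolved (M := rounded_torus) (smp w) n torus_centre| ^+ 2.
Proof.
have centre_origin : centred_rep torus_centre = 0 by apply/rowP => j; rewrite mxE torus_centreE mxE subrr.
by rewrite real_normK ?num_real // evolved_sampleE ?centre_origin // => j; rewrite torus_centreE; lia.
Qed.

Lemma Rintegrable_rounded_drift : Rintegrable P setT (fun w => lattice_drift (rounded_cond w) n 0 ^+ 2).
Proof.
have m_sample := measurable_sample (@measurable_round_cond R alpha beta hab m) copy_embedding_inj.
have := Rintegrable_bin P m_sample (fun s => `|evolved (M := rounded_torus) s n torus_centre| ^+ 2).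
by apply: eq_Rintegrable => [|w _]; [exact: measurableT|rewrite lattice_drift_origin].
Qed.

Lemma Rintegral_rounded_drift : \int[P]_w (lattice_drift (rounded_cond w) n 0 ^+ 2) = sol_norm rounded_torus 2 n ^+ 2.
Proof.
under eq_Rintegral do rewrite lattice_drift_origin.
rewrite (Rintegral_sample (@measurable_round_cond R alpha beta hab m) hP copy_embedding_inj
  (fun s => `|evolved (M := rounded_torus) s n torus_centre| ^+ 2)).
rewrite sol_normX // -[LHS](site_mean_cst rounded_torus); congr (_ * _); apply: eq_bigr => x _.
rewrite -[LHS](expect_translate (M := rounded_torus) (x - torus_centre)); apply: eq_expect => s.
by rewrite evolved_translate [torus_centre + _]addrC subrK.
Qed.

End TorusModel.

Lemma cvg_rounded_cond (R : realType) (alpha beta : R) (hab : alpha <= beta) d (w : Omega hab d) e :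
  rounded_cond m w e @[m --> \oo] --> conductance_val (w e).
Proof.
apply/cvgrPdist_le => eps eps0; near=> m.
rewrite distrC; apply: le_trans (round_cond_le m (w e)) _.
rewrite ler_pdivrMr ?ltr0n // mulrC -ler_pdivrMr //; apply: ltW; apply: (@lt_le_trans _ _ m%:R); last by rewrite ler_nat.
by near: m; exact: nbhs_infty_gtr.
Unshelve. all: by end_near. Qed.

Lemma cvg_rounded_drift (R : realType) (alpha beta : R) (hab : alpha <= beta) d (P : probability (Omega hab d) R)
    (nu : probability (conductance hab) R) (xi : 'rV[R]_d) n : 0 < alpha -> (0 < d)%N -> product_measure nu P ->
  (forall i, `|xi 0 i| <= 1) ->
  \int[P]_w (heat_ldrift (@unit_vec d) beta (xi 0) (rounded_cond m w) n 0 ^+ 2) @[m --> \oo] -->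
  \int[P]_w (evolved_drift xi n w ^+ 2).
Proof.
move=> alpha0 d0 hP hxi; have mT : measurable [set: Omega hab d] := measurableT.
apply: (cvg_Rintegral_dominated mT _ _ (Rintegrable_cst P ((2 * d%:R * beta) ^+ 2))) => [m||m w _|w _].
- exact: Rintegrable_measurable (Rintegrable_rounded_drift alpha0 d0 nu P hxi n m).
- by apply: measurable_funX; case: (L2_evolved_drift alpha0 hP xi n).
- rewrite normrX; apply: ler_sqr_nneg => //.
  have ell : elliptic alpha beta (rounded_cond m w) by move=> e; exact: bin_value_bounds.
  by apply: (normr_heat_le_sup _ d0 alpha0 hab ell) => y; exact: (normr_ldrift_le _ _ alpha0 hab ell hxi).
rewrite -[w in evolved_drift _ _ w]shift0 evolved_drift_lattice.
have drift_cvg := @cvg_lattice_drift _ beta _ xi _ _ (@cvg_rounded_cond _ _ _ _ _ w) n 0.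
exact: (cvgM drift_cvg drift_cvg).
Qed.

Lemma evolved_drift_decay (R : realType) (alpha beta : R) (alpha_gt0 : 0 < alpha) (hab : alpha <= beta) (d : nat) : (1 < d)%N ->
  exists2 C : R, 0 < C & forall (nu : probability (conductance hab) R) (P : probability (Omega hab d) R),
  product_measure nu P -> forall xi : 'rV[R]_d, (forall i, `|xi 0 i| <= 1) ->
  forall n, \int[P]_w (evolved_drift xi n w ^+ 2) <= C * powS n (- (d%:R / 2 + 1)).
Proof.
move=> d1; have d0 : (0 < d)%N := ltnW d1.
have [C C0 sol_decay] := variance_decay d1 alpha_gt0 hab; exists (C ^+ 2); first by rewrite exprn_gt0.
move=> nu P hP xi hxi n; apply/ler_addgt0Pr => eps eps0.
have [m _ /(_ m (leqnn m))] := (cvgrPdist_le _ _).1 (cvg_rounded_drift (n := n) alpha_gt0 d0 hP hxi) eps eps0.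
rewrite /= ler_norml => /andP[_]; rewrite lerBlDl => /le_trans; apply; rewrite lerD2r.
rewrite (Rintegral_rounded_drift alpha_gt0 d0 hP hxi).
have := sol_decay (rounded_torus alpha_gt0 d0 nu hxi n m) n (leqnn n) => /(ler_sqr_nneg (sol_norm_ge0 _ _ _)) /le_trans; apply.
by rewrite exprMn powS_exprn /decay_exp mulNr divfK.
Qed.

(** * Positive functionals on polynomials and the functional calculus *)

Lemma mul_bin_ffact N i k : (i + k <= N)%N -> ('C(N, i + k) * (i + k) ^_ i = N ^_ i * 'C(N - i, k))%N.
Proof.
move=> ikN; have iN : (i <= N)%N := leq_trans (leq_addr k i) ikN.
have k_le : (k <= N - i)%N by rewrite leq_subRL.
apply/eqP; rewrite -(eqn_pmul2r (fact_gt0 (N - i - k))) -(eqn_pmul2r (fact_gt0 k)); apply/eqP.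
have choose_ik := bin_fact ikN; have choose_k := bin_fact k_le.
have arrange_i := ffact_fact (leq_addr k i); have arrange_N := ffact_fact iN.
rewrite addKn in arrange_i; rewrite subnDA in choose_ik.
by transitivity (N`!)%N; [rewrite -choose_ik -arrange_i|rewrite -arrange_N -choose_k]; ring.
Qed.

Section FallingRatio.
Variable R : realFieldType.

Definition ffact_ratio N k i : R := (k ^_ i)%:R / (N ^_ i)%:R.

Lemma sub_ratio_close (N k i : nat) : (k <= N)%N -> (i < N)%N ->
  `|(k - i)%:R / (N - i)%:R - k%:R / N%:R| <= i%:R / (N - i)%:R :> R.
Proof.
move=> kN iN; have N0 : 0 < N%:R :> R by rewrite ltr0n (leq_ltn_trans _ iN).
have Ni0 : 0 < (N - i)%:R :> R by rewrite ltr0n subn_gt0.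
have cross_le : (k - i)%:R * N%:R <= k%:R * (N - i)%:R :> R.
  by rewrite -!natrM ler_nat; clear -kN iN; nia.
have cross_ge : k%:R * (N - i)%:R <= (k - i)%:R * N%:R + i%:R * N%:R :> R.
  by rewrite -!natrM -natrD ler_nat; clear -kN iN; nia.
have -> : (k - i)%:R / (N - i)%:R - k%:R / N%:R = ((k - i)%:R * N%:R - k%:R * (N - i)%:R) / (N%:R * (N - i)%:R) :> R.
  by field; rewrite !gt_eqF.
rewrite normrM [X in _ * X]ger0_norm ?invr_ge0 ?mulr_ge0 // ler_pdivrMr ?mulr_gt0 //.
rewrite mulrA mulrAC mulfVK ?gt_eqF // [X in `|X|]addrC ler0_norm ?subr_le0 //; last by move: cross_le; lra.
by move: cross_ge; lra.
Qed.

Lemma ffact_ratio_close N k i : (k <= N)%N -> (i < N)%N ->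
  0 <= ffact_ratio N k i <= 1 /\ `|ffact_ratio N k i - (k%:R / N%:R) ^+ i| <= (i * i)%:R / (N - i)%:R.
Proof.
move=> kN; elim: i => [|i IH] iN.
  by rewrite /ffact_ratio !ffactn0 divr1 expr0 subrr normr0 muln0 mul0r lexx ler01.
have [/andP[ratio_ge0 ratio_le1] close] := IH (ltnW iN).
have N0 : 0 < N%:R :> R by rewrite ltr0n (leq_ltn_trans _ iN).
have Ni0 : 0 < (N - i)%:R :> R by rewrite ltr0n subn_gt0 ltnW.
have factor_close := sub_ratio_close kN (ltnW iN).
set a : R := (k - i)%:R / (N - i)%:R in factor_close; set t : R := k%:R / N%:R in close factor_close *.
have ratioS : ffact_ratio N k i.+1 = ffact_ratio N k i * a by rewrite /ffact_ratio !ffactnSr !natrM invfM /a; ring.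
have a0 : 0 <= a by rewrite divr_ge0.
have a1 : a <= 1 by rewrite ler_pdivrMr // mul1r ler_nat leq_sub2r.
have t0 : 0 <= t by rewrite divr_ge0.
have t1 : t <= 1 by rewrite ler_pdivrMr // mul1r ler_nat.
split; first by rewrite ratioS mulr_ge0 // mulr_ile1.
rewrite ratioS exprSr.
have -> : ffact_ratio N k i * a - t ^+ i * t = (ffact_ratio N k i - t ^+ i) * a + t ^+ i * (a - t) by ring.
apply: le_trans (ler_normD _ _) _; rewrite normrM (ger0_norm a0) [`|t ^+ i * _|]normrM (ger0_norm (exprn_ge0 i t0)).
apply: (@le_trans _ _ ((i * i)%:R / (N - i)%:R + i%:R / (N - i)%:R)).
  apply: lerD; first by apply: le_trans close; rewrite ler_piMr.
  by apply: le_trans factor_close; rewrite ler_piMl // exprn_ile1.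
rewrite -mulrDl; apply: ler_pM; rewrite ?addr_ge0 ?invr_ge0 // -?natrD ?ler_nat; first by clear; nia.
by rewrite lef_pV2 ?posrE ?ltr0n ?subn_gt0 ?ler_nat ?leq_sub2l // ltnW.
Qed.

End FallingRatio.
Arguments ffact_ratio {R} N k i.

Section PositiveFunctional.
Variables (R : realType) (form : {poly R} -> R) (b : R).
Hypothesis form_lin : forall a p q, form (a *: p + q) = a * form p + form q.
Hypothesis b_ge0 : 0 <= b.
Hypothesis bernstein_ge0 : forall a m, 0 <= form ('X^a * (b%:P - 'X) ^+ m).

Let form0 : form 0 = 0.
Proof. by have := form_lin 1 0 0; rewrite scaler0 addr0 mul1r; move: (form 0) => z; lra. Qed.
Let formD p q : form (p + q) = form p + form q.
Proof. by rewrite -{1}[p]scale1r form_lin mul1r. Qed.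
Let formZ a p : form (a *: p) = a * form p.
Proof. by rewrite -[a *: p]addr0 form_lin form0 addr0. Qed.
Let form_sum n (F : nat -> {poly R}) : form (\sum_(i < n) F i) = \sum_(i < n) form (F i).
Proof. by elim: n => [|n IH]; rewrite ?big_ord0 // !big_ord_recr /= formD IH. Qed.

Let form_coef r : form r = \sum_(i < size r) r`_i * form 'X^i.
Proof.
rewrite -{1}[r]coefK poly_def (form_sum _ (fun i => r`_i *: 'X^i)).
by apply: eq_bigr => i _; rewrite formZ.
Qed.

(* The Bernstein polynomials of degree N form a partition of unity on [0, b], so these weights are nonnegative and,
   up to [O(1/N)], represent the functional by point masses at the nodes b k / N. *)
Definition bernstein_weight N k : R := b ^- N * ('C(N, k)%:R * form ('X^k * (b%:P - 'X) ^+ (N - k))).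

Let bernstein_weight_ge0 N k : 0 <= bernstein_weight N k.
Proof. by rewrite mulr_ge0 ?invr_ge0 ?exprn_ge0 // mulr_ge0. Qed.

Let form_monomial_binomial N i : (i <= N)%N -> b ^+ (N - i) * form 'X^i =
  \sum_(k < (N - i).+1) 'C(N - i, k)%:R * form ('X^(i + k) * (b%:P - 'X) ^+ (N - (i + k))).
Proof.
move=> iN; rewrite -formZ -mul_polyC polyC_exp mulrC.
have -> : b%:P ^+ (N - i) = ((b%:P - 'X) + 'X) ^+ (N - i) :> {poly R} by rewrite subrK.
rewrite exprDn mulr_sumr (form_sum _ (fun k => 'X^i * ((b%:P - 'X) ^+ (N - i - k) * 'X^k *+ 'C(N - i, k)))).
apply: eq_bigr => k _; rewrite -formZ scaler_nat -subnDA -mulrnAr; congr form.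
by rewrite exprD !mulrnAr -mulrA [X in 'X^i * X *+ _]mulrC.
Qed.

Let form_monomial N i : 0 < b -> (i <= N)%N ->
  form 'X^i = b ^+ i * \sum_(k < N.+1) bernstein_weight N k * ffact_ratio N k i.
Proof.
move=> b0 iN; have ffact0 : (N ^_ i)%:R != 0 :> R by rewrite pnatr_eq0 -lt0n ffact_gt0.
have -> : form 'X^i = b ^- (N - i) * (b ^+ (N - i) * form 'X^i) by rewrite mulKf // expf_neq0 // gt_eqF.
rewrite (form_monomial_binomial iN) -(big_mkord xpredT (fun k => bernstein_weight N k * ffact_ratio N k i)).
rewrite (@big_cat_nat _ _ _ i) //=; last exact: leqW.
rewrite [X in _ * (X + _)]big1_seq ?add0r; last first.
  by move=> k; rewrite mem_index_iota => /andP[_ /= ki]; rewrite /ffact_ratio ffact_small // mul0r mulr0.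
rewrite -[X in \sum_(X <= _ < _) _]add0n big_addn subSn // big_mkord !mulr_sumr; apply: eq_bigr => k _.
have ikN : (i + k <= N)%N by rewrite -leq_subRL // -ltnS.
have counts := congr1 (fun n : nat => n%:R : R) (mul_bin_ffact ikN); rewrite !natrM in counts.
rewrite /bernstein_weight /ffact_ratio [(k + i)%N]addnC.
have -> : b ^- (N - i) = b ^+ i * b ^- N by rewrite -{2}(subnK iN) exprD invfM mulrC mulfVK // expf_neq0 // gt_eqF.
move: (form _) => L.
transitivity (b ^+ i * b ^- N * L * (('C(N, i + k))%:R * ((i + k) ^_ i)%:R) / (N ^_ i)%:R); last by ring.
rewrite counts; move: (b ^+ i / b ^+ N) ('C(N - i, k)%:R : R) ffact0 => u v.
by move: ((N ^_ i)%:R : R) => z z0; field.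
Qed.

Let form_bernstein (r : {poly R}) N : 0 < b -> (size r <= N.+1)%N ->
  form r = \sum_(k < N.+1) bernstein_weight N k * \sum_(i < size r) r`_i * b ^+ i * ffact_ratio N k i.
Proof.
move=> b0 rN; rewrite form_coef.
under eq_bigr => i _ do rewrite (form_monomial b0 (leq_trans (ltn_ord i) rN : (i <= N)%N)) mulrA mulr_sumr.
by rewrite exchange_big /=; apply: eq_bigr => k _; rewrite mulr_sumr; apply: eq_bigr => i _; ring.
Qed.

Let sum_bernstein_weight N : 0 < b -> form 1 = \sum_(k < N.+1) bernstein_weight N k.
Proof.
move=> b0; have := form_monomial b0 (leq0n N); rewrite !expr0 mul1r => ->; apply: eq_bigr => k _.
by rewrite /ffact_ratio !ffactn0 divr1 mulr1.
Qed.

Let node_error (r : {poly R}) : R := \sum_(i < size r) `|r`_i| * b ^+ i * (size r * size r)%:R.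

Let node_error_ge0 (r : {poly R}) : 0 <= node_error r.
Proof. by rewrite sumr_ge0 // => i _; rewrite !mulr_ge0 // exprn_ge0. Qed.

Let node_value_le (r : {poly R}) n k : (k <= size r + n.+1)%N ->
  \sum_(i < size r) r`_i * b ^+ i * ffact_ratio (size r + n.+1) k i <=
  r.[b * (k%:R / (size r + n.+1)%:R)] + node_error r / n.+1%:R.
Proof.
set s := size r; set N := (s + n.+1)%N => kN; have sN : (s < N)%N by rewrite /N addnS ltnS leq_addr.
have -> : \sum_(i < s) r`_i * b ^+ i * ffact_ratio N k i = r.[b * (k%:R / N%:R)] +
    \sum_(i < s) r`_i * b ^+ i * (ffact_ratio N k i - (k%:R / N%:R) ^+ i).
  by rewrite horner_coef -/s -big_split; apply: eq_bigr => i _ /=; rewrite exprMn; ring.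
rewrite lerD2l /node_error mulr_suml; apply: ler_sum => i _.
apply: le_trans (ler_norm _) _; rewrite !normrM (ger0_norm (exprn_ge0 i b_ge0)) -[leRHS]mulrA.
rewrite ler_wpM2l ?mulr_ge0 ?exprn_ge0 //.
have [_ close] := ffact_ratio_close R kN (ltn_trans (ltn_ord i) sN); apply: le_trans close _.
have si := ltn_ord i; apply: ler_pM; rewrite ?invr_ge0 // ?ler_nat; first by rewrite leq_mul // ltnW.
rewrite lef_pV2 ?posrE ?ltr0n ?subn_gt0 ?(ltn_trans si sN) // ler_nat /N; move: (nat_of_ord i) si => i' si.
by clearbody s; clear -si; lia.
Qed.

Let positive_functional_le0 r M : b = 0 -> r.[0] <= M -> form r <= M * form 1.
Proof.
move=> b0 r0M; have form1_ge0 : 0 <= form 1 by have := bernstein_ge0 0 0; rewrite expr0 mul1r.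
have form_pos_degree i : form ('X^(i.+1)) = 0.
  apply: le_anti; have := bernstein_ge0 i 1; have := bernstein_ge0 i.+1 0.
  rewrite b0 expr0 mulr1 => ->; rewrite andbT sub0r expr1 mulrN -exprSr -scaleN1r formZ; lra.
suff -> : form r = r`_0 * form 1 by rewrite ler_wpM2r // -horner_coef0.
rewrite form_coef; case size_r: (size r) => [|n]; first by rewrite big_ord0 nth_default ?mul0r // size_r.
by rewrite big_ord_recl big1 ?addr0 // => i _; rewrite form_pos_degree mulr0.
Qed.

Lemma positive_functional_le r M : (forall x, 0 <= x <= b -> r.[x] <= M) -> form r <= M * form 1.
Proof.
move=> r_le; have form1_ge0 : 0 <= form 1 by have := bernstein_ge0 0 0; rewrite expr0 mul1r.
have [b0|b_neq0] := eqVneq b 0.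
  by apply: positive_functional_le0 => //; apply: r_le; rewrite lexx b_ge0.
have b0 : 0 < b by rewrite lt_neqAle eq_sym b_neq0.
have le_err n : form r <= (M + node_error r / n.+1%:R) * form 1.
  set N := (size r + n.+1)%N; rewrite (sum_bernstein_weight N b0) mulr_sumr.
  rewrite (@form_bernstein r N b0) ?leqW ?leq_addr //; apply: ler_sum => k _; rewrite mulrC ler_wpM2r //.
  have kN : (k <= N)%N by rewrite -ltnS.
  apply: le_trans (node_value_le kN) _; rewrite lerD2r; apply: r_le.
  rewrite mulr_ge0 ?divr_ge0 //= ler_piMr // ler_pdivrMr ?ltr0n ?addnS // mul1r ler_nat.
  by rewrite -addnS.
apply/ler_addgt0Pr => eps eps0; pose err := node_error r * form 1; have err_ge0 : 0 <= err by rewrite mulr_ge0.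
set n := Num.bound (err / eps); apply: le_trans (le_err n) _.
rewrite mulrDl lerD2l mulrAC -/err ler_pdivrMr // mulrC -ler_pdivrMr //.
apply: ltW; apply: lt_le_trans (archi_boundP (divr_ge0 err_ge0 (ltW eps0))) _.
by rewrite -/n ler_nat.
Qed.

End PositiveFunctional.

Section FunctionalCalculus.
Context (dd : measure_display) (T : measurableType dd) (R : realType).
Variables (P : probability T R) (L : (T -> R) -> (T -> R)) (c : R).
Local Notation L2 := (L2 P).
Hypothesis L_lin : forall a f g w, L (fun v => a * f v + g v) w = a * L f w + L g w.
Hypothesis L_L2 : forall f, L2 f -> L2 (L f).
Hypothesis L_sym : forall f g, L2 f -> L2 g -> \int[P]_w (g w * L f w) = \int[P]_w (f w * L g w).
Hypothesis L_ge0 : forall f, L2 f -> 0 <= \int[P]_w (f w * L f w).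
Hypothesis c_gt0 : 0 < c.
Hypothesis L_le : forall f, L2 f -> \int[P]_w (f w * L f w) <= c * \int[P]_w (f w ^+ 2).
Implicit Types (p q : {poly R}) (f g : T -> R).
Let mT : measurable [set: T]. Proof. exact: measurableT. Qed.

Lemma poly_op_widen n p f w : (size p <= n)%N -> poly_op L p f w = \sum_(i < n) p`_i * iter i L f w.
Proof.
move=> h; rewrite /poly_op (big_ord_widen_cond _ xpredT (fun i => p`_i * iter i L f w) h) big_mkcond /=.
by apply: eq_bigr => i _; case: ltnP => // h2; rewrite nth_default // mul0r.
Qed.

Lemma poly_op_lin a p q f w : poly_op L (a *: p + q) f w = a * poly_op L p f w + poly_op L q f w.
Proof.
pose n := maxn (size p) (size q).
rewrite !(@poly_op_widen n) ?leq_maxl ?leq_maxr //; last first.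
  by apply: leq_trans (size_polyD _ _) _; rewrite geq_max leq_maxr (leq_trans (size_scale_leq _ _)) ?leq_maxl.
by rewrite mulr_sumr -big_split; apply: eq_bigr => i _ /=; rewrite coefD coefZ; ring.
Qed.

Lemma poly_opC a f w : poly_op L a%:P f w = a * f w.
Proof. by rewrite (@poly_op_widen 1) ?size_polyC_leq1 // big_ord1 coefC. Qed.

Let L0 w : L (fun=> 0) w = 0.
Proof.
have -> : (fun=> 0) = (fun v : T => (-1) * 0 + 0) :> (T -> R) by apply/funext => v; ring.
by have -> := L_lin (-1) (fun=> 0) (fun=> 0) w; rewrite mulN1r addNr.
Qed.

Let L_sum n (a : nat -> R) (F : nat -> T -> R) w : L (fun v => \sum_(i < n) a i * F i v) w = \sum_(i < n) a i * L (F i) w.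
Proof.
elim: n => [|n IH].
  by rewrite big_ord0 -[RHS](L0 w); congr (L _ w); apply/funext => v; rewrite big_ord0.
rewrite big_ord_recr /= -IH addrC -L_lin; congr (L _ w); apply/funext => v; by rewrite big_ord_recr /= addrC.
Qed.

Lemma poly_opMX p f w : poly_op L (p * 'X) f w = L (poly_op L p f) w.
Proof.
rewrite (@poly_op_widen (size p).+1); last by have [->|h] := eqVneq p 0; rewrite ?mul0r ?size_poly0 // size_mulX.
rewrite big_ord_recl coefMX mul0r add0r.
have -> : poly_op L p f = (fun v => \sum_(i < size p) p`_i * iter i L f v) by [].
rewrite (L_sum _ (fun i => p`_i) (fun i => iter i L f)).
by apply: eq_bigr => i _; rewrite coefMX.
Qed.

Lemma poly_opM p q f w : poly_op L (p * q) f w = poly_op L p (poly_op L q f) w.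
Proof.
elim/poly_ind: p w => [|p a IH] w.
  by rewrite mul0r /poly_op size_poly0 !big_ord0.
have -> : (p * 'X + a%:P) * q = a *: q + (p * q) * 'X by rewrite -mul_polyC; ring.
rewrite poly_op_lin poly_opMX [p * 'X + _]addrC -[a%:P]alg_polyC poly_op_lin poly_opMX.
rewrite -polyC1 poly_opC mul1r; congr (_ + L _ w); exact/funext.
Qed.

Lemma poly_opX f w : poly_op L 'X f w = L f w.
Proof.
rewrite -[X in poly_op L X]mul1r poly_opMX; congr (L _ w); apply/funext => u.
by rewrite -polyC1 poly_opC mul1r.
Qed.

Lemma L2_poly_op p f : L2 f -> L2 (poly_op L p f).
Proof.
move=> hf; apply: L2_sum => i; apply: L2Z; elim: (nat_of_ord i) => //= n; exact: L_L2.
Qed.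

Lemma poly_op_sym p f g : L2 f -> L2 g -> \int[P]_w (g w * poly_op L p f w) = \int[P]_w (f w * poly_op L p g w).
Proof.
move=> hf hg; elim/poly_ind: p f g hf hg => [|p a IH] f g hf hg.
  by apply: eq_Rintegral => w _; rewrite /poly_op size_poly0 !big_ord0 !mulr0.
have poly_op_step h w : poly_op L (p * 'X + a%:P) h w = a * h w + L (poly_op L p h) w.
  by rewrite addrC -alg_polyC poly_op_lin poly_opMX -polyC1 poly_opC mul1r.
have poly_op_comm h w : L (poly_op L p h) w = poly_op L p (L h) w.
  by rewrite -poly_opMX poly_opM (_ : poly_op L 'X h = L h) //; apply/funext => v; exact: poly_opX.
have expand (h k : T -> R) : L2 h -> L2 k ->
    \int[P]_w (k w * poly_op L (p * 'X + a%:P) h w) = a * \int[P]_w (k w * h w) + \int[P]_w (k w * L (poly_op L p h) w).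
  move=> hh hk; have form_int := L2_mul_Rintegrable hk hh; have op_int := L2_mul_Rintegrable hk (L_L2 (L2_poly_op p hh)).
  rewrite -(RintegralZl _ mT form_int) -(RintegralD mT (RintegrableZl mT a form_int) op_int).
  by apply: eq_Rintegral => w _; rewrite poly_op_step; ring.
rewrite !expand //; congr (_ * _ + _); first by apply: eq_Rintegral => w _; rewrite mulrC.
rewrite (L_sym (L2_poly_op p hf) hg).
under eq_Rintegral do rewrite mulrC; rewrite IH //; last exact: L_L2.
by apply: eq_Rintegral => w _; rewrite -poly_op_comm.
Qed.

Definition spec_form f p : R := \int[P]_w (f w * poly_op L p f w).

Lemma spec_form_sqrM f p q : L2 f -> spec_form f (p ^+ 2 * q) = spec_form (poly_op L p f) q.
Proof.
move=> hf; rewrite /spec_form.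
have -> : \int[P]_w (f w * poly_op L (p ^+ 2 * q) f w) = \int[P]_w (f w * poly_op L p (poly_op L q (poly_op L p f)) w).
  apply: eq_Rintegral => w _; have -> : p ^+ 2 * q = p * (q * p) by ring.
  rewrite poly_opM; congr (_ * poly_op L p _ w); apply/funext => v; exact: poly_opM.
rewrite poly_op_sym //; last by do 2!apply: L2_poly_op.
by apply: eq_Rintegral => w _; rewrite mulrC.
Qed.

Lemma spec_form_lin f a p q : L2 f -> spec_form f (a *: p + q) = a * spec_form f p + spec_form f q.
Proof.
move=> hf; have p_int := L2_mul_Rintegrable hf (L2_poly_op p hf); have q_int := L2_mul_Rintegrable hf (L2_poly_op q hf).
by rewrite /spec_form -(RintegralZl _ mT p_int) -(RintegralD mT (RintegrableZl mT a p_int) q_int); apply: eq_Rintegral => w _; rewrite poly_op_lin; ring.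
Qed.

Lemma spec_form0 f : L2 f -> spec_form f 0 = 0.
Proof. move=> hf; have := spec_form_lin 1 0 0 hf; rewrite scaler0 addr0 mul1r; move: (spec_form f 0) => z; lra. Qed.

Lemma spec_form1 f : spec_form f 1 = \int[P]_w (f w ^+ 2).
Proof. by apply: eq_Rintegral => w _; rewrite -polyC1 poly_opC mul1r expr2. Qed.

Lemma spec_formX f : spec_form f 'X = \int[P]_w (f w * L f w).
Proof. by apply: eq_Rintegral => w _; rewrite poly_opX. Qed.

Lemma spec_formX2 f : L2 f -> spec_form f 'X^2 = \int[P]_w (L f w ^+ 2).
Proof. by move=> hf; rewrite -[X in spec_form f X]mulr1 spec_form_sqrM // spec_form1; apply: eq_Rintegral => w _; rewrite poly_opX. Qed.

Lemma spec_form_bernstein_ge0 f b a m : L2 f ->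
  (forall g, L2 g -> \int[P]_w (g w * L g w) <= b * \int[P]_w (g w ^+ 2)) ->
  (forall g, L2 g -> \int[P]_w (L g w ^+ 2) <= b * \int[P]_w (g w * L g w)) ->
  0 <= spec_form f ('X^a * (b%:P - 'X) ^+ m).
Proof.
move=> hf L_le_b L_sqr_le_b; pose p := 'X^(a./2) * (b%:P - 'X) ^+ m./2.
have -> : 'X^a * (b%:P - 'X) ^+ m = p ^+ 2 * ('X^(odd a) * (b%:P - 'X) ^+ odd m).
  rewrite -{1}(odd_double_half a) -{1}(odd_double_half m) -!muln2 /p !exprD !exprM; ring.
rewrite spec_form_sqrM //; have hg := L2_poly_op p hf; move: (poly_op L p f) hg => g hg {p}.
have form1_ge0 : 0 <= spec_form g 1 by rewrite spec_form1; exact: L2_sqr_ge0.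
have formX_ge0 : 0 <= spec_form g 'X by rewrite spec_formX; exact: L_ge0.
have formX_le : spec_form g 'X <= b * spec_form g 1 by rewrite spec_formX spec_form1; exact: L_le_b.
have formX2_le : spec_form g 'X^2 <= b * spec_form g 'X by rewrite spec_formX spec_formX2 //; exact: L_sqr_le_b.
case: (odd a); case: (odd m) => /=; rewrite ?expr0 ?expr1 ?mul1r ?mulr1 //.
- have -> : 'X * (b%:P - 'X) = b *: 'X + (-1) *: 'X^2 + 0 :> {poly R} by rewrite -!mul_polyC; ring.
  by rewrite -addrA !spec_form_lin // spec_form0 //; lra.
- have -> : b%:P - 'X = (-1) *: 'X + b *: 1 + 0 :> {poly R} by rewrite -!mul_polyC; ring.
  by rewrite -addrA !spec_form_lin // spec_form0 //; lra.
Qed.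

(* Positivity of [L] at [b g - L g] gives [|L g|^2 <= b (g, L g)]. *)
Lemma form_sqr_le b : 0 < b -> (forall g, L2 g -> \int[P]_w (g w * L g w) <= b * \int[P]_w (g w ^+ 2)) ->
  forall g, L2 g -> \int[P]_w (L g w ^+ 2) <= b * \int[P]_w (g w * L g w).
Proof.
move=> b0 L_le_b g hg; have form_Lg_le := L_le_b _ (L_L2 hg); have form_res_ge0 := L_ge0 (L2_poly_op ('X - b%:P) hg).
rewrite -spec_formX -spec_form_sqrM // in form_res_ge0.
have poly_opX_fun : poly_op L 'X g = L g by apply/funext => v; exact: poly_opX.
have form_LgE : \int[P]_w (L g w * L (L g) w) = spec_form g ('X^2 * 'X).
  by rewrite spec_form_sqrM // spec_formX poly_opX_fun.
rewrite form_LgE -(spec_formX2 hg) in form_Lg_le; rewrite -(spec_formX2 hg) -(spec_formX g).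
have expand : ('X - b%:P) ^+ 2 * 'X = 1 *: ('X^2 * 'X) + (- (2 * b) *: 'X^2 + ((b ^+ 2) *: 'X + 0)) :> {poly R}.
  by rewrite -!mul_polyC polyCN polyCM polyC_exp polyC_natr; ring.
rewrite expand !spec_form_lin // spec_form0 // in form_res_ge0.
by rewrite -(ler_pM2l b0); move: form_Lg_le form_res_ge0; rewrite expr2; nra.
Qed.

Lemma poly_op_dist_le b p q f eps : 0 <= b -> 0 <= eps -> L2 f ->
  (forall g, L2 g -> \int[P]_w (g w * L g w) <= b * \int[P]_w (g w ^+ 2)) ->
  (forall g, L2 g -> \int[P]_w (L g w ^+ 2) <= b * \int[P]_w (g w * L g w)) ->
  (forall x, 0 <= x <= b -> `|p.[x] - q.[x]| <= eps) ->
  Num.sqrt (\int[P]_w ((poly_op L p f w - poly_op L q f w) ^+ 2)) <= eps * Num.sqrt (\int[P]_w (f w ^+ 2)).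
Proof.
move=> b0 eps0 hf L_le_b L_sqr_le_b pq_le.
have -> : \int[P]_w ((poly_op L p f w - poly_op L q f w) ^+ 2) = spec_form f ((p - q) ^+ 2).
  rewrite -[X in spec_form f X]mulr1 spec_form_sqrM // spec_form1; apply: eq_Rintegral => w _; congr (_ ^+ 2).
  by rewrite addrC -mulN1r -poly_op_lin scaleN1r addrC.
apply: (@le_trans _ _ (Num.sqrt (eps ^+ 2 * \int[P]_w (f w ^+ 2)))); last first.
  by rewrite sqrtrM ?sqr_ge0 // sqrtr_sqr (ger0_norm eps0).
rewrite ler_wsqrtr // -spec_form1; apply: (@positive_functional_le _ (spec_form f) b) => //.
- by move=> a r s; exact: spec_form_lin.
- by move=> a m; exact: spec_form_bernstein_ge0.
by move=> x hx; rewrite !hornerE -real_normK ?num_real //; apply: ler_sqr_nneg => //; exact: pq_le.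
Qed.

Section NormBound.
Variable K : R.
Hypothesis L_norm_le : forall g, g \in Lfun P 2%:E -> (norm2 P (L g) <= K%:E * norm2 P g)%E.

Let K_ge0 : 0 <= K.
Proof.
have L2_1 := L2_cst P 1; have := L_norm_le ((Lfun_L2P _ _).2 L2_1).
rewrite (norm2_L2E L2_1) (norm2_L2E (L_L2 L2_1)) expr1n Rintegral_prob_cst sqrtr1 mule1 lee_fin.
exact: le_trans (sqrtr_ge0 _).
Qed.

Let L_sqr_le_K g : L2 g -> \int[P]_w (L g w ^+ 2) <= K ^+ 2 * \int[P]_w (g w ^+ 2).
Proof.
move=> hg; have := L_norm_le ((Lfun_L2P _ _).2 hg); rewrite !norm2_L2E //; last exact: L_L2.
rewrite -EFinM lee_fin => sqrt_le; rewrite -(sqr_sqrtr (L2_sqr_ge0 P (L g))) -(sqr_sqrtr (L2_sqr_ge0 P g)) -exprMn.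
by apply: ler_sqr_nneg => //; exact: sqrtr_ge0.
Qed.

Let L_form_le_K g : L2 g -> \int[P]_w (g w * L g w) <= K * \int[P]_w (g w ^+ 2).
Proof.
move=> hg; rewrite -(ler_pXn2r (_ : (0 < 2)%N)) ?nnegrE ?L_ge0 ?mulr_ge0 ?L2_sqr_ge0 //.
apply: le_trans (L2_CauchySchwarz hg (L_L2 hg)) _; rewrite exprMn expr2 mulrA mulrC.
by rewrite ler_wpM2r ?L2_sqr_ge0 // L_sqr_le_K.
Qed.

Lemma spectral_radius_bound : exists2 b, 0 <= b & [/\ b <= K, b <= c,
  forall g, L2 g -> \int[P]_w (g w * L g w) <= b * \int[P]_w (g w ^+ 2) &
  forall g, L2 g -> \int[P]_w (L g w ^+ 2) <= b * \int[P]_w (g w * L g w)].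
Proof.
pose b := Num.min K c; have b0 : 0 <= b by rewrite le_min K_ge0 ltW.
have L_le_b g : L2 g -> \int[P]_w (g w * L g w) <= b * \int[P]_w (g w ^+ 2).
  by move=> hg; rewrite /b; case: (leP K c) => _; [exact: L_form_le_K|exact: L_le].
exists b => //; split=> [||//|]; [by rewrite ge_min lexx|by rewrite ge_min lexx orbT|].
have [b_eq0|b_neq0] := eqVneq b 0; last by apply: form_sqr_le => //; rewrite lt_neqAle eq_sym b_neq0.
have K0 : K = 0 by move: b_eq0; rewrite /b; case: (leP K c) => // _ c0; move: c_gt0; rewrite c0 ltxx.
by move=> g hg; rewrite b_eq0 mul0r; have := L_sqr_le_K hg; rewrite K0 expr2 !mul0r.
Qed.

End NormBound.

Lemma functional_calculus_poly (Psi : R -> R) q f : L2 f -> (forall x, 0 <= x <= c -> Psi x = q.[x]) ->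
  functional_calculus P L Psi f (poly_op L q f).
Proof.
move=> hf Psi_q; have hg := L2_poly_op q hf; split; first exact/Lfun_L2P.
move=> K p L_norm_le p_cvg; have [b b0 [bK bc L_le_b L_sqr_le_b]] := spectral_radius_bound L_norm_le.
pose S := Num.sqrt (\int[P]_w (f w ^+ 2)); have S0 : 0 <= S := sqrtr_ge0 _.
have normE n : norm2 P (fun w => poly_op L (p n) f w - poly_op L q f w) =
    (Num.sqrt (\int[P]_w ((poly_op L (p n) f w - poly_op L q f w) ^+ 2)))%:E.
  by apply: norm2_L2E; apply: L2B => //; exact: L2_poly_op.
apply/fine_cvgP; split; first by apply: nearW => n; rewrite normE.
apply/cvgrPdist_le => eps eps0; have S1 : 0 < S + 1 by rewrite ltr_wpDl.
have delta0 : 0 < eps / (S + 1) by rewrite divr_gt0.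
apply: filterS (p_cvg _ delta0) => n p_close; rewrite /= normE /= sub0r normrN ger0_norm ?sqrtr_ge0 //.
apply: le_trans (poly_op_dist_le b0 (ltW delta0) hf L_le_b L_sqr_le_b _) _.
  move=> x /andP[x0 xb]; rewrite -(Psi_q x) ?x0 ?(le_trans xb) //.
  by apply: p_close; rewrite x0 (le_trans xb bK).
by rewrite mulrAC ler_pdivrMr // ler_pM2l // lerDl.
Qed.

End FunctionalCalculus.

(** * The spectral measure of the drift *)

Section StepSymbol.
Variables (R : realFieldType) (c : R).
Hypothesis c_gt0 : 0 < c.

(* The heat step is the polynomial 1 - X / c of the generator. *)
Definition step_symbol (x : R) : R := 1 - c^-1 * x.

Lemma step_symbol_itv x : 0 <= x <= c -> 0 <= step_symbol x <= 1.
Proof.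
move=> /andP[x0 xc]; rewrite subr_ge0 gerBl mulr_ge0 ?invr_ge0 ?(ltW c_gt0) // andbT.
by rewrite mulrC ler_pdivrMr // mul1r.
Qed.

End StepSymbol.

Section Spectral.
Variables (R : realType) (alpha beta : R) (alpha_gt0 : 0 < alpha) (hab : alpha <= beta) (d : nat) (d_gt0 : (0 < d)%N).
Local Notation Om := (Omega hab d).
Variables (nu : probability (conductance hab) R) (P : probability Om R).
Hypothesis hP : product_measure nu P.
Variable xi : 'rV[R]_d.
Variable e : {measure set (measurableTypeR R) -> \bar R}.
Local Notation dr := (@drift R alpha beta hab d xi).
Local Notation Lop := (@opL R alpha beta hab d).
Local Notation c := (spec_bound d beta).
Local Notation step_symbol := (step_symbol c).
Local Notation drift_corr := (@drift_corr R alpha beta hab d P xi).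
Local Notation evolved_drift := (@evolved_drift R alpha beta hab d xi).
Hypothesis he : spectral_measure P Lop dr e.
Hypothesis drift_corr_cvg0 : drift_corr j @[j --> \oo] --> 0.
Let c0 : 0 < c := spec_bound_gt0 d_gt0 alpha_gt0 hab.
Local Notation IR := (`[0%R, +oo[%classic : set (measurableTypeR R)).
Local Notation D := (`]0%R, c]%classic : set (measurableTypeR R)).
Let mI : measurable IR. Proof. exact: measurable_itv. Qed.
Let mD : measurable D. Proof. exact: measurable_itv. Qed.

Let L_lin a f g w : Lop (fun v => a * f v + g v) w = a * Lop f w + Lop g w.
Proof. by rewrite (opLD (fun v => a * f v) g) (opLZ a f). Qed.

Lemma spectral_poly (Psi : R -> R) (q : {poly R}) : {within `[0, +oo[%classic, continuous Psi} ->
  (exists M : R, forall x : R, 0 <= x -> `|Psi x| <= M) -> (forall x, 0 <= x <= c -> Psi x = q.[x]) ->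
  (\int[e]_(x in IR) (Psi x)%:E)%E = (spec_form P Lop dr q)%:E.
Proof.
move=> cPsi bPsi Psi_q; have hdr := L2_drift alpha_gt0 hP xi.
have fc : functional_calculus P Lop Psi dr (poly_op Lop q dr).
  apply: (@functional_calculus_poly _ _ _ P Lop c) => //.
  - by move=> f hf; apply: (L2_opL alpha_gt0 hP hf).
  - by move=> f g hf hg; apply: (opL_sym alpha_gt0 hP hf hg).
  - by move=> f hf; apply: (opL_ge0 alpha_gt0 hP hf).
  - by move=> f hf; apply: (opL_le alpha_gt0 hP hf).
have form_int := L2_mul_Rintegrable hdr (L2_poly_op (L2_opL alpha_gt0 hP) q hdr).
by rewrite -(he.2 _ _ cPsi bPsi fc) (expectationE form_int).
Qed.

Lemma spectral_horner (q : {poly R}) : (\int[e]_(x in IR) (q.[Num.min x c])%:E)%E = (spec_form P Lop dr q)%:E.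
Proof.
apply: spectral_poly.
- apply: continuous_subspaceT => x.
  have min_cont : {for x, continuous (@id R \min (fun=> c))} by apply: continuous_min; [exact: cvg_id|exact: cvg_cst].
  exact: (continuous_comp min_cont (@continuous_horner _ q _)).
- exists (\sum_(i < size q) `|q`_i| * c ^+ i) => x x0.
  have m0 : 0 <= Num.min x c by rewrite le_min x0 ltW.
  rewrite horner_coef; apply: le_trans (ler_norm_sum _ _ _) _; apply: ler_sum => i _.
  by rewrite normrM ler_wpM2l // normrX lerXn2r ?nnegrE ?(ltW c0) // ger0_norm // ge_min lexx orbT.
- by move=> x /andP[_ xc]; rewrite min_l.
Qed.

Let step_poly : {poly R} := 1 - c^-1 *: 'X.
Let step_poly_horner x : step_poly.[x] = step_symbol x. Proof. by rewrite /step_poly /step_symbol !hornerE. Qed.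

Lemma spec_form_step_poly j : spec_form P Lop dr (step_poly ^+ j) = drift_corr j.
Proof.
apply: eq_Rintegral => w _; congr (_ * _); elim: j w => [|j IH] w.
  by rewrite expr0 -polyC1 poly_opC mul1r.
rewrite exprSr /step_poly mulrBr mulr1 -scalerAr addrC -scaleNr poly_op_lin (poly_opMX L_lin) IH /= /env_step.
have -> : poly_op Lop ((1 - c^-1 *: 'X) ^+ j) dr = evolved_drift j by apply/funext.
rewrite /evolved_drift; ring.
Qed.

Lemma spectral_moment j : (\int[e]_(x in IR) (step_symbol (Num.min x c) ^+ j)%:E)%E = (drift_corr j)%:E.
Proof.
rewrite -spec_form_step_poly -spectral_horner; apply: eq_integral => x _; by rewrite horner_exp step_poly_horner.
Qed.

Let measurable_step_symbol_min j : measurable_fun IR (fun x => step_symbol (Num.min x c) ^+ j).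
Proof.
apply: measurable_funX; apply: measurable_funB => //; apply: measurable_funM => //.
exact: measurable_minr.
Qed.

Let step_symbol_min_itv x : IR x -> 0 <= step_symbol (Num.min x c) <= 1.
Proof.
rewrite /= in_itv /= andbT => x0; apply: (step_symbol_itv c0); by rewrite le_min x0 (ltW c0) ge_min lexx orbT.
Qed.

Lemma spectral_measure_above0 : e `]c, +oo[%classic = 0%E.
Proof.
pose Psi (x : R) := Num.min (Num.max (x - c) 0) 1.
have int_Psi : (\int[e]_(x in IR) (Psi x)%:E)%E = 0%E.
  rewrite (@spectral_poly Psi 0).
  - by rewrite (spec_form0 (L2_opL alpha_gt0 hP) (L2_drift alpha_gt0 hP xi)).
  - apply: continuous_subspaceT => x.
    have pos_cont : {for x, continuous ((fun x => x - c) \max (fun=> 0))}.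
      by apply: continuous_max; [apply: cvgB; [exact: cvg_id|exact: cvg_cst]|exact: cvg_cst].
    exact: (continuous_min pos_cont (cvg_cst _)).
  - exists 1 => x _; rewrite ger0_norm /Psi ?ge_min ?lexx ?orbT // le_min ler01 andbT le_max lexx orbT //.
  - by move=> x /andP[_ xc]; rewrite horner0 /Psi max_r ?subr_le0 // min_l.
have mPsi : measurable_fun IR Psi.
  apply: measurable_minr => //; apply: measurable_maxr => //; exact: measurable_funB.
have Psi_ge0 x : 0 <= Psi x by rewrite /Psi le_min ler01 andbT le_max lexx orbT.
have : (\int[e]_(x in IR) `|(Psi x)%:E|)%E = 0%E.
  by rewrite -int_Psi; apply: eq_integral => x _; rewrite gee0_abs // lee_fin.
have mEPsi : measurable_fun IR (EFin \o Psi) by exact/measurable_EFinP.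
move=> /(ae_eq_integral_abs e mI mEPsi).1 [N [mN N0 sub]].
apply/eqP; rewrite -measure_le0 -N0; apply: le_measure; rewrite ?inE //.
move=> x /=; rewrite in_itv /= andbT => cx; apply: sub => /= /(_ _).
rewrite in_itv /= andbT (ltW (lt_trans c0 cx)) => /(_ isT) [].
rewrite /Psi; have : 0 < Num.min (Num.max (x - c) 0) 1 by rewrite lt_min ltr01 andbT lt_max subr_gt0 cx.
by move=> /lt0r_neq0/eqP.
Qed.

Lemma spectral_measure_zero0 : e [set 0] = 0%E.
Proof.
have le_corr j : (e [set 0%R] <= (drift_corr j)%:E)%E.
  rewrite -spectral_moment.
  apply: (@le_trans _ _ (\int[e]_(x in [set 0%R]) (step_symbol (Num.min x c) ^+ j)%:E)%E).
    have -> : (\int[e]_(x in [set 0%R]) (step_symbol (Num.min x c) ^+ j)%:E = \int[e]_(x in [set 0%R]) (1%:E : \bar R))%E.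
      by apply: eq_integral => x; rewrite inE => ->; rewrite min_l ?(ltW c0) // /step_symbol mulr0 subr0 expr1n.
    by rewrite integral_cst // mul1e.
  apply: ge0_subset_integral => //; first exact/measurable_EFinP.
    by move=> x /step_symbol_min_itv /andP[r0 _]; rewrite lee_fin exprn_ge0.
  by move=> x ->; rewrite /= in_itv /= lexx.
apply/eqP; rewrite -measure_le0; apply/lee_addgt0Pr => eps eps0; rewrite add0e.
have [j _ /(_ j (leqnn j))] := (cvgrPdist_le _ _).1 drift_corr_cvg0 eps eps0; rewrite /= sub0r normrN => hj.
by apply: le_trans (le_corr j) _; rewrite lee_fin (le_trans (ler_norm _) hj).
Qed.

Let N : set (measurableTypeR R) := [set 0] `|` `]c, +oo[%classic.
Let mN : measurable N. Proof. exact: measurableU. Qed.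
Let N0 : e N = 0%E.
Proof. by rewrite measureU0 ?spectral_measure_zero0 // spectral_measure_above0. Qed.
Let DE : IR `\` N = D.
Proof.
apply/seteqP; split => x /=; rewrite /N !in_itv /= ?andbT.
  move=> [x0 /not_orP[/eqP xn /negP xc]]; move: xc; rewrite in_itv /= andbT -leNgt => ->.
  by rewrite lt_neqAle eq_sym x0 xn.
move=> /andP[x0 xc]; split; first exact: ltW.
by rewrite in_itv /= andbT => -[xz|]; [move: x0; rewrite xz ltxx|rewrite ltNge xc].
Qed.

Lemma spectral_restrict (F : R -> R) : measurable_fun IR F -> Rintegrable e D F ->
  (\int[e]_(x in IR) (F x)%:E)%E = (\int[e]_(x in D) F x)%:E.
Proof.
move=> mF iF; rewrite -(integral_EFin mD iF) -DE; apply: negligible_integral => //.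
apply/(negligible_integrable mN mI _ N0); first exact/measurable_EFinP.
by rewrite DE.
Qed.

Lemma spectral_measure_fin : (e D < +oo)%E.
Proof.
have := spectral_moment 0; under eq_integral do rewrite expr0; rewrite integral_cst // mul1e => h.
apply: (@le_lt_trans _ _ (e IR)); last by rewrite h ltry.
by apply: le_measure; rewrite ?inE // -DE; exact: subDsetl.
Qed.

Lemma bounded_Rintegrable_spectral (F : R -> R) K : measurable_fun D F -> (forall x, 0 < x <= c -> `|F x| <= K) -> Rintegrable e D F.
Proof.
move=> mF h; have iK : Rintegrable e D (fun=> K).
  apply/integrableP; split; first exact: measurable_cst.
  rewrite integral_cst //= lte_mul_pinfty ?lee_fin ?spectral_measure_fin //.
apply: (le_Rintegrable mD mF _ iK) => x; rewrite /= in_itv /=; exact: h.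
Qed.

Lemma measurable_step_symbol j : measurable_fun D (fun x => step_symbol x ^+ j).
Proof. by apply: measurable_funX; apply: measurable_funB => //; apply: measurable_funM. Qed.

Lemma Rintegrable_step_symbol j : Rintegrable e D (fun x => step_symbol x ^+ j).
Proof.
apply: (@bounded_Rintegrable_spectral _ 1 (measurable_step_symbol j)) => x /andP[x0 xc].
have /andP[r0 r1] := step_symbol_itv c0 (introT andP (conj (ltW x0) xc)).
by rewrite ger0_norm ?exprn_ge0 // exprn_ile1.
Qed.

Lemma Rintegral_step_symbol j : \int[e]_(x in D) (step_symbol x ^+ j) = drift_corr j.
Proof.
have min_int : Rintegrable e D (fun x => step_symbol (Num.min x c) ^+ j).
  by apply: eq_Rintegrable (Rintegrable_step_symbol j) => // x; rewrite inE /= in_itv /= => /andP[_ xc]; rewrite min_l.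
have := spectral_restrict (measurable_step_symbol_min j) min_int; rewrite spectral_moment => -[->].
by apply: eq_Rintegral => x; rewrite inE /= in_itv /= => /andP[_ xc]; rewrite min_l.
Qed.

End Spectral.

(** * Comparison of the approximation with the partial sums *)

Section Kernel.
Variables (R : realType) (mu : R).
Hypothesis mu_gt0 : 0 < mu.
Implicit Types (x : R) (k i I J K : nat).

Definition filter_prod k x : R := \prod_(i < k) (2 ^+ i * mu / (2 ^+ i * mu + x)) ^+ 2.
Definition filter_cst k : R := \prod_(i < k) (2 ^+ i) ^+ 2.

Let scale_gt0 i : 0 < 2 ^+ i * mu. Proof. by rewrite mulr_gt0 // exprn_gt0. Qed.

Lemma Qpoly_horner k x : (Qpoly mu k).[x] = \prod_(i < k) (2 ^+ i * mu + x) ^+ 2.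
Proof. by rewrite /Qpoly horner_prod; apply: eq_bigr => i _; rewrite !hornerE. Qed.

Lemma Qpoly_gt0 k x : 0 <= x -> 0 < (Qpoly mu k).[x].
Proof. by move=> x0; rewrite Qpoly_horner prodr_gt0 // => i _; rewrite exprn_gt0 // ltr_pwDl. Qed.

Lemma Qpoly0 k : (Qpoly mu k).[0] = 2 ^+ (k * k.-1) * mu ^+ (2 * k).
Proof.
rewrite Qpoly_horner; elim: k => [|k IH]; first by rewrite big_ord0 mul0n muln0 !expr0 mulr1.
rewrite big_ord_recr /= IH addr0 exprMn -exprM mulrACA -!exprD; congr (2 ^+ _ * mu ^+ _); last by rewrite mulnS addnC.
by case: k {IH} => //= k; lia.
Qed.

Lemma Ppoly_div_Qpoly k x : 0 < x -> (Ppoly mu k).[x] / (Qpoly mu k).[x] = (1 - filter_prod k x) / x.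
Proof.
move=> x0; have Q0 := lt0r_neq0 (Qpoly_gt0 k (ltW x0)).
have filterE : filter_prod k x = (Qpoly mu k).[0] / (Qpoly mu k).[x].
  rewrite !Qpoly_horner -prodfV -big_split; apply: eq_bigr => i _ /=.
  by rewrite addr0 exprMn exprVn.
have PpolyE : Ppoly mu k * 'X = Qpoly mu k - ((Qpoly mu k).[0])%:P.
  rewrite Qpoly0 divpK // -[X in X %| _]subr0 -polyC0 dvdp_XsubCl rootE !hornerE Qpoly0 subrr //.
have := congr1 (fun p => p.[x]) PpolyE; rewrite !hornerE => PpolyE_at.
by rewrite filterE -[1](divff Q0) -mulrBl -PpolyE_at; field; rewrite Q0 gt_eqF.
Qed.

Let factor_itv x i : 0 <= x -> 0 <= 2 ^+ i * mu / (2 ^+ i * mu + x) <= 1.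
Proof.
move=> x0; have sum_gt0 := ltr_pwDl (scale_gt0 i) x0.
by rewrite divr_ge0 ?(ltW (scale_gt0 i)) ?(ltW sum_gt0) //= ler_pdivrMr // mul1r lerDl.
Qed.

Lemma filter_prod_itv k x : 0 <= x -> 0 <= filter_prod k x <= 1.
Proof.
move=> x0; rewrite prodr_ge0 /=; last by move=> i _; exact: sqr_ge0.
by apply: prodr_ile1 => i _; have /andP[f0 f1] := factor_itv i x0; rewrite exprn_ge0 // exprn_ile1.
Qed.

Lemma filter_prod_antimono k k' x : 0 <= x -> (k' <= k)%N -> filter_prod k x <= filter_prod k' x.
Proof.
move=> x0 /subnK <-; elim: (k - k')%N => [|n IH] //; rewrite addSn /filter_prod big_ord_recr /=; apply: le_trans IH.
have /andP[f0 f1] := factor_itv (n + k') x0; have /andP[h0 _] := filter_prod_itv (n + k') x0.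
by rewrite ler_piMr // exprn_ile1.
Qed.

Lemma filter_prod_le k x : 0 <= x -> filter_prod k x <= filter_cst k * (mu / (mu + x)) ^+ (2 * k).
Proof.
move=> x0; elim: k => [|k IH]; first by rewrite /filter_prod /filter_cst !big_ord0 muln0 mulr1.
rewrite /filter_prod /filter_cst !big_ord_recr /= mulnS addnC exprD mulrACA.
have mx : 0 < mu + x by rewrite ltr_pwDl.
have /andP[h0 _] := filter_prod_itv k x0; apply: ler_pM => //; first exact: sqr_ge0.
rewrite -exprMn; apply: ler_sqr_nneg; first by case/andP: (factor_itv k x0).
rewrite -[leLHS]mulrA ler_pM2l ?exprn_gt0 // ler_pM2l //.
by rewrite lef_pV2 ?posrE ?ltr_pwDl // lerD2r ler_peMl ?exprn_ege1 ?ler1n // ltW.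
Qed.

Lemma filter_prod_ge k x : 0 <= x -> expR (- (4 * x / mu)) <= filter_prod k x.
Proof.
move=> x0; apply: (@le_trans _ _ (expR (- ((4 - 4 / 2 ^+ k) * x / mu)))).
  rewrite ler_expR lerN2 ler_pM2r ?invr_gt0 // ler_wpM2r // gerBl divr_ge0 // exprn_ge0 //.
elim: k => [|k IH]; first by rewrite /filter_prod big_ord0 expr0 divr1 subrr !mul0r oppr0 expR0.
rewrite /filter_prod big_ord_recr /=; set y := x / (2 ^+ k * mu).
have y0 : 0 <= y by rewrite divr_ge0 // ltW.
have pow2_neq0 : 2 ^+ k != 0 :> R by rewrite expf_neq0.
have -> : 2 ^+ k * mu / (2 ^+ k * mu + x) = (1 + y)^-1.
  by rewrite /y; field; rewrite pow2_neq0 (gt_eqF mu_gt0) /= gt_eqF // ltr_pwDl.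
have -> : - ((4 - 4 / 2 ^+ k.+1) * x / mu) = - ((4 - 4 / 2 ^+ k) * x / mu) + - y *+ 2.
  by rewrite /y exprS mulr2n; field; rewrite pow2_neq0 (gt_eqF mu_gt0).
rewrite expRD; apply: ler_pM; rewrite ?expR_ge0 //.
have -> : - y *+ 2 = 2%:R * - y by rewrite mulr_natl.
rewrite expRM_natl expRN; apply: ler_sqr_nneg; first by rewrite invr_ge0 expR_ge0.
by rewrite lef_pV2 ?posrE ?expR_gt0 ?ltr_pwDl // expR_ge1Dx.
Qed.

Variable c : R.
Hypothesis c_gt0 : 0 < c.
Local Notation ro := (step_symbol c).

Lemma step_symbolX_le_filter J k x : 0 <= x <= c -> 4 * c / mu <= J%:R -> ro x ^+ J <= filter_prod k x.
Proof.
move=> xc hJ; have /andP[x0 _] := xc; apply: le_trans (filter_prod_ge k x0).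
apply: (@le_trans _ _ (expR (- (c^-1 * x)) ^+ J)).
  have /andP[r0 _] := step_symbol_itv c_gt0 xc.
  by rewrite lerXn2r ?nnegrE ?expR_ge0 //; exact: expR_ge1Dx.
rewrite -expRM_natl ler_expR mulrN lerN2.
have -> : 4 * x / mu = 4 * c / mu * (c^-1 * x) by field; rewrite !gt_eqF.
by rewrite ler_wpM2r // mulr_ge0 // invr_ge0 ltW.
Qed.

Definition green_sum J x : R := c^-1 * \sum_(j < J) ro x ^+ j.

Lemma green_sum_ge0 J x : 0 <= x <= c -> 0 <= green_sum J x.
Proof.
move=> xc; have /andP[r0 _] := step_symbol_itv c_gt0 xc.
by rewrite mulr_ge0 ?invr_ge0 ?(ltW c_gt0) // sumr_ge0 // => i _; rewrite exprn_ge0.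
Qed.

Lemma green_sumE J x : 0 < x -> green_sum J x = (1 - ro x ^+ J) / x.
Proof.
move=> x0; have -> : 1 - ro x ^+ J = c^-1 * x * \sum_(j < J) ro x ^+ j.
  by rewrite -[1](expr1n _ J) subrXX; congr (_ * _); [by rewrite /step_symbol; ring|apply: eq_bigr => i _; rewrite expr1n mul1r].
by rewrite /green_sum mulrAC mulfK ?gt_eqF.
Qed.

Lemma green_sum_sub_itv J k x : 0 < x <= c -> 4 * c / mu <= J%:R ->
  0 <= green_sum J x - (Ppoly mu k).[x] / (Qpoly mu k).[x] <= filter_prod k x * green_sum J x.
Proof.
move=> /andP[x0 xc] hJ; have x0c : 0 <= x <= c by rewrite ltW.
have rJ_le := step_symbolX_le_filter k x0c hJ; have /andP[_ filter_le1] := filter_prod_itv k (ltW x0).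
have /andP[r0 _] := step_symbol_itv c_gt0 x0c; have rJ := exprn_ge0 J r0.
rewrite Ppoly_div_Qpoly // green_sumE // mulrA -mulrBl divr_ge0 ?(ltW x0) //=; last by move: rJ_le; lra.
rewrite ler_pM2r ?invr_gt0 //; move: rJ_le filter_le1 rJ; set f := filter_prod _ _; set r := _ ^+ J => rJ_le filter_le1 rJ.
have := mulr_ge0 rJ (_ : 0 <= 1 - f); rewrite subr_ge0 => /(_ filter_le1); lra.
Qed.

(* [X = mu / (mu + x)] solves [X (1 + mu / c) = mu / c + ro x * X]; iterating gives powers of [ro x] with polynomially growing coefficients. *)
Lemma resolvent_powX_le K I x : 0 <= x <= c ->
  (mu / (mu + x)) ^+ K.+1 <= ro x ^+ I + (mu / c) ^+ K.+1 * \sum_(i < I) i.+1%:R ^+ K * ro x ^+ i.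
Proof.
move=> xc; have /andP[x0 _] := xc; have /andP[r0 _] := step_symbol_itv c_gt0 xc.
set X := mu / (mu + x); set m := mu / c; set r := ro x.
have m0 : 0 < m by rewrite divr_gt0.
have mx : 0 < mu + x by rewrite ltr_pwDl.
have X0 : 0 <= X by rewrite divr_ge0 // ltW.
have X1 : X <= 1 by rewrite ler_pdivrMr // mul1r lerDl.
have XE : X * (1 + m) = m + r * X by rewrite /X /m /r /step_symbol; field; rewrite !gt_eqF.
elim: K I => [|K IHK] I.
  elim: I => [|I IHI]; first by rewrite !expr1 expr0 big_ord0 mulr0 addr0.
  rewrite expr1 in IHI *; apply: (@le_trans _ _ (m + r * X)).
    by rewrite -XE mulrDr mulr1 lerDl mulr_ge0 // ltW.
  rewrite big_ord_recl expr0 mulr1 mulrDr mulr1 addrCA lerD2l.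
  apply: le_trans (ler_wpM2l r0 IHI) _; rewrite mulrDr -exprS lerD2l mulrCA ler_pM2l // mulr_sumr.
  by apply: ler_sum => i _; rewrite !expr0 !mul1r -exprS.
elim: I => [|I IHI]; first by rewrite big_ord0 mulr0 addr0 expr0 exprn_ile1.
have m1_gt0 : 0 < 1 + m by rewrite addr_gt0.
rewrite -(ler_pM2r m1_gt0).
have -> : X ^+ K.+2 * (1 + m) = m * X ^+ K.+1 + r * X ^+ K.+2.
  by rewrite exprSr -mulrA XE; ring.
apply: le_trans (lerD (ler_wpM2l (ltW m0) (IHK I.+1)) (ler_wpM2l r0 IHI)) _.
set S1 := \sum_(i < I.+1) i.+1%:R ^+ K * r ^+ i; set S2 := \sum_(i < I) i.+1%:R ^+ K.+1 * r ^+ i.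
set S := \sum_(i < I.+1) i.+1%:R ^+ K.+1 * r ^+ i.
have S0 : 0 <= S by rewrite sumr_ge0 // => i _; rewrite mulr_ge0 ?exprn_ge0.
have S_split : S1 + r * S2 <= S.
  rewrite /S1 /S2 /S !big_ord_recl !expr0 !mulr1 !expr1n -addrA lerD2l mulr_sumr -big_split /=.
  apply: ler_sum => i _; rewrite /bump /= !add1n.
  have -> : r * (i.+1%:R ^+ K.+1 * r ^+ i) = i.+1%:R ^+ K.+1 * r ^+ i.+1 by rewrite [r ^+ i.+1]exprS mulrCA.
  rewrite -mulrDl ler_wpM2r ?exprn_ge0 // [leRHS]exprS -[X in X * _]natr1 mulrDl mul1r addrC lerD2r.
  by rewrite exprS ler_wpM2l // lerXn2r ?nnegrE // ler_nat.
have mpow_gt0 : 0 < m ^+ K.+2 by rewrite exprn_gt0.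
have mS_split := ler_wpM2l (ltW mpow_gt0) S_split; have mS_ge0 := mulr_ge0 (ltW m0) (mulr_ge0 (ltW mpow_gt0) S0); rewrite -/r.
have -> : m * (r ^+ I.+1 + m ^+ K.+1 * S1) + r * (r ^+ I + m ^+ K.+2 * S2) = (1 + m) * r ^+ I.+1 + m ^+ K.+2 * (S1 + r * S2).
  by rewrite [in m ^+ K.+2]exprS exprS; ring.
move: mS_split mS_ge0; set A := m ^+ K.+2 * _; set B := m ^+ K.+2 * S; set Z := r ^+ _; move: A B Z => A B Z; lra.
Qed.

End Kernel.

(* The error of truncating at time I a resolvent of order 2 k at scale mu, for correlations decaying like j^(-(1 + s)). *)
Definition truncation_error (R : realType) (c s mu : R) k I : R :=
  powS I (- s) + (mu / c) ^+ (2 * k) * \sum_(i < I) powS i ((2 * k).-1%:R - s).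

Section Approximation.
Variables (R : realType) (alpha beta : R) (alpha_gt0 : 0 < alpha) (hab : alpha <= beta) (d : nat) (d_gt0 : (0 < d)%N).
Variables (nu : probability (conductance hab) R) (P : probability (Omega hab d) R).
Hypothesis hP : product_measure nu P.
Variables (xi : 'rV[R]_d) (Ahom Amuk : 'M[R]_d) (mu : R) (k : nat) (s Cm : R).
Local Notation c := (spec_bound d beta).
Local Notation drift_corr := (@drift_corr R alpha beta hab d P xi).
Hypotheses (hA : homogenized_matrix P Ahom) (hAk : approx_matrix P mu k Amuk) (mu_gt0 : 0 < mu).
Hypotheses (s_gt0 : 0 < s) (Cm_gt0 : 0 < Cm).
Hypothesis hmm : forall j, drift_corr j <= Cm * powS j (- (1 + s)).
Let c0 : 0 < c := spec_bound_gt0 d_gt0 alpha_gt0 hab.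

Definition green_tail_cst : R := c^-1 * (Cm * geom_cst s).

Lemma green_tail_cst_gt0 : 0 < green_tail_cst.
Proof. by apply: mulr_gt0; [rewrite invr_gt0|apply: mulr_gt0 => //; exact: geom_cst_gt0]. Qed.

Lemma drift_corr_tail i J : c^-1 * \sum_(j < J) drift_corr (i + j) <= green_tail_cst * powS i (- s).
Proof.
rewrite /green_tail_cst -mulrA ler_pM2l ?invr_gt0 // -mulrA.
apply: le_trans (ler_wpM2l (ltW Cm_gt0) (sum_powS_tail_le i (i + J) s_gt0)).
have -> : \sum_(i <= j < i + J) powS j (- (1 + s)) = \sum_(j < J) powS (i + j) (- (1 + s)) :> R.
  by rewrite -{1}[i]add0n big_addn addKn big_mkord; apply: eq_bigr => j _; rewrite addnC.
by rewrite mulr_sumr; apply: ler_sum.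
Qed.

Lemma drift_corr_cvg0 : drift_corr j @[j --> \oo] --> 0.
Proof.
apply/cvgrPdist_le => eps eps0; have exponent_gt0 : 0 < 1 + s by rewrite addr_gt0.
have [M0 powS_small] := @powS_le_eventually R (1 + s) (eps / Cm) exponent_gt0 (divr_gt0 eps0 Cm_gt0).
exists M0 => // j /= Mj; rewrite sub0r normrN ger0_norm ?(drift_corr_ge0 alpha_gt0 d_gt0 hP) //.
by apply: le_trans (hmm j) _; have := powS_small j Mj; rewrite ler_pdivlMr // mulrC.
Qed.

Section SpectralSide.
Variable e : {measure set (measurableTypeR R) -> \bar R}.
Hypothesis he : spectral_measure P (@opL R alpha beta hab d) (@drift R alpha beta hab d xi) e.
Local Notation D := (`]0%R, c]%classic : set (measurableTypeR R)).
Local Notation itg := (Rintegrable e D).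
Local Notation S := (green_sum c).
Local Notation ro := (step_symbol c).
Local Notation G := (fun x : R => (Ppoly mu k).[x] / (Qpoly mu k).[x]).
Let mD : measurable D. Proof. exact: measurable_itv. Qed.

Let Rintegrable_step i := Rintegrable_step_symbol alpha_gt0 d_gt0 hP he i.
Let Rintegral_step i := Rintegral_step_symbol alpha_gt0 d_gt0 hP he drift_corr_cvg0 i.

Let step_greenE i J x : ro x ^+ i * S J x = c^-1 * \sum_(j < J) ro x ^+ (i + j).
Proof. by rewrite /green_sum mulrCA mulr_sumr; congr (_ * _); apply: eq_bigr => j _; rewrite exprD. Qed.

Let Rintegrable_step_green i J : itg (fun x => ro x ^+ i * S J x).
Proof.
apply: (eq_Rintegrable mD (fun x _ => esym (step_greenE i J x))); apply: RintegrableZl => //; apply: Rintegrable_sum => // j; exact: Rintegrable_step.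
Qed.

Let Rintegral_step_green i J : \int[e]_(x in D) (ro x ^+ i * S J x) = c^-1 * \sum_(j < J) drift_corr (i + j).
Proof.
have -> : \int[e]_(x in D) (ro x ^+ i * S J x) = \int[e]_(x in D) (c^-1 * \sum_(j < J) ro x ^+ (i + j)) by apply: eq_Rintegral => x _; exact: step_greenE.
rewrite RintegralZl //; last by apply: Rintegrable_sum => // j; exact: Rintegrable_step.
rewrite Rintegral_sum //.
by congr (_ * _); apply: eq_bigr => j _; rewrite Rintegral_step.
Qed.

Let Rintegrable_green J : itg (S J).
Proof. by apply: eq_Rintegrable (Rintegrable_step_green 0 J) => // x _; rewrite expr0 mul1r. Qed.
Lemma Rintegral_green_sum J : \int[e]_(x in D) S J x = c^-1 * \sum_(j < J) drift_corr j.
Proof. by rewrite -(Rintegral_step_green 0); apply: eq_Rintegral => x _; rewrite expr0 mul1r. Qed.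

Let measurable_quotient : measurable_fun (`[0%R, +oo[%classic : set (measurableTypeR R)) G.
Proof.
apply: subspace_continuous_measurable_fun; first exact: measurable_itv.
apply: continuous_in_subspaceT => x; rewrite inE /= in_itv /= andbT => x0.
apply: cvgM; first exact: continuous_horner.
by apply: cvgV; [exact: lt0r_neq0 (Qpoly_gt0 mu_gt0 k x0)|exact: continuous_horner].
Qed.

Let J0 : nat := (Num.truncn (4 * c / mu)).+1.
Let J0_le J : (J0 <= J)%N -> 4 * c / mu <= J%:R.
Proof. by move=> h; apply: le_trans (ltW (truncnS_gt _)) _; rewrite ler_nat. Qed.

Let Rintegrable_quotient : itg G.
Proof.
apply: (le_Rintegrable mD _ _ (Rintegrable_green J0)).
  by apply: measurable_funS measurable_quotient => // x; rewrite /= !in_itv /= => /andP[/ltW ->].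
move=> x; rewrite /= in_itv /= => x0c; have /andP[x0 xc] := x0c.
have /andP[h _] := green_sum_sub_itv mu_gt0 c0 k x0c (J0_le (leqnn _)).
rewrite ger0_norm; first by rewrite -subr_ge0.
rewrite Ppoly_div_Qpoly // divr_ge0 ?(ltW x0) // subr_ge0.
by case/andP: (filter_prod_itv mu_gt0 k (ltW x0)).
Qed.

Lemma integral_spectral_quotient : (\int[e]_(x in `[0%R, +oo[%classic) ((Ppoly mu k).[x] / (Qpoly mu k).[x])%:E)%E = (\int[e]_(x in D) G x)%:E.
Proof. exact: (spectral_restrict alpha_gt0 d_gt0 hP he drift_corr_cvg0 measurable_quotient Rintegrable_quotient). Qed.

Lemma green_sum_gap_ge0 J : (J0 <= J)%N -> 0 <= \int[e]_(x in D) S J x - \int[e]_(x in D) G x.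
Proof.
move=> hJ; rewrite -(RintegralB mD (Rintegrable_green J) Rintegrable_quotient); apply: Rintegral_ge0 => x; rewrite /= in_itv /= => x0c.
by case/andP: (green_sum_sub_itv mu_gt0 c0 k x0c (J0_le hJ)).
Qed.

Lemma green_sum_gap_le_cst J : (J0 <= J)%N -> \int[e]_(x in D) S J x - \int[e]_(x in D) G x <= green_tail_cst.
Proof.
move=> hJ; apply: (@le_trans _ _ (\int[e]_(x in D) S J x)).
  rewrite gerBl; apply: Rintegral_ge0 => x; rewrite /= in_itv /= => /andP[x0 xc].
  rewrite Ppoly_div_Qpoly // divr_ge0 ?(ltW x0) // subr_ge0.
  by case/andP: (filter_prod_itv mu_gt0 k (ltW x0)).
by rewrite Rintegral_green_sum; have := drift_corr_tail 0 J; rewrite powS0l mulr1.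
Qed.

Let Rintegrable_expansion I J K : itg (fun x => \sum_(i < I) i.+1%:R ^+ K * (ro x ^+ i * S J x)).
Proof. by apply: Rintegrable_sum => // i; exact: (RintegrableZl mD _ (Rintegrable_step_green i J)). Qed.

Lemma spectral_gap_le J I k' x : (J0 <= J)%N -> (0 < k' <= k)%N -> 0 < x <= c ->
  S J x - G x <= filter_cst R k' * (ro x ^+ I * S J x +
    (mu / c) ^+ (2 * k') * \sum_(i < I) i.+1%:R ^+ (2 * k').-1 * (ro x ^+ i * S J x)).
Proof.
move=> hJ /andP[k'0 k'k] x_itv; have /andP[x0 xc] := x_itv; have x_itv' : 0 <= x <= c by rewrite ltW.
have filter_cst_ge0 : 0 <= filter_cst R k' by rewrite prodr_ge0 // => i _; exact: sqr_ge0.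
have S0 := green_sum_ge0 c0 J x_itv'.
have /andP[_ gap_le] := green_sum_sub_itv mu_gt0 c0 k x_itv (J0_le hJ); apply: le_trans gap_le _.
apply: (@le_trans _ _ (filter_cst R k' * (mu / (mu + x)) ^+ (2 * k') * S J x)).
  by rewrite ler_wpM2r //; apply: le_trans (filter_prod_antimono mu_gt0 (ltW x0) k'k) _; exact: filter_prod_le (ltW x0).
have -> : (2 * k' = (2 * k').-1.+1)%N by rewrite prednK // muln_gt0.
rewrite -mulrA ler_wpM2l //; apply: le_trans (ler_wpM2r S0 (resolvent_powX_le mu_gt0 c0 _ I x_itv')) _.
rewrite mulrDl lerD2l -[leLHS]mulrA ler_wpM2l ?exprn_ge0 ?divr_ge0 ?(ltW mu_gt0) ?(ltW c0) //.
by rewrite mulr_suml; apply: ler_sum => i _; rewrite mulrA.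
Qed.

Lemma green_sum_gap_le J I k' : (J0 <= J)%N -> (0 < k' <= k)%N ->
  \int[e]_(x in D) S J x - \int[e]_(x in D) G x <= filter_cst R k' * green_tail_cst * truncation_error c s mu k' I.
Proof.
move=> hJ hk'; pose m := (mu / c) ^+ (2 * k').
pose X x := \sum_(i < I) i.+1%:R ^+ (2 * k').-1 * (ro x ^+ i * S J x).
have m0 : 0 <= m by rewrite exprn_ge0 // divr_ge0 // ltW.
have filter_cst_ge0 : 0 <= filter_cst R k' by rewrite prodr_ge0 // => i _; exact: sqr_ge0.
have X_int : itg X := Rintegrable_expansion I J _; have mX_int := RintegrableZl mD m X_int.
have bound_int := RintegrableD mD (Rintegrable_step_green I J) mX_int.
rewrite -(RintegralB mD (Rintegrable_green J) Rintegrable_quotient).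
apply: (@le_trans _ _ (\int[e]_(x in D) (filter_cst R k' * (ro x ^+ I * S J x + m * X x)))).
  apply: le_Rintegral => //; [exact: RintegrableB|exact: RintegrableZl|].
  by move=> x; rewrite /= in_itv /= => x_itv; exact: spectral_gap_le.
rewrite (RintegralZl _ mD bound_int) -mulrA ler_wpM2l // (RintegralD mD (Rintegrable_step_green I J) mX_int).
rewrite (RintegralZl _ mD X_int) mulrDr; apply: lerD; first by rewrite Rintegral_step_green; exact: drift_corr_tail.
rewrite [leRHS]mulrCA ler_wpM2l // (Rintegral_sum mD); last by move=> i; exact: (RintegrableZl mD _ (Rintegrable_step_green i J)).
rewrite mulr_sumr; apply: ler_sum => i _.
rewrite (RintegralZl _ mD (Rintegrable_step_green i J)) Rintegral_step_green.
apply: le_trans (ler_wpM2l _ (drift_corr_tail i J)) _; first by rewrite exprn_ge0.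
by rewrite mulrCA powSD -powR_mulrn.
Qed.

End SpectralSide.

Lemma approx_matrix_gap_le : 0 <= qform (Amuk - Ahom) xi <= green_tail_cst /\
  forall I k', (0 < k' <= k)%N ->
    qform (Amuk - Ahom) xi <= filter_cst R k' * green_tail_cst * truncation_error c s mu k' I.
Proof.
have [_ /(_ xi) [e [he spectralE]]] := hAk.
have series_cvg := homogenized_matrix_series alpha_gt0 d_gt0 hP hA s_gt0 Cm_gt0 hmm.
have q_int : Rintegrable P setT (fun w => qform (Amat w 0) xi) by exact: itg_qform.
rewrite (expectationE q_int) (integral_spectral_quotient he) -EFinB in spectralE; case: spectralE => spectralE.
have -> : qform (Amuk - Ahom) xi = qform Amuk xi - qform Ahom xi.
  by rewrite /qform mulmxBr mulmxBl !mxE.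
rewrite spectralE; set g := Rintegral e _ _; set q := Rintegral P _ _; set a := qform _ _.
have gap_cvg : c^-1 * (\sum_(0 <= j < J) drift_corr j) - g @[J --> \oo] --> q - g - a.
  by rewrite addrAC; apply: cvgB => //; exact: cvg_cst.
have greenE J : c^-1 * (\sum_(0 <= j < J) drift_corr j) = \int[e]_(x in `]0, c]%classic) green_sum c J x.
  by rewrite (Rintegral_green_sum he) big_mkord.
have eventually (Q : nat -> Prop) : (forall J, ((Num.truncn (4 * c / mu)).+1 <= J)%N -> Q J) -> \forall J \near \oo, Q J.
  by move=> hQ; exists (Num.truncn (4 * c / mu)).+1.
split; first (apply/andP; split).
- by apply: (cvgr_to_ge gap_cvg); apply: eventually => J hJ; rewrite greenE; exact: green_sum_gap_ge0.
- by apply: (cvgr_to_le gap_cvg); apply: eventually => J hJ; rewrite greenE; exact: green_sum_gap_le_cst.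
by move=> I k' hk'; apply: (cvgr_to_le gap_cvg); apply: eventually => J hJ; rewrite greenE; exact: green_sum_gap_le.
Qed.

End Approximation.

Section ErrorFunction.
Variable R : realType.
Implicit Types (D c mu x t : R) (k I n : nat).

Lemma ln_plus_ge1 x : 1 <= ln_plus x. Proof. by rewrite /ln_plus le_max lexx orbT. Qed.

Lemma Err0E D k mu : 0 < mu -> Err D 0 k%:R mu = if (2 * k)%:R < D / 2 then mu ^+ (2 * k) else
  if (2 * k)%:R == D / 2 then mu ^+ (2 * k) * ln_plus mu^-1 else mu `^ (D / 2).
Proof.
move=> m0; have -> : ((2 * k)%:R < D / 2) = (k%:R < D / 4) by rewrite natrM; apply/idP/idP; lra.
have -> : ((2 * k)%:R == D / 2) = (k%:R == D / 4) by rewrite natrM; apply/eqP/eqP; lra.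
rewrite /Err addr0 powRr0 mulr1 powRr1 ?(le_trans ler01 (ln_plus_ge1 _)) //.
by have -> : mu `^ (2 * k%:R) = mu ^+ (2 * k) by rewrite -natrM powR_mulrn // ltW.
Qed.

Lemma Err_ge1 D k mu : 0 < D -> 1 < mu -> 1 <= Err D 0 k%:R mu.
Proof.
move=> D0 m1; have pow_ge1 : 1 <= mu ^+ (2 * k) by rewrite exprn_ege1 // ltW.
rewrite Err0E ?(lt_trans ltr01 m1) //; case: ifP => // _; case: ifP => _.
  by rewrite mulr_ege1 // ln_plus_ge1.
by rewrite -[leLHS](powRr0 mu) ler_powR ?(ltW m1) // ltW // divr_gt0.
Qed.

Lemma Err_le_q D q k mu : 0 <= q -> 0 < mu -> Err D 0 k%:R mu <= Err D q k%:R mu.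
Proof.
move=> q0 m0; rewrite /Err; case: ifP => // _; case: ifP => _; rewrite ler_wpM2l ?powR_ge0 //.
  by rewrite ler_powR ?ln_plus_ge1 // lerD2l.
by rewrite ler_powR ?ln_plus_ge1.
Qed.

Lemma sum_harmonic_le n : \sum_(i < n) powS i (-1) <= 1 + ln n%:R :> R.
Proof.
case: n => [|n]; first by rewrite big_ord0 ln0 // addr0.
elim: n => [|n IH]; first by rewrite big_ord1 powS0l ln1 addr0.
rewrite big_ord_recr /=; apply: le_trans (lerD IH (lexx _)) _; rewrite -addrA lerD2l.
have n1 : 0 < n.+1%:R :> R by []; have n2 : 0 < n.+2%:R :> R by [].
have := @le_ln1Dx R (- n.+2%:R^-1); rewrite ltrN2 invf_lt1 // ltr1n => /(_ isT).
have succE : n.+2%:R = n.+1%:R + 1 :> R by rewrite natr1.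
have -> : 1 + - n.+2%:R^-1 = n.+1%:R / n.+2%:R :> R.
  by apply: (mulIf (lt0r_neq0 n2)); rewrite mulrBl mul1r divfK ?mulVf ?gt_eqF // succE addrK.
by rewrite ln_div ?posrE // powSN powSr1; move: (n.+2%:R^-1) (ln _) (ln _) => z u v; lra.
Qed.

Lemma sum_powS_growing_le t : 0 < t -> exists2 C : R, 0 < C & forall n, \sum_(i < n) powS i (t - 1) <= C * powS n t.
Proof.
move=> t0; have [t1|t1] := leP t 1.
  exists (geom_cst t); first exact: geom_cst_gt0.
  by move=> n; rewrite -(big_mkord xpredT (fun i => powS i (t - 1))); apply: sum_powS_divergent_le; rewrite t0.
exists 1 => // n; rewrite mul1r; apply: (@le_trans _ _ (\sum_(i < n) powS n (t - 1))).
  by apply: ler_sum => i _; apply: powS_mono; [lra|exact: ltnW].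
have -> : powS n t = powS n (t - 1) * n.+1%:R by rewrite -powSr1 -powSD subrK.
by rewrite sumr_const card_ord -[leLHS]mulr_natr ler_wpM2l ?powS_ge0 // ler_nat.
Qed.

Section TruncationTime.
Variables (mu c s : R) (k : nat).
Hypotheses (mu_itv : 0 < mu <= 1) (c_gt0 : 0 < c) (s_gt0 : 0 < s) (k_gt0 : (0 < k)%N).
Let mu_gt0 : 0 < mu. Proof. by case/andP: mu_itv. Qed.
Let I := Num.truncn mu^-1.

Let I_le : I%:R <= mu^-1. Proof. by rewrite truncn_le invr_ge0 ltW. Qed.

Let SI_le : I.+1%:R <= 2 / mu.
Proof. by have /andP[_ mu1] := mu_itv; have := invf_ge1 mu_gt0; rewrite mu1 -natr1 => inv_ge1; have := I_le; lra. Qed.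

Let powS_I_le : powS I (- s) <= mu `^ s.
Proof.
have -> : mu `^ s = (mu^-1 `^ s)^-1 by rewrite -[mu^-1]powR_inv1 ?(ltW mu_gt0) // -powRrM mulN1r powRN invrK.
rewrite powSN lef_pV2 ?posrE ?powR_gt0 ?invr_gt0 //.
by rewrite ge0_ler_powR ?nnegrE ?invr_ge0 ?(ltW s_gt0) ?(ltW mu_gt0) // ltW // truncnS_gt.
Qed.

Let predE : (2 * k).-1%:R = (2 * k)%:R - 1 :> R.
Proof. by rewrite -[in RHS](@prednK (2 * k)) ?muln_gt0 // -natr1 addrK. Qed.

Let truncation_errorE (B K : R) : mu `^ s <= B ->
  mu ^+ (2 * k) * \sum_(i < I) powS i ((2 * k)%:R - 1 - s) <= K * B ->
  truncation_error c s mu k I <= (1 + c ^- (2 * k) * K) * B.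
Proof.
move=> head_le tail_le; rewrite /truncation_error predE mulrDl mul1r.
apply: lerD; first exact: le_trans powS_I_le head_le.
rewrite exprMn exprVn [_ * c ^- _]mulrC -[leLHS]mulrA -[leRHS]mulrA.
by rewrite ler_wpM2l ?invr_ge0 ?exprn_ge0 // ltW.
Qed.

Lemma truncation_error_low : (2 * k)%:R < s ->
  truncation_error c s mu k I <= (1 + c ^- (2 * k) * geom_cst (s - (2 * k)%:R)) * mu ^+ (2 * k).
Proof.
move=> ks; apply: truncation_errorE.
  by rewrite -powR_mulrn ?(ltW mu_gt0) // ger_powR // ltW.
rewrite mulrC ler_wpM2r ?exprn_ge0 ?(ltW mu_gt0) //.
have -> : (2 * k)%:R - 1 - s = - (1 + (s - (2 * k)%:R)) by ring.
have := sum_powS_tail_le 0 I (_ : 0 < s - (2 * k)%:R); rewrite powS0l mulr1 big_mkord; apply.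
by rewrite subr_gt0.
Qed.

Lemma truncation_error_critical : (2 * k)%:R = s ->
  truncation_error c s mu k I <= (1 + c ^- (2 * k) * 2) * (mu ^+ (2 * k) * ln_plus mu^-1).
Proof.
move=> ks; have ln1 := ln_plus_ge1 mu^-1; have muk0 : 0 < mu ^+ (2 * k) by rewrite exprn_gt0.
apply: truncation_errorE; first by rewrite -ks powR_mulrn ?(ltW mu_gt0) // ler_peMr // ltW.
rewrite mulrCA ler_pM2l // ks addrAC subrr add0r; apply: le_trans (sum_harmonic_le _) _.
have : ln I%:R <= ln_plus mu^-1.
  have [->|I0] := posnP I; first by rewrite ln0 // (le_trans ler01).
  by rewrite /ln_plus le_max ler_ln ?posrE ?ltr0n ?invr_gt0 // I_le.
by move: ln1; lra.
Qed.

Lemma truncation_error_high C : 0 < C -> s < (2 * k)%:R ->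
  (forall n, \sum_(i < n) powS i ((2 * k)%:R - s - 1) <= C * powS n ((2 * k)%:R - s)) ->
  truncation_error c s mu k I <= (1 + c ^- (2 * k) * (C * 2 `^ ((2 * k)%:R - s))) * mu `^ s.
Proof.
move=> C0 ks sum_le; apply: truncation_errorE => //.
have -> : (2 * k)%:R - 1 - s = (2 * k)%:R - s - 1 by ring.
apply: (@le_trans _ _ (mu ^+ (2 * k) * (C * (2 / mu) `^ ((2 * k)%:R - s)))).
  rewrite ler_pM2l ?exprn_gt0 //; apply: le_trans (sum_le _) _; rewrite ler_pM2l //.
  by apply: ge0_ler_powR; rewrite ?nnegrE ?divr_ge0 ?(ltW mu_gt0) ?SI_le // subr_ge0 ltW.
rewrite powRM ?invr_ge0 ?(ltW mu_gt0) // -powR_mulrn ?(ltW mu_gt0) // -[mu^-1]powR_inv1 ?(ltW mu_gt0) // -powRrM mulN1r.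
have -> : mu `^ s = mu `^ (2 * k)%:R * mu `^ (- ((2 * k)%:R - s)).
  by rewrite -powRD ?(gt_eqF mu_gt0) ?implybT //; congr (_ `^ _); ring.
by apply: le_of_eq; ring.
Qed.

End TruncationTime.

Lemma truncation_error_le_Err D c k : 0 < D -> 0 < c -> exists2 C : R, 0 < C &
  (0 < k)%N -> forall mu, 0 < mu <= 1 -> exists I, truncation_error c (D / 2) mu k I <= C * Err D 0 k%:R mu.
Proof.
move=> D0 c0; have s0 : 0 < D / 2 by rewrite divr_gt0.
have ck0 : 0 < c ^- (2 * k) by rewrite invr_gt0 exprn_gt0.
have [ks|ks|ks] := ltgtP (2 * k)%:R (D / 2).
- exists (1 + c ^- (2 * k) * geom_cst (D / 2 - (2 * k)%:R)).
    by rewrite addr_gt0 // mulr_gt0 // geom_cst_gt0 // subr_gt0.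
  move=> k0 mu mu_itv; have /andP[mu0 _] := mu_itv; exists (Num.truncn mu^-1).
  by rewrite Err0E // ks; exact: truncation_error_low.
- have [|C C0 sum_le] := @sum_powS_growing_le ((2 * k)%:R - D / 2); first by rewrite subr_gt0.
  exists (1 + c ^- (2 * k) * (C * 2 `^ ((2 * k)%:R - D / 2))).
    by rewrite addr_gt0 // !mulr_gt0 // powR_gt0.
  move=> k0 mu mu_itv; have /andP[mu0 _] := mu_itv; exists (Num.truncn mu^-1).
  by rewrite Err0E // ltNge (ltW ks) /= gt_eqF //; exact: truncation_error_high.
exists (1 + c ^- (2 * k) * 2); first by rewrite addr_gt0 // mulr_gt0.
move=> k0 mu mu_itv; have /andP[mu0 _] := mu_itv; exists (Num.truncn mu^-1).
by rewrite Err0E // ks ltxx eqxx; exact: truncation_error_critical.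
Qed.

Lemma Err_ge0 D k mu : 0 <= Err D 0 k%:R mu.
Proof. by rewrite /Err; case: ifP => _; [|case: ifP => _]; rewrite ?mulr_ge0 ?powR_ge0. Qed.

Lemma Err_minn D d k mu : 0 < mu -> 0 < D <= d%:R -> Err D 0 (minn k d)%:R mu = Err D 0 k%:R mu.
Proof.
move=> mu0 /andP[D0 Dd]; case: (leqP k d) => // dk; rewrite !Err0E //.
have d_high : D / 2 < (2 * d)%:R by rewrite natrM; lra.
have k_high : D / 2 < (2 * k)%:R by apply: lt_le_trans d_high _; rewrite ler_nat leq_mul2l ltnW.
by rewrite !ltNge (ltW d_high) (ltW k_high) /= !gt_eqF.
Qed.

(* Since Err does not depend on k >= d, the orders k <= d provide a constant valid for all k. *)
Lemma le_Err_of_truncation D c d : 0 < D <= d%:R -> 0 < c -> (0 < d)%N -> exists2 B : R, 0 < B &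
  forall gap A mu k, 0 <= A -> 0 < mu -> (0 < k)%N -> gap <= A ->
  (forall I k', (0 < k' <= k)%N -> gap <= filter_cst R k' * A * truncation_error c (D / 2) mu k' I) ->
  gap <= A * B * Err D 0 k%:R mu.
Proof.
move=> Dd c0 d0; have /andP[D0 _] := Dd.
have [F F_spec] := boolp.choice (fun k => (exists2P _ _).1 (truncation_error_le_Err k D0 c0)).
have filter_cst_ge0 k : 0 <= filter_cst R k by rewrite prodr_ge0 // => i _; exact: sqr_ge0.
have term_ge0 k : 0 <= filter_cst R k * F k by rewrite mulr_ge0 // ltW // (F_spec k).1.
have sum_ge0 : 0 <= \sum_(k < d.+1) filter_cst R k * F k by rewrite sumr_ge0.
exists (1 + \sum_(k < d.+1) filter_cst R k * F k); first by rewrite ltr_pwDl.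
move=> gap A mu k A0 mu0 k0 gap_le gap_trunc; have [mu1|mu1] := leP mu 1; last first.
  by apply: le_trans gap_le _; rewrite -mulrA ler_peMr // mulr_ege1 ?lerDl //; exact: Err_ge1.
pose k' := minn k d; have k'0 : (0 < k')%N by rewrite leq_min k0.
have [|I I_le] := (F_spec k').2 k'0 mu; first by rewrite mu0.
apply: le_trans (gap_trunc I k' _) _; first by rewrite k'0 geq_minl.
apply: le_trans (ler_wpM2l _ I_le) _; first by rewrite mulr_ge0.
rewrite Err_minn // mulrA ler_wpM2r ?Err_ge0 // -mulrA mulrCA ler_wpM2l //.
have k'd : (k' < d.+1)%N by rewrite ltnS geq_minr.
by rewrite (bigD1 (Ordinal k'd)) //= addrCA lerDl addr_ge0 // sumr_ge0.
Qed.

Lemma error_bound_exponent d : (1 < d)%N -> exists2 D : R, 0 < D <= d%:R &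
  forall k mu, 0 < mu -> Err D 0 k%:R mu <= error_bound d 0 k mu.
Proof.
move=> d1; rewrite /error_bound; have [->|d2] := eqVneq d 2%N; first by exists 2 => //; rewrite ltr0n lexx.
have [_|d5] := boolP (2 < d <= 5)%N; first by exists d%:R => //; rewrite ltr0n (ltnW d1) lexx.
have [->|d6] := eqVneq d 6%N.
  by exists 6 => // [|k mu m0]; [rewrite ltr0n lexx|exact: Err_le_q].
have d7 : (6 < d)%N by clear -d1 d2 d5 d6; lia.
have [_|_] := boolP (6 < d <= 12)%N; first by exists 6 => //; rewrite ltr0n ler_nat (ltnW d7).
exists (d%:R - 6) => //; rewrite subr_gt0 ltr_nat d7 /=; lra.
Qed.

Lemma normr_coord_le (d : nat) (xi : 'rV[R]_d) i : `|xi 0 i| <= euclid_norm xi.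
Proof.
rewrite -sqrtr_sqr ler_wsqrtr // (bigD1 i) //= lerDl sumr_ge0 // => j _.
exact: sqr_ge0.
Qed.

End ErrorFunction.

Theorem theorem3 (R : realType) (alpha beta : R)
    (halpha : 0 < alpha) (hab : alpha <= beta) :
  exists q : R, 0 <= q /\
  forall d : nat, (2 <= d)%N ->
  exists C : R, 0 < C /\
  forall (nu : probability (conductance hab) R)
         (P : probability (Omega hab d) R),
    product_measure nu P ->
  forall Ahom : 'M[R]_d, homogenized_matrix P Ahom ->
  forall (xi : 'rV[R]_d) (mu : R) (k : nat) (Amuk : 'M[R]_d),
    euclid_norm xi = 1 -> 0 < mu -> (1 <= k)%N ->
    approx_matrix P mu k Amuk ->
    0 <= qform (Amuk - Ahom) xi <= C * error_bound d q k mu.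
Proof.
exists 0; split => // d d1; have d0 : (0 < d)%N := ltnW d1.
have [D Dd Err_le] := error_bound_exponent R d1; have /andP[D0 D_le] := Dd.
have [C C0 drift_decay] := evolved_drift_decay halpha hab d1; have c0 := spec_bound_gt0 d0 halpha hab.
pose eta := d%:R / 2 + 1 : R; pose Cm := C * 2 `^ eta; have Cm0 : 0 < Cm by rewrite mulr_gt0 // powR_gt0.
have eta0 : 0 <= eta by rewrite addr_ge0 // divr_ge0.
have s0 : 0 < D / 2 by rewrite divr_gt0.
pose A := green_tail_cst beta d (D / 2) Cm; have A0 : 0 < A := green_tail_cst_gt0 halpha hab d0 s0 Cm0.
have [B B0 gap_le_Err] := le_Err_of_truncation Dd c0 d0; exists (A * B); split; first exact: mulr_gt0.
move=> nu P hP Ahom hA xi mu k Amuk xi1 mu0 k0 hAk.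
have xi_le i : `|xi 0 i| <= 1 by rewrite -xi1 normr_coord_le.
have corr_le j : drift_corr P xi j <= Cm * powS j (- (1 + D / 2)).
  apply: le_trans (drift_corr_decay halpha d0 hP eta0 C0 (drift_decay nu P hP xi xi_le) j) _.
  by rewrite ler_pM2l //; apply: ler_powS; rewrite /eta; lra.
have [/andP[gap_ge0 gap_le] gap_trunc] := approx_matrix_gap_le halpha d0 hP hA hAk mu0 s0 Cm0 corr_le.
rewrite gap_ge0 /=; apply: le_trans (gap_le_Err _ A mu k (ltW A0) mu0 k0 gap_le gap_trunc) _.
by apply: ler_wpM2l (Err_le k mu mu0); exact/ltW/mulr_gt0.
Qed.
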